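(* Let $V_0$ be a real $1$-periodic locally integrable potential, $p\ge 2$ an integer, and $$V(x)=\sum_{l=1}^\infty c_le^{-i\phi_lx}\gamma_l(x)$$ real-valued with $\sup_l\mathrm{Var}(\gamma_l,(0,\infty))<\infty$ and $\sup_l\int_0^\infty|\gamma_l(x)|^pdx<\infty$. Assume that for some $\mathfrak a\in(0,1/(p-1))$, $\sum_{l=1}^\infty|c_l|^{\mathfrak a}<\infty$. Let $H=-\frac{d^2}{dx^2}+V_0+V$ on $L^2(0,\infty)$ with boundary condition $u'(0)\sin\theta=u(0)\cos\theta$, $\theta\in[0,\pi)$, and let $$S=\{E\in\mathrm{Int}(\sigma_{ess}(H)) : \text{not all solutions of } -u''+(V+V_0)u=Eu \text{ are bounded}\}.$$ Then the Hausdorff dimension of $S$ is at most $(p-1)\mathfrak a$. Moreover, on $\mathrm{Int}(\sigma_{ess}(H))\setminus S$ the spectral measure $\mu$ is mutually absolutely continuous with Lebesgue measure, so the absolutely continuous spectrum of $H$ equals $\sigma_{ess}(H)$.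
   Context: For $\mathrm{Im}\,z>0$ let $u_z$ be a nontrivial solution of $-u''+(V+V_0)u=zu$ that is $L^2$ near $+\infty$; the $m$-function is $m(z)=\frac{u_z'(0)\cos\theta+u_z(0)\sin\theta}{u_z(0)\cos\theta-u_z'(0)\sin\theta}$ and the spectral measure is $d\mu=\frac1\pi\,\mathrm{w\text{-}lim}_{\epsilon\downarrow0}\,\mathrm{Im}\,m(x+i\epsilon)\,dx$. Solutions are real solutions. *)

(* Defs.v *)
From HB Require Import structures.
From mathcomp Require Import all_boot all_order all_algebra.
From mathcomp Require Import all_classical all_reals all_analysis.
From mathcomp Require Import complex.
Set Implicit Arguments.
Unset Strict Implicit.
Unset Printing Implicit Defensive.
Import Order.TTheory GRing.Theory Num.Theory.
Import numFieldNormedType.Exports.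
Local Open Scope classical_set_scope.
Local Open Scope ring_scope.

Section Defs.
Variable R : realType.
Local Notation leb := (@lebesgue_measure R).

Definition halfline : set R := `[0, +oo[%classic.

Definition posline : set R := `]0, +oo[%classic.

Definition Rint (A : set R) (f : R -> R) : R := fine (\int[leb]_(x in A) (f x)%:E).

Definition loc_int (f : R -> R) : Prop :=
  forall a b : R, leb.-integrable `[a, b]%classic (EFin \o f).

(** [u] is absolutely continuous on [0,oo) with (a.e.) derivative [w],
    and [w] is absolutely continuous on [0,oo) with (a.e.) derivative [g]:
    u(x) = u(0) + int_0^x w,  w(x) = w(0) + int_0^x g  for x >= 0. *)
Definition solves (g u w : R -> R) : Prop :=
  forall x : R, 0 <= x ->
    [/\ leb.-integrable `[0, x]%classic (EFin \o w),
        leb.-integrable `[0, x]%classic (EFin \o g),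
        u x = u 0 + Rint `[0, x] w &
        w x = w 0 + Rint `[0, x] g].

Definition rsol (q : R -> R) (E : R) (u : R -> R) : Prop :=
  exists w, solves (fun t => (q t - E) * u t) u w.

(** complex solution u = a + i b, with quasi-derivative wa + i wb, of
    -u'' + q u = z u, i.e. u'' = (q - z) u, written in real/imaginary parts *)
Definition csol (q : R -> R) (z : R[i]) (a b wa wb : R -> R) : Prop :=
  solves (fun t => (q t - complex.Re z) * a t + complex.Im z * b t) a wa /\
  solves (fun t => (q t - complex.Re z) * b t - complex.Im z * a t) b wb.

Definition L2_near_oo (a b : R -> R) : Prop :=
  exists c : R, 0 <= c /\
    (\int[leb]_(x in (`[c, +oo[%classic : set R)) (a x ^+ 2 + b x ^+ 2)%:E < +oo)%E.

Definition m_value (q : R -> R) (theta : R) (z w : R[i]) : Prop :=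
  exists a b wa wb : R -> R,
    [/\ csol q z a b wa wb,
        exists2 x, 0 <= x & (a x != 0) || (b x != 0),
        L2_near_oo a b &
        w = (((wa 0 +i* wb 0) * (cos theta)%:C + (a 0 +i* b 0) * (sin theta)%:C) /
             ((a 0 +i* b 0) * (cos theta)%:C - (wa 0 +i* wb 0) * (sin theta)%:C))%C].

Definition spectral_measure (q : R -> R) (theta : R)
    (mu : measure (measurableTypeR R) R) : Prop :=
  forall m : R[i] -> R[i],
    (forall z, 0 < complex.Im z -> m_value q theta z (m z)) ->
    forall f : R -> R, continuous f ->
      (exists K : R, forall x, K < `|x| -> f x = 0) ->
      (fun eps : R =>
         (\int[leb]_x (f x * complex.Im (m (x +i* eps)%C) / pi)%:E)%E)
        @ 0^'+ --> (\int[mu]_x (f x)%:E)%E.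

Definition L2 (f : R -> R) : Prop :=
  measurable_fun halfline f /\
  (\int[leb]_(x in halfline) (f x ^+ 2)%:E < +oo)%E.

(** u is in the domain of H (potential q, boundary condition
    u'(0) sin theta = u(0) cos theta) and H u = f, for real-valued u *)
Definition domH (q : R -> R) (theta : R) (u f : R -> R) : Prop :=
  exists w, [/\ solves (fun t => q t * u t - f t) u w, L2 u, L2 f &
                w 0 * sin theta = u 0 * cos theta].

(** essential spectrum of H, via singular Weyl sequences; complex-valued
    functions of L^2(0,oo) are written as pairs (real part, imaginary part) *)
Definition ess_spec (q : R -> R) (theta : R) : set R :=
  [set E | exists a b fa fb : nat -> R -> R,
     [/\ forall n, domH q theta (a n) (fa n) /\ domH q theta (b n) (fb n),
         forall n, (\int[leb]_(x in halfline) (a n x ^+ 2 + b n x ^+ 2)%:E = 1)%E,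
         forall g, L2 g ->
           (fun n => Rint halfline (fun x => a n x * g x)) @ \oo --> 0 /\
           (fun n => Rint halfline (fun x => b n x * g x)) @ \oo --> 0 &
         (fun n => Rint halfline (fun x => (fa n x - E * a n x) ^+ 2 +
                                            (fb n x - E * b n x) ^+ 2))
           @ \oo --> 0]].

Definition ac_part (mu nu : measure (measurableTypeR R) R) : Prop :=
  exists nus : measure (measurableTypeR R) R,
    [/\ forall A, measurable A -> mu A = (nu A + nus A)%E,
        forall A, measurable A -> leb A = 0%E -> nu A = 0%E &
        exists2 N, measurable N /\ leb N = 0%E & nus (~` N) = 0%E].

Definition ac_spec (mu : measure (measurableTypeR R) R) : set R :=
  [set E : R | exists nu, ac_part mu nu /\
     forall eps : R, 0 < eps -> (0 < nu (`](E - eps)%R, (E + eps)%R[%classic : set R))%E].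

Definition diam (A : set R) : \bar R :=
  ereal_sup [set (`|x - y|)%:E | x in A & y in A].

Definition diam_pow (s : R) (A : set R) : \bar R :=
  if `[< A = set0 >] then 0%E
  else match diam A with r%:E => (r `^ s)%:E | _ => +oo%E end.

Definition hcontent (s delta : R) (A : set R) : \bar R :=
  ereal_inf [set (\sum_(0 <= n <oo) diam_pow s (F n))%E | F in
    [set F : nat -> set R | A `<=` \bigcup_n F n /\
                            forall n, (diam (F n) <= delta%:E)%E]].

Definition hmeasure (s : R) (A : set R) : \bar R :=
  ereal_sup [set hcontent s delta A | delta in `]0, +oo[%classic].

Definition hdim (A : set R) : \bar R :=
  ereal_inf [set s%:E | s in [set s : R | 0 <= s /\ hmeasure s A = 0%E]].

Definition var_oo (f : R -> R[i]) : \bar R :=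
  ereal_sup [set (\sum_(i < n) Normc.normc (f (s i.+1) - f (s i)))%:E |
     n in [set: nat] & s in [set s : nat -> R | 0 < s 0 /\ forall i, s i < s i.+1]].

Definition expmi (t : R) : R[i] := (cos t -i* sin t)%C.

End Defs.

(* Main.v *)
Require Import Defs.
From HB Require Import structures.
From mathcomp Require Import all_boot all_order all_algebra.
From mathcomp Require Import all_classical all_reals all_analysis.
From mathcomp Require Import measurable_realfun complex ring lra zify.
Import Order.TTheory GRing.Theory Num.Theory.
Import numFieldNormedType.Exports.
Local Open Scope classical_set_scope.
Local Open Scope ring_scope.
Import Defs.
Set Implicit Arguments.
Unset Strict Implicit.
Unset Printing Implicit Defensive.

(* At an energy [E] inside a band of [V0], let [phi] be the Floquet solution. Variation of constants turns a solution
of the perturbed equation into [zeta' = -iV (A zeta - B conj zeta)], with [A], [B] built from [phi]. If [w] solves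
the Riccati equation [w' = iV (B - 2 A w + conj B w^2)] up to an integrable error and [|w| <= 1/2], then
[|zeta - w conj zeta|^2] and [1 - |w|^2] have the same logarithmic derivative up to integrable terms, so [zeta] is
bounded. An approximate [w] is a sum over words [l_1 ... l_k], [k < p], of (product of the [c_l gamma_l]) times a
quasi-periodic function [H_u], obtained by integrating quasi-periodic functions; each integration costs a small
divisor [|mu_v(E) - 1|], [v] a subword. The error consists of terms with a factor [gamma'] or with [p] factors
[gamma], both integrable. The small divisors are summable off a set of dimension at most [(p - 1) fa].

The essential spectrum is [|D| <= 2], [D] the discriminant of [V0]. Where all solutions are bounded,
[1 + |m(z)|^2 <= C |z - E| Im m(z) / y], together with [Im m <= C (1 + |m|^2) y] in the gaps, controls the
boundary values of [m], hence the spectral measure. *)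

(** The dimension comes from [n0 = p - 1], the largest word length: a word is integrated once per
    letter, so it meets at most [n0] divisors, and [|c_u|^fa] times the power [n0 * fa] of an
    inverse divisor has to be summable. Since [n0 * fa < 1], the exceptional set is also Lebesgue
    null, and [fa <= 1] makes [sum |c_l|] finite. Three obstacles shape the rest. The [gamma_l] have
    no derivative and are replaced by averages. [V] is only a uniform limit of finite sums, so the
    bound at a point [x] uses a truncation depending on [x], and every constant has to be
    independent of the number [N] of letters. Finally, the [m]-function is given only through Weyl
    solutions: its Lipschitz continuity, its derivative and its growth are all derived from
    [Im m = Im z * TN u] and the analogous formula for the norm of a difference of Weyl solutions.
    Essential spectrum is excluded in the gaps by an exponential dichotomy and produced in the bands
    by cut-off Floquet solutions. In a gap the spectral measure may have atoms, locally at most one;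
    they are put into a null set. *)

Section Halfline.
Context {R : realType}.
Notation C := R[i].
Notation Re := complex.Re.
Notation Im := complex.Im.
Notation nrm := Normc.normc.
Notation conj := conjc.
Notation leb := (@lebesgue_measure R).
Notation oitv x d := (`](x - d)%R, (x + d)%R[%classic : set R).

(* [lra] compares all atoms of the context up to conversion, which is slow when the context is large. *)
Ltac lin := first [solve [repeat match goal with H : ?T |- _ =>
  lazymatch type of T with Prop => lazymatch T with
  | is_true (Order.le _ _) => fail | is_true (Order.lt _ _) => fail | @eq _ _ _ => fail | and _ _ => fail | _ => clear H
  end end end; lra] | lra].

Lemma eqW d (T : porderType d) (a b : T) : a = b -> (a <= b)%O. Proof. by move=> ->. Qed.

(** * Absolutely continuous functions with an explicit derivative *)

Section AbsolutelyContinuous.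
Implicit Types (f g F G u v k h : R -> R) (x y s t a b d e M : R).

Definition LI f : Prop := forall x, 0 <= x -> leb.-integrable `[0, x]%classic (EFin \o f).

(** These are the multipliers under which [LI] is stable. Absolutely continuous functions are among
    them ([AC_LB]), which is how products of solutions with potentials get integrated. *)
Definition LB f : Prop := forall x, 0 <= x -> measurable_fun (`[0, x]%classic : set R) f /\
  exists M : R, forall y, 0 <= y -> y <= x -> `|f y| <= M.

(** The derivative is an explicit argument, determined only up to null sets. Calculus then means
    comparing integrals of derivatives ([AC_le], [AC_eq]), in agreement with [solves], which
    consists of integral equations. *)
Definition AC f g : Prop := LI g /\ forall x, 0 <= x -> f x = f 0 + Rint `[0, x] g.

Lemma in_cc0 x y : (`[0, x]%classic : set R) y = (0 <= y <= x).
Proof. by rewrite /= in_itv. Qed.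

Lemma LI_ext f g : (forall x, 0 <= x -> f x = g x) -> LI f -> LI g.
Proof.
move=> fg If x x0; apply: eq_integrable (If x x0) => //= y.
by rewrite inE /= in_itv /= => /andP[y0 _]; rewrite /= fg.
Qed.

Lemma LI_add f g : LI f -> LI g -> LI (fun x => f x + g x).
Proof. by move=> If Ig x x0; have := integrableD _ (If x x0) (Ig x x0); apply. Qed.
Lemma LI_scale (c : R) f : LI f -> LI (fun x => c * f x).
Proof. by move=> If x x0; have := integrableZl _ c (If x x0); apply. Qed.
Lemma LI_opp f : LI f -> LI (fun x => - f x).
Proof. by move=> /(LI_scale (-1)); apply: LI_ext => x _; rewrite mulN1r. Qed.
Lemma LI_sub f g : LI f -> LI g -> LI (fun x => f x - g x).
Proof. by move=> If /LI_opp; exact: LI_add. Qed.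
Lemma LI_norm f : LI f -> LI (fun x => `|f x|).
Proof. by move=> If x x0; have := integrable_norm (If x x0); apply. Qed.
Lemma LI_meas f : LI f -> forall x, 0 <= x -> measurable_fun (`[0, x]%classic : set R) f.
Proof. by move=> If x x0; have /measurable_int/measurable_EFinP := If x x0. Qed.

Lemma LB_LI f : LB f -> LI f.
Proof.
move=> Bf x x0; have [mf [M fM]] := Bf x x0.
apply: measurable_bounded_integrable => //=.
 by rewrite lebesgue_measure_itv /=; case: ifP => _; rewrite ?ltry.
exists M; split; first exact: num_real.
by move=> y My z; rewrite /= in_itv /= => /andP[z0 zx]; exact: le_trans (fM z z0 zx) (ltW My).
Qed.

Lemma LB_mulLI f g : LB f -> LI g -> LI (fun x => f x * g x).
Proof.
move=> Bf Ig x x0; have [mf [M fM]] := Bf x x0.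
have M0 : 0 <= M by apply: le_trans (fM 0 _ x0).
apply: (@le_integrable _ _ _ leb _ _ _ (EFin \o (fun y => M * g y))) => //.
- by apply/measurable_EFinP; apply: measurable_funM => //; exact: LI_meas.
- move=> y; rewrite in_cc0 => /andP[y0 yx] /=; rewrite lee_fin !normrM (ger0_norm M0).
 by rewrite ler_wpM2r // fM.
- exact: LI_scale.
Qed.

Lemma LB_add f g : LB f -> LB g -> LB (fun x => f x + g x).
Proof.
move=> Bf Bg x x0; have [mf [M fM]] := Bf x x0; have [mg [N gN]] := Bg x x0.
split; first exact: measurable_funD.
by exists (M + N) => y y0 yx; apply: le_trans (ler_normD _ _) (lerD (fM _ _ _) (gN _ _ _)).
Qed.

Lemma LB_mul f g : LB f -> LB g -> LB (fun x => f x * g x).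
Proof.
move=> Bf Bg x x0; have [mf [M fM]] := Bf x x0; have [mg [N gN]] := Bg x x0.
split; first exact: measurable_funM.
by exists (M * N) => y y0 yx; rewrite normrM ler_pM // ?fM ?gN.
Qed.

Lemma LB_cst (c : R) : LB (fun=> c).
Proof. by move=> x x0; split; [exact: measurable_cst | exists `|c|]. Qed.

Lemma LB_opp f : LB f -> LB (fun x => - f x).
Proof.
move=> Bf x x0; have [mf [M fM]] := Bf x x0; split; first exact: measurableT_comp.
by exists M => y y0 yx; rewrite normrN fM.
Qed.

Lemma LB_sub f g : LB f -> LB g -> LB (fun x => f x - g x).
Proof. by move=> Bf /LB_opp; exact: LB_add. Qed.
Lemma LI_mulLB f g : LI f -> LB g -> LI (fun x => f x * g x).
Proof. by move=> If Bg; apply: LI_ext (LB_mulLI Bg If) => x _; rewrite mulrC. Qed.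
Lemma LI_cst (c : R) : LI (fun=> c). Proof. exact: LB_LI (LB_cst c). Qed.
Lemma RintI0 g : Rint `[0, 0] g = 0.
Proof. by rewrite /Rint set_itv1 integral_set1. Qed.

Lemma LI_sub_itv f s t : LI f -> 0 <= s -> leb.-integrable `[s, t]%classic (EFin \o f).
Proof.
move=> If s0; have [st|ts] := leP s t; last by rewrite set_itv_ge ?bnd_simp -?ltNge //; exact: integrable_set0.
have t0 := le_trans s0 st.
apply: integrableS (If t t0) => //.
by apply: subset_itvr; rewrite bnd_simp.
Qed.

Lemma AC_itv f g s t : AC f g -> 0 <= s -> s <= t -> f t - f s = Rint `[s, t] g.
Proof.
move=> [Ig fE] s0 st; have t0 := le_trans s0 st.
rewrite (fE t t0) (fE s s0) opprD addrACA subrr add0r.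
have := @Rintegral_itvB R g (BLeft 0) (BRight t) s (Ig t t0).
rewrite !bnd_simp => /(_ s0 st); rewrite /Rintegral /Rint => ->.
apply: (Rintegral_itv_obnd_cbnd).
apply: integrableS (LI_sub_itv t Ig s0) => //.
by apply: subset_itvr; rewrite bnd_simp.
Qed.

Lemma AC_prim (c : R) g : LI g -> AC (fun x => c + Rint `[0, x] g) g.
Proof. by move=> Ig; split=> // x x0; rewrite RintI0 addr0. Qed.

Lemma AC_ext f g f1 g1 : (forall x, 0 <= x -> f x = f1 x) -> (forall x, 0 <= x -> g x = g1 x) ->
  AC f g -> AC f1 g1.
Proof.
move=> ff gg [Ig fE]; split; first exact: LI_ext Ig.
move=> x x0; rewrite -!ff // fE //; congr (_ + _).
by rewrite /Rint; congr fine; apply: eq_integral => y; rewrite inE in_cc0 => /andP[y0 _]; rewrite gg.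
Qed.

Lemma AC_add f g f1 g1 : AC f g -> AC f1 g1 -> AC (fun x => f x + f1 x) (fun x => g x + g1 x).
Proof.
move=> [Ig fE] [Ig1 fE1]; split; first exact: LI_add.
move=> x x0; rewrite fE // fE1 // addrACA; congr (_ + _).
by rewrite /Rint -(RintegralD _ (Ig x x0) (Ig1 x x0)).
Qed.

Lemma AC_scale (c : R) f g : AC f g -> AC (fun x => c * f x) (fun x => c * g x).
Proof.
move=> [Ig fE]; split; first exact: LI_scale.
move=> x x0; rewrite fE // mulrDr; congr (_ + _).
by rewrite /Rint -(RintegralZl _ _ (Ig x x0)).
Qed.

Lemma AC_cst (c : R) : AC (fun=> c) (fun=> 0).
Proof.
split; first exact: LI_cst.
by move=> x x0; rewrite /Rint integral0 addr0.
Qed.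

Lemma AC_opp f g : AC f g -> AC (fun x => - f x) (fun x => - g x).
Proof. by move=> /(AC_scale (-1)); apply: AC_ext => x _; rewrite mulN1r. Qed.
Lemma AC_sub f g f1 g1 : AC f g -> AC f1 g1 -> AC (fun x => f x - f1 x) (fun x => g x - g1 x).
Proof. by move=> a /AC_opp; exact: AC_add. Qed.

Lemma leb_cc s t : s <= t -> leb (`[s, t]%classic : set R) = (t - s)%:E.
Proof.
move=> st; rewrite lebesgue_measure_itv /= lte_fin.
by case: (ltP s t) => //= h; rewrite (_ : t = s) ?subrr //; apply/eqP; rewrite eq_le st h.
Qed.

Lemma AC_id : AC (fun x => x) (fun=> 1).
Proof.
split; first exact: LI_cst.
move=> x x0; rewrite add0r /Rint (integral_cst leb _ 1) // mul1e.
by have /= -> := leb_cc x0; rewrite subr0.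
Qed.

Lemma AC_le f g F G s t : AC f g -> AC F G -> 0 <= s -> s <= t ->
  (forall x, s <= x -> x <= t -> g x <= G x) -> f t - f s <= F t - F s.
Proof.
move=> af aF s0 st gG; rewrite (AC_itv af s0 st) (AC_itv aF s0 st).
apply: le_Rintegral => //=; try exact: LI_sub_itv (proj1 _) _.
 by apply: LI_sub_itv s0; case: af. by apply: LI_sub_itv s0; case: aF.
by move=> x; rewrite in_itv /= => /andP[]; exact: gG.
Qed.

Lemma AC_eq f g F s t : AC f g -> AC F g -> 0 <= s -> s <= t -> f t - f s = F t - F s.
Proof. by move=> af aF s0 st; apply/eqP; rewrite eq_le; apply/andP; split; apply: AC_le; eauto. Qed.

Lemma AC_norm_le f g F G s t : AC f g -> AC F G -> 0 <= s -> s <= t ->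
  (forall x, s <= x -> x <= t -> `|g x| <= G x) -> `|f t - f s| <= F t - F s.
Proof.
move=> af aF s0 st gG; rewrite ler_norml; apply/andP; split.
 have := AC_le (AC_opp af) aF s0 st. rewrite -opprD => H; rewrite lerNl; apply: H => x sx xt.
 exact: le_trans (ler_norm _) (eq_ind_r (fun z => z <= _) (gG x sx xt) (normrN _)).
by apply: AC_le af aF s0 st _ => x sx xt; exact: le_trans (ler_norm _) (gG x sx xt).
Qed.

Lemma AC_homo f g s t : AC f g -> 0 <= s -> s <= t ->
  (forall x, s <= x -> x <= t -> 0 <= g x) -> f s <= f t.
Proof. by move=> af s0 st g0; have := AC_le (AC_cst 0) af s0 st g0; rewrite subrr subr_ge0. Qed.

Lemma AC_lip f g (M : R) s t : AC f g -> 0 <= s -> s <= t ->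
  (forall x, s <= x -> x <= t -> `|g x| <= M) -> `|f t - f s| <= M * (t - s).
Proof.
move=> af s0 st gM; rewrite mulrBr; apply: AC_norm_le af (AC_scale M AC_id) s0 st _ => x sx xt.
by rewrite mulr1 gM.
Qed.

(** Absolute continuity of the Lebesgue integral, applied to [g] set to 0 outside [[0, X]]. *)
Lemma AC_unif_cont f g (X e : R) : AC f g -> 0 < e -> exists2 d : R, 0 < d &
  forall s t, 0 <= s -> s <= t -> t <= X -> t - s < d -> `|f t - f s| <= e.
Proof.
move=> af e0; have [X0|X0] := leP 0 X; last first.
 by exists 1 => // s t s0 st tX; move: (le_lt_trans (le_trans (le_trans s0 st) tX) X0); rewrite ltxx.
have Ig := (proj1 af).
pose g0 := g \_ (`[0, X]%classic : set R).
have Ig0 : leb.-integrable setT (EFin \o g0).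
 by rewrite /g0 -restrict_EFin; apply/integrable_restrict => //=; rewrite setTI; exact: Ig.
have [d [d0 dP]] := integral_normr_continuous Ig0 e0.
exists d => // s t s0 st tX std.
rewrite (AC_itv af s0 st).
have -> : Rint `[s, t] g = \int[leb]_(x in `[s, t]) g0 x.
 apply: eq_Rintegral => x; rewrite inE /= in_itv /= => /andP[sx xt].
 by rewrite /g0 patchE ifT // inE in_cc0 (le_trans s0 sx) (le_trans xt tX).
apply: le_trans (ltW (dP `[s, t]%classic (measurable_itv _) _)).
 apply: le_normr_Rintegral => //=. apply: integrableS Ig0 => //; exact: measurable_itv.
by have /= -> := leb_cc st; rewrite lte_fin.
Qed.

End AbsolutelyContinuous.

(** * Product rule, exponential, and Gronwall inequalities *)

Section Calculus.
Implicit Types (f g F G u v k h : R -> R) (x y s t a b d e M : R).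

Lemma eps_le0 (a b : R) : (forall e, 0 < e -> a <= e * b) -> a <= 0.
Proof.
move=> H; have [b0|b0] := leP b 0.
 by apply: le_trans (H 1 ltr01) _; rewrite mul1r.
rewrite leNgt; apply/negP => a0.
have : a <= a / (2 * b) * b by apply: H; rewrite divr_gt0 // mulr_gt0.
have -> : a / (2 * b) * b = a / 2 by field; rewrite gt_eqF.
lin.
Qed.

(* A function whose increments are o(K t - K s) on short intervals is constant. *)
Lemma local_null (Phi K : R -> R) X : 0 <= X ->
  (forall eta, 0 < eta -> exists2 d : R, 0 < d & forall s t, 0 <= s -> s <= t -> t <= X ->
     t - s < d -> `|Phi t - Phi s| <= eta * (K t - K s)) -> Phi X = Phi 0.
Proof.
move=> X0 H; apply/eqP; rewrite -subr_eq0 -normr_eq0 eq_le normr_ge0 andbT.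
apply: (@eps_le0 _ (K X - K 0)) => eta eta0; have [d d0 dP] := H eta eta0.
have [n nP] : exists n : nat, X / d < n.+1%:R.
 exists (Num.truncn (X / d)); apply: truncnS_gt.
pose p (i : nat) := X * i%:R / n.+1%:R.
have n0 : 0 < n.+1%:R :> R by rewrite ltr0n.
have p0 i : 0 <= p i by rewrite /p divr_ge0 ?mulr_ge0 // ltW.
have pS i : p i.+1 - p i = X / n.+1%:R.
 by rewrite /p -natr1; field; rewrite gt_eqF.
suff Hi i : (i <= n.+1)%N -> `|Phi (p i) - Phi 0| <= eta * (K (p i) - K 0).
 have -> : X = p n.+1 by rewrite /p mulfK // gt_eqF. exact: Hi.
elim: i => [_|i IH iS].
 by rewrite /p mulr0 mul0r !subrr normr0 mulr0.
have -> : Phi (p i.+1) - Phi 0 = (Phi (p i.+1) - Phi (p i)) + (Phi (p i) - Phi 0) by ring.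
have -> : eta * (K (p i.+1) - K 0) = eta * (K (p i.+1) - K (p i)) + eta * (K (p i) - K 0) by ring.
apply: le_trans (ler_normD _ _) (lerD _ (IH (ltnW iS))).
apply: dP => //.
- by rewrite -subr_ge0 pS divr_ge0 // ltW.
- by rewrite /p ler_pdivrMr // ler_wpM2l // ler_nat.
- by rewrite pS ltr_pdivrMr // mulrC -ltr_pdivrMr.
Qed.

Lemma AC_unif_cont_all f g X (e : R) : AC f g -> 0 < e -> exists2 d : R, 0 < d &
  forall s t, 0 <= s -> 0 <= t -> s <= X -> t <= X -> `|t - s| < d -> `|f t - f s| <= e.
Proof.
move=> af e0; have [d d0 dP] := AC_unif_cont X af e0; exists d => // s t s0 t0 sX tX.
have [st|ts] := leP s t; first by rewrite ger0_norm ?subr_ge0 //; exact: dP.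
by rewrite distrC ger0_norm ?subr_ge0 ?(ltW ts) // => H; rewrite distrC; apply: dP => //; exact: ltW.
Qed.

Lemma AC_within f g a b : AC f g -> 0 <= a -> {within `[a, b], continuous f}.
Proof.
move=> af a0; apply/subspace_continuousP => x; rewrite /= in_itv /= => /andP[ax xb].
apply/cvgrPdist_le => e e0; have [d d0 dP] := AC_unif_cont_all b af e0.
rewrite near_withinE.
have : \forall y \near x, `|x - y| < d by exact: (@cvgr_dist_lt _ R^o _ (nbhs x) _ id x cvg_id d d0).
apply: filterS => y xy; rewrite /= in_itv /= => /andP[ay yb].
by apply: dP => //; [exact: le_trans a0 ay|exact: le_trans a0 ax].
Qed.

Lemma AC_LB f g : AC f g -> LB f.
Proof.
move=> af x x0; have cf := AC_within (b := x) af (lexx 0); split.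
 by apply: subspace_continuous_measurable_fun.
have [c _ cP] := EVT_max x0 cf; have [d _ dP] := EVT_min x0 cf.
exists (`|f c| + `|f d|) => y y0 yx.
have yI : y \in `[0, x]%R by rewrite in_itv /= y0 yx.
have := cP y yI; have := dP y yI; have := ler_norm (f c); have := ler_norm (- f d).
rewrite normrN ler_norml => h1 h2 h3 h4; have := normr_ge0 (f c); have := normr_ge0 (f d) => h5 h6; apply/andP; split; lin.
Qed.

Lemma AC_LI f g : AC f g -> LI f. Proof. by move=> /AC_LB /LB_LI. Qed.

(** Let [P] be the integral of the expected derivative and [K] that of [|g| + |g1|]. By uniform
    continuity the increments of [f * f1 - P] over short intervals are small multiples of those of
    [K], so [local_null] applies. *)
Lemma AC_mul f g f1 g1 : AC f g -> AC f1 g1 ->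
  AC (fun x => f x * f1 x) (fun x => g x * f1 x + f x * g1 x).
Proof.
move=> af af1; have [Ig _] := af; have [Ig1 _] := af1.
have Ip : LI (fun x => g x * f1 x + f x * g1 x).
 by apply: LI_add; [apply: LI_mulLB (AC_LB af1)|apply: LB_mulLI (AC_LB af) _].
split=> // X X0.
have aP := AC_prim 0 Ip; set P := (fun x => 0 + _) in aP.
have aK := AC_prim 0 (LI_add (LI_norm Ig) (LI_norm Ig1)); set K := (fun x => 0 + _) in aK.
suff : (fun x => f x * f1 x - P x) X = (fun x => f x * f1 x - P x) 0.
 by rewrite /P /= RintI0 addr0 subr0 add0r => <-; rewrite subrK.
apply: (@local_null (fun x => f x * f1 x - P x) K) => // eta eta0.
have [d d0 dP] := AC_unif_cont_all X af eta0.
have [d1 d10 dP1] := AC_unif_cont_all X af1 eta0.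
exists (Num.min d d1); first by rewrite lt_min d0 d10.
move=> s t s0 st tX; rewrite lt_min => /andP[sd sd1].
(* With [f1] frozen at [t] and [f] at [s], this linear combination has exactly the increment of the
   product; only [g * (f1 t - f1 x)] and [g1 * (f s - f x)] are left to estimate. *)
have ah := AC_sub (AC_add (AC_scale (f1 t) af) (AC_scale (f s) af1)) aP.
have := AC_norm_le ah (AC_scale eta aK) s0 st.
have -> : f1 t * f t + f s * f1 t - P t - (f1 t * f s + f s * f1 s - P s) =
 f t * f1 t - P t - (f s * f1 s - P s) by ring.
rewrite -mulrBr; apply => x sx xt.
have -> : f1 t * g x + f s * g1 x - (g x * f1 x + f x * g1 x) =
 g x * (f1 t - f1 x) + g1 x * (f s - f x) by ring.
have x0 := le_trans s0 sx.
apply: le_trans (ler_normD _ _) _; rewrite !normrM mulrDr [eta * `|g x|]mulrC [eta * `|g1 x|]mulrC.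
apply: lerD; apply: ler_wpM2l => //.
 by apply: dP1; rewrite ?(le_trans x0 xt) ?(le_trans xt tX) // ger0_norm ?subr_ge0 //; lin.
apply: dP; rewrite ?(le_trans xt tX) //; first lin.
by rewrite distrC ger0_norm ?subr_ge0 //; lin.
Qed.

Lemma LB_expR f : LB f -> LB (expR \o f).
Proof.
move=> Bf x x0; have [mf [M fM]] := Bf x x0; split.
 by apply: measurableT_comp => //; apply: continuous_measurable_fun; exact: continuous_expR.
exists (expR M) => y y0 yx /=; rewrite ger0_norm ?expR_ge0 // ler_expR.
exact: le_trans (ler_norm _) (fM y y0 yx).
Qed.

Lemma expR_dist_le (a b M : R) : a <= M -> b <= M -> `|expR a - expR b| <= expR M * `|a - b|.
Proof.
wlog ab : a b / b <= a => [H|aM bM].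
 by have [/H|/ltW /H] := leP b a; [exact|rewrite distrC (distrC a) => H1 aM bM; exact: H1].
rewrite !ger0_norm ?subr_ge0 ?ler_expR //.
apply: (@le_trans _ _ (expR a * (a - b))); last by rewrite ler_wpM2r ?subr_ge0 // ler_expR.
have := expR_ge1Dx (b - a); rewrite expRD expRN => H.
have e0 := expR_gt0 a.
have : expR a * (1 + (b - a)) <= expR b.
 rewrite mulrC -ler_pdivlMr //.
lin.
Qed.

Lemma AC_expR K k : AC K k -> AC (fun x => expR (K x)) (fun x => k x * expR (K x)).
Proof.
move=> aK; have [Ik _] := aK; have BK := AC_LB aK.
have Ip : LI (fun x => k x * expR (K x)) by apply: LI_mulLB => //; exact: LB_expR.
split=> // X X0; have [_ [M KM]] := BK X X0.
have KM' y : 0 <= y -> y <= X -> K y <= M by move=> y0 yX; exact: le_trans (ler_norm _) (KM y y0 yX).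
have aP := AC_prim 0 Ip; set P := (fun x => 0 + _) in aP.
have aV := AC_prim 0 (LI_norm Ik); set V := (fun x => 0 + _) in aV.
suff : (fun x => expR (K x) - P x) X = (fun x => expR (K x) - P x) 0.
 by rewrite /P /= RintI0 addr0 subr0 add0r => <-; rewrite subrK.
apply: (@local_null (fun x => expR (K x) - P x) V) => // eta eta0.
have c0 : 0 < 2 * expR M by rewrite mulr_gt0 // expR_gt0.
have [d d0 dP] := AC_unif_cont_all X aK (divr_gt0 eta0 c0).
exists d => // s t s0 st tX sd; have t0 := le_trans s0 st; have sX := le_trans st tX.
have close x : s <= x -> x <= t -> `|expR (K s) - expR (K x)| <= eta / 2.
 move=> sx xt; have x0 := le_trans s0 sx; have xX := le_trans xt tX. apply: le_trans (expR_dist_le (KM' _ s0 sX) (KM' _ x0 xX)) _.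
 have -> : eta / 2 = expR M * (eta / (2 * expR M)) by field; rewrite gt_eqF ?expR_gt0. rewrite ler_wpM2l ?expR_ge0 //; apply: dP => //.
 by rewrite distrC ger0_norm ?subr_ge0 //; lin.
(* [E1] freezes the exponential at [s]. [E2] is the linearisation error of [expR] at [K s], which
   follows from [1 + x <= expR x] used at both ends. *)
have E1 : `|expR (K s) * (K t - K s) - (P t - P s)| <= eta / 2 * (V t - V s).
 have := AC_norm_le (AC_sub (AC_scale (expR (K s)) aK) aP) (AC_scale (eta / 2) aV) s0 st.
 rewrite -mulrBr (_ : expR (K s) * (K t - K s) - (P t - P s) =
   expR (K s) * K t - P t - (expR (K s) * K s - P s)); last ring.
 apply=> x sx xt; have -> : expR (K s) * k x - k x * expR (K x) = (expR (K s) - expR (K x)) * k x by ring.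
 by rewrite normrM ler_wpM2r // close.
have E2 : `|expR (K t) - expR (K s) - expR (K s) * (K t - K s)| <= eta / 2 * (V t - V s).
 have VK : `|K t - K s| <= V t - V s by apply: AC_norm_le aK aV s0 st _.
 apply: (@le_trans _ _ (eta / 2 * `|K t - K s|)); last by rewrite ler_wpM2l // divr_ge0 // ltW.
 apply: (@le_trans _ _ (`|expR (K s) - expR (K t)| * `|K t - K s|)); last by rewrite ler_wpM2r // close.
 have h1 := expR_ge1Dx (K t - K s); have h2 := expR_ge1Dx (K s - K t). have e0 := expR_gt0 (K s); have e1 := expR_gt0 (K t).
 have h1' : expR (K s) * (1 + (K t - K s)) <= expR (K t) by rewrite mulrC -ler_pdivlMr // -expRN -expRD.
 have h2' : expR (K t) * (1 + (K s - K t)) <= expR (K s) by rewrite mulrC -ler_pdivlMr // -expRN -expRD.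
 rewrite -normrM; apply: le_trans (_ : (expR (K t) - expR (K s)) * (K t - K s) <= _); last first.
  by apply: le_trans (ler_norm _) _; rewrite !normrM (distrC (expR (K s))).
 rewrite ger0_norm; lin.
have -> : expR (K t) - P t - (expR (K s) - P s) =
 (expR (K t) - expR (K s) - expR (K s) * (K t - K s)) + (expR (K s) * (K t - K s) - (P t - P s)) by ring.
apply: le_trans (ler_normD _ _) _; lin.
Qed.

(** Multiplying by [expR (- K)] makes [N] nonincreasing, whatever the signs of [k] and [N]. The
    Riccati argument applies it with an oscillating [k], and to the negative quantity
    [|w|^2 - 1]. *)
Lemma gronwall0 N n K k s t : AC N n -> AC K k -> 0 <= s -> s <= t ->
  (forall x, s <= x -> x <= t -> n x <= k x * N x) -> N t <= expR (K t - K s) * N s.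
Proof.
move=> aN aK s0 st H.
have := AC_le (AC_mul aN (AC_expR (AC_opp aK))) (AC_cst 0) s0 st.
rewrite subrr => H1.
have : N t * expR (- K t) - N s * expR (- K s) <= 0.
 apply: H1 => x sx xt; have := H x sx xt; have := expR_ge0 (- K x).
 move=> e0 /(ler_wpM2r e0); rewrite -subr_le0 => h; apply: le_trans h; apply: eqW; ring.
rewrite subr_le0 !expRN -(ler_pM2r (expR_gt0 (K t))) mulfVK ?gt_eqF ?expR_gt0 // => h.
apply: le_trans h _; rewrite expRD expRN; apply: eqW; ring.
Qed.

Lemma gronwall N n K k H h s t : AC N n -> AC K k -> AC H h -> 0 <= s -> s <= t ->
  (forall x, s <= x -> x <= t -> n x <= k x * N x + h x) ->
  (forall x, s <= x -> x <= t -> 0 <= h x) -> (forall x, s <= x -> x <= t -> 0 <= k x) ->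
  N t <= expR (K t - K s) * (N s + (H t - H s)).
Proof.
move=> aN aK aH s0 st Hn h0 k0.
have := AC_le (AC_mul aN (AC_expR (AC_opp aK))) (AC_scale (expR (- K s)) aH) s0 st.
rewrite -mulrBr => H1.
have : N t * expR (- K t) - N s * expR (- K s) <= expR (- K s) * (H t - H s).
 apply: H1 => x sx xt; have e0 := expR_ge0 (- K x).
 have Kx : K s <= K x by apply: AC_homo aK s0 sx _ => y sy yx; apply: k0 => //; exact: le_trans xt.
 apply: (@le_trans _ _ (expR (- K x) * h x)).
  have := ler_wpM2r e0 (Hn x sx xt) => h1; rewrite -subr_ge0; move: h1; rewrite -subr_ge0 => h1. apply: le_trans h1 _; apply: eqW; ring.
 by rewrite ler_wpM2r ?h0 // ler_expR lerN2.
rewrite lerBlDr !expRN -(ler_pM2r (expR_gt0 (K t))) mulfVK ?gt_eqF ?expR_gt0 // => h1.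
apply: le_trans h1 _; rewrite expRD expRN; apply: eqW; ring.
Qed.

Lemma gronwall_back N n K k H h s t : AC N n -> AC K k -> AC H h -> 0 <= s -> s <= t ->
  (forall x, s <= x -> x <= t -> - n x <= k x * N x + h x) ->
  (forall x, s <= x -> x <= t -> 0 <= h x) -> (forall x, s <= x -> x <= t -> 0 <= k x) ->
  N s <= expR (K t - K s) * (N t + (H t - H s)).
Proof.
move=> aN aK aH s0 st Hn h0 k0.
have := AC_le (AC_opp (AC_mul aN (AC_expR aK))) (AC_scale (expR (K t)) aH) s0 st.
rewrite -mulrBr => H1.
have : - (N t * expR (K t)) - - (N s * expR (K s)) <= expR (K t) * (H t - H s).
 apply: H1 => x sx xt; have e0 := expR_ge0 (K x). have Kx : K x <= K t.
  apply: AC_homo aK (le_trans s0 sx) xt _ => y xy yt; apply: k0 => //; exact: le_trans sx xy.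
 apply: (@le_trans _ _ (expR (K x) * h x)).
  have := ler_wpM2r e0 (Hn x sx xt) => h1; rewrite -subr_ge0; move: h1; rewrite -subr_ge0 => h1. apply: le_trans h1 _; apply: eqW; ring.
 by rewrite ler_wpM2r ?h0 // ler_expR.
rewrite opprK addrC lerBlDr => h1.
rewrite -(ler_pM2r (expR_gt0 (K s))); apply: le_trans h1 _; rewrite expRD expRN; apply: eqW.
by field; rewrite gt_eqF // expR_gt0.
Qed.

End Calculus.

(** * Translations, and limits of absolutely continuous functions *)

Section Shift.
Implicit Types (f g F G u v k h : R -> R) (x y s t a b d e M : R).

Lemma meas_shift a : measurable_fun setT (fun x : R => x + a : measurableTypeR R).
Proof. by apply: measurable_funD => //; exact: measurable_cst. Qed.

Lemma preimage_shift a s t :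
  (fun x : R => x + a : measurableTypeR R) @^-1` (`[s, t]%classic : set R) = `[s - a, t - a]%classic.
Proof. by apply/seteqP; split => x /=; rewrite !in_itv /= lerBlDr lerBrDr. Qed.

(** Both measures agree on half-open intervals, and a measure with these values is unique. *)
Lemma leb_shift a (A : set (measurableTypeR R)) : measurable A ->
  pushforward leb (fun x : R => x + a : measurableTypeR R) A = leb A.
Proof.
move=> mA; apply/esym/(lebesgue_measure_unique (mu := pushforward leb (fun x : R => x + a : measurableTypeR R))) => //=; first exact: meas_shift.
move=> ma _ [[s t]] _ <-; rewrite /pushforward.
have -> : (fun x : R => x + a) @^-1` [set` `](s, t).1, (s, t).2]] = [set` `](s - a), (t - a)]].
 by apply/seteqP; split => x /=; rewrite !in_itv /= ltrBlDr lerBrDr.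
rewrite !lebesgue_measure_itv /= !lte_fin ltrBlDr subrK; case: ifP => // _.
by rewrite -!EFinB; congr EFin; ring.
Qed.

Lemma ge0_integral_shift a s t (f : R -> \bar R) :
  measurable_fun (`[s, t]%classic : set (measurableTypeR R)) f -> (forall x, 0 <= f x)%E ->
  (\int[leb]_(x in `[s, t]%classic) f x = \int[leb]_(x in `[(s - a)%R, (t - a)%R]%classic) f (x + a)%R)%E.
Proof.
move=> mf f0; rewrite -preimage_shift.
rewrite -(@ge0_integral_pushforward _ _ (measurableTypeR R) (measurableTypeR R) R _ (meas_shift a) leb) //.
apply: eq_measure_integral => [|ma A mA _]; first exact: meas_shift.
by apply/esym; exact: leb_shift.
Qed.

Lemma integral_shift a s t (f : R -> \bar R) :
  measurable_fun (`[s, t]%classic : set (measurableTypeR R)) f ->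
  (\int[leb]_(x in `[s, t]%classic) f x = \int[leb]_(x in `[(s - a)%R, (t - a)%R]%classic) f (x + a)%R)%E.
Proof.
move=> mf; rewrite integralE [RHS]integralE.
rewrite (@ge0_integral_shift a _ _ (f^\+)%E) ?(@ge0_integral_shift a _ _ (f^\-)%E) //; last 2 first.
 exact: measurable_funeneg. exact: measurable_funepos.
by congr (_ - _)%E; apply: eq_integral => x _; rewrite ?funeposE ?funenegE.
Qed.

Lemma LI_shift a f : 0 <= a -> LI f -> LI (fun x => f (x + a)).
Proof.
move=> a0 If x x0; have xa0 : 0 <= x + a by exact: addr_ge0.
have /integrableP[mf ff] := LI_sub_itv (x + a) If a0.
apply/integrableP; split.
 have := @measurable_comp _ _ _ _ _ _ (`[a, x + a]%classic : set (measurableTypeR R)) (EFin \o f) (`[0, x]%classic : set (measurableTypeR R)) (fun x : R => x + a).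
 apply => //; last by apply: measurable_funTS; exact: meas_shift. by move=> _ [y /= yx <-]; move: yx; rewrite /= !in_itv /= lerD2r lerDr.
move: ff; rewrite (@ge0_integral_shift a _ _ (fun x => `|(EFin \o f) x|%E)) ?subrr ?addrK //.
exact: measurableT_comp.
Qed.

Lemma AC_shift a f g : 0 <= a -> AC f g -> AC (fun x => f (x + a)) (fun x => g (x + a)).
Proof.
move=> a0 af; have Ig := proj1 af; split; first exact: LI_shift.
move=> x x0; rewrite add0r.
have := AC_itv af a0 (_ : a <= x + a); rewrite lerDr => /(_ x0) => H.
rewrite -(subrK (f a) (f (x + a))) H addrC; congr (_ + _); rewrite /Rint.
rewrite (@integral_shift a) ?subrr ?addrK //.
by have /integrableP[] := LI_sub_itv (x + a) Ig a0.
Qed.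

(** Dominated convergence in the integral equation; it passes to the limit in the Picard series. *)
Lemma AC_cvg (f_ g_ : nat -> R -> R) f g G : (forall n, AC (f_ n) (g_ n)) -> LI G ->
  (forall x, 0 <= x -> f_ n x @[n --> \oo] --> f x) ->
  (forall x, 0 <= x -> g_ n x @[n --> \oo] --> g x) ->
  (forall n x, 0 <= x -> `|g_ n x| <= G x) -> AC f g.
Proof.
move=> afg IG cf cg gG.
have key x (x0 : 0 <= x) : leb.-integrable `[0, x]%classic (EFin \o g) /\
  Rint `[0, x] (g_ n) @[n --> \oo] --> Rint `[0, x] g.
 have mg : measurable_fun (`[0, x]%classic : set (measurableTypeR R)) g.
  apply: (@measurable_fun_cvg _ _ _ _ g_) => [n|y]; first exact: LI_meas (proj1 (afg n)) _ x0. by rewrite in_cc0 => /andP[y0 _]; exact: cg.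
 have [] := @dominated_convergence _ _ R leb (`[0, x]%classic) (measurable_itv _)
  (fun n => EFin \o g_ n) (EFin \o g) (EFin \o G).
 - by move=> n; apply/measurable_EFinP; exact: LI_meas (proj1 (afg n)) _ x0.
 - exact/measurable_EFinP.
 - apply: aeW => y; rewrite in_cc0 => /andP[y0 _]; apply/fine_cvgP; split; first by near=> n.
  exact: cg.
 - exact: IG.
 - by apply: aeW => y n; rewrite in_cc0 => /andP[y0 _] /=; rewrite lee_fin gG. move=> Ig _ cI; split => //.
 have fin : (\int[leb]_(y in `[0%R, x]%classic) (g y)%:E)%E \is a fin_num by exact: integrable_fin_num.
 move: cI; rewrite -(fineK fin); exact: fine_cvg.
split; first by move=> x x0; case: (key x x0).
move=> x x0; have [_ cI] := key x x0.
have E : (fun n => f_ n x) = (fun n => f_ n 0 + Rint `[0, x] (g_ n)).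
 by apply/funext => n; exact: (proj2 (afg n)).
have c1 := cf x x0; rewrite E in c1.
have c2 : f_ n 0 + Rint `[0, x] (g_ n) @[n --> \oo] --> f 0 + Rint `[0, x] g by apply: cvgD => //; exact: cf.
exact: (cvg_unique (@Rhausdorff R) c1 c2).
Unshelve. all: by end_near. Qed.

End Shift.

(** * Complex-valued absolutely continuous functions *)

Section ComplexCalculus.
Implicit Types (z w : C) (f g h : R -> C) (x y s t M a : R).

Definition nsq z : R := Re z ^+ 2 + Im z ^+ 2.

Lemma ReD z w : Re (z + w) = Re z + Re w. Proof. by case: z; case: w. Qed.
Lemma ImD z w : Im (z + w) = Im z + Im w. Proof. by case: z; case: w. Qed.
Lemma ReN z : Re (- z) = - Re z. Proof. by case: z. Qed.
Lemma ImN z : Im (- z) = - Im z. Proof. by case: z. Qed.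
Lemma ReM z w : Re (z * w) = Re z * Re w - Im z * Im w. Proof. by case: z; case: w. Qed.
Lemma ImM z w : Im (z * w) = Re z * Im w + Im z * Re w. Proof. by case: z; case: w. Qed.
Lemma ReJ z : Re (conj z) = Re z. Proof. by case: z. Qed.
Lemma ImJ z : Im (conj z) = - Im z. Proof. by case: z. Qed.
Lemma ReC (r : R) : Re r%:C%C = r. Proof. by []. Qed.
Lemma ImC (r : R) : Im r%:C%C = 0. Proof. by []. Qed.
Lemma Re0 : Re (0 : C) = 0. Proof. by []. Qed.
Lemma Im0 : Im (0 : C) = 0. Proof. by []. Qed.
Lemma Re1 : Re (1 : C) = 1. Proof. by []. Qed.
Lemma Im1 : Im (1 : C) = 0. Proof. by []. Qed.
Lemma Rei : Re ('i%C : C) = 0. Proof. by []. Qed.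
Lemma Imi : Im ('i%C : C) = 1. Proof. by []. Qed.
Definition CE := (ReD, ImD, ReN, ImN, ReM, ImM, ReJ, ImJ, ReC, ImC, Re0, Im0, Re1, Im1, Rei, Imi).

Lemma C_eq z w : Re z = Re w -> Im z = Im w -> z = w.
Proof. by case: z => a b; case: w => c d /= -> ->. Qed.

Lemma nsq_ge0 z : 0 <= nsq z. Proof. by rewrite addr_ge0 // sqr_ge0. Qed.
Lemma nrmE z : nrm z ^+ 2 = nsq z.
Proof. by case: z => a b /=; rewrite sqr_sqrtr // addr_ge0 // sqr_ge0. Qed.
Lemma nrm_ge0 z : 0 <= nrm z. Proof. by case: z => a b /=; rewrite sqrtr_ge0. Qed.
Lemma nsqM z w : nsq (z * w) = nsq z * nsq w. Proof. by rewrite /nsq !CE; ring. Qed.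
Lemma nsqN z : nsq (- z) = nsq z. Proof. by rewrite /nsq !CE; ring. Qed.
Lemma nsqJ z : nsq (conj z) = nsq z. Proof. by rewrite /nsq !CE; ring. Qed.
Lemma nsqD_le z w : nsq (z + w) <= 2 * (nsq z + nsq w).
Proof.
have := nsq_ge0 (z - w); rewrite /nsq !CE => h; nra.
Qed.
Lemma nrmM z w : nrm (z * w) = nrm z * nrm w. Proof. exact: Normc.normcM. Qed.
Lemma nrmD z w : nrm (z + w) <= nrm z + nrm w. Proof. exact: le_normcD. Qed.
Lemma nrmN z : nrm (- z) = nrm z. Proof. exact: normcN. Qed.
Lemma nrmB z w : nrm (z - w) <= nrm z + nrm w.
Proof. by rewrite -(nrmN w); exact: nrmD. Qed.
Lemma nrmJ z : nrm (conj z) = nrm z. Proof. by case: z => a b /=; rewrite sqrrN. Qed.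
Lemma nrmC (r : R) : nrm r%:C%C = `|r|. Proof. by rewrite /= expr0n addr0 sqrtr_sqr. Qed.
Lemma nrm0 : nrm (0 : C) = 0. Proof. exact: Normc.normc0. Qed.
Lemma nrm1 : nrm (1 : C) = 1. Proof. exact: Normc.normc1. Qed.
Lemma nrmi : nrm ('i%C : C) = 1. Proof. by rewrite /= expr0n expr1n add0r sqrtr1. Qed.
Lemma nrm_eq0 z : (nrm z == 0) = (z == 0).
Proof. by apply/eqP/eqP => [/Normc.eq0_normc //|->]; rewrite nrm0. Qed.
Lemma nrm_gt0 z : (0 < nrm z) = (z != 0).
Proof. by rewrite lt_neqAle nrm_ge0 andbT eq_sym nrm_eq0. Qed.
Lemma nrm_sqr_le z (M : R) : 0 <= M -> nsq z <= M ^+ 2 -> nrm z <= M.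
Proof. by move=> M0; rewrite -nrmE ler_pXn2r // nnegrE // nrm_ge0. Qed.
Lemma Re_le z : `|Re z| <= nrm z.
Proof.
rewrite -(@ler_pXn2r _ 2) ?nnegrE ?nrm_ge0 // nrmE real_normK ?num_real //.
by rewrite /nsq lerDl sqr_ge0.
Qed.
Lemma Im_le z : `|Im z| <= nrm z.
Proof.
rewrite -(@ler_pXn2r _ 2) ?nnegrE ?nrm_ge0 // nrmE real_normK ?num_real //.
by rewrite /nsq lerDr sqr_ge0.
Qed.
Lemma nrm_ReIm z : nrm z <= `|Re z| + `|Im z|.
Proof.
apply: nrm_sqr_le; first exact: addr_ge0.
rewrite /nsq sqrrD !real_normK ?num_real // -addrA lerD2l lerDr.
by rewrite mulrn_wge0 // mulr_ge0.
Qed.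

Definition CLI f := LI (fun x => Re (f x)) /\ LI (fun x => Im (f x)).
Definition CLB f := LB (fun x => Re (f x)) /\ LB (fun x => Im (f x)).
Definition CAC f g := AC (fun x => Re (f x)) (fun x => Re (g x)) /\ AC (fun x => Im (f x)) (fun x => Im (g x)).

Lemma CAC_CLB f g : CAC f g -> CLB f.
Proof. by move=> [/AC_LB ? /AC_LB ?]. Qed.
Lemma CLB_CLI f : CLB f -> CLI f.
Proof. by move=> [/LB_LI ? /LB_LI ?]. Qed.
Lemma CLI_ext f g : (forall x, 0 <= x -> f x = g x) -> CLI f -> CLI g.
Proof. by move=> fg [a b]; split; [move: a|move: b]; apply: LI_ext => x x0; rewrite fg. Qed.
Lemma CLI_add f g : CLI f -> CLI g -> CLI (fun x => f x + g x).
Proof.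
by move=> [a b] [c d]; split; [apply: LI_ext (LI_add a c)|apply: LI_ext (LI_add b d)] => x _; rewrite CE.
Qed.
Lemma CLI_opp f : CLI f -> CLI (fun x => - f x).
Proof.
by move=> [a b]; split; [apply: LI_ext (LI_opp a)|apply: LI_ext (LI_opp b)] => x _; rewrite CE.
Qed.
Lemma CLI_sub f g : CLI f -> CLI g -> CLI (fun x => f x - g x).
Proof. by move=> If /CLI_opp; exact: CLI_add. Qed.
Lemma CLB_mulCLI f g : CLB f -> CLI g -> CLI (fun x => f x * g x).
Proof.
move=> [a b] [c d]; split.
 by apply: LI_ext (LI_sub (LB_mulLI a c) (LB_mulLI b d)) => x _; rewrite CE.
by apply: LI_ext (LI_add (LB_mulLI a d) (LB_mulLI b c)) => x _; rewrite CE.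
Qed.
Lemma CLI_mulCLB f g : CLI f -> CLB g -> CLI (fun x => f x * g x).
Proof. by move=> a b; apply: CLI_ext (CLB_mulCLI b a) => x _; rewrite mulrC. Qed.
Lemma CLB_cst z : CLB (fun=> z). Proof. by split; exact: LB_cst. Qed.
Lemma CLI_cst z : CLI (fun=> z). Proof. exact: CLB_CLI (CLB_cst z). Qed.
Lemma LB_ext (F G : R -> R) : (forall x, 0 <= x -> F x = G x) -> LB F -> LB G.
Proof.
move=> FG BF x x0; have [mF [M FM]] := BF x x0; split.
 by apply: eq_measurable_fun mF => y; rewrite inE in_cc0 => /andP[y0 _]; rewrite FG.
by exists M => y y0 yx; rewrite -FG // FM.
Qed.
Lemma CLB_ext f g : (forall x, 0 <= x -> f x = g x) -> CLB f -> CLB g.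
Proof. by move=> fg [a b]; split; [move: a|move: b]; apply: LB_ext => x x0; rewrite fg. Qed.
Lemma CLB_add f g : CLB f -> CLB g -> CLB (fun x => f x + g x).
Proof.
by move=> [a b] [c d]; split; [apply: LB_ext (LB_add a c)|apply: LB_ext (LB_add b d)] => x _; rewrite CE.
Qed.
Lemma CLB_mul f g : CLB f -> CLB g -> CLB (fun x => f x * g x).
Proof.
move=> [a b] [c d]; split.
 by apply: LB_ext (LB_sub (LB_mul a c) (LB_mul b d)) => x _; rewrite CE.
by apply: LB_ext (LB_add (LB_mul a d) (LB_mul b c)) => x _; rewrite CE.
Qed.
Lemma CLB_conj f : CLB f -> CLB (fun x => conj (f x)).
Proof.
by move=> [a b]; split; [apply: LB_ext a|apply: LB_ext (LB_opp b)] => x _; rewrite CE.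
Qed.
Lemma CLB_real (F : R -> R) : LB F -> CLB (fun x => (F x)%:C%C).
Proof. by move=> BF; split; [exact: BF|exact: LB_cst]. Qed.
Lemma CLI_real (F : R -> R) : LI F -> CLI (fun x => (F x)%:C%C).
Proof. by move=> BF; split; [exact: BF|exact: LI_cst]. Qed.
Lemma LI_nrm f : CLI f -> LI (fun x => nrm (f x)).
Proof.
move=> [a b] x x0.
apply: (@le_integrable _ _ _ lebesgue_measure _ _ _ (EFin \o (fun y => `|Re (f y)| + `|Im (f y)|))) => //.
- apply/measurable_EFinP.
 have -> : (fun y => nrm (f y)) = (fun y => Num.sqrt (Re (f y) ^+ 2 + Im (f y) ^+ 2)).
  by apply/funext => y; case: (f y).
 have ms : measurable_fun setT (Num.sqrt : R -> R) by apply: continuous_measurable_fun; exact: sqrt_continuous.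
 apply: (measurableT_comp ms). by apply: measurable_funD; apply: measurable_funX; [exact: LI_meas a _ x0|exact: LI_meas b _ x0].
- move=> y _ /=; rewrite lee_fin ger0_norm ?nrm_ge0 // [X in _ <= X]ger0_norm ?addr_ge0 //.
 exact: nrm_ReIm.
- exact: LI_add (LI_norm a) (LI_norm b) x x0.
Qed.
Lemma CLB_bound f x : CLB f -> 0 <= x -> exists2 M : R, 0 <= M & forall y, 0 <= y -> y <= x -> nrm (f y) <= M.
Proof.
move=> [a b] x0; have [_ [M HM]] := a x x0; have [_ [N HN]] := b x x0.
exists (M + N).
 by apply: addr_ge0; [apply: le_trans (HM 0 _ x0)|apply: le_trans (HN 0 _ x0)].
by move=> y y0 yx; apply: le_trans (nrm_ReIm _) (lerD (HM _ _ _) (HN _ _ _)).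
Qed.

Lemma CAC_ext f g f1 g1 : (forall x, 0 <= x -> f x = f1 x) -> (forall x, 0 <= x -> g x = g1 x) ->
  CAC f g -> CAC f1 g1.
Proof.
by move=> ff gg [a b]; split; [move: a|move: b]; apply: AC_ext => x x0; rewrite ?ff ?gg.
Qed.
Lemma CAC_add f g f1 g1 : CAC f g -> CAC f1 g1 -> CAC (fun x => f x + f1 x) (fun x => g x + g1 x).
Proof.
by move=> [a b] [c d]; split; [apply: AC_ext (AC_add a c)|apply: AC_ext (AC_add b d)] => x _; rewrite CE.
Qed.
Lemma CAC_opp f g : CAC f g -> CAC (fun x => - f x) (fun x => - g x).
Proof.
by move=> [a b]; split; [apply: AC_ext (AC_opp a)|apply: AC_ext (AC_opp b)] => x _; rewrite CE.
Qed.
Lemma CAC_sub f g f1 g1 : CAC f g -> CAC f1 g1 -> CAC (fun x => f x - f1 x) (fun x => g x - g1 x).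
Proof. by move=> a /CAC_opp; exact: CAC_add. Qed.
Lemma CAC_cst z : CAC (fun=> z) (fun=> 0). Proof. by split; exact: AC_cst. Qed.
Lemma CAC_mul f g f1 g1 : CAC f g -> CAC f1 g1 ->
  CAC (fun x => f x * f1 x) (fun x => g x * f1 x + f x * g1 x).
Proof.
move=> [a b] [c d]; split.
 by apply: AC_ext (AC_sub (AC_mul a c) (AC_mul b d)) => x _; rewrite !CE; ring.
by apply: AC_ext (AC_add (AC_mul a d) (AC_mul b c)) => x _; rewrite !CE; ring.
Qed.
Lemma CAC_scale z f g : CAC f g -> CAC (fun x => z * f x) (fun x => z * g x).
Proof. by move=> a; apply: CAC_ext (CAC_mul (CAC_cst z) a) => x _ //; rewrite mul0r add0r. Qed.
Lemma CAC_conj f g : CAC f g -> CAC (fun x => conj (f x)) (fun x => conj (g x)).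
Proof.
by move=> [a b]; split; [apply: AC_ext a|apply: AC_ext (AC_opp b)] => x _; rewrite CE.
Qed.
Lemma CAC_real (F G : R -> R) : AC F G -> CAC (fun x => (F x)%:C%C) (fun x => (G x)%:C%C).
Proof. by move=> a; split; [exact: a|exact: AC_cst]. Qed.
Lemma CAC_shift a f g : 0 <= a -> CAC f g -> CAC (fun x => f (x + a)) (fun x => g (x + a)).
Proof. by move=> a0 [b c]; split; [exact: (AC_shift a0 b)|exact: (AC_shift a0 c)]. Qed.
Lemma CAC_nsq f g : CAC f g -> AC (fun x => nsq (f x)) (fun x => 2 * Re (conj (f x) * g x)).
Proof.
move=> [a b]; apply: AC_ext (AC_add (AC_mul a a) (AC_mul b b)) => x _; rewrite ?CE /nsq; ring.
Qed.
Lemma CAC_prim z g : CLI g ->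
  exists2 f, CAC f g & f 0 = z.
Proof.
move=> [a b]; exists (fun x => Complex (Re z + Rint `[0, x] (fun y => Re (g y))) (Im z + Rint `[0, x] (fun y => Im (g y)))).
 by split; exact: AC_prim.
by rewrite !RintI0 !addr0; case: z.
Qed.
(** Working coordinatewise would lose a constant. Instead the real part of [conj D * g] is
    integrated, where [D] is the increment itself. *)
Lemma CAC_le_nrm f g (F G : R -> R) s t : CAC f g -> AC F G -> 0 <= s -> s <= t ->
  (forall x, s <= x -> x <= t -> nrm (g x) <= G x) -> nrm (f t - f s) <= F t - F s.
Proof.
move=> [a b] aF s0 st gG; set D := f t - f s.
have [D0|D0] := eqVneq D 0.
 rewrite D0 nrm0; have := AC_le (AC_cst 0) aF s0 st; rewrite subrr; apply => x sx xt. exact: le_trans (nrm_ge0 _) (gG x sx xt).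
have n0 : 0 < nrm D by rewrite nrm_gt0.
have := AC_le (AC_add (AC_scale (Re D) a) (AC_scale (Im D) b)) (AC_scale (nrm D) aF) s0 st.
have -> : Re D * Re (f t) + Im D * Im (f t) - (Re D * Re (f s) + Im D * Im (f s)) = nsq D.
 by rewrite /nsq /D !CE; ring.
rewrite -nrmE -mulrBr expr2 ler_pM2l //; apply => x sx xt.
apply: le_trans (_ : nrm (conj D * g x) <= _).
 by apply: le_trans (Re_le _); apply: le_trans (ler_norm _); rewrite !CE; apply: eqW; ring.
by rewrite nrmM nrmJ ler_wpM2l ?nrm_ge0 // gG.
Qed.
Lemma CAC_itv_eq f g h s t : CAC f g -> CAC h g -> 0 <= s -> s <= t -> f t - f s = h t - h s.
Proof.
move=> [a b] [c d] s0 st; have := AC_eq a c s0 st; have := AC_eq b d s0 st.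
by move=> e1 e2; apply: C_eq; rewrite !CE.
Qed.
Lemma CAC_const f s t : CAC f (fun=> 0) -> 0 <= s -> s <= t -> f t = f s.
Proof. by move=> a s0 st; apply/eqP; rewrite -subr_eq0 (CAC_itv_eq a (CAC_cst 0) s0 st) subrr. Qed.

End ComplexCalculus.

(** * Existence of solutions by Picard series *)

Section Existence.
Implicit Types (z w : C) (x y s t M a : R).

Lemma AC_sum (F G : nat -> R -> R) n : (forall i, AC (F i.+1) (G i)) -> AC (F 0%N) (fun=> 0) ->
  AC (fun x => \sum_(0 <= i < n.+1) F i x) (fun x => \sum_(0 <= i < n) G i x).
Proof.
move=> aF a0; elim: n => [|n IH].
 by apply: AC_ext a0 => x _; rewrite ?big_nat1 ?big_geq.
by apply: AC_ext (AC_add IH (aF n)) => x _; rewrite [RHS]big_nat_recr.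
Qed.

Lemma AC_expcoeff (K k : R -> R) n : AC K k ->
  AC (fun x => K x ^+ n.+1 / n.+1`!%:R) (fun x => k x * (K x ^+ n / n`!%:R)).
Proof.
move=> aK; suff H : AC (fun x => K x ^+ n.+1) (fun x => n.+1%:R * (k x * K x ^+ n)).
 apply: AC_ext (AC_scale n.+1`!%:R^-1 H) => x _; first by rewrite mulrC.
 by rewrite factS natrM; field; rewrite pnatr_eq0 -lt0n fact_gt0 /= addrC natr1 pnatr_eq0.
elim: n => [|n IH].
 by apply: AC_ext aK => x _; rewrite ?expr1 // expr0 mulr1 mul1r.
apply: AC_ext (AC_mul IH aK) => x _; first by rewrite -exprSr.
rewrite -[in RHS]natr1 [K x ^+ n.+1]exprS; ring.
Qed.

Lemma series_expcoeff_le (a : R) n : 0 <= a -> \sum_(0 <= i < n) a ^+ i / i`!%:R <= expR a.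
Proof.
move=> a0; rewrite /expR; apply: (@nondecreasing_cvgn_le _ (series (exp_coeff a)) _ _ n).
 by apply/nondecreasing_seqP => m; rewrite /series /= big_nat_recr //= lerDl exp_coeff_ge0.
exact: is_cvg_series_exp_coeff.
Qed.

Variables (Q : R -> C) (u0 w0 : C).
Hypothesis IQ : CLI Q.

Let Cprim (g : R -> C) (x : R) : C :=
  Complex (Rint `[0, x] (fun y => Re (g y))) (Rint `[0, x] (fun y => Im (g y))).

Let CprimP g : CLI g -> CAC (Cprim g) g.
Proof.
by move=> [a b]; split; split=> // x x0; rewrite /Cprim /= RintI0 add0r.
Qed.

(** [picard n] is the [n]-th term of the series for [(u, w)], not the [n]-th approximation: the
    system [u' = w], [w' = Q u] is linear, so each term is the integral of the right-hand side at
    the previous one. *)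
Fixpoint picard n : (R -> C) * (R -> C) :=
  if n is m.+1 then (Cprim (picard m).2, Cprim (fun x => Q x * (picard m).1 x)) else ((fun=> u0), (fun=> w0)).

Let picard_CLB n : CLB (picard n).1 /\ CLB (picard n).2.
Proof.
elim: n => [|n [IH1 IH2]] /=; first by split; exact: CLB_cst.
split; apply: CAC_CLB; apply: CprimP; first exact: CLB_CLI.
exact: CLI_mulCLB.
Qed.

Let picard_AC1 n : CAC (picard n.+1).1 (picard n).2.
Proof. by apply: CprimP; apply: CLB_CLI; case: (picard_CLB n). Qed.
Let picard_AC2 n : CAC (picard n.+1).2 (fun x => Q x * (picard n).1 x).
Proof. by apply: CprimP; apply: CLI_mulCLB => //; case: (picard_CLB n). Qed.

Let picard0 n : (picard n.+1).1 0 = 0 /\ (picard n.+1).2 0 = 0.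
Proof. by rewrite /= /Cprim !RintI0. Qed.

Let k x := 1 + nrm (Q x).
Let K x := 0 + Rint `[0, x] k.
Let Ik : LI k. Proof. by apply: LI_add; [exact: LI_cst|exact: LI_nrm]. Qed.
Let aK : AC K k. Proof. exact: AC_prim. Qed.
Let K0 : K 0 = 0. Proof. by rewrite /K RintI0 addr0. Qed.
Let k_ge0 x : 0 <= k x. Proof. by rewrite addr_ge0 // nrm_ge0. Qed.
Let K_ge0 x : 0 <= x -> 0 <= K x.
Proof. by move=> x0; rewrite -K0; apply: AC_homo aK (lexx 0) x0 _. Qed.
Let A := nrm u0 + nrm w0.
Let A0 : 0 <= A. Proof. by rewrite addr_ge0 // nrm_ge0. Qed.

(** The factorial bound in the variable [K], the integral of [1 + |Q|], because [Q] is integrable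
    but not bounded. *)
Let picard_bound n x : 0 <= x ->
  nrm ((picard n).1 x) <= A * (K x ^+ n / n`!%:R) /\ nrm ((picard n).2 x) <= A * (K x ^+ n / n`!%:R).
Proof.
elim: n x => [|n IH] x x0.
 rewrite expr0 fact0 divr1 mulr1 /=; split; first by rewrite lerDl nrm_ge0. by rewrite lerDr nrm_ge0.
have aF := AC_scale A (AC_expcoeff n aK).
have F0 y : 0 <= y -> 0 <= A * (K y ^+ n / n`!%:R).
 by move=> y0; rewrite mulr_ge0 // divr_ge0 // exprn_ge0 // K_ge0.
split.
- have := CAC_le_nrm (picard_AC1 n) aF (lexx 0) x0.
 rewrite (proj1 (picard0 n)) subr0 K0 expr0n mul0r mulr0 subr0; apply => y y0 _.
 have [_ h] := IH y y0; apply: le_trans h _; rewrite [leRHS]mulrCA; apply: ler_peMl; [exact: F0|by rewrite lerDl nrm_ge0].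
- have := CAC_le_nrm (picard_AC2 n) aF (lexx 0) x0.
 rewrite (proj2 (picard0 n)) subr0 K0 expr0n mul0r mulr0 subr0; apply => y y0 _.
 have [h _] := IH y y0; rewrite nrmM mulrCA; apply: ler_pM; rewrite ?nrm_ge0 // lerDr //.
Qed.

Let ser (g : nat -> R -> R) (x : R) (n : nat) := \sum_(0 <= i < n) g i x.
Let dom (g : nat -> R -> R) := forall n x, 0 <= x -> `|g n x| <= A * (K x ^+ n / n`!%:R).

Let ser_cvg g x : dom g -> 0 <= x -> ser g x n @[n --> \oo] --> limn (ser g x).
Proof.
move=> dg x0; apply: (@normed_cvg R R^o (fun i => g i x)).
apply: (@series_le_cvg R _ (fun n => A * exp_coeff (K x) n)) => [n|n|n|].
- exact: normr_ge0.
- by rewrite mulr_ge0 // exp_coeff_ge0 // K_ge0.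
- exact: dg.
- have -> : series (fun n => A * exp_coeff (K x) n) = (fun n => A * series (exp_coeff (K x)) n).
  by apply/funext => n; rewrite /series /= mulr_sumr.
 by apply: is_cvgMr; exact: is_cvg_series_exp_coeff.
Qed.

Let ser_bound g x n : dom g -> 0 <= x -> `|ser g x n| <= A * expR (K x).
Proof.
move=> dg x0; apply: le_trans (ler_norm_sum _ _ _) _.
apply: (@le_trans _ _ (\sum_(0 <= i < n) A * (K x ^+ i / i`!%:R))).
 by apply: ler_sum => i _; exact: dg.
by rewrite -mulr_sumr ler_wpM2l // series_expcoeff_le // K_ge0.
Qed.

Let r1 i x := Re ((picard i).1 x). Let i1 i x := Im ((picard i).1 x).
Let r2 i x := Re ((picard i).2 x). Let i2 i x := Im ((picard i).2 x).
Let dr1 : dom r1. Proof. by move=> n x x0; apply: le_trans (Re_le _) _; case: (picard_bound n x0). Qed.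
Let di1 : dom i1. Proof. by move=> n x x0; apply: le_trans (Im_le _) _; case: (picard_bound n x0). Qed.
Let dr2 : dom r2. Proof. by move=> n x x0; apply: le_trans (Re_le _) _; case: (picard_bound n x0). Qed.
Let di2 : dom i2. Proof. by move=> n x x0; apply: le_trans (Im_le _) _; case: (picard_bound n x0). Qed.

Lemma ode_exists : exists u w : R -> C,
  [/\ CAC u w, CAC w (fun x => Q x * u x), u 0 = u0 & w 0 = w0].
Proof.
pose u x : C := Complex (limn (ser r1 x)) (limn (ser i1 x)).
pose w x : C := Complex (limn (ser r2 x)) (limn (ser i2 x)).
have IG : LI (fun x => A * expR (K x)) by apply: LB_LI; apply: LB_mul; [exact: LB_cst|apply: LB_expR; exact: AC_LB aK].
have IGQ : LI (fun x => (A * expR (K x)) * nrm (Q x) * 2).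
 by apply: LI_mulLB; [apply: LB_mulLI; [apply: LB_mul; [exact: LB_cst|apply: LB_expR; exact: AC_LB aK]|exact: LI_nrm]|exact: LB_cst].
have shiftcvg g x : dom g -> 0 <= x -> ser g x n.+1 @[n --> \oo] --> limn (ser g x).
 by move=> dg x0; have := ser_cvg dg x0; rewrite -(cvg_shiftS (ser g x)).
have init (g : nat -> R -> R) : (forall i, g i.+1 0 = 0) -> limn (ser g 0) = g 0%N 0.
 move=> g0; apply: (@lim_near_cst R^o) => //; exists 1%N => // -[//|n] _ /=. rewrite /ser big_nat_recl //= big1 ?addr0 // => i _; exact: g0.
exists u, w; split.
- split.
 + apply: (@AC_cvg (fun n x => ser r1 x n.+1) (fun n x => ser r2 x n) _ _ (fun x => A * expR (K x))) => //.
  * by move=> n; apply: AC_sum; [move=> i; exact: (proj1 (picard_AC1 i))|exact: AC_cst].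
  * by move=> x x0; exact: shiftcvg.
  * by move=> x x0; exact: ser_cvg.
  * by move=> n x x0; exact: ser_bound.
 + apply: (@AC_cvg (fun n x => ser i1 x n.+1) (fun n x => ser i2 x n) _ _ (fun x => A * expR (K x))) => //.
  * by move=> n; apply: AC_sum; [move=> i; exact: (proj2 (picard_AC1 i))|exact: AC_cst].
  * by move=> x x0; exact: shiftcvg.
  * by move=> x x0; exact: ser_cvg.
  * by move=> n x x0; exact: ser_bound.
- have lin (a b : R) g h x n : ser (fun i x => a * g i x + b * h i x) x n = a * ser g x n + b * ser h x n.
  by rewrite /ser big_split /= -!mulr_sumr.
 have bnd (c : R -> R) g x n : (forall x, `|c x| <= nrm (Q x)) -> dom g -> 0 <= x -> `|c x * ser g x n| <= nrm (Q x) * (A * expR (K x)).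
  by move=> cQ dg x0; rewrite normrM ler_pM // ser_bound.
 have NI y : `|- Im (Q y)| <= nrm (Q y) by rewrite normrN Im_le. split.
 + apply: (@AC_cvg (fun n x => ser r2 x n.+1) (fun n x => Re (Q x) * ser r1 x n + (- Im (Q x)) * ser i1 x n) _ _ _ _ IGQ).
  * move=> n; apply: AC_ext (@AC_sum r2 (fun i x => Re (Q x) * r1 i x + (- Im (Q x)) * i1 i x) n _ _) => //.
   - by move=> x _; rewrite -lin.
   - by move=> i; apply: AC_ext (proj1 (picard_AC2 i)) => // x _; rewrite !CE mulNr.
   - exact: AC_cst.
  * by move=> x x0; exact: shiftcvg.
  * move=> x x0; rewrite !CE -mulNr; apply: cvgD; apply: cvgMr; exact: ser_cvg.
  * move=> n x x0; apply: le_trans (ler_normD _ _) _.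
   have h1 := bnd (fun x => Re (Q x)) _ _ n (fun x => Re_le (Q x)) dr1 x0. have h2 := bnd (fun x => - Im (Q x)) _ _ n NI di1 x0.
   by apply: le_trans (lerD h1 h2) _; apply: eqW; ring.
 + apply: (@AC_cvg (fun n x => ser i2 x n.+1) (fun n x => Re (Q x) * ser i1 x n + Im (Q x) * ser r1 x n) _ _ _ _ IGQ).
  * move=> n; apply: AC_ext (@AC_sum i2 (fun i x => Re (Q x) * i1 i x + Im (Q x) * r1 i x) n _ _) => //.
   - by move=> x _; rewrite -lin.
   - by move=> i; apply: AC_ext (proj2 (picard_AC2 i)) => // x _; rewrite !CE.
   - exact: AC_cst.
  * by move=> x x0; exact: shiftcvg.
  * move=> x x0; rewrite !CE; apply: cvgD; apply: cvgMr; exact: ser_cvg.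
  * move=> n x x0; apply: le_trans (ler_normD _ _) _.
   have h1 := bnd (fun x => Re (Q x)) _ _ n (fun x => Re_le (Q x)) di1 x0.
   have h2 := bnd (fun x => Im (Q x)) _ _ n (fun x => Im_le (Q x)) dr1 x0. by apply: le_trans (lerD h1 h2) _; apply: eqW; ring.
- by apply: C_eq; rewrite /u /= init // => i; rewrite /r1 /i1 /= RintI0.
- by apply: C_eq; rewrite /w /= init // => i; rewrite /r2 /i2 /= RintI0.
Qed.

End Existence.

(** * Linear second-order equations: growth, uniqueness, Wronskians *)

Section LinearODE.
Implicit Types (z : C) (x y s t M a : R) (Q g u w : R -> C).

(** With [Q = q - z] the source [g] means [(H - z) u = g]. *)
Definition solg Q g u w := CAC u w /\ CAC w (fun x => Q x * u x - g x).
Definition sol Q u w := CAC u w /\ CAC w (fun x => Q x * u x).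
Definition U2 u w x : R := nsq (u x) + nsq (w x).

Lemma U2_ge0 u w x : 0 <= U2 u w x. Proof. by rewrite addr_ge0 // nsq_ge0. Qed.
Lemma sol_solg Q u w : sol Q u w -> solg Q (fun=> 0) u w.
Proof. by move=> [a b]; split=> //; apply: CAC_ext b => x _ //; rewrite subr0. Qed.

Lemma nsq_prod_le (a b : C) : 2 * `|Re (conj a * b)| <= nsq a + nsq b.
Proof.
have := nsq_ge0 (a - b); have := nsq_ge0 (a + b); rewrite /nsq !CE => h1 h2.
by rewrite -[2]ger0_norm // -normrM ler_norml; apply/andP; split; nra.
Qed.

Lemma Re_nrm_le (a b : C) : `|Re (conj a * b)| <= nrm a * nrm b.
Proof. by apply: le_trans (Re_le _) _; rewrite nrmM nrmJ. Qed.
Lemma nrm_prod_le (a b : C) : 2 * (nrm a * nrm b) <= nsq a + nsq b.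
Proof. by rewrite -!nrmE; have := sqr_ge0 (nrm a - nrm b); nra. Qed.

(** The derivative of [|u|^2 + |w|^2] is at most [2 + |Q|] times that quantity plus [|g|^2], in
    absolute value; hence Gronwall in both directions. *)
Lemma solg_growth Q g u w (K H : R -> R) s t : solg Q g u w ->
  AC K (fun x => 2 + nrm (Q x)) -> AC H (fun x => nsq (g x)) -> 0 <= s -> s <= t ->
  U2 u w t <= expR (K t - K s) * (U2 u w s + (H t - H s)) /\
  U2 u w s <= expR (K t - K s) * (U2 u w t + (H t - H s)).
Proof.
move=> [au aw] aK aH s0 st.
have aN := AC_add (CAC_nsq au) (CAC_nsq aw).
have key x : `|2 * Re (conj (u x) * w x) + 2 * Re (conj (w x) * (Q x * u x - g x))| <=
  (2 + nrm (Q x)) * (nsq (u x) + nsq (w x)) + nsq (g x).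
 have h1 := nsq_prod_le (u x) (w x); have h2 := nsq_prod_le (w x) (g x).
 have h3 : 2 * `|Re (conj (w x) * (Q x * u x))| <= nrm (Q x) * (nsq (u x) + nsq (w x)).
  apply: (@le_trans _ _ (2 * (nrm (w x) * (nrm (Q x) * nrm (u x))))).
   by rewrite ler_pM2l //; apply: le_trans (Re_nrm_le _ _) _; rewrite nrmM.
  have := ler_wpM2l (nrm_ge0 (Q x)) (nrm_prod_le (u x) (w x)); lin.
 have h4 : Re (conj (w x) * (Q x * u x - g x)) = Re (conj (w x) * (Q x * u x)) - Re (conj (w x) * g x) by rewrite mulrBr !(ReD, ReN).
 have := nsq_ge0 (u x); have := nsq_ge0 (w x); rewrite h4.
 have h6 := ler_norm (Re (conj (u x) * w x)); have h6' := lerNnormlW (lexx `|Re (conj (u x) * w x)|).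
 have h7 := ler_norm (Re (conj (w x) * (Q x * u x))); have h7' := lerNnormlW (lexx `|Re (conj (w x) * (Q x * u x))|).
 have h8 := ler_norm (Re (conj (w x) * g x)); have h8' := lerNnormlW (lexx `|Re (conj (w x) * g x)|).
 by move=> p1 p2; rewrite ler_norml; apply/andP; split; lin.
have k0 x : 0 <= 2 + nrm (Q x) by rewrite addr_ge0 // nrm_ge0.
have h0 x : 0 <= nsq (g x) by exact: nsq_ge0.
split.
 apply: (gronwall aN aK aH s0 st) => x _ _ //. exact: le_trans (ler_norm _) (key x).
apply: (gronwall_back aN aK aH s0 st) => x _ _ //.
by apply: le_trans (key x); rewrite -normrN; exact: ler_norm.
Qed.

Lemma sol_growth Q u w (K : R -> R) s t : sol Q u w ->
  AC K (fun x => 2 + nrm (Q x)) -> 0 <= s -> s <= t ->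
  U2 u w t <= expR (K t - K s) * U2 u w s /\ U2 u w s <= expR (K t - K s) * U2 u w t.
Proof.
move=> /sol_solg sl aK s0 st.
have a0 : AC (fun=> 0) (fun x : R => nsq (0 : C)) by apply: AC_ext (AC_cst 0) => // x _; rewrite /nsq !CE; ring.
by have := solg_growth sl aK a0 s0 st; rewrite subrr !addr0.
Qed.

Lemma CAC_lin (a b : C) (f g f1 g1 : R -> C) : CAC f g -> CAC f1 g1 ->
  CAC (fun x => a * f x + b * f1 x) (fun x => a * g x + b * g1 x).
Proof. by move=> h1 h2; exact: CAC_add (CAC_scale a h1) (CAC_scale b h2). Qed.

Lemma sol_lin (a b : C) Q u w u1 w1 : sol Q u w -> sol Q u1 w1 ->
  sol Q (fun x => a * u x + b * u1 x) (fun x => a * w x + b * w1 x).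
Proof.
move=> [h1 h2] [h3 h4]; split; first exact: CAC_lin.
by apply: CAC_ext (CAC_lin a b h2 h4) => x _ //; ring.
Qed.

Lemma sol_CLI_K Q : CLI Q -> exists2 K : R -> R, AC K (fun x => 2 + nrm (Q x)) & K 0 = 0.
Proof.
move=> IQ; exists (fun x => 0 + Rint `[0, x] (fun x => 2 + nrm (Q x))).
 by apply: AC_prim; apply: LI_add; [exact: LI_cst|exact: LI_nrm].
by rewrite RintI0 addr0.
Qed.

Lemma nsq_eq0 z : nsq z = 0 -> z = 0.
Proof. by move=> h; apply: Normc.eq0_normc; apply/eqP; rewrite -sqrf_eq0 nrmE h. Qed.

Lemma sol_unique Q u w u1 w1 : CLI Q -> sol Q u w -> sol Q u1 w1 -> u 0 = u1 0 -> w 0 = w1 0 ->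
  forall x, 0 <= x -> u x = u1 x /\ w x = w1 x.
Proof.
move=> IQ s1 s2 e1 e2 x x0; have [K aK _] := sol_CLI_K IQ.
have [+ _] := sol_growth (sol_lin 1 (-1) s1 s2) aK (lexx 0) x0.
rewrite {2}/U2 e1 e2 (_ : 1 * u1 0 + -1 * u1 0 = 0); last ring.
rewrite (_ : 1 * w1 0 + -1 * w1 0 = 0); last ring.
rewrite /nsq !(Re0, Im0) !expr0n !addr0 mulr0 => h.
have /eqP : U2 (fun x => 1 * u x + -1 * u1 x) (fun x => 1 * w x + -1 * w1 x) x = 0.
 by apply/eqP; rewrite eq_le h U2_ge0.
rewrite /U2.
rewrite paddr_eq0 ?nsq_ge0 // => /andP[/eqP/nsq_eq0 h1 /eqP/nsq_eq0 h2].
split; apply/eqP; rewrite -subr_eq0; apply/eqP; [rewrite -{}h1|rewrite -{}h2]; ring.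
Qed.

Definition Wr u w u1 w1 x : C := u x * w1 x - w x * u1 x.

Lemma Wr_AC Q Q1 u w u1 w1 : sol Q u w -> sol Q1 u1 w1 ->
  CAC (Wr u w u1 w1) (fun x => (Q1 x - Q x) * (u x * u1 x)).
Proof.
move=> [a b] [c d]; apply: CAC_ext (CAC_sub (CAC_mul a d) (CAC_mul b c)) => x _ //; ring.
Qed.

Lemma Wr_const Q u w u1 w1 x : sol Q u w -> sol Q u1 w1 -> 0 <= x -> Wr u w u1 w1 x = Wr u w u1 w1 0.
Proof.
move=> s1 s2 x0; apply: CAC_const (lexx 0) x0.
by apply: CAC_ext (Wr_AC s1 s2) => y _ //; ring.
Qed.

Lemma sol_conj Q u w : sol Q u w -> sol (fun x => conj (Q x)) (fun x => conj (u x)) (fun x => conj (w x)).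
Proof.
move=> [a b]; split; first exact: CAC_conj.
by apply: CAC_ext (CAC_conj b) => x _ //; rewrite rmorphM.
Qed.

(** The [L^2] mass of [u] on a unit interval controls [u] and [w] pointwise there. Let [X] be the
    maximum of [|u|]. The equation limits the oscillation of [w] by [Q0 X + ga], and the mean of [w]
    is [u (s + 1) - u s], so [|w| <= (2 + Q0) X + ga]. Then [|u|^2] varies so little that its mean
    is at least a fixed part of [X ^+ 2], up to [ga ^+ 2]. *)
Lemma unit_bound Q g u w (KQ Kg P : R -> R) (Q0 s : R) : solg Q g u w ->
  AC KQ (fun x => nrm (Q x)) -> AC Kg (fun x => nrm (g x)) -> AC P (fun x => nsq (u x)) ->
  0 <= s -> 0 <= Q0 -> KQ (s + 1) - KQ s <= Q0 -> forall x, s <= x -> x <= s + 1 ->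
  U2 u w x <= ((1 + 2 * (2 + Q0) ^+ 2) * (2 * (1 + 4 * (2 + Q0) ^+ 2)) + 2) *
              ((P (s + 1) - P s) + (Kg (s + 1) - Kg s) ^+ 2).
Proof.
move=> [au aw] aKQ aKg aP s0 Q00 KQ0.
set A := P _ - P _; set ga := Kg _ - Kg _; set B := 2 + Q0.
have s1 : s <= s + 1 by rewrite lerDl.
have B2 : 2 <= B by rewrite /B lerDl.
have ga0 : 0 <= ga.
 by rewrite subr_ge0; apply: AC_homo aKg s0 s1 _ => y _ _; exact: nrm_ge0.
have [xm] := EVT_max s1 (AC_within (b := s + 1) (CAC_nsq au) s0).
rewrite in_itv /= => /andP[sxm xms] xmP; set X := nrm (u xm).
have X0 : 0 <= X by exact: nrm_ge0.
have uX y : s <= y -> y <= s + 1 -> nsq (u y) <= X ^+ 2.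
 by move=> sy ys; rewrite nrmE; apply: xmP; rewrite in_itv /= sy ys.
have uX' y : s <= y -> y <= s + 1 -> nrm (u y) <= X.
 by move=> sy ys; apply: nrm_sqr_le => //; exact: uX.
have wd0 x y : s <= y -> y <= x -> x <= s + 1 -> nrm (w x - w y) <= Q0 * X + ga.
 move=> sy yx xs; have y0 := le_trans s0 sy. have := CAC_le_nrm aw (AC_add (AC_scale X aKQ) aKg) y0 yx => h.
 apply: le_trans (h _) _ => [t yt tx|].
  apply: le_trans (nrmB _ _) _; rewrite lerD2r nrmM mulrC ler_wpM2r ?nrm_ge0 // uX' //; lin.
 have m1 a b : s <= a -> a <= b -> b <= s + 1 -> KQ a <= KQ b.
  by move=> sa ab bs; apply: AC_homo aKQ (le_trans s0 sa) ab _ => t _ _; exact: nrm_ge0.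
 have m2 a b : s <= a -> a <= b -> b <= s + 1 -> Kg a <= Kg b.
  by move=> sa ab bs; apply: AC_homo aKg (le_trans s0 sa) ab _ => t _ _; exact: nrm_ge0.
 have h1 := m1 s y (lexx s) sy (le_trans yx xs); have h2 := m1 x (s + 1) (le_trans sy yx) xs (lexx _).
 have h3 := m2 s y (lexx s) sy (le_trans yx xs); have h4 := m2 x (s + 1) (le_trans sy yx) xs (lexx _).
 have h5 : X * (KQ x - KQ y) <= X * Q0 by rewrite ler_wpM2l //; lin. rewrite /ga; lin.
have wd x y : s <= y -> y <= s + 1 -> s <= x -> x <= s + 1 -> nrm (w x - w y) <= Q0 * X + ga.
 move=> sy ys sx xs; have [yx|xy] := leP y x; first exact: wd0. by rewrite -nrmN opprB; apply: wd0 => //; exact: ltW.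
set Wm := B * X + ga.
have wm x : s <= x -> x <= s + 1 -> nrm (w x) <= Wm.
 (* Integrating [w - w x] over the unit interval compares [w x] with the mean of [w]. *)
 move=> sx xs. have := CAC_le_nrm (CAC_sub au (CAC_scale (w x) (CAC_real AC_id))) (AC_scale (Q0 * X + ga) AC_id) s0 s1.
 rewrite -mulrBr (_ : s + 1 - s = 1) ?mulr1; last ring.
 rewrite (_ : u (s + 1) - w x * (s + 1)%:C%C - (u s - w x * s%:C%C) = u (s + 1) - u s - w x); last first.
  by rewrite rmorphD /=; ring.
 move=> h; have {h} := h _; set T := nrm _ => h. have hT : T <= Q0 * X + ga.
  by apply: h => y sy ys; exact: wd.
 have -> : w x = (u (s + 1) - u s) - (u (s + 1) - u s - w x) by ring. apply: le_trans (nrmB _ _) _; have h2 := nrmB (u (s + 1)) (u s).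
 have h3 := uX' (s + 1) s1 (lexx _); have h4 := uX' s (lexx _) s1. rewrite /Wm /B -/T; lin.
have Wm0 : 0 <= Wm by rewrite /Wm addr_ge0 // mulr_ge0 //; lin.
(* A weighted Young inequality for [2 |u| |w|]: with this weight [tau * Wm ^+ 2] contributes only
   half of [X ^+ 2], which is absorbed in [hX2]. *)
have tau0 : 0 < (4 * B ^+ 2)^-1 by rewrite invr_gt0 mulr_gt0 // exprn_gt0 //; lin.
set tau := (4 * B ^+ 2)^-1 in tau0.
have tauV : tau^-1 = 4 * B ^+ 2 by rewrite invrK.
set cc := A / tau + tau * Wm ^+ 2.
have A0 a b : s <= a -> a <= b -> P a <= P b.
 by move=> sa ab; apply: AC_homo aP (le_trans s0 sa) ab _ => t _ _; exact: nsq_ge0.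
have aF := AC_add (AC_scale tau^-1 aP) (AC_scale (tau * Wm ^+ 2) AC_id).
have nd0 x y : s <= y -> y <= x -> x <= s + 1 -> `|nsq (u x) - nsq (u y)| <= cc.
 move=> sy yx xs; have y0 := le_trans s0 sy. apply: le_trans (AC_norm_le (CAC_nsq au) aF y0 yx _) _ => [t yt tx|].
  have wt := wm t (le_trans sy yt) (le_trans tx xs). have hw : nsq (w t) <= Wm ^+ 2 by rewrite -nrmE ler_pXn2r // nnegrE nrm_ge0.
  rewrite normrM ger0_norm // mulr1. apply: le_trans (_ : 2 * (nrm (u t) * nrm (w t)) <= _); first by rewrite ler_pM2l // Re_nrm_le.
  apply: (@le_trans _ _ (tau^-1 * nsq (u t) + tau * nsq (w t))); last by rewrite lerD2l ler_wpM2l // ltW. rewrite -!nrmE -subr_ge0.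
  rewrite (_ : _ - _ = tau^-1 * (nrm (u t) - tau * nrm (w t)) ^+ 2); last by field; rewrite gt_eqF.
  by rewrite mulr_ge0 ?sqr_ge0 // invr_ge0 ltW.
 have h1 := A0 s y (lexx s) sy; have h2 := A0 x (s + 1) (le_trans sy yx) xs. have hA : P x - P y <= A by rewrite /A lerB.
 have h3 : tau^-1 * (P x - P y) <= tau^-1 * A by rewrite ler_wpM2l // invr_ge0 ltW. have h4 : tau * Wm ^+ 2 * (x - y) <= tau * Wm ^+ 2 * 1.
  by rewrite ler_wpM2l //; [rewrite mulr_ge0 ?sqr_ge0 // ltW|lin].
 rewrite /cc; lin.
have nd x y : s <= y -> y <= s + 1 -> s <= x -> x <= s + 1 -> `|nsq (u x) - nsq (u y)| <= cc.
 move=> sy ys sx xs; have [yx|xy] := leP y x; first exact: nd0. by rewrite distrC; apply: nd0 => //; exact: ltW.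
have hX : X ^+ 2 <= A + cc.
 have := AC_le (AC_scale (X ^+ 2 - cc) AC_id) aP s0 s1. rewrite -mulrBr (_ : s + 1 - s = 1) ?mulr1; last ring.
 rewrite -/A lerBlDr; apply => y sy ys; rewrite nrmE. have := nd xm y sy ys sxm xms; have := ler_norm (nsq (u xm) - nsq (u y)); lin.
have A00 : 0 <= A by rewrite subr_ge0 A0.
have htau : tau * Wm ^+ 2 <= X ^+ 2 / 2 + ga ^+ 2 / 2.
 apply: (@le_trans _ _ (tau * (2 * B ^+ 2 * X ^+ 2 + 2 * ga ^+ 2))).
  rewrite ler_wpM2l ?(ltW tau0) // -subr_ge0. by rewrite (_ : _ - _ = (B * X - ga) ^+ 2) ?sqr_ge0 // /Wm; ring.
 have -> : tau * (2 * B ^+ 2 * X ^+ 2 + 2 * ga ^+ 2) = X ^+ 2 / 2 + 2 * tau * ga ^+ 2.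
  by rewrite /tau; field; rewrite gt_eqF //; lin.
 rewrite lerD2l [leRHS]mulrC ler_wpM2r ?sqr_ge0 //. rewrite /tau -ler_pdivlMl // ; have hB : 4 <= 4 * B ^+ 2 by nra.
 have : (4 * B ^+ 2)^-1 <= 4^-1 by rewrite lef_pV2 // posrE; lin. lin.
have hX2 : X ^+ 2 <= 2 * (1 + 4 * B ^+ 2) * A + ga ^+ 2.
 have : cc = 4 * B ^+ 2 * A + tau * Wm ^+ 2 by rewrite /cc tauV mulrC. move: hX htau; lin.
move=> x sx xs; rewrite /U2.
have h1 := uX x sx xs.
have h2 : nsq (w x) <= 2 * B ^+ 2 * X ^+ 2 + 2 * ga ^+ 2.
 rewrite -nrmE; apply: (@le_trans _ _ (Wm ^+ 2)); first by rewrite ler_pXn2r ?nnegrE ?nrm_ge0 // wm.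
 by rewrite -subr_ge0 (_ : _ - _ = (B * X - ga) ^+ 2) ?sqr_ge0 // /Wm; ring.
have g2 := sqr_ge0 ga.
have hB0 : 0 <= B ^+ 2 by exact: sqr_ge0.
have h3 : (1 + 2 * B ^+ 2) * X ^+ 2 <= (1 + 2 * B ^+ 2) * (2 * (1 + 4 * B ^+ 2) * A + ga ^+ 2).
 by rewrite ler_wpM2l //; lin.
apply: (@le_trans _ _ ((1 + 2 * B ^+ 2) * X ^+ 2 + 2 * ga ^+ 2)); first lin.
set c1 := 1 + 2 * B ^+ 2 in h3 *; set c2 := 2 * (1 + 4 * B ^+ 2) in h3 *.
have c10 : 1 <= c1 by rewrite /c1; lin.
have c20 : 2 <= c2 by rewrite /c2; lin.
have h4 : c1 * ga ^+ 2 <= c1 * c2 * ga ^+ 2 by rewrite -mulrA ler_wpM2l ?ler_peMl //; lin.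
have h5 : 0 <= 2 * A by lin.
apply: (@le_trans _ _ (c1 * (c2 * A + ga ^+ 2) + 2 * ga ^+ 2)); first by rewrite lerD2r.
rewrite mulrDr mulrA; lin.
Qed.

End LinearODE.

(** * Square-integrable functions and the Cauchy-Schwarz inequality *)

Section SquareIntegrable.
Implicit Types (z : C) (x y s t M a : R) (Q g u v w : R -> C).

Definition N2 u x : R := Rint `[0, x] (fun y => nsq (u y)).
Definition L2b u : Prop := exists M : R, forall x, 0 <= x -> N2 u x <= M.
(** The squared norm on the half-line; as a [limn] it is meaningful only together with [L2b u]. *)
Definition TN u : R := limn (fun n => N2 u n%:R).

Lemma CLB_nsq u : CLB u -> LB (fun x => nsq (u x)).
Proof. by move=> [a b]; apply: LB_ext (LB_add (LB_mul a a) (LB_mul b b)) => x _; rewrite /nsq !expr2. Qed.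
Lemma N2_0 u : N2 u 0 = 0. Proof. by rewrite /N2 RintI0. Qed.
Lemma N2_AC u : CLB u -> AC (N2 u) (fun x => nsq (u x)).
Proof. by move=> Bu; split; [exact: LB_LI (CLB_nsq Bu)|move=> x x0; rewrite N2_0 add0r]. Qed.
Lemma N2_mono u s t : CLB u -> 0 <= s -> s <= t -> N2 u s <= N2 u t.
Proof. by move=> Bu s0 st; apply: AC_homo (N2_AC Bu) s0 st _ => x _ _; exact: nsq_ge0. Qed.
Lemma N2_ge0 u x : CLB u -> 0 <= x -> 0 <= N2 u x.
Proof. by move=> Bu x0; rewrite -(N2_0 u); exact: N2_mono. Qed.

Lemma N2_cvg u : CLB u -> L2b u -> N2 u n%:R @[n --> \oo] --> TN u.
Proof.
move=> Bu [M HM]; apply: nondecreasing_is_cvgn.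
 by apply/nondecreasing_seqP => n; apply: N2_mono => //; rewrite ler_nat.
by exists M => _ [n _ <-]; exact: HM.
Qed.

Lemma N2_le_TN u x : CLB u -> L2b u -> 0 <= x -> N2 u x <= TN u.
Proof.
move=> Bu Lu x0; pose n := (Num.truncn x).+1.
apply: (@le_trans _ _ (N2 u n%:R)).
 by apply: N2_mono => //; exact: ltW (truncnS_gt _).
apply: (@nondecreasing_cvgn_le _ (fun n => N2 u n%:R)); last exact: N2_cvg.
by apply/nondecreasing_seqP => i; apply: N2_mono => //; rewrite ler_nat.
Qed.

Lemma TN_ge0 u : CLB u -> L2b u -> 0 <= TN u.
Proof. by move=> Bu Lu; rewrite -(N2_0 u); exact: N2_le_TN. Qed.

Lemma TN_le u M : CLB u -> (forall x, 0 <= x -> N2 u x <= M) -> TN u <= M.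
Proof.
move=> Bu HM; have c : cvgn (fun n => N2 u n%:R) by apply: N2_cvg => //; exists M.
by apply: (limr_le c); apply: nearW => n; exact: HM.
Qed.

(** The choice [tau = c / a] gives the claim at once. If [a = 0] and [c > 0], the choice
    [tau = (b + 1) / c] gives [2 c <= c]. *)
Lemma optim_le (a b c : R) : 0 <= a -> 0 <= b -> 0 <= c ->
  (forall tau, 0 < tau -> 2 * c <= tau * a + tau^-1 * b) -> c ^+ 2 <= a * b.
Proof.
move=> a0 b0 c0 H; rewrite leNgt; apply/negP => h.
have c1 : 0 < c by rewrite lt_neqAle c0 andbT eq_sym; apply: contraTneq h => ->; rewrite expr0n -leNgt mulr_ge0.
have [a1|a1] := eqVneq a 0.
 have hb : c * b / (b + 1) <= c by rewrite ler_pdivrMr ?ltr_wpDl // ler_wpM2l // lerDl.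
 have := H ((b + 1) / c) (divr_gt0 (ltr_wpDl b0 ltr01) c1); rewrite a1 mulr0 add0r invf_div [c / _ * b]mulrAC; lin.
have a2 : 0 < a by rewrite lt_neqAle a0 andbT eq_sym.
have := H (c / a) (divr_gt0 c1 a2); rewrite invf_div divfK // [a / c * b]mulrAC.
have -> : 2 * c = c + c by ring.
by rewrite lerD2l ler_pdivlMr // -expr2 leNgt h.
Qed.

Lemma CS_le u v F x : CLB u -> CLB v -> CAC F (fun x => u x * v x) -> 0 <= x ->
  nsq (F x - F 0) <= N2 u x * N2 v x.
Proof.
move=> Bu Bv aF x0; rewrite -nrmE; apply: optim_le; rewrite ?N2_ge0 ?nrm_ge0 // => tau tau0.
have := CAC_le_nrm aF (AC_add (AC_scale (tau / 2) (N2_AC Bu)) (AC_scale (tau^-1 / 2) (N2_AC Bv))) (lexx 0) x0.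
rewrite !N2_0 !mulr0 addr0 subr0 => H.
have : nrm (F x - F 0) <= tau / 2 * N2 u x + tau^-1 / 2 * N2 v x.
 apply: H => y _ _; rewrite nrmM. have -> : tau / 2 * nsq (u y) + tau^-1 / 2 * nsq (v y) =
  nrm (u y) * nrm (v y) + tau / 2 * (nrm (u y) - tau^-1 * nrm (v y)) ^+ 2. by rewrite -!nrmE; field; rewrite gt_eqF.
 by rewrite lerDl mulr_ge0 ?sqr_ge0 // divr_ge0 // ltW.
lin.
Qed.

Lemma nat_incr_small (f : R -> R) M (e : R) : (forall n : nat, f n%:R <= M) ->
  (forall n : nat, f n%:R <= f n.+1%:R) -> 0 < e ->
  exists N, forall n, (N <= n)%N -> f n.+1%:R - f n%:R <= e.
Proof.
move=> fM fi e0.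
have cf : f n%:R @[n --> \oo] --> limn (fun n => f n%:R).
 apply: nondecreasing_is_cvgn; first by apply/nondecreasing_seqP. by exists M => _ [n _ <-].
have e2 : 0 < e / 2 by rewrite divr_gt0.
have /cvgrPdist_le/(_ _ e2)[N _ HN] := cf.
exists N => n Nn; have h1 := HN n Nn; have h2 := HN n.+1 (leqW Nn).
have := ler_norm (f n.+1%:R - f n%:R).
have := ler_normB (limn (fun n => f n%:R) - f n%:R) (limn (fun n => f n%:R) - f n.+1%:R).
move: h1 h2; rewrite /=; set L := limn _ => h1 h2.
rewrite (_ : L - f n%:R - (L - f n.+1%:R) = f n.+1%:R - f n%:R); last ring.
lin.
Qed.

End SquareIntegrable.

(** * Weyl solutions *)

Section Weyl.
Implicit Types (z : C) (x y s t M a : R) (u v w : R -> C).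

Lemma complex_cluster (m : nat -> C) M : (forall n, nrm (m n) <= M) ->
  exists l : C, forall e N, 0 < e -> exists2 n, (N <= n)%N & nrm (m n - l) <= e.
Proof.
move=> mM; pose f n : R * R := (Re (m n), Im (m n)).
have cK : compact ((`[- M, M]%classic : set R) `*` (`[- M, M]%classic : set R)).
 by apply: compact_setX; exact: segment_compact.
have [] := cK (f @ \oo) _.
 exists 0%N => // n _ /=; rewrite !in_itv /= -!ler_norml. by rewrite (le_trans (Re_le _) (mM n)) (le_trans (Im_le _) (mM n)).
move=> [a b] [_ cl]; exists (Complex a b) => e N e0.
have e2 : 0 < e / 2 by rewrite divr_gt0.
pose A := [set f n | n in [set n | (N <= n)%N]].
have FA : (f @ \oo) A by exists N => // n /= Nn; exists n.
pose B : set (R * R) := ball a (e / 2) `*` ball b (e / 2).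
have NB : nbhs (a, b) B by exists (ball a (e / 2), ball b (e / 2)) => //; split; exact: nbhsx_ballx.
have [_ [[n /= Nn <-] [/= h1 h2]]] := cl A B FA NB.
exists n => //; apply: le_trans (nrm_ReIm _) _; rewrite !CE /=.
by move: h1 h2; rewrite /ball /= /f /= => h1 h2; rewrite (distrC _ a) (distrC _ b); lin.
Qed.

Variables (q Kq : R -> R) (Q0 : R).
Hypotheses (Iq : LI q) (aKq : AC Kq (fun x => `|q x|)) (Q00 : 0 <= Q0)
  (uni : forall s, 0 <= s -> Kq (s + 1) - Kq s <= Q0).

Definition Qz z x : C := (q x)%:C%C - z.

Lemma Qz_CLI z : CLI (Qz z).
Proof. by apply: CLI_sub; [exact: CLI_real|exact: CLI_cst]. Qed.

(** The constant of [unit_bound], with [B] a bound for the integral of [|q - z|] over unit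
    intervals. *)
Definition cU (B : R) : R := (1 + 2 * (2 + B) ^+ 2) * (2 * (1 + 4 * (2 + B) ^+ 2)) + 2.

Lemma cU_gt0 B : 0 < cU B.
Proof.
have h := sqr_ge0 (2 + B); rewrite /cU; apply: ltr_wpDl => //.
by rewrite !mulr_ge0 // addr_ge0 // mulr_ge0.
Qed.

Lemma unit_z z g u w (Kg : R -> R) s x : solg (Qz z) g u w -> AC Kg (fun x => nrm (g x)) ->
  0 <= s -> s <= x -> x <= s + 1 ->
  U2 u w x <= cU (Q0 + nrm z) * ((N2 u (s + 1) - N2 u s) + (Kg (s + 1) - Kg s) ^+ 2).
Proof.
move=> sl aKg s0 sx xs; have Bu := CAC_CLB (proj1 sl).
have aKQ := AC_prim 0 (LI_nrm (Qz_CLI z)).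
apply: (unit_bound sl aKQ aKg (N2_AC Bu) s0) => //; first by rewrite addr_ge0 // nrm_ge0.
have s1 : s <= s + 1 by rewrite lerDl.
apply: le_trans (AC_le aKQ (AC_add aKq (AC_scale (nrm z) AC_id)) s0 s1 _) _ => [y _ _|].
 by apply: le_trans (nrmB _ _) _; rewrite nrmC mulr1.
have := uni s0; lin.
Qed.

Lemma unit_z0 z u w s x : sol (Qz z) u w -> 0 <= s -> s <= x -> x <= s + 1 ->
  U2 u w x <= cU (Q0 + nrm z) * (N2 u (s + 1) - N2 u s).
Proof.
move=> /sol_solg sl s0 sx xs.
have a0 : AC (fun=> 0) (fun x : R => nrm (0 : C)) by apply: AC_ext (AC_cst 0) => // y _; rewrite nrm0.
by have := unit_z sl a0 s0 sx xs; rewrite subrr expr0n addr0.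
Qed.

Lemma Im_green z u w x : sol (Qz z) u w -> 0 <= x ->
  Im (conj (u x) * w x) = Im (conj (u 0) * w 0) - Im z * N2 u x.
Proof.
move=> [au aw] x0; have Bu := CAC_CLB au.
have [_ a] := CAC_mul (CAC_conj au) aw.
have b : AC (fun x => - Im z * N2 u x) (fun x => Im (conj (w x) * w x + conj (u x) * (Qz z x * u x))).
 apply: AC_ext (AC_scale (- Im z) (N2_AC Bu)) => // y _; rewrite /Qz !CE /nsq; ring.
have := AC_eq a b (lexx 0) x0; rewrite N2_0 mulr0 subr0 mulNr => <-; ring.
Qed.

Definition weyl z u w := sol (Qz z) u w /\ L2b u.

Lemma sol_scale_bound z : exists phi chi wphi wchi : R -> C,
  [/\ sol (Qz z) phi wphi, sol (Qz z) chi wchi, phi 0 = 0 /\ wphi 0 = 1 & chi 0 = 1 /\ wchi 0 = 0].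
Proof.
have [phi [wphi [a b c d]]] := ode_exists 0 1 (Qz_CLI z).
have [chi [wchi [a1 b1 c1 d1]]] := ode_exists 1 0 (Qz_CLI z).
by exists phi, chi, wphi, wchi.
Qed.

Lemma N2_eq0 z u w x : sol (Qz z) u w -> 1 <= x -> N2 u x = 0 -> U2 u w 0 = 0.
Proof.
move=> sl x1 h; have Bu := CAC_CLB (proj1 sl).
apply/eqP; rewrite eq_le U2_ge0 andbT.
have := unit_z0 sl (lexx 0) (lexx 0) (_ : 0 <= 0 + 1); rewrite add0r N2_0 subr0 => /(_ ler01).
have -> : N2 u 1 = 0.
 by apply/eqP; rewrite eq_le N2_ge0 // andbT -h; apply: N2_mono.
by rewrite mulr0.
Qed.

(** [m n] is chosen so that the solution with [u 0 = 1] vanishes at [n + 1]. Green's identity gives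
    [Im (m n) = Im z] times its squared norm, while [unit_z0] bounds [1 + |m n|^2] by a multiple of
    that norm. So the [m n] and the norms stay bounded, and a cluster point of [m n] gives a
    square-integrable solution. *)
Lemma weyl_exists z : 0 < Im z -> exists u w, weyl z u w /\ u 0 = 1.
Proof.
move=> z0; have [phi [chi [wphi [wchi [sp sc [p0 wp0] [c0 wc0]]]]]] := sol_scale_bound z.
have Bp := CAC_CLB (proj1 sp); have Bc := CAC_CLB (proj1 sc).
pose m n : C := - chi n.+1%:R / phi n.+1%:R.
pose u n x := 1 * chi x + m n * phi x; pose w n x := 1 * wchi x + m n * wphi x.
have su n : sol (Qz z) (u n) (w n) by exact: sol_lin.
(* A zero of [phi] at [n + 1] would make [z] a nonreal Dirichlet eigenvalue; Green's identity then
   forces the norm of [phi] to vanish. *)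
have pn0 n : phi n.+1%:R != 0.
 apply/negP => /eqP h; have := Im_green sp (ler0n R n.+1). rewrite h p0 !CE !(oppr0, mul0r, addr0, subrr, sub0r) => /esym/eqP.
 rewrite oppr_eq0 mulf_eq0 gt_eqF //= => /eqP/(N2_eq0 sp); rewrite ler1n => /(_ isT).
 by rewrite /U2 p0 wp0 /nsq !CE expr0n expr1n !(addr0, add0r) => /eqP; rewrite oner_eq0.
have un n : u n n.+1%:R = 0 by rewrite /u /m; field.
have u0 n : u n 0 = 1 by rewrite /u c0 p0; ring.
have w0 n : w n 0 = m n by rewrite /w wc0 wp0; ring.
have E n : Im (m n) = Im z * N2 (u n) n.+1%:R.
 have := Im_green (su n) (ler0n R n.+1); rewrite un u0 w0 !CE; lin.
have Bu n := CAC_CLB (proj1 (su n)).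
set c := cU (Q0 + nrm z); have c_gt0 : 0 < c by exact: cU_gt0.
have key n : 1 + nsq (m n) <= c * N2 (u n) n.+1%:R.
 have := unit_z0 (su n) (lexx 0) (lexx 0) (_ : 0 <= 0 + 1); rewrite add0r N2_0 subr0 => /(_ ler01).
 rewrite /U2 u0 w0 {1}/nsq !CE expr1n expr0n addr0 => h; apply: le_trans h _.
 by rewrite ler_wpM2l ?(ltW c_gt0) //; apply: N2_mono => //; rewrite ler1n.
have mb n : nrm (m n) <= c / Im z.
 have h1 := key n; have h2 := Im_le (m n); have h3 := ler_norm (Im (m n)). have h4 : (1 + nsq (m n)) * Im z <= c * nrm (m n).
  apply: le_trans (ler_wpM2r (ltW z0) h1) _; rewrite -mulrA ler_wpM2l ?(ltW c_gt0) //. by rewrite mulrC -E; lin.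
 rewrite ler_pdivlMr //; have [->|m0] := eqVneq (nrm (m n)) 0; first by rewrite mul0r ltW.
 have mp : 0 < nrm (m n) by rewrite lt_neqAle nrm_ge0 andbT eq_sym.
 rewrite -(ler_pM2r mp) mulrAC -expr2; apply: le_trans h4; rewrite ler_wpM2r ?(ltW z0) // -nrmE lerDr //.
have Nb n : N2 (u n) n.+1%:R <= c / Im z ^+ 2.
 have := E n; have := Im_le (m n); have := ler_norm (Im (m n)); have := mb n => h1 h2 h3 h4.
 have h5 : Im z * N2 (u n) n.+1%:R <= c / Im z by lin. by rewrite expr2 invfM mulrA ler_pdivlMr // mulrC.
have [l lP] := complex_cluster mb.
exists (fun x => 1 * chi x + l * phi x), (fun x => 1 * wchi x + l * wphi x); split; last by rewrite c0 p0; ring.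
split; first exact: sol_lin.
exists (2 * (c / Im z ^+ 2) + 2) => x x0.
pose P := N2 phi x; have P0 : 0 <= P by exact: N2_ge0.
(* This precision makes [|m n - l|^2 * P] at most 1, so the final bound does not depend on [x]. *)
have e0 : 0 < (1 + P)^-1 by rewrite invr_gt0 ltr_wpDr.
have [n Nn nP] := lP _ (Num.truncn x) e0.
have xn : x <= n.+1%:R by apply: ltW; apply: lt_le_trans (truncnS_gt x) _; rewrite ler_nat.
have Bl : CLB (fun x => 1 * chi x + l * phi x) by apply: CAC_CLB; exact: (proj1 (sol_lin 1 l sc sp)).
have := AC_le (N2_AC Bl) (AC_add (AC_scale 2 (N2_AC (Bu n))) (AC_scale (2 * nsq (m n - l)) (N2_AC Bp))) (lexx 0) x0.
rewrite !N2_0 !mulr0 addr0 !subr0 => H.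
have {H} : N2 (fun x => 1 * chi x + l * phi x) x <= 2 * N2 (u n) x + 2 * nsq (m n - l) * P.
 apply: H => y _ _; have -> : 1 * chi y + l * phi y = u n y + - ((m n - l) * phi y) by rewrite /u; ring.
 by apply: le_trans (nsqD_le _ _) _; rewrite nsqN nsqM; lin.
have h1 : N2 (u n) x <= c / Im z ^+ 2 by apply: le_trans (N2_mono (Bu n) x0 xn) (Nb n).
have h2 : nsq (m n - l) * P <= 1.
 have h3 : nsq (m n - l) <= (1 + P)^-1 ^+ 2 by rewrite -nrmE ler_pXn2r // nnegrE ?nrm_ge0 // ltW.
 apply: le_trans (ler_wpM2r P0 h3) _; rewrite expr2 -mulrA. have hP : (1 + P)^-1 * P <= 1 by rewrite ler_pdivrMl ?ltr_wpDr //; lin.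
 apply: mulr_ile1 => //; rewrite ?mulr_ge0 // ?(ltW e0) //. by rewrite invf_le1 ?ltr_wpDr //; lin.
lin.
Qed.

(** The mass on [[n, n + 1]] tends to 0, and [unit_z0] turns this into decay of the Cauchy data.
    This removes the boundary terms at infinity in all the identities below. *)
Lemma weyl_decay z u w e : weyl z u w -> 0 < e -> exists N, forall n, (N <= n)%N -> U2 u w n%:R <= e.
Proof.
move=> [sl [M HM]] e0; have Bu := CAC_CLB (proj1 sl); have c0 := cU_gt0 (Q0 + nrm z).
have [||N HN] := @nat_incr_small (N2 u) M (e / cU (Q0 + nrm z)) _ _ (divr_gt0 e0 c0).
- by move=> n; exact: HM.
- by move=> n; apply: N2_mono => //; rewrite ler_nat.
exists N => n Nn; have := unit_z0 sl (ler0n R n) (lexx _) (_ : n%:R <= n%:R + 1); rewrite lerDl => /(_ ler01) h.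
apply: le_trans h _; rewrite mulrC -ler_pdivlMr // natr1; exact: HN.
Qed.

End Weyl.

(** * The m-function through normalised Weyl solutions *)

Section MFunction.
Implicit Types (z : C) (x y s t M a : R) (u v w : R -> C).

Definition rc (f : nat -> R) (l : R) := forall e, 0 < e -> exists N, forall n, (N <= n)%N -> `|f n - l| <= e.
Definition ccv (f : nat -> C) (l : C) := forall e : R, 0 < e -> exists N, forall n, (N <= n)%N -> nrm (f n - l) <= e.

Lemma rcP (f : nat -> R) l : f n @[n --> \oo] --> l -> rc f l.
Proof.
move=> /cvgrPdist_le h e e0; have [N _ HN] := h e e0; exists N => n Nn.
by rewrite distrC; exact: HN.
Qed.

Lemma rc_ext f g l : (forall n, f n = g n) -> rc f l -> rc g l.
Proof. by move=> fg h e e0; have [N HN] := h e e0; exists N => n Nn; rewrite -fg; exact: HN. Qed.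

Lemma rc_add f g a b : rc f a -> rc g b -> rc (fun n => f n + g n) (a + b).
Proof.
move=> hf hg e e0; have e2 : 0 < e / 2 by rewrite divr_gt0.
have [N HN] := hf _ e2; have [N' HN'] := hg _ e2; exists (maxn N N') => n; rewrite geq_max => /andP[h1 h2].
have := ler_normD (f n - a) (g n - b); have := HN n h1; have := HN' n h2.
by rewrite (_ : f n - a + (g n - b) = f n + g n - (a + b)); [lin|ring].
Qed.

Lemma rc_scale (c : R) f a : rc f a -> rc (fun n => c * f n) (c * a).
Proof.
move=> hf e e0; have c0 : 0 < `|c| + 1 by rewrite ltr_wpDl.
have [N HN] := hf _ (divr_gt0 e0 c0); exists N => n Nn; rewrite -mulrBr normrM.
have := HN n Nn; rewrite ler_pdivlMr // mulrC => h; apply: le_trans h.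
by rewrite ler_wpM2r // lerDl.
Qed.

Lemma rc_unique f (l m : R) : rc f l -> rc f m -> l = m.
Proof.
move=> h1 h2; apply/eqP; rewrite -subr_eq0 -normr_eq0 eq_le normr_ge0 andbT.
rewrite leNgt; apply/negP => h; have h3 : 0 < `|l - m| / 4 by rewrite divr_gt0.
have [N HN] := h1 _ h3; have [N' HN'] := h2 _ h3.
have := HN (maxn N N') (leq_maxl _ _); have := HN' (maxn N N') (leq_maxr _ _).
have := ler_normB (f (maxn N N') - m) (f (maxn N N') - l).
rewrite (_ : f (maxn N N') - m - (f (maxn N N') - l) = l - m); [lin|ring].
Qed.

Lemma rc_Re f l : ccv f l -> rc (fun n => Re (f n)) (Re l).
Proof.
move=> h e e0; have [N HN] := h e e0; exists N => n Nn; apply: le_trans (HN n Nn).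
by apply: le_trans (Re_le _); rewrite !CE.
Qed.

Lemma ccv_ReIm f l : rc (fun n => Re (f n)) (Re l) -> rc (fun n => Im (f n)) (Im l) -> ccv f l.
Proof.
move=> h1 h2 e e0; have e2 : 0 < e / 2 by rewrite divr_gt0.
have [N HN] := h1 _ e2; have [N' HN'] := h2 _ e2; exists (maxn N N') => n; rewrite geq_max => /andP[n1 n2].
apply: le_trans (nrm_ReIm _) _; rewrite !CE; have := HN n n1; have := HN' n n2; lin.
Qed.

Lemma ccv_sub f g l m : ccv f l -> ccv g m -> ccv (fun n => f n - g n) (l - m).
Proof.
move=> hf hg e e0; have e2 : 0 < e / 2 by rewrite divr_gt0.
have [N HN] := hf _ e2; have [N' HN'] := hg _ e2; exists (maxn N N') => n; rewrite geq_max => /andP[h1 h2].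
have := nrmB (f n - l) (g n - m); have := HN n h1; have := HN' n h2.
by rewrite (_ : f n - l - (g n - m) = f n - g n - (l - m)); [lin|ring].
Qed.

Lemma ccv_scale (c : C) f l : ccv f l -> ccv (fun n => c * f n) (c * l).
Proof.
move=> hf e e0; have c0 : 0 < nrm c + 1 by rewrite ltr_wpDl // nrm_ge0.
have [N HN] := hf _ (divr_gt0 e0 c0); exists N => n Nn; rewrite -mulrBr nrmM.
have := HN n Nn; rewrite ler_pdivlMr // mulrC => h; apply: le_trans h.
by rewrite ler_wpM2r ?nrm_ge0 // lerDl.
Qed.

Lemma ccv_ext f g l : (forall n, f n = g n) -> ccv f l -> ccv g l.
Proof. by move=> fg h e e0; have [N HN] := h e e0; exists N => n Nn; rewrite -fg; exact: HN. Qed.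

Lemma ccv_nsq_le f (l : C) (B : R) : ccv f l -> (forall n, nsq (f n) <= B) -> nsq l <= B.
Proof.
move=> h fB; have B0 : 0 <= B by exact: le_trans (nsq_ge0 _) (fB 0%N).
rewrite -nrmE -[B]sqr_sqrtr // ler_pXn2r ?nnegrE ?nrm_ge0 ?sqrtr_ge0 //.
rewrite leNgt; apply/negP => Bl.
have [|N HN] := h ((nrm l - Num.sqrt B) / 2); first by rewrite divr_gt0 // subr_gt0.
have := HN N (leqnn N); have := nrmB (f N) (f N - l); rewrite (_ : f N - (f N - l) = l); last ring.
have : nrm (f N) <= Num.sqrt B by apply: nrm_sqr_le; rewrite ?sqrtr_ge0 // sqr_sqrtr.
lin.
Qed.

Variables (q Kq : R -> R) (Q0 : R).
Hypotheses (Iq : LI q) (aKq : AC Kq (fun x => `|q x|)) (Q00 : 0 <= Q0)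
  (uni : forall s, 0 <= s -> Kq (s + 1) - Kq s <= Q0).
Variable theta : R.
Let ct : C := (cos theta)%:C%C.
Let st : C := (sin theta)%:C%C.
Let cs1 : ct * ct + st * st = 1.
Proof. by rewrite /ct /st -!rmorphM -rmorphD /= -!expr2 cos2Dsin2. Qed.

(** [bca] and [bcb] are the Cauchy data at 0 rotated by [theta], and the [m]-function is their
    quotient. The rotation preserves the Wronskian, [Im (conj u * w)] and the norm of the data
    ([bc_Wr], [bc_Im], [bc_U2]), so the estimates come out the same for every [theta]. *)
Definition bca u w : C := w 0 * (cos theta)%:C%C + u 0 * (sin theta)%:C%C.
Definition bcb u w : C := u 0 * (cos theta)%:C%C - w 0 * (sin theta)%:C%C.
Definition nweyl z (m : C) u w := [/\ weyl q z u w, bcb u w = 1 & bca u w = m].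

Lemma bc_Wr u w u1 w1 : Wr u w u1 w1 0 = bcb u w * bca u1 w1 - bca u w * bcb u1 w1.
Proof.
rewrite /bca /bcb /Wr -/ct -/st.
have -> : u 0 * w1 0 - w 0 * u1 0 = (u 0 * w1 0 - w 0 * u1 0) * (ct * ct + st * st) by rewrite cs1 mulr1.
ring.
Qed.

Lemma bc_Im u w : Im (conj (u 0) * w 0) = Im (conj (bcb u w) * bca u w).
Proof.
rewrite /bca /bcb !CE; have h := cos2Dsin2 theta.
rewrite -[LHS]mulr1 -h; ring.
Qed.

Lemma bc_U2 u w : U2 u w 0 = nsq (bca u w) + nsq (bcb u w).
Proof.
rewrite /bca /bcb /U2 /nsq !CE; have h := cos2Dsin2 theta.
rewrite -[LHS]mulr1 -h; ring.
Qed.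

Lemma weyl_Im z u w : weyl q z u w -> Im (conj (u 0) * w 0) = Im z * TN u.
Proof.
move=> wl; have [sl Lu] := wl; have Bu := CAC_CLB (proj1 sl).
have h1 := rc_scale (Im z) (rcP (N2_cvg Bu Lu)).
apply: rc_unique h1; move=> e e0.
have [N HN] := weyl_decay Iq aKq Q00 uni wl e0; exists N => n Nn.
have := Im_green sl (ler0n R n) => h; have := HN n Nn; rewrite distrC.
rewrite (_ : _ - _ = Im (conj (u n%:R) * w n%:R)); last by rewrite h.
apply: le_trans; apply: le_trans (Im_le _) _; rewrite nrmM nrmJ.
have := nrm_prod_le (u n%:R) (w n%:R); rewrite /U2; have := nrm_ge0 (u n%:R); have := nrm_ge0 (w n%:R) => a b.
by have := mulr_ge0 b a; lin.
Qed.

(** Green's identity with no contribution from infinity. Through it, estimates of [Im m] become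
    estimates of the norm of [u]. *)
Lemma nweyl_Im z m u w : nweyl z m u w -> Im m = Im z * TN u.
Proof. by move=> [wl b1 am]; rewrite -(weyl_Im wl) bc_Im b1 am !CE; ring. Qed.

(** The derivative of the Wronskian is [(z - z1) u u1], and the Wronskian tends to 0 along the
    integers. *)
Lemma weyl_Wr_lim z z1 u w u1 w1 F : weyl q z u w -> weyl q z1 u1 w1 ->
  CAC F (fun x => u x * u1 x) -> F 0 = 0 ->
  ccv (fun n => (z - z1) * F n%:R) (- Wr u w u1 w1 0).
Proof.
move=> wl wl1 aF F0 e e0; have [N HN] := weyl_decay Iq aKq Q00 uni wl e0.
have [N' HN'] := weyl_decay Iq aKq Q00 uni wl1 e0; exists (maxn N N') => n; rewrite geq_max => /andP[n1 n2].
have aW := Wr_AC (proj1 wl) (proj1 wl1).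
have aW' : CAC (fun x => (z - z1) * F x) (fun x => (Qz q z1 x - Qz q z x) * (u x * u1 x)).
 by apply: CAC_ext (CAC_scale (z - z1) aF) => // x _; rewrite /Qz; ring.
have := CAC_itv_eq aW' aW (lexx 0) (ler0n R n); rewrite F0 mulr0 subr0 => ->.
rewrite opprK subrK /Wr; apply: le_trans (nrmB _ _) _; rewrite !nrmM.
have h1 := HN n n1; have h2 := HN' n n2; rewrite /U2 in h1 h2.
have h3 := nrm_prod_le (u n%:R) (w1 n%:R); have h4 := nrm_prod_le (w n%:R) (u1 n%:R); lin.
Qed.

Lemma CAC_prod_ex u u1 : CLB u -> CLB u1 -> exists2 F, CAC F (fun x => u x * u1 x) & F 0 = 0.
Proof. by move=> B B1; apply: CAC_prim; apply: CLB_CLI; exact: CLB_mul. Qed.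

(** [m - m1] is [z - z1] times the integral of [u u1], to which Cauchy-Schwarz applies. *)
Lemma nweyl_lip z z1 m m1 u w u1 w1 : nweyl z m u w -> nweyl z1 m1 u1 w1 ->
  nsq (m - m1) <= nsq (z - z1) * (TN u * TN u1).
Proof.
move=> [wl b1 am] [wl1 b11 am1].
have Bu := CAC_CLB (proj1 (proj1 wl)); have Bu1 := CAC_CLB (proj1 (proj1 wl1)).
have [F aF F0] := CAC_prod_ex Bu Bu1.
have := weyl_Wr_lim wl wl1 aF F0; rewrite bc_Wr b1 b11 am am1 mul1r mulr1 opprB => lim.
apply: (ccv_nsq_le lim) => n; rewrite nsqM ler_wpM2l ?nsq_ge0 //.
have := CS_le Bu Bu1 aF (ler0n R n); rewrite F0 subr0 => h; apply: le_trans h _.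
by apply: ler_pM; rewrite ?N2_ge0 ?N2_le_TN //; [case: wl|case: wl1].
Qed.

Lemma conj_weyl z u w : weyl q z u w -> weyl q (conj z) (fun x => conj (u x)) (fun x => conj (w x)).
Proof.
move=> [sl [M HM]]; split.
 have [a b] := sol_conj sl; split => //; apply: CAC_ext b => // x _.
 by congr (_ * _); rewrite /Qz rmorphB /=; congr (_ - _); apply: C_eq; rewrite !CE ?oppr0.
exists M => x x0; apply: le_trans (HM x x0).
by rewrite /N2 (_ : (fun y => nsq (conj (u y))) = (fun y => nsq (u y))) //; apply/funext => y; rewrite nsqJ.
Qed.

Lemma nweyl_conj z m u w : nweyl z m u w ->
  nweyl (conj z) (conj m) (fun x => conj (u x)) (fun x => conj (w x)).
Proof.
move=> [wl b1 am]; split; first exact: conj_weyl.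
 have -> : (1 : C) = conj 1 by rewrite rmorph1. by rewrite -b1 /bcb; apply: C_eq; rewrite !CE; ring.
by rewrite -am /bca; apply: C_eq; rewrite !CE; ring.
Qed.

(** This is the squared norm of [u - u1] for the normalised Weyl solutions at [z] and [z1]
    ([nweyl_dist]), because the integral of [u * conj u1] is [(m - conj m1) / (z - conj z1)].
    Written through [m] alone, it can be estimated without the solutions. *)
Definition mdist (z z1 m m1 : C) : R := Im m / Im z + Im m1 / Im z1 - 2 * Re ((m - conj m1) / (z - conj z1)).

Lemma nweyl_dist z z1 m m1 u w u1 w1 : 0 < Im z -> 0 < Im z1 -> nweyl z m u w -> nweyl z1 m1 u1 w1 ->
  [/\ CLB (fun x => u x - u1 x), L2b (fun x => u x - u1 x) & TN (fun x => u x - u1 x) = mdist z z1 m m1].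
Proof.
move=> z0 z10 nw nw1; have [wl b1 am] := nw; have [wl1 b11 am1] := nw1.
have [wlc bc1 amc] := nweyl_conj nw1.
have Bu := CAC_CLB (proj1 (proj1 wl)); have Bu1 := CAC_CLB (proj1 (proj1 wl1)).
have Buc := CAC_CLB (proj1 (proj1 wlc)).
have [F aF F0] := CAC_prod_ex Bu Buc.
have zz : z - conj z1 != 0.
 by apply/negP => /eqP h; have : Im (z - conj z1) = 0 by [rewrite h]; rewrite !CE; lin.
have Bd : CLB (fun x => u x - u1 x) by apply: CAC_CLB (CAC_sub (proj1 (proj1 wl)) (proj1 (proj1 wl1))).
have lim := weyl_Wr_lim wl wlc aF F0; rewrite bc_Wr b1 bc1 am amc mul1r mulr1 opprB in lim.
have limF : ccv (fun n => F n%:R) ((m - conj m1) / (z - conj z1)).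
 have := ccv_scale (z - conj z1)^-1 lim; rewrite mulrC; apply: ccv_ext => n. by rewrite mulKf.
have E x : 0 <= x -> N2 (fun x => u x - u1 x) x = N2 u x + N2 u1 x + (-2) * Re (F x).
 move=> x0; have a := AC_add (AC_add (N2_AC Bu) (N2_AC Bu1)) (AC_scale (-2) (proj1 aF)).
 have b : AC (fun x => N2 u x + N2 u1 x + (-2) * Re (F x)) (fun x => nsq (u x - u1 x)).
  by apply: AC_ext a => // y _; rewrite /nsq !CE; ring.
 by have := AC_eq (N2_AC Bd) b (lexx 0) x0; rewrite !N2_0 F0 !CE mulr0 !addr0 !subr0.
have Ld : L2b (fun x => u x - u1 x).
 have [_ [M HM]] := wl; have [_ [M1 HM1]] := wl1; exists (2 * M + 2 * M1) => x x0.
 have := AC_le (N2_AC Bd) (AC_add (AC_scale 2 (N2_AC Bu)) (AC_scale 2 (N2_AC Bu1))) (lexx 0) x0.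
 rewrite !N2_0 !mulr0 addr0 !subr0 => H; apply: le_trans (H _) _ => [y _ _|].
  by apply: le_trans (nsqD_le _ _) _; rewrite nsqN; lin.
 have := HM x x0; have := HM1 x x0; lin.
split => //.
have r1 := rcP (N2_cvg Bd Ld).
have r2 := rc_add (rc_add (rcP (N2_cvg Bu (proj2 wl))) (rcP (N2_cvg Bu1 (proj2 wl1)))) (rc_scale (-2) (rc_Re limF)).
have := rc_unique r1 (rc_ext (fun n => esym (E _ (ler0n R n))) r2) => ->.
rewrite /mdist (nweyl_Im nw) (nweyl_Im nw1) ![Im _ * TN _]mulrC !mulfK ?gt_eqF //.
by rewrite mulNr.
Qed.

Lemma AC_dom_cvg (F f G g : R -> R) M : AC F f -> AC G g -> (forall x, 0 <= x -> `|f x| <= g x) ->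
  (forall x, 0 <= x -> G x <= M) -> exists l, rc (fun n => F n%:R) l.
Proof.
move=> aF aG fg GM.
have mono (H h : R -> R) B : AC H h -> (forall x, 0 <= x -> 0 <= h x) -> (forall x, 0 <= x -> H x <= B) ->
  exists l, rc (fun n => H n%:R) l.
 move=> aH h0 HB; exists (limn (fun n => H n%:R)); apply: rcP; apply: nondecreasing_is_cvgn.
  apply/nondecreasing_seqP => n; apply: AC_homo aH (ler0n _ _) _ _; first by rewrite ler_nat.
  by move=> x nx _; apply: h0; exact: le_trans nx.
 by exists B => _ [n _ <-]; exact: HB.
have g0 x : 0 <= x -> 0 <= g x by move=> x0; exact: le_trans (normr_ge0 _) (fg x x0).
have [l1 h1] := mono _ _ M aG g0 GM.
have [||l2 h2] := mono _ _ (F 0 - G 0 + M + M) (AC_add aF aG).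
- by move=> x x0; have := lerNnormlW (fg x x0); lin.
- move=> x x0; have := AC_norm_le aF aG (lexx 0) x0 (fun y h _ => fg y h).
 by have := ler_norm (F x - F 0); have := GM x x0; lin.
exists (l2 + (-1) * l1); have := rc_add h2 (rc_scale (-1) h1); apply: rc_ext => n; ring.
Qed.

Lemma L2_sq_cvg u F : CLB u -> L2b u -> CAC F (fun x => u x * u x) -> exists d, ccv (fun n => F n%:R) d.
Proof.
move=> Bu [M HM] [a b].
have [|l hl] := AC_dom_cvg a (N2_AC Bu) _ HM.
 by move=> x _; apply: le_trans (Re_le _) _; rewrite nrmM -expr2 nrmE.
have [|l' hl'] := AC_dom_cvg b (N2_AC Bu) _ HM.
 by move=> x _; apply: le_trans (Im_le _) _; rewrite nrmM -expr2 nrmE.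
by exists (Complex l l'); apply: ccv_ReIm.
Qed.

(** [d z1] is the integral of [u1 ^+ 2], the complex derivative of [m] at [z1]: the remainder is
    [z - z1] times the integral of [u1 * (u - u1)], and Cauchy-Schwarz brings in the norm of
    [u - u1]. Holomorphy of [m] is used only in this quantitative form. *)
Lemma m_struct (m : C -> C) : (forall z, 0 < Im z -> exists u w, nweyl z (m z) u w) ->
  exists d : C -> C, forall z z1, 0 < Im z -> 0 < Im z1 ->
  [/\ 0 <= Im (m z), 0 <= mdist z z1 (m z) (m z1),
   nsq (m z - m z1) <= nsq (z - z1) * (Im (m z) / Im z * (Im (m z1) / Im z1)) &
   nsq (m z - m z1 - (z - z1) * d z1) <=
     nsq (z - z1) * (Im (m z1) / Im z1 * mdist z z1 (m z) (m z1))].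
Proof.
move=> Hm.
have Hd z1 : exists d : C, 0 < Im z1 -> exists u1 w1 F,
  [/\ nweyl z1 (m z1) u1 w1, CAC F (fun x => u1 x * u1 x), F 0 = 0 & ccv (fun n => F n%:R) d].
 have [z0|z0] := ltP 0 (Im z1); last by exists 0. have [u [w nw]] := Hm z1 z0; have [wl _ _] := nw; have Bu := CAC_CLB (proj1 (proj1 wl)).
 have [F aF F0] := CAC_prod_ex Bu Bu. by have [d hd] := L2_sq_cvg Bu (proj2 wl) aF; exists d => _; exists u, w, F.
have [d dP] := choice Hd; exists d => z z1 z0 z10.
have [u [w nw]] := Hm z z0; have [u1 [w1 [F1 [nw1 aF1 F10 lim1]]]] := dP z1 z10.
have [wl b1 am] := nw; have [wl1 b11 am1] := nw1.
have Bu := CAC_CLB (proj1 (proj1 wl)); have Bu1 := CAC_CLB (proj1 (proj1 wl1)).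
have [Bd Ld Td] := nweyl_dist z0 z10 nw nw1.
have T0 : Im (m z) / Im z = TN u by rewrite (nweyl_Im nw) mulrC mulKf // gt_eqF.
have T1 : Im (m z1) / Im z1 = TN u1 by rewrite (nweyl_Im nw1) mulrC mulKf // gt_eqF.
have Tp := TN_ge0 Bu (proj2 wl).
split.
- by rewrite (nweyl_Im nw) mulr_ge0 // ltW.
- by rewrite -Td; exact: TN_ge0.
- by rewrite T0 T1; exact: nweyl_lip nw nw1.
- rewrite T1 -Td.
 have [F aF F0] := CAC_prod_ex Bu Bu1. have lim := weyl_Wr_lim wl wl1 aF F0; rewrite bc_Wr b1 b11 am am1 mul1r mulr1 opprB in lim.
 apply: (ccv_nsq_le (ccv_sub lim (ccv_scale (z - z1) lim1))) => n. rewrite -mulrBr nsqM ler_wpM2l ?nsq_ge0 //.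
 have aG : CAC (fun x => F x - F1 x) (fun x => u1 x * (u x - u1 x)).
  by apply: CAC_ext (CAC_sub aF aF1) => // x _; ring.
 have := CS_le Bu1 Bd aG (ler0n R n); rewrite F0 F10 !subr0 => h; apply: le_trans h _.
 by apply: ler_pM; rewrite ?N2_ge0 ?N2_le_TN //; case: wl1.
Qed.

End MFunction.

(** * Energies with bounded solutions, and the link with the given definitions *)

Section Bounded.
Implicit Types (z : C) (x y s t M a : R) (u v w : R -> C).

Lemma halfline_bigcup : @halfline R = \bigcup_n (`[0, n%:R]%classic : set R).
Proof.
apply/seteqP; split=> x; rewrite /halfline /=.
 rewrite in_itv /= andbT => x0; exists (Num.truncn x).+1 => //=. by rewrite in_itv /= x0 ltW // truncnS_gt.
by move=> [n _] /=; rewrite !in_itv /= andbT => /andP[].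
Qed.

Lemma meas_half : measurable (@halfline R : set (measurableTypeR R)).
Proof. exact: measurable_itv. Qed.

Lemma meas_ray (f : R -> R) : (forall x, 0 <= x -> measurable_fun (`[0, x]%classic : set R) f) ->
  measurable_fun (@halfline R) f.
Proof.
move=> mf; rewrite halfline_bigcup.
by apply/measurable_fun_bigcup => // n; exact: mf.
Qed.

Lemma itv_Rint_le (f F : R -> R) x : AC F f -> (forall y, 0 <= y -> 0 <= f y) -> F 0 = 0 -> 0 <= x ->
  (\int[leb]_(y in `[0%R, x]%classic) (f y)%:E = (F x)%:E)%E.
Proof.
move=> [If FE] f0 F0 x0; rewrite (FE x x0) F0 add0r /Rint fineK //.
exact: integrable_fin_num (If x x0).
Qed.

Lemma halfline_ge (f F : R -> R) x : AC F f -> (forall y, 0 <= y -> 0 <= f y) -> F 0 = 0 -> 0 <= x ->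
  ((F x)%:E <= \int[leb]_(y in @halfline R) (f y)%:E)%E.
Proof.
move=> aF f0 F0 x0; rewrite -(itv_Rint_le aF f0 F0 x0); apply: ge0_subset_integral => //=.
- exact: meas_half.
- by apply/measurable_EFinP; apply: meas_ray => y y0; exact: LI_meas (proj1 aF) _ y0.
- by move=> y; rewrite /halfline /= in_itv /= andbT => y0; rewrite lee_fin f0.
- by move=> y; rewrite /halfline /= !in_itv /= => /andP[-> _].
Qed.

Lemma halfline_le (f F : R -> R) M : AC F f -> (forall y, 0 <= y -> 0 <= f y) -> F 0 = 0 ->
  (forall x, 0 <= x -> F x <= M) -> (\int[leb]_(y in @halfline R) (f y)%:E <= M%:E)%E.
Proof.
move=> aF f0 F0 FM; rewrite halfline_bigcup.
have H := @ge0_nondecreasing_set_cvg_integral _ (measurableTypeR R) R (fun n => `[0, n%:R]%classic) (EFin \o f) leb.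
have {}H : (\int[leb]_(x in `[0%R, i%:R]%classic) (f x)%:E @[i --> \oo] --> \int[leb]_(x in \bigcup_i `[0%R, i%:R]%classic) (f x)%:E)%E.
 apply: H.
 - apply/nondecreasing_seqP => n; apply/subsetPset => x /=; rewrite !in_itv /= => /andP[-> h].
  by apply: le_trans h _; rewrite ler_nat.
 - by move=> n; exact: measurable_itv.
 - by move=> n; apply/measurable_EFinP; exact: LI_meas (proj1 aF) _ _.
 - by move=> n x; rewrite in_cc0 => /andP[x0 _] /=; rewrite lee_fin f0.
rewrite -(cvg_lim _ H) //; apply: lime_le; first exact: cvgP H.
by apply: nearW => n; rewrite (itv_Rint_le aF) // lee_fin FM.
Qed.

Lemma solvesP (g u w : R -> R) : solves g u w <-> AC u w /\ AC w g.
Proof.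
split=> [h|[[Iw hu] [Ig hw]] x x0]; last by split; [exact: Iw|exact: Ig|exact: hu|exact: hw].
by split; split => x x0; case: (h x x0).
Qed.

Variables (q Kq : R -> R) (Q0 : R).
Hypotheses (Iq : LI q) (aKq : AC Kq (fun x => `|q x|)) (Q00 : 0 <= Q0)
  (uni : forall s, 0 <= s -> Kq (s + 1) - Kq s <= Q0).

Lemma csolP z (a b wa wb : R -> R) : csol q z a b wa wb <->
  sol (Qz q z) (fun x => Complex (a x) (b x)) (fun x => Complex (wa x) (wb x)).
Proof.
rewrite /csol !solvesP /sol /CAC /=; split.
 move=> [[h1 h2] [h3 h4]]; split=> //; split.
  by apply: AC_ext h2 => // x _; rewrite /Qz !CE /=; ring.
 by apply: AC_ext h4 => // x _; rewrite /Qz !CE /=; ring.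
move=> [[h1 h3] [h2 h4]]; split; split => //.
 by apply: AC_ext h2 => // x _; rewrite /Qz !CE /=; ring.
by apply: AC_ext h4 => // x _; rewrite /Qz !CE /=; ring.
Qed.

Lemma rsol_Re (E : R) u w : sol (Qz q E%:C%C) u w -> rsol q E (fun x => Re (u x)) /\ rsol q E (fun x => Im (u x)).
Proof.
move=> [[a b] [c d]]; split; [exists (fun x => Re (w x))|exists (fun x => Im (w x))]; apply/solvesP; split=> //.
 by apply: AC_ext c => // x _; rewrite /Qz !CE /=; ring.
by apply: AC_ext d => // x _; rewrite /Qz !CE /=; ring.
Qed.

Lemma rsol_sol (E : R) (u : R -> R) : rsol q E u -> exists w : R -> R,
  sol (Qz q E%:C%C) (fun x => (u x)%:C%C) (fun x => (w x)%:C%C).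
Proof.
move=> [w /solvesP[a b]]; exists w; split; first exact: CAC_real.
by apply: CAC_ext (CAC_real b) => // x _; rewrite /Qz -rmorphB -rmorphM.
Qed.

(** Boundedness of all solutions at [E], with one constant for a fundamental system and its
    derivatives; the constant allows these energies to be exhausted by countably many sets
    ([BE_exists]). *)
Definition BE (E M : R) := exists phi chi wphi wchi : R -> C,
  [/\ sol (Qz q E%:C%C) phi wphi, sol (Qz q E%:C%C) chi wchi, phi 0 = 0 /\ wphi 0 = 1, chi 0 = 1 /\ wchi 0 = 0 &
   forall x, 0 <= x -> U2 phi wphi x <= M /\ U2 chi wchi x <= M].

Lemma bounded_U2 (E B : R) u w : sol (Qz q E%:C%C) u w -> (forall x, 0 <= x -> nsq (u x) <= B) ->
  forall x, 0 <= x -> U2 u w x <= cU (Q0 + nrm E%:C%C) * B.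
Proof.
move=> sl uB x x0; have Bu := CAC_CLB (proj1 sl).
have x1 : x <= x + 1 by rewrite lerDl.
apply: le_trans (unit_z0 Iq aKq Q00 uni sl x0 (lexx x) x1) _.
rewrite ler_wpM2l ?(ltW (cU_gt0 _)) //.
have := AC_le (N2_AC Bu) (AC_scale B AC_id) x0 x1; rewrite -mulrBr (_ : x + 1 - x = 1) ?mulr1; last ring.
by apply => y xy _; apply: uB; exact: le_trans xy.
Qed.

Lemma BE_exists (E : R) : (forall u : R -> R, rsol q E u -> exists M : R, forall x, 0 <= x -> `|u x| <= M) ->
  exists n : nat, BE E n%:R.
Proof.
move=> H; have [phi [chi [wphi [wchi [sp sc p0 c0]]]]] := sol_scale_bound Iq E%:C%C.
have bd u w : sol (Qz q E%:C%C) u w -> exists B, forall x, 0 <= x -> nsq (u x) <= B.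
 move=> sl; have [h1 h2] := rsol_Re sl; have [M1 H1] := H _ h1; have [M2 H2] := H _ h2. exists (M1 ^+ 2 + M2 ^+ 2) => x x0; rewrite /nsq.
 by apply: lerD; rewrite -[leLHS]real_normK ?num_real // ler_pXn2r ?nnegrE //;
   rewrite ?H1 ?H2 // (le_trans (normr_ge0 _) (H1 x x0)) || rewrite (le_trans (normr_ge0 _) (H2 x x0)).
have [B1 HB1] := bd _ _ sp; have [B2 HB2] := bd _ _ sc.
pose c := cU (Q0 + nrm E%:C%C); exists (Num.truncn (Num.max (c * B1) (c * B2))).+1.
exists phi, chi, wphi, wchi; split=> // x x0.
have h1 := bounded_U2 sp HB1 x0; have h2 := bounded_U2 sc HB2 x0.
have h3 := ltW (truncnS_gt (Num.max (c * B1) (c * B2))).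
by split; [apply: le_trans h1 _|apply: le_trans h2 _]; apply: le_trans h3; rewrite le_max lexx ?orbT.
Qed.

(** The Wronskian of a Weyl solution at [z] with a bounded solution at [E] changes by [z - E] times
    the integral of [u v], which stays under control up to distance [1 / |z - E|]. On each unit
    interval up to there, its value is bounded by the mass of [u] on that interval; averaging over
    about [1 / |z - E|] intervals gains the factor [|z - E|]. *)
Lemma wr_bound (E M : R) z u w v wv : 0 <= M -> sol (Qz q E%:C%C) v wv -> (forall x, 0 <= x -> U2 v wv x <= M) ->
  weyl q z u w -> 0 < nrm (z - E%:C%C) -> nrm (z - E%:C%C) <= 1 ->
  nsq (Wr u w v wv 0) <= 4 * M * (cU (Q0 + nrm z) + 1) * (nrm (z - E%:C%C) * TN u).
Proof.
move=> M0 sv vM wl d0 d1; have [su Lu] := wl.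
have Bu := CAC_CLB (proj1 su); have Bv := CAC_CLB (proj1 sv).
set del := nrm _ in d0 d1 *; set c := cU _; have c0 : 0 < c by exact: cU_gt0.
have [F aF F0] := CAC_prod_ex Bu Bv.
set W0 := nsq (Wr u w v wv 0); set T := TN u.
have T0 : 0 <= T by exact: TN_ge0.
(* [n] is just above [1 / del], so [n * del] lies between 1 and [1 + del <= 2]. *)
pose n := (Num.truncn del^-1).+1.
have n1 : del^-1 <= n%:R by apply: ltW; exact: truncnS_gt.
have n2 : n%:R * del <= 2.
 have h : (Num.truncn del^-1)%:R <= del^-1 by rewrite truncn_le // invr_ge0 ltW.
 have := ler_wpM2r (ltW d0) h; rewrite mulVf ?gt_eqF // /n -natr1 mulrDl mul1r; lin.
have key j : (j < n)%N -> W0 <= 4 * M * c * (N2 u j.+1%:R - N2 u j%:R) + 2 * del * M * T.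
 move=> jn; have j0 := ler0n R j. have aW := Wr_AC su sv.
 have aW' : CAC (fun x => (z - E%:C%C) * F x) (fun x => (Qz q E%:C%C x - Qz q z x) * (u x * v x)).
  by apply: CAC_ext (CAC_scale (z - E%:C%C) aF) => // x _; rewrite /Qz; ring.
 have := CAC_itv_eq aW' aW (lexx 0) j0; rewrite F0 mulr0 subr0 => e1.
 have e2 : Wr u w v wv 0 = Wr u w v wv j%:R + - ((z - E%:C%C) * F j%:R) by rewrite e1; ring.
 have h1 : nsq (Wr u w v wv j%:R) <= 2 * (U2 u w j%:R * M).
  rewrite /Wr; apply: le_trans (nsqD_le _ _) _; rewrite nsqN !nsqM ler_pM2l //.
  have := vM j%:R j0; have := ler_wpM2l (U2_ge0 u w j%:R) (vM j%:R j0); rewrite /U2.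
  have := nsq_ge0 (u j%:R); have := nsq_ge0 (w j%:R); have := nsq_ge0 (v j%:R); have := nsq_ge0 (wv j%:R).
  move=> p1 p2 p3 p4; have := mulr_ge0 p4 p2; have := mulr_ge0 p3 p1; lin.
 have h2 : U2 u w j%:R <= c * (N2 u j.+1%:R - N2 u j%:R).
  by have := unit_z0 Iq aKq Q00 uni su j0 (lexx _) (_ : j%:R <= j%:R + 1); rewrite natr1 ler_nat => /(_ (leqnSn _)).
 have h3 : nsq (F j%:R) <= T * (M * j%:R).
  have := CS_le Bu Bv aF j0; rewrite F0 subr0 => h; apply: le_trans h _. apply: ler_pM; rewrite ?N2_ge0 ?N2_le_TN //.
  have := AC_le (N2_AC Bv) (AC_scale M AC_id) (lexx 0) j0; rewrite N2_0 mulr0 !subr0; apply => y y0 _.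
  by rewrite mulr1; apply: le_trans (vM y y0); rewrite /U2 lerDl nsq_ge0.
 have h4 : del * j%:R <= 1.
  have : j%:R <= del^-1 by apply: le_trans (_ : (Num.truncn del^-1)%:R <= _); rewrite ?ler_nat // truncn_le // invr_ge0 ltW.
  by move=> /(ler_wpM2l (ltW d0)); rewrite mulfV ?gt_eqF.
 rewrite /W0 e2; apply: le_trans (nsqD_le _ _) _; rewrite nsqN nsqM -[nsq (z - _)]nrmE -/del.
 have h5 : del ^+ 2 * nsq (F j%:R) <= del * M * T.
  apply: le_trans (ler_wpM2l (sqr_ge0 del) h3) _. rewrite [leLHS](_ : _ = del * M * T * (del * j%:R)); last ring.
  by rewrite ler_piMr // !mulr_ge0 // ltW.
 have h6 := ler_wpM2r M0 h2; lin.
have sum : n%:R * W0 <= 4 * M * c * N2 u n%:R + n%:R * (2 * del * M * T).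
 have : forall k, (k <= n)%N -> k%:R * W0 <= 4 * M * c * N2 u k%:R + k%:R * (2 * del * M * T).
  elim=> [_|k IH kn]; first by rewrite N2_0 !mul0r mulr0 addr0. have := key k kn; have := IH (ltnW kn); rewrite -natr1; lin.
 exact.
have h1 : 4 * M * c * N2 u n%:R <= 4 * M * c * T by rewrite ler_wpM2l ?N2_le_TN // !mulr_ge0 // ltW.
have h2 : n%:R * (2 * del * M * T) <= 4 * M * T.
 rewrite [leLHS](_ : _ = 2 * M * T * (n%:R * del)); last ring. have := ler_wpM2l (mulr_ge0 (mulr_ge0 (ler0n R 2) M0) T0) n2; lin.
have h3 : del^-1 * W0 <= n%:R * W0 by rewrite ler_wpM2r ?nsq_ge0.
have h4 : del^-1 * W0 <= 4 * M * (c + 1) * T by lin.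
rewrite -(ler_pM2l (_ : 0 < del^-1)) ?invr_gt0 //; apply: le_trans h4 _.
by rewrite (_ : del^-1 * _ = 4 * M * (c + 1) * T) //; field; rewrite gt_eqF.
Qed.

Variable theta : R.

(** Taking [phi] and [chi] as bounded solution recovers [u 0] and [w 0], whose squared moduli add up
    to [1 + |m|^2] by rotation invariance. *)
Lemma BE_m (E M : R) z m u w : 0 <= M -> BE E M -> nweyl q theta z m u w ->
  0 < nrm (z - E%:C%C) -> nrm (z - E%:C%C) <= 1 ->
  1 + nsq m <= 8 * M * (cU (Q0 + nrm z) + 1) * (nrm (z - E%:C%C) * TN u).
Proof.
move=> M0 [phi [chi [wphi [wchi [sp sc [p0 wp0] [c0 wc0] HM]]]]] [wl b1 am] d0 d1.
have h1 := wr_bound M0 sp (fun x h => proj1 (HM x h)) wl d0 d1.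
have h2 := wr_bound M0 sc (fun x h => proj2 (HM x h)) wl d0 d1.
have e1 : nsq (Wr u w phi wphi 0) = nsq (u 0) by rewrite /Wr p0 wp0 mulr1 mulr0 subr0.
have e2 : nsq (Wr u w chi wchi 0) = nsq (w 0) by rewrite /Wr c0 wc0 mulr1 mulr0 sub0r nsqN.
have := bc_U2 theta u w; rewrite /U2 b1 am [nsq 1]/nsq !CE expr1n expr0n addr0.
rewrite e1 in h1; rewrite e2 in h2; lin.
Qed.

Lemma nweyl_low z m u w : nweyl q theta z m u w -> 1 + nsq m <= cU (Q0 + nrm z) * TN u.
Proof.
move=> [[su Lu] b1 am]; have Bu := CAC_CLB (proj1 su).
have := unit_z0 Iq aKq Q00 uni su (lexx 0) (lexx 0) (_ : 0 <= 0 + 1); rewrite add0r N2_0 subr0 => /(_ ler01).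
rewrite (bc_U2 theta) b1 am [nsq 1]/nsq !CE expr1n expr0n addr0 addrC => h; apply: le_trans h _.
by rewrite ler_wpM2l ?(ltW (cU_gt0 _)) // N2_le_TN.
Qed.

(** If [bcb] vanished, [u] would be an eigenfunction with nonreal eigenvalue, hence of norm 0. *)
Lemma bcb_neq0 z u w : 0 < Im z -> weyl q z u w -> U2 u w 0 != 0 -> bcb theta u w != 0.
Proof.
move=> z0 wl; apply: contra => /eqP b0; have [su Lu] := wl; have Bu := CAC_CLB (proj1 su).
have := weyl_Im Iq aKq Q00 uni wl; rewrite (bc_Im theta) b0 rmorph0 mul0r Im0 => /esym/eqP.
rewrite mulf_eq0 gt_eqF //= => /eqP T0; apply/eqP; apply: (N2_eq0 Iq aKq Q00 uni su (lexx 1)).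
by apply/eqP; rewrite eq_le N2_ge0 // andbT -T0 N2_le_TN.
Qed.

Lemma weyl_scale (k : C) z u w : weyl q z u w -> weyl q z (fun x => k * u x) (fun x => k * w x).
Proof.
move=> [su [M HM]]; have Bu := CAC_CLB (proj1 su); split.
 have [a b] := sol_lin k 0 su su; split; first by apply: CAC_ext a => x _; ring. by apply: CAC_ext b => x _; ring.
exists (nsq k * M) => x x0.
have Bk : CLB (fun x => k * u x) by apply: CLB_mul => //; exact: CLB_cst.
have b : AC (fun x => nsq k * N2 u x) (fun x => nsq (k * u x)).
 by apply: AC_ext (AC_scale (nsq k) (N2_AC Bu)) => // y _; rewrite nsqM.
have := AC_eq (N2_AC Bk) b (lexx 0) x0; rewrite !N2_0 mulr0 !subr0 => ->.
by rewrite ler_wpM2l ?nsq_ge0 // HM.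
Qed.

Lemma weyl_nweyl z u w : 0 < Im z -> weyl q z u w -> U2 u w 0 != 0 ->
  exists u1 w1, nweyl q theta z (bca theta u w / bcb theta u w) u1 w1.
Proof.
move=> z0 wl U0; have b0 := bcb_neq0 z0 wl U0.
exists (fun x => (bcb theta u w)^-1 * u x), (fun x => (bcb theta u w)^-1 * w x); split; first exact: weyl_scale.
 by rewrite {1}/bcb -!mulrA -mulrBr -/(bcb theta u w) mulVf.
by rewrite {1}/bca -!mulrA -mulrDr -/(bca theta u w) mulrC.
Qed.

Lemma m_value_nweyl z (m : C) : 0 < Im z -> m_value q theta z m -> exists u w, nweyl q theta z m u w.
Proof.
move=> z0 [a [b [wa [wb [/csolP sl [x x0 nz] [c [c0 Hc]] ->]]]]].
pose u x := Complex (a x) (b x); pose w x := Complex (wa x) (wb x).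
have Bu := CAC_CLB (proj1 sl).
have wl : weyl q z u w.
 split=> //; exists (N2 u c + fine (\int[leb]_(x in `[c, +oo[%classic) (a x ^+ 2 + b x ^+ 2)%:E)%E) => y y0.
 have mh : measurable_fun (`[c, +oo[%classic : set R) (fun x => a x ^+ 2 + b x ^+ 2).
  apply: (@measurable_funS _ _ _ _ (@halfline R)) => //.
   exact: meas_half. by move=> t; rewrite /halfline /= !in_itv /= !andbT; exact: le_trans.
  by apply: meas_ray => t t0; exact: LI_meas (proj1 (N2_AC Bu)) _ t0.
 have I0 : (0 <= \int[leb]_(x in `[c, +oo[%classic) (a x ^+ 2 + b x ^+ 2)%:E)%E.
  by apply: integral_ge0 => t _; rewrite lee_fin addr_ge0 // sqr_ge0.
 have [yc|/ltW cy] := leP y c.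
  by apply: le_trans (N2_mono Bu y0 yc) _; rewrite lerDl fine_ge0.
 rewrite -lerBlDl (AC_itv (N2_AC Bu) c0 cy) /Rint; apply: fine_le.
 - exact: integrable_fin_num (LI_sub_itv y (proj1 (N2_AC Bu)) c0).
 - by rewrite ge0_fin_numE.
 - apply: ge0_subset_integral => //=; first exact/measurable_EFinP.
  + by move=> t _; rewrite lee_fin addr_ge0 // sqr_ge0.
  + by move=> t; rewrite /= !in_itv /= => /andP[->].
have U0 : U2 u w 0 != 0.
 apply/negP => /eqP; rewrite /U2 => /eqP; rewrite paddr_eq0 ?nsq_ge0 // => /andP[/eqP/nsq_eq0 h1 /eqP/nsq_eq0 h2].
 have s0 : sol (Qz q z) (fun=> 0) (fun=> 0).
  by split; [exact: CAC_cst|apply: CAC_ext (CAC_cst 0) => // t _; rewrite mulr0].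
 have [h3 h4] := sol_unique (Qz_CLI Iq z) sl s0 h1 h2 x0. by case/orP: nz => /eqP; apply; case: h3.
have [u1 [w1 nw]] := weyl_nweyl z0 wl U0; exists u1, w1; exact: nw.
Qed.

Lemma m_value_exists z : 0 < Im z -> exists m, m_value q theta z m.
Proof.
move=> z0; have [u [w [wl u0]]] := weyl_exists Iq aKq Q00 uni z0.
have [su [M HM]] := wl; have Bu := CAC_CLB (proj1 su).
exists (bca theta u w / bcb theta u w), (fun x => Re (u x)), (fun x => Im (u x)), (fun x => Re (w x)), (fun x => Im (w x)).
have eta (f : R -> C) : (fun x => Complex (Re (f x)) (Im (f x))) = f by apply/funext => x; case: (f x).
split.
- by apply/csolP; rewrite !eta.
- by exists 0 => //; rewrite u0 /= oner_eq0.
- exists 0; split => //; apply: le_lt_trans (halfline_le (N2_AC Bu) (fun y _ => nsq_ge0 _) (N2_0 u) HM) _.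
 exact: ltry.
- rewrite /bca /bcb; have e (f : R -> C) : Complex (Re (f 0)) (Im (f 0)) = f 0 by case: (f 0).
 by rewrite !e.
Qed.

End Bounded.

(** * Boundary behaviour of the imaginary part of the m-function *)

Section HarmonicStrip.
Implicit Types (z w : C) (x y s t a L : R) (f g h : R -> R).

Lemma half_gt0 (e : R) : 0 < e -> 0 < e / 2.
Proof. by move=> e0; rewrite divr_gt0. Qed.

(** Differentiability with a remainder uniform on [[0, X]]. Exchanging [s] and [t] in it shows that
    the derivative is uniformly continuous, whence absolute continuity. *)
Definition unif_diff (f f' : R -> R) := forall X eta, 0 < eta -> exists2 d : R, 0 < d &
  forall s t, 0 <= s -> s <= X -> 0 <= t -> t <= X -> `|t - s| < d ->
  `|f t - f s - (t - s) * f' s| <= eta * `|t - s|.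

Lemma unif_diff_cont f f' X eta : unif_diff f f' -> 0 < eta -> exists2 d : R, 0 < d &
  forall s t, 0 <= s -> s <= X -> 0 <= t -> t <= X -> `|t - s| < d -> `|f' t - f' s| <= eta.
Proof.
move=> h e0; have [d d0 dP] := h X (eta / 2) (half_gt0 e0); exists d => // s t s0 sX t0 tX std.
have [->|ts] := eqVneq t s; first by rewrite subrr normr0 ltW.
have p : 0 < `|t - s| by rewrite normr_gt0 subr_eq0.
have h1 := dP s t s0 sX t0 tX std; have := dP t s t0 tX s0 sX; rewrite distrC => /(_ std) h2.
rewrite -(ler_pM2l p) -normrM.
have -> : (t - s) * (f' t - f' s) = (f t - f s - (t - s) * f' s) + (f s - f t - (s - t) * f' t) by ring.
apply: le_trans (ler_normD _ _) _; lin.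
Qed.

Lemma unif_cont_LB (f : R -> R) : (forall X eta, 0 < eta -> exists2 d : R, 0 < d &
  forall s t, 0 <= s -> s <= X -> 0 <= t -> t <= X -> `|t - s| < d -> `|f t - f s| <= eta) -> LB f.
Proof.
move=> h x x0.
have cf : {within `[0, x], continuous f}.
 apply/subspace_continuousP => y; rewrite /= in_itv /= => /andP[y0 yx].
 apply/cvgrPdist_le => e e0; have [d d0 dP] := h x e e0; rewrite near_withinE.
 have : \forall t \near y, `|y - t| < d by exact: (@cvgr_dist_lt _ R^o _ (nbhs y) _ id y cvg_id d d0).
 apply: filterS => t yt; rewrite /= in_itv /= => /andP[t0 tx]. by apply: dP.
split; first exact: subspace_continuous_measurable_fun.
have [c _ cP] := EVT_max x0 cf; have [d _ dP] := EVT_min x0 cf.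
exists (`|f c| + `|f d|) => y y0 yx.
have yI : y \in `[0, x]%R by rewrite in_itv /= y0 yx.
have := cP y yI; have := dP y yI; have := ler_norm (f c); have := ler_norm (- f d).
rewrite normrN ler_norml => h1 h2 h3 h4; have := normr_ge0 (f c); have := normr_ge0 (f d) => h5 h6; apply/andP; split; lin.
Qed.

Lemma unif_diff_AC f f' : unif_diff f f' -> AC f f'.
Proof.
move=> h; have If : LI f'.
 by apply: LB_LI; apply: unif_cont_LB => X eta e0; exact: unif_diff_cont h e0.
split=> // X X0; have aP := AC_prim 0 If; set P := (fun x => 0 + _) in aP.
suff : (fun x => f x - P x) X = (fun x => f x - P x) 0.
 by rewrite /P /= RintI0 addr0 subr0 add0r => <-; rewrite subrK.
apply: (@local_null (fun x => f x - P x) (fun x => x)) => // eta e0.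
have [d d0 dP] := h X (eta / 2) (half_gt0 e0).
have [d1 d10 dP1] := unif_diff_cont X h (half_gt0 e0).
exists (Num.min d d1); first by rewrite lt_min d0 d10.
move=> s t s0 st tX; rewrite lt_min => /andP[sd sd1].
have ts : `|t - s| = t - s by rewrite ger0_norm // subr_ge0.
have h1 := dP s t s0 (le_trans st tX) (le_trans s0 st) tX; rewrite ts in h1.
have h2 : `|P t - f' s * t - (P s - f' s * s)| <= eta / 2 * (t - s).
 apply: (AC_lip (AC_sub aP (AC_scale (f' s) AC_id)) s0 st) => y sy yt; rewrite mulr1.
 apply: dP1; [by []|exact: le_trans st tX|exact: le_trans sy|exact: le_trans yt tX|]. by rewrite ger0_norm ?subr_ge0 //; lin.
have -> : f t - P t - (f s - P s) = (f t - f s - (t - s) * f' s) - (P t - f' s * t - (P s - f' s * s)) by ring.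
apply: le_trans (ler_normB _ _) _; have := h1 sd; lin.
Qed.

Variables m d : C -> C.
Let T z : R := Im (m z) / Im z.
Hypothesis Him : forall z, 0 < Im z -> 0 <= Im (m z).
Hypothesis Hbd : forall rho : R, exists B : R, forall z, nrm z <= rho -> 0 < Im z -> nrm (m z) <= B / Im z.
Hypothesis Hlip : forall z w, 0 < Im z -> 0 < Im w -> nsq (m z - m w) <= nsq (z - w) * (T z * T w).
Hypothesis Hd : forall z w, 0 < Im z -> 0 < Im w ->
  nsq (m z - m w - (z - w) * d w) <= nsq (z - w) * (T w * mdist z w (m z) (m w)).

(** The third bound sharpens [Hd]: [mdist] vanishes at [z = w] and is Lipschitz there above height
    [y0], so the remainder is of order [|z - w|] to the power [3/2], which is what makes [d] a
    derivative. *)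
Lemma m_hol (rho y0 : R) : 0 < y0 -> exists2 K : R, 0 < K & forall z w,
  nrm z <= rho -> nrm w <= rho -> y0 <= Im z -> y0 <= Im w ->
  [/\ nrm (m z) <= K, nrm (m z - m w) <= K * nrm (z - w) &
      nsq (m z - m w - (z - w) * d w) <= K * (nsq (z - w) * nrm (z - w))].
Proof.
move=> y00; have [B HB] := Hbd rho.
pose B1 := `|B| / y0; have B10 : 0 <= B1 by rewrite divr_ge0 // ltW.
have mB z : nrm z <= rho -> y0 <= Im z -> nrm (m z) <= B1.
 move=> zr yz; have z0 := lt_le_trans y00 yz; apply: le_trans (HB z zr z0) _.
 apply: (@le_trans _ _ (`|B| / Im z)); first by rewrite ler_wpM2r ?invr_ge0 ?(ltW z0) // ler_norm. by rewrite ler_wpM2l // lef_pV2 // posrE.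
pose T0 := B1 / y0; have T00 : 0 <= T0 by rewrite divr_ge0 // ltW.
have TB z : nrm z <= rho -> y0 <= Im z -> 0 <= T z <= T0.
 move=> zr yz; have z0 := lt_le_trans y00 yz; rewrite /T divr_ge0 ?Him ?(ltW z0) //=.
 rewrite /T0; apply: ler_pM; rewrite ?invr_ge0 ?Him ?(ltW z0) //.
  by apply: le_trans (mB z zr yz); apply: le_trans (Im_le _); exact: ler_norm.
 by rewrite lef_pV2 // posrE.
have lip z w : nrm z <= rho -> nrm w <= rho -> y0 <= Im z -> y0 <= Im w -> nrm (m z - m w) <= T0 * nrm (z - w).
 move=> zr wr yz yw; have /andP[t1 t2] := TB z zr yz; have /andP[t3 t4] := TB w wr yw.
 apply: nrm_sqr_le; first by rewrite mulr_ge0 // nrm_ge0. apply: le_trans (Hlip (lt_le_trans y00 yz) (lt_le_trans y00 yw)) _.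
 by rewrite exprMn nrmE mulrC expr2 ler_wpM2r ?nsq_ge0 // ler_pM.
pose D := T0 * (2 * (T0 + T0) / y0 + (T0 + T0) / y0).
have D0 : 0 <= D by rewrite /D mulr_ge0 // addr_ge0 // divr_ge0 ?(ltW y00) // ?mulr_ge0 // addr_ge0.
exists (B1 + T0 + D + 1); first by rewrite ltr_wpDl // !addr_ge0.
move=> z w zr wr yz yw; have z0 := lt_le_trans y00 yz; have w0 := lt_le_trans y00 yw.
have N0 := nrm_ge0 (z - w); have S0 := nsq_ge0 (z - w).
split.
- by apply: le_trans (mB z zr yz) _; lin.
- by apply: le_trans (lip z w zr wr yz yw) _; rewrite ler_wpM2r //; lin.
- apply: le_trans (Hd z0 w0) _; rewrite [leRHS]mulrCA ler_wpM2l //.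
 apply: (@le_trans _ _ (D * nrm (z - w))); last by rewrite ler_wpM2r //; lin.
 have /andP[t3 t4] := TB w wr yw; have /andP[t1 t2] := TB z zr yz. have zw : z - conj w != 0.
  by apply/negP => /eqP h; have : Im (z - conj w) = 0 by [rewrite h]; rewrite !CE; lin.
 have nzw : y0 <= nrm (z - conj w).
  by apply: le_trans (Im_le _); apply: le_trans (ler_norm _); rewrite !CE; lin.
 (* Splitting off the value [T w], attained at [z = w], exhibits the cancellation in [mdist]. *)
 have e1 : (m z - conj (m w)) / (z - conj w) = (T w)%:C%C + (m z - m w - (T w)%:C%C * (z - w)) / (z - conj w).
  have -> : m z - conj (m w) = (T w)%:C%C * (z - conj w) + (m z - m w - (T w)%:C%C * (z - w)).
   have h : Im (m w) = T w * Im w by rewrite /T divfK // gt_eqF. by apply: C_eq; rewrite !CE ?h; ring.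
  by rewrite mulrDl mulfK.
 have h1 : nrm ((m z - m w - (T w)%:C%C * (z - w)) / (z - conj w)) <= (T0 + T0) / y0 * nrm (z - w).
  rewrite nrmM Normc.normcV mulrAC; apply: ler_pM; rewrite ?nrm_ge0 ?invr_ge0 ?nrm_ge0 //.
   apply: le_trans (nrmB _ _) _; rewrite mulrDl nrmM nrmC ger0_norm //. by apply: lerD; [exact: lip|rewrite ler_wpM2r].
  by rewrite lef_pV2 // posrE //; exact: lt_le_trans nzw.
 have h2 : T z - T w <= (T0 + T0) / y0 * nrm (z - w).
  have h3 : Im (m z) - Im (m w) <= T0 * nrm (z - w).
   apply: le_trans (lip z w zr wr yz yw); apply: le_trans (Im_le _); apply: le_trans (ler_norm _); by rewrite !CE.
  have h4 : Im w - Im z <= nrm (z - w).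
   by rewrite -nrmN; apply: le_trans (Im_le _); apply: le_trans (ler_norm _); rewrite !CE; lin.
  have -> : T z - T w = (Im (m z) - Im (m w) + T w * (Im w - Im z)) / Im z.
   by rewrite /T; field; rewrite !gt_eqF.
  have h5 : T w * (Im w - Im z) <= T0 * nrm (z - w).
   by apply: le_trans (ler_wpM2l t3 h4) _; rewrite ler_wpM2r.
  apply: (@le_trans _ _ ((T0 + T0) * nrm (z - w) / Im z)); first by rewrite ler_wpM2r ?invr_ge0 ?(ltW z0) //; lin.
  by rewrite mulrAC ler_wpM2r // ler_wpM2l ?addr_ge0 // lef_pV2 // posrE.
 have h6 : mdist z w (m z) (m w) <= (2 * (T0 + T0) / y0 + (T0 + T0) / y0) * nrm (z - w).
  rewrite /mdist e1 ReD ReC -/(T z) -/(T w).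
  have := Re_le ((m z - m w - (T w)%:C%C * (z - w)) / (z - conj w)); rewrite ler_norml => /andP[h7 _]; lin.
 rewrite /D -mulrA; apply: le_trans (ler_wpM2l t3 h6) _; rewrite ler_wpM2r // mulr_ge0 //.
 have c0 : 0 <= (T0 + T0) / y0 by rewrite divr_ge0 ?(ltW y00) // addr_ge0. lin.
Qed.

Definition zp (a xi y : R) : C := Complex (a + xi) y.

Lemma zp_bound a L Y : exists rho, forall xi y, 0 <= xi -> xi <= L -> 0 <= y -> y <= Y -> nrm (zp a xi y) <= rho.
Proof.
exists (`|a| + L + Y) => xi y x0 xL y0 yY; apply: le_trans (nrm_ReIm _) _ => /=.
by have := ler_normD a xi; rewrite (ger0_norm x0) (ger0_norm y0); lin.
Qed.

(* Partial derivatives along [k = 1] (horizontal) and [k = 'i] (vertical). *)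
Lemma m_diff_est (k : C) (zf : R -> C) : nrm k = 1 -> (forall s t, zf t - zf s = (t - s)%:C%C * k) ->
  (forall X, exists rho y0, 0 < y0 /\ forall s, 0 <= s -> s <= X -> nrm (zf s) <= rho /\ y0 <= Im (zf s)) ->
  unif_diff (fun s => Re (m (zf s))) (fun s => Re (k * d (zf s))) /\
  unif_diff (fun s => Im (m (zf s))) (fun s => Im (k * d (zf s))).
Proof.
move=> k1 zd zb.
have key X eta : 0 < eta -> exists2 d0 : R, 0 < d0 & forall s t, 0 <= s -> s <= X -> 0 <= t -> t <= X -> `|t - s| < d0 ->
  nrm (m (zf t) - m (zf s) - (t - s)%:C%C * (k * d (zf s))) <= eta * `|t - s|.
 move=> e0; have [rho [y0 [y00 hz]]] := zb X; have [K K0 HK] := m_hol rho y00.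
 exists (eta ^+ 2 / K); first by rewrite divr_gt0 // exprn_gt0.
 move=> s t s0 sX t0 tX std; have [z1 z2] := hz s s0 sX; have [z3 z4] := hz t t0 tX. have [_ _ h] := HK _ _ z3 z1 z4 z2.
 have nd : nrm (zf t - zf s) = `|t - s| by rewrite zd nrmM k1 mulr1 nrmC. apply: nrm_sqr_le; first by rewrite mulr_ge0 // ltW.
 rewrite mulrA -zd; apply: le_trans h _; rewrite -nrmE nd exprMn [leRHS]mulrC mulrCA ler_wpM2l ?sqr_ge0 //.
 by rewrite mulrC -ler_pdivlMr // ltW.
split=> X eta e0; have [d0 d00 H] := key X eta e0; exists d0 => // s t s0 sX t0 tX std; apply: le_trans (H s t s0 sX t0 tX std).
 by apply: le_trans (Re_le _); rewrite !CE /=; apply: eqW; congr (`|_|); ring.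
by apply: le_trans (Im_le _); rewrite !CE /=; apply: eqW; congr (`|_|); ring.
Qed.

Lemma Im_zp a x y : Im (zp a x y) = y. Proof. by []. Qed.

Lemma zp_sub a x x' y y' : zp a x y - zp a x' y' = (x - x')%:C%C + (y - y')%:C%C * 'i%C.
Proof.
change (Complex ((a + x) - (a + x')) (y - y') = Complex ((x - x') + ((y - y') * 0 - 0 * 1)) (0 + ((y - y') * 1 + 0 * 0))).
by congr Complex; ring.
Qed.

Lemma Rint_prim f F L : AC F f -> 0 <= L -> Rint `[0, L] f = F L - F 0.
Proof. by move=> aF L0; rewrite (AC_itv aF (lexx 0) L0). Qed.

Lemma Rint_parts f f' g g' L : AC f f' -> AC g g' -> 0 <= L -> g 0 = 0 -> g L = 0 ->
  Rint `[0, L] (fun x => f' x * g x) = - Rint `[0, L] (fun x => f x * g' x).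
Proof.
move=> af ag L0 g0 gL.
have i1 : LI (fun x => f' x * g x) by apply: LI_mulLB (AC_LB ag); case: af.
have i2 : LI (fun x => f x * g' x) by apply: LB_mulLI (AC_LB af) _; case: ag.
have := AC_eq (AC_add (AC_prim 0 i1) (AC_prim 0 i2)) (AC_mul af ag) (lexx 0) L0.
by rewrite g0 gL !mulr0 subrr !RintI0 !add0r subr0 => /eqP; rewrite addr_eq0 => /eqP.
Qed.

Lemma Rint_le f g L : LI f -> LI g -> 0 <= L -> (forall x, 0 <= x -> x <= L -> f x <= g x) ->
  Rint `[0, L] f <= Rint `[0, L] g.
Proof.
move=> If Ig L0 fg; have := AC_le (AC_prim 0 If) (AC_prim 0 Ig) (lexx 0) L0 fg.
by rewrite !RintI0 !add0r !subr0.
Qed.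

Lemma Rint_scale (c : R) f L : LI f -> 0 <= L -> Rint `[0, L] (fun x => c * f x) = c * Rint `[0, L] f.
Proof.
move=> If L0; have := AC_eq (AC_prim 0 (LI_scale c If)) (AC_scale c (AC_prim 0 If)) (lexx 0) L0.
by rewrite !RintI0 !add0r mulr0 !subr0.
Qed.

Lemma m_ACx a y : 0 < y ->
  AC (fun xi => Re (m (zp a xi y))) (fun xi => Re (d (zp a xi y))) /\
  AC (fun xi => Im (m (zp a xi y))) (fun xi => Im (d (zp a xi y))).
Proof.
move=> y0; have [||] := @m_diff_est 1 (fun xi => zp a xi y) nrm1.
- by move=> s t; rewrite zp_sub subrr rmorph0; ring.
- move=> X; have [rho Hr] := zp_bound a X y; exists rho, y; split=> // s s0 sX.
 by rewrite /= lexx; split=> //; apply: Hr => //; exact: ltW.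
by move=> h1 h2; split; [apply: AC_ext (unif_diff_AC h1)|apply: AC_ext (unif_diff_AC h2)] => x _; rewrite ?mul1r.
Qed.

(** Differentiation under the integral sign. By the Cauchy-Riemann equations the vertical derivative
    of [Im m] is the horizontal one of [Re m], and that of [Re m] is minus the horizontal one of
    [Im m]. *)
Lemma m_ACy a eps L g : 0 < eps -> 0 <= L -> LB g ->
  AC (fun t => Rint `[0, L] (fun xi => Im (m (zp a xi (eps + t))) * g xi))
     (fun t => Rint `[0, L] (fun xi => Re (d (zp a xi (eps + t))) * g xi)) /\
  AC (fun t => Rint `[0, L] (fun xi => Re (m (zp a xi (eps + t))) * g xi))
     (fun t => Rint `[0, L] (fun xi => - Im (d (zp a xi (eps + t))) * g xi)).
Proof.
move=> e0 L0 Bg; have y0 t : 0 <= t -> 0 < eps + t by move=> t0; rewrite ltr_wpDr.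
have key X eta : 0 < eta -> exists2 d0 : R, 0 < d0 & forall xi s t, 0 <= xi -> xi <= L -> 0 <= s -> s <= X -> 0 <= t -> t <= X ->
  `|t - s| < d0 -> nrm (m (zp a xi (eps + t)) - m (zp a xi (eps + s)) - (t - s)%:C%C * ('i%C * d (zp a xi (eps + s)))) <= eta * `|t - s|.
 move=> eta0; have [rho Hr] := zp_bound a L (eps + X). have [K K0 HK] := @m_hol rho eps e0.
 exists (eta ^+ 2 / K); first by rewrite divr_gt0 // exprn_gt0. move=> xi s t x0 xL s0 sX t0 tX std.
 have z1 : nrm (zp a xi (eps + s)) <= rho by apply: Hr; rewrite ?lerD2l // ltW // y0.
 have z3 : nrm (zp a xi (eps + t)) <= rho by apply: Hr; rewrite ?lerD2l // ltW // y0. have [||_ _ h] := HK _ _ z3 z1; rewrite ?lerDl //.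
 have zd : zp a xi (eps + t) - zp a xi (eps + s) = (t - s)%:C%C * 'i%C by rewrite zp_sub subrr rmorph0 (_ : eps + t - (eps + s) = t - s); ring.
 have nd : nrm (zp a xi (eps + t) - zp a xi (eps + s)) = `|t - s| by rewrite zd nrmM nrmi mulr1 nrmC.
 apply: nrm_sqr_le; first by rewrite mulr_ge0 // ltW.
 rewrite mulrA -zd; apply: le_trans h _; rewrite -nrmE nd exprMn [leRHS]mulrC mulrCA ler_wpM2l ?sqr_ge0 //.
 by rewrite mulrC -ler_pdivlMr // ltW.
have gen (h hy : R -> R -> R) : (forall t, 0 <= t -> LI (fun xi => h xi t)) -> (forall t, 0 <= t -> LI (fun xi => hy xi t)) ->
  (forall xi s t, `|h xi t - h xi s - (t - s) * hy xi s| <=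
   nrm (m (zp a xi (eps + t)) - m (zp a xi (eps + s)) - (t - s)%:C%C * ('i%C * d (zp a xi (eps + s))))) ->
  AC (fun t => Rint `[0, L] (fun xi => h xi t * g xi)) (fun t => Rint `[0, L] (fun xi => hy xi t * g xi)).
 move=> Ih Ihy hE; apply: unif_diff_AC => X eta eta0. have aG := AC_prim 0 (LI_norm (LB_LI Bg)); set G := (fun x => 0 + _) in aG.
 have G0 : G 0 = 0 by rewrite /G RintI0 addr0. have GL : 0 <= G L by rewrite -G0; apply: AC_homo aG (lexx 0) L0 _ => x _ _.
 have c0 : 0 < 1 + G L by rewrite ltr_wpDr. have [d0 d00 H] := key X _ (divr_gt0 eta0 c0); exists d0 => // s t s0 sX t0 tX std.
 have a1 := AC_prim 0 (LI_mulLB (Ih t t0) Bg); have a2 := AC_prim 0 (LI_mulLB (Ih s s0) Bg). have a3 := AC_prim 0 (LI_mulLB (Ihy s s0) Bg).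
 have := AC_norm_le (AC_sub (AC_sub a1 a2) (AC_scale (t - s) a3)) (AC_scale (eta / (1 + G L) * `|t - s|) aG) (lexx 0) L0.
 have E0 (A B D : R) : (0 + A) - (0 + B) - (t - s) * (0 + D) - (0 + 0 - (0 + 0) - (t - s) * (0 + 0)) = A - B - (t - s) * D by ring.
 rewrite !RintI0 E0 G0 mulr0 subr0 => HH; apply: le_trans (HH _) _ => [xi x0 xL|].
  rewrite (_ : _ - _ = (h xi t - h xi s - (t - s) * hy xi s) * g xi); last ring.
  rewrite normrM ler_wpM2r //; apply: le_trans (hE xi s t) _; exact: H.
 have hh : eta / (1 + G L) * G L <= eta by rewrite mulrAC ler_pdivrMr // ler_wpM2l ?(ltW eta0) // lerDr.
 rewrite mulrAC; exact: ler_wpM2r hh.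
have LIx t : 0 <= t -> [/\ LI (fun xi => Re (m (zp a xi (eps + t)))), LI (fun xi => Im (m (zp a xi (eps + t)))),
  LI (fun xi => Re (d (zp a xi (eps + t)))) & LI (fun xi => Im (d (zp a xi (eps + t))))].
 by move=> t0; have [h1 h2] := m_ACx a (y0 t t0); split; [exact: AC_LI h1|exact: AC_LI h2|case: h1|case: h2].
split.
 apply: (gen (fun xi t => Im (m (zp a xi (eps + t)))) (fun xi t => Re (d (zp a xi (eps + t))))).
 - by move=> t /LIx[].
 - by move=> t /LIx[].
 - move=> xi s t; apply: le_trans (Im_le _); rewrite !(ReM, ImM, ReD, ImD, ReN, ImN) Rei Imi ReC ImC; apply: eqW; congr (`|_|); ring.
apply: (gen (fun xi t => Re (m (zp a xi (eps + t)))) (fun xi t => - Im (d (zp a xi (eps + t))))).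
- by move=> t /LIx[].
- by move=> t /LIx[_ _ _]; exact: LI_opp.
- move=> xi s t; apply: le_trans (Re_le _); rewrite !(ReM, ImM, ReD, ImD, ReN, ImN) Rei Imi ReC ImC; apply: eqW; congr (`|_|); ring.
Qed.

Lemma AC_sq f f' : AC f f' -> AC (fun x => f x ^+ 2) (fun x => 2 * f x * f' x).
Proof. by move=> a; apply: AC_ext (AC_mul a a) => x _; rewrite ?expr2 //; ring. Qed.

(* Green's formula against the weight (xi (L - xi))^2, whose second derivative is at least -(18/L^2) times
   the weight, gives F'' <= (18/L^2) F; comparing with s = t + c t^3 / 4 yields a Harnack bound up to the boundary. *)
Lemma strip_bound a L eps B P : 0 < L -> 0 < eps -> eps <= L / 8 ->
  (forall xi, 0 <= xi -> xi <= L -> Im (m (zp a xi (L / 8))) <= B) ->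
  AC P (fun xi => Im (m (zp a xi eps))) ->
  P (3 / 4 * L) - P (L / 4) <= 16 / 9 * expR 2 * B * L.
Proof.
move=> L0 e0 eL vB aP; have L0' := ltW L0.
pose p x := x * (L - x).
have ap : AC p (fun x => L - 2 * x).
 by apply: AC_ext (AC_mul AC_id (AC_sub (AC_cst L) AC_id)) => x _ //; ring.
pose g x := p x ^+ 2; pose g1 x := 2 * p x * (L - 2 * x); pose g2 x := 2 * (L - 2 * x) ^+ 2 - 4 * p x.
have ag : AC g g1 by exact: AC_sq.
have al : AC (fun x => L - 2 * x) (fun=> -2).
 by apply: AC_ext (AC_sub (AC_cst L) (AC_scale 2 AC_id)) => x _ //; ring.
have ag1 : AC g1 g2.
 by apply: AC_ext (AC_scale 2 (AC_mul ap al)) => x _; rewrite /g1 /g2; ring.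
have Bg := AC_LB ag; have Bg1 := AC_LB ag1.
have Bg2 : LB g2.
 exact: AC_LB (AC_sub (AC_scale 2 (AC_sq al)) (AC_scale 4 ap)).
have g0 x : 0 <= g x by exact: sqr_ge0.
(* The number 18 makes [g2 + kap * g] the perfect square [2 * (L - 3 * p x / L) ^+ 2]. *)
set kap := 18 / L ^+ 2; have kap0 : 0 < kap by rewrite divr_gt0 // exprn_gt0.
have gg x : - kap * g x <= g2 x.
 rewrite -subr_ge0 (_ : _ - _ = 2 * (L - 3 * p x / L) ^+ 2); first by rewrite mulr_ge0 // sqr_ge0.
 by rewrite /g2 /g /kap /p; field; rewrite gt_eqF.
pose v xi t := Im (m (zp a xi (eps + t))); pose r xi t := Re (m (zp a xi (eps + t))).
have y0 t : 0 <= t -> 0 < eps + t by move=> t0; rewrite ltr_wpDr.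
have v0 xi t : 0 <= t -> 0 <= v xi t by move=> t0; apply: Him; exact: y0.
pose F t := Rint `[0, L] (fun xi => v xi t * g xi).
pose G t := Rint `[0, L] (fun xi => r xi t * g1 xi).
pose H t := Rint `[0, L] (fun xi => v xi t * g2 xi).
have LIv t : 0 <= t -> LI (fun xi => v xi t) by move=> t0; exact: AC_LI (proj2 (m_ACx a (y0 t t0))).
(* Cauchy-Riemann and two integrations by parts move both derivatives onto the weight, which
   vanishes at 0 and [L] together with its slope: [F' = - G] and [G' = H]. *)
have aF : AC F (fun t => - G t).
 have [h _] := m_ACy a e0 L0' Bg; apply: AC_ext h => // t t0. have := Rint_parts (proj1 (m_ACx a (y0 t t0))) ag L0'; apply.
  by rewrite /g /p mul0r expr0n.
 by rewrite /g /p subrr mulr0 expr0n.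
have aG : AC G H.
 have [_ h] := m_ACy a e0 L0' Bg1; apply: AC_ext h => // t t0. have := Rint_parts (AC_opp (proj2 (m_ACx a (y0 t t0)))) ag1 L0'.
 rewrite /g1 /p mul0r mulr0 mul0r => /(_ erefl) /=.
 rewrite subrr !mulr0 mul0r => /(_ erefl) ->; rewrite /H -mulN1r -Rint_scale //; last first.
  by apply: LI_mulLB (LI_opp (LIv t t0)) Bg2.
 congr Rint; apply/funext => x; rewrite /v; ring.
have F0 t : 0 <= t -> 0 <= F t.
 move=> t0; have a0 := AC_prim 0 (LI_mulLB (LIv t t0) Bg).
 have := AC_homo a0 (lexx 0) L0'; rewrite RintI0 !add0r; apply => x _ _; exact: mulr_ge0 (v0 _ _ t0) (g0 _).
have HF t : 0 <= t -> - H t <= kap * F t.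
 move=> t0; have I1 := LI_mulLB (LIv t t0) Bg2; have I2 := LI_mulLB (LIv t t0) Bg.
 rewrite /H /F -mulN1r -!Rint_scale //; apply: Rint_le => //; try exact: LI_scale. move=> x _ _; have := ler_wpM2l (v0 x t t0) (gg x); lin.
set b := L / 4 - eps; have b0 : 0 < b by rewrite /b; lin.
pose tt x := b - x; have att : AC tt (fun=> -1).
 by apply: AC_ext (AC_sub (AC_cst b) AC_id) => x _ //; rewrite sub0r.
(* [s] vanishes at [t = b] and satisfies [s'' >= kap * s], since [kap * tt ^+ 2 <= 9 / 8]. The
   function [w] below is [F' s - F s']: it is nonincreasing and nonnegative at [b], hence
   nonnegative, and so [- F' / F <= - s' / s <= 16 / L] up to [t1]. *)
pose s x := tt x + kap / 4 * (tt x * tt x ^+ 2).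
pose s1 x := -1 - kap / 4 * (3 * tt x ^+ 2).
pose s2 x := kap / 4 * (6 * tt x).
have as_ : AC s s1.
 by apply: AC_ext (AC_add att (AC_scale (kap / 4) (AC_mul att (AC_sq att)))) => x _ //; rewrite /s1; ring.
have as1 : AC s1 s2.
 apply: AC_ext (AC_sub (AC_cst (-1)) (AC_scale (kap / 4 * 3) (AC_sq att))) => x _; rewrite /s1 /s2 ?sub0r; ring.
have kt x : 0 <= x -> x <= b -> 0 <= tt x /\ kap * tt x ^+ 2 <= 9 / 8.
 move=> x0 xb; have t0 : 0 <= tt x by rewrite subr_ge0.
 split=> //; have : tt x ^+ 2 <= (L / 4) ^+ 2 by rewrite ler_pXn2r ?nnegrE //; rewrite /tt /b; lin.
 move=> /(ler_wpM2l (ltW kap0)) h; apply: le_trans h _; rewrite /kap; apply: eqW. by field; rewrite gt_eqF.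
pose w x := - G x * s x - F x * s1 x.
have aw : AC w (fun x => (- H x * s x + - G x * s1 x) - (- G x * s1 x + F x * s2 x)).
 exact: AC_sub (AC_mul (AC_opp aG) as_) (AC_mul aF as1).
have w0 x : 0 <= x -> x <= b -> 0 <= w x.
 move=> x0 xb; apply: (@le_trans _ _ (w b)).
  rewrite /w (_ : s b = 0); last by rewrite /s /tt subrr expr0n !mulr0 addr0.
  rewrite mulr0 sub0r -mulrN mulr_ge0 ?F0 ?(ltW b0) // /s1 /tt subrr expr0n !mulr0 subr0 opprK //.
 rewrite -lerN2; apply: (AC_homo (AC_opp aw) x0 xb) => y xy yb. have y00 := le_trans x0 xy; have [t0 tk] := kt y y00 yb.
 have h1 := HF y y00; have h2 := F0 y y00.
 have s0 : 0 <= s y by rewrite /s addr_ge0 // mulr_ge0 ?divr_ge0 ?(ltW kap0) // mulr_ge0 // sqr_ge0. have h3 : kap * s y <= s2 y.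
  rewrite /s /s2 -subr_ge0. rewrite (_ : _ - _ = kap * tt y * (1 / 2 - (kap * tt y ^+ 2) / 4)); last by field.
  by apply: mulr_ge0; [apply: mulr_ge0 => //; exact: ltW|lin].
 have h4 := ler_wpM2r s0 h1; have h5 := ler_wpM2l h2 h3; lin.
set t1 := L / 8 - eps; have t10 : 0 <= t1 by rewrite /t1 subr_ge0.
have t1b : t1 <= b by rewrite /t1 /b; lin.
have FF : F 0 <= expR (16 / L * t1 - 16 / L * 0) * (F t1 + (0 - 0)).
 apply: (gronwall_back aF (AC_scale (16 / L) AC_id) (AC_cst 0) (lexx 0) t10) => // x x0 xt.
 - have xb := le_trans xt t1b; have [tx tk] := kt x x0 xb; have h1 := w0 x x0 xb; have h2 := F0 x x0.
  have tx8 : L / 8 <= tt x by rewrite /tt /b; move: xt; rewrite /t1; lin. have sx : L / 8 <= s x.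
   by apply: le_trans tx8 _; rewrite /s lerDl mulr_ge0 ?divr_ge0 ?(ltW kap0) // mulr_ge0 // sqr_ge0.
  have sx0 : 0 < s x by apply: lt_le_trans sx; rewrite divr_gt0. have s1x : - s1 x <= 2 by rewrite /s1; lin.
  rewrite opprK addr0 mulr1 -(ler_pM2r sx0). have h3 : G x * s x <= F x * 2 by have := ler_wpM2l h2 s1x; rewrite /w in h1; lin.
  apply: le_trans h3 _; rewrite [leRHS](_ : _ = F x * (16 / L * s x)); last ring. rewrite ler_wpM2l //.
  rewrite -(ler_pM2l (_ : 0 < L / 8)) ?divr_gt0 //. rewrite (_ : L / 8 * (16 / L * s x) = 2 * s x); last by field; rewrite gt_eqF. lin.
 - by rewrite mulr1 divr_ge0.
have FF2 : F 0 <= expR 2 * F t1.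
 apply: le_trans FF _; rewrite mulr0 !subr0 addr0 ler_wpM2r ?F0 // ler_expR.
 have : 16 / L * t1 <= 16 / L * (L / 8) by rewrite ler_wpM2l ?divr_ge0 // /t1; lin.
 by rewrite (_ : 16 / L * (L / 8) = 2) //; field; rewrite gt_eqF.
have B0 : 0 <= B by apply: le_trans (vB 0 (lexx 0) L0'); apply: Him; rewrite /= divr_gt0.
have Ft1 : F t1 <= B * L ^+ 5 / 16.
 have := AC_le (AC_prim 0 (LI_mulLB (LIv t1 t10) Bg)) (AC_scale (B * (L ^+ 2 / 4) ^+ 2) AC_id) (lexx 0) L0'.
 rewrite RintI0 !add0r mulr0 !subr0 => h; apply: le_trans (h _) _ => [x x0 xL|].
  rewrite mulr1; apply: ler_pM => //; rewrite ?v0 //.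
   by rewrite /v /t1 addrCA subrr addr0; exact: vB.
  have p0 : 0 <= p x by rewrite mulr_ge0 // subr_ge0. rewrite /g ler_pXn2r ?nnegrE // ?divr_ge0 ?sqr_ge0 //.
  by rewrite -subr_ge0 (_ : _ - _ = (L / 2 - x) ^+ 2) ?sqr_ge0 // /p; field.
 by apply: eqW; field.
(* On [[L / 4, 3 L / 4]] the factor [p] is at least its value [3 * L ^+ 2 / 16] at the ends. *)
have low : 9 * L ^+ 4 / 256 * (P (3 / 4 * L) - P (L / 4)) <= F 0.
 have aQ := AC_prim 0 (LI_mulLB (LIv 0 (lexx 0)) Bg); set Q := (fun x => 0 + _) in aQ. have FQ : F 0 = Q L by rewrite /Q add0r.
 have qm s' t' : 0 <= s' -> s' <= t' -> Q s' <= Q t'.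
  by move=> s'0 st; apply: AC_homo aQ s'0 st _ => x _ _; rewrite mulr_ge0 // v0.
 have Q0 : Q 0 = 0 by rewrite /Q RintI0 addr0. apply: (@le_trans _ _ (Q (3 / 4 * L) - Q (L / 4))); last first.
  have h1 := qm 0 (L / 4) (lexx 0); have h2 := qm (3 / 4 * L) L. rewrite FQ; have : Q 0 <= Q (L / 4) by apply: h1; rewrite divr_ge0.
  have : Q (3 / 4 * L) <= Q L by apply: h2; lin. lin.
 rewrite mulrBr; apply: (AC_le (AC_scale (9 * L ^+ 4 / 256) aP) aQ); [by rewrite divr_ge0|lin|].
 move=> x x1 x2; rewrite /v addr0 mulrC ler_wpM2l //; first exact: Him. have p0 : 3 * L ^+ 2 / 16 <= p x.
  by rewrite -subr_ge0 (_ : _ - _ = (x - L / 4) * (3 / 4 * L - x)); [rewrite mulr_ge0 // subr_ge0|rewrite /p; field].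
 rewrite (_ : 9 * L ^+ 4 / 256 = (3 * L ^+ 2 / 16) ^+ 2); last by field.
 have q0 : 0 <= 3 * L ^+ 2 / 16 by rewrite divr_ge0 // mulr_ge0 // sqr_ge0. by rewrite /g ler_pXn2r ?nnegrE //; exact: le_trans p0.
have c0 : 0 < 9 * L ^+ 4 / 256 by rewrite divr_gt0 // mulr_gt0 // exprn_gt0.
rewrite -(ler_pM2l c0); apply: le_trans low _; apply: le_trans FF2 _.
by apply: le_trans (ler_wpM2l (expR_ge0 2) Ft1) _; apply: eqW; field.
Qed.

End HarmonicStrip.

(** * From the weak limit to values of the spectral measure *)

Section WeakLimit.
Implicit Types (x y s t a e r : R) (K : set R).

Definition dst K x : R := inf [set `|x - k| | k in K].

Lemma dst_ge0 K x : 0 <= dst K x.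
Proof.
rewrite /dst; have [->|/set0P[k Kk]] := eqVneq K set0; first by rewrite image_set0 inf0.
by apply: lb_le_inf; [exists `|x - k|; exists k|move=> _ [k' _ <-]].
Qed.

Lemma dst_le K x k : K k -> dst K x <= `|x - k|.
Proof. by move=> Kk; apply: ge_inf; [exists 0 => _ [k' _ <-]|exists k]. Qed.

Lemma dst_lt K x e : K !=set0 -> dst K x < e -> exists2 k, K k & `|x - k| < e.
Proof.
move=> [k0 Kk0] h; have [] := @inf_adherent R [set `|x - k| | k in K] (e - dst K x).
- by rewrite subr_gt0.
- by split; [exists `|x - k0|; exists k0|exists 0 => _ [k' _ <-]].
by move=> _ [k Kk <-]; rewrite -/(dst K x) addrCA subrr addr0 => ?; exists k.
Qed.

Lemma dst_lip K x y : K !=set0 -> dst K x <= dst K y + `|x - y|.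
Proof.
move=> K0; rewrite -lerBlDr; apply: lb_le_inf.
 by have [k Kk] := K0; exists `|y - k|; exists k.
move=> _ [k Kk <-]; rewrite lerBlDr; apply: le_trans (dst_le x Kk) _.
by have := ler_normD (y - k) (x - y); rewrite (_ : y - k + (x - y) = x - k); last ring.
Qed.

Lemma dst_in K x : K x -> dst K x = 0.
Proof. by move=> Kx; apply/eqP; rewrite eq_le dst_ge0 andbT; have := dst_le x Kx; rewrite subrr normr0. Qed.

(** Equal to 1 on [K] and to 0 at distance [1 / n] or more: the compactly supported test functions
    for the weak limit. *)
Definition bump K (n : R) x : R := Num.max 0 (1 - n * dst K x).

Lemma bump_ge0 K n x : 0 <= bump K n x. Proof. by rewrite /bump le_max lexx. Qed.
Lemma bump_le1 K n x : 0 <= n -> bump K n x <= 1.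
Proof. by move=> n0; rewrite /bump ge_max ler01 lerBlDr lerDl mulr_ge0 // dst_ge0. Qed.
Lemma bump_in K n x : K x -> bump K n x = 1.
Proof. by move=> /dst_in h; rewrite /bump h mulr0 subr0 max_r. Qed.
Lemma bump_out K n x : 1 <= n * dst K x -> bump K n x = 0.
Proof. by move=> h; rewrite /bump max_l // subr_le0. Qed.

Lemma lip_continuous (f : R -> R) (L : R) : 0 <= L -> (forall x y, `|f x - f y| <= L * `|x - y|) -> continuous f.
Proof.
move=> L0 h x; apply/cvgrPdist_le => e e0.
have L1 : 0 < L + 1 by rewrite ltr_wpDl.
have : \forall t \near x, `|x - t| < e / (L + 1) by exact: (@cvgr_dist_lt _ R^o _ (nbhs x) _ id x cvg_id _ (divr_gt0 e0 L1)).
apply: filterS => t; rewrite ltr_pdivlMr // => ht; apply: le_trans (h x t) _; apply: le_trans (ltW ht).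
by rewrite mulrC ler_wpM2l // lerDl.
Qed.

Lemma bump_continuous K n : K !=set0 -> 0 <= n -> continuous (bump K n).
Proof.
move=> K0 n0; have one x y : bump K n x <= bump K n y + n * `|x - y|.
 rewrite /bump ge_max; apply/andP; split; first by rewrite addr_ge0 ?mulr_ge0 // le_max lexx.
 apply: (@le_trans _ _ (1 - n * dst K y + n * `|x - y|)); last by rewrite lerD2r le_max lexx orbT.
 have := ler_wpM2l n0 (dst_lip y x K0); rewrite (distrC y x); lin.
apply: (lip_continuous n0) => x y; rewrite ler_norml; apply/andP; split.
 by have := one y x; rewrite (distrC y x); lin.
by have := one x y; lin.
Qed.

Variables (m : C -> C) (mu : measure (measurableTypeR R) R).
Hypothesis Him : forall z, 0 < Im z -> 0 <= Im (m z).
Hypothesis Hc : forall eps, 0 < eps -> continuous (fun x : R => Im (m (Complex x eps))).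
Hypothesis Hw : forall f : R -> R, continuous f -> (exists K : R, forall x, K < `|x| -> f x = 0) ->
  (fun eps : R => (\int[leb]_x (f x * Im (m (Complex x eps)) / pi)%:E)%E) @ 0^'+ --> (\int[mu]_x (f x)%:E)%E.

Let mIm eps : 0 < eps -> measurable_fun setT (fun x : R => Im (m (Complex x eps))).
Proof. by move=> e0; apply: continuous_measurable_fun; exact: Hc. Qed.

Lemma mu_upper (f : R -> R) (B : \bar R) (e0 : R) : continuous f -> (exists K : R, forall x, K < `|x| -> f x = 0) -> 0 < e0 ->
  (forall eps, 0 < eps -> eps < e0 -> (\int[leb]_x (f x * Im (m (Complex x eps)) / pi)%:E <= B)%E) ->
  (\int[mu]_x (f x)%:E <= B)%E.
Proof.
move=> cf sf e00 H; have lim := Hw cf sf; rewrite -(cvg_lim _ lim) //.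
apply: lime_le; first exact: cvgP lim.
near=> eps; apply: H; near: eps; first exact: nbhs_right_gt.
exact: nbhs_right_lt.
Unshelve. all: by end_near. Qed.

Lemma mu_lower (f : R -> R) (B : \bar R) (e0 : R) : continuous f -> (exists K : R, forall x, K < `|x| -> f x = 0) -> 0 < e0 ->
 (forall eps, 0 < eps -> eps < e0 -> (B <= \int[leb]_x (f x * Im (m (Complex x eps)) / pi)%:E)%E) ->
 (B <= \int[mu]_x (f x)%:E)%E.
Proof.
move=> cf sf e00 H; have lim := Hw cf sf; rewrite -(cvg_lim _ lim) //.
apply: lime_ge; first exact: cvgP lim.
near=> eps; apply: H; near: eps; first exact: nbhs_right_gt.
exact: nbhs_right_lt.
Unshelve. all: by end_near. Qed.

Lemma bump_supp K n (r : R) : 0 < n -> K !=set0 -> (forall k, K k -> `|k| <= r) ->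
 exists M : R, forall x, M < `|x| -> bump K n x = 0.
Proof.
move=> n0 K0 Kr; exists (r + n^-1) => x h; apply: bump_out.
have : n^-1 <= dst K x.
 rewrite leNgt; apply/negP => /(dst_lt K0)[k Kk hk]. by have := Kr k Kk; have := ler_normD k (x - k); rewrite addrCA subrr addr0; lin.
by move=> /(ler_wpM2l (ltW n0)); rewrite mulfV // gt_eqF.
Qed.

Lemma le_mu_bump K n : measurable (K : set (measurableTypeR R)) -> K !=set0 -> 0 <= n ->
  (mu K <= \int[mu]_x (bump K n x)%:E)%E.
Proof.
move=> mK K0 n0; rewrite -[X in (mu X <= _)%E](setIT K) -integral_indic //.
apply: ge0_le_integral => //=.
- by apply/measurable_EFinP; exact: measurable_indic.
- by apply/measurable_EFinP; apply: continuous_measurable_fun; exact: bump_continuous.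
- move=> x _; rewrite lee_fin indicE; case: (boolP (x \in K)) => [|_]; last exact: bump_ge0.
 by rewrite inE => Kx; rewrite bump_in.
Qed.

(** The margin between the two intervals leaves room for the slopes of a bump that is 1 on the inner
    one. *)
Lemma mu_itv_le (c c' e' e : R) (B e0 : R) : c < c' -> c' <= e' -> e' < e -> 0 < e0 ->
  (forall eps, 0 < eps -> eps < e0 -> (\int[leb]_(x in `[c, e]%classic) (Im (m (Complex x eps)))%:E <= B%:E)%E) ->
  (mu (`[c', e']%classic : set R) <= (B / pi)%:E)%E.
Proof.
move=> cc ce' ee e00 H; pose K : set R := `[c', e']%classic.
have K0 : K !=set0 by exists c'; rewrite /K /= in_itv /= lexx ce'.
pose dd := Num.min (c' - c) (e - e'); have d0 : 0 < dd by rewrite lt_min !subr_gt0 cc ee.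
have [dc de] : dd <= c' - c /\ dd <= e - e' by split; rewrite ge_min lexx ?orbT.
have n0 : 0 < dd^-1 by rewrite invr_gt0.
apply: le_trans (le_mu_bump (n := dd^-1) _ K0 (ltW n0)) _; first exact: measurable_itv.
apply: (mu_upper _ _ e00).
- exact: bump_continuous (ltW n0).
- apply: (@bump_supp K _ (`|c'| + `|e'|)) => // k; rewrite /K /= in_itv /= => /andP[k1 k2].
 have := ler_norm c'; have := ler_norm (- c'); have := ler_norm e'; have := ler_norm (- e'); rewrite !normrN ler_norml => *.
 by apply/andP; split; have := normr_ge0 c'; have := normr_ge0 e'; lin.
- move=> eps ep0 epe.
 have out x : ~~ (c <= x <= e) -> bump K dd^-1 x = 0.
  move=> hx; apply: bump_out; rewrite ler_pdivlMl // mulr1 leNgt; apply/negP => /(dst_lt K0)[k].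
  rewrite /K /= in_itv /= => /andP[k1 k2]; rewrite ltr_norml => /andP[h1 h2]; move: hx; apply/negP; rewrite negbK.
  by apply/andP; split; lin.
 have pi0 : 0 < (pi : R) by exact: pi_gt0. apply: (@le_trans _ _ (\int[leb]_(x in `[c, e]%classic) (pi^-1 * Im (m (Complex x eps)))%:E)%E).
  rewrite [X in (_ <= X)%E]integral_mkcond; apply: ge0_le_integral => //=.
  + by move=> x _; rewrite lee_fin !mulr_ge0 ?bump_ge0 ?Him ?invr_ge0 ?(ltW pi0).
  + apply/measurable_EFinP; apply: measurable_funM; last exact: measurable_cst.
   by apply: measurable_funM; [apply: continuous_measurable_fun; exact: bump_continuous (ltW n0)|exact: mIm].
  + apply: (iffLR (measurable_restrictT _ _)); first exact: measurable_itv.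
   apply/measurable_EFinP; apply: measurable_funTS. by apply: measurable_funM; [exact: measurable_cst|exact: mIm].
  + move=> x _; rewrite patchE; case: ifPn => [_|].
    rewrite lee_fin mulrC; apply: ler_pM; rewrite ?invr_ge0 ?(ltW pi0) ?mulr_ge0 ?bump_ge0 ?Him //.
    by rewrite ler_piMl ?Him // bump_le1 // ltW.
   by rewrite notin_setE /= in_itv /= => /negP hx; rewrite out // !mul0r.
 under eq_integral do rewrite EFinM. rewrite ge0_integralZl //; last 3 first.
 + by apply/measurable_EFinP; apply: measurable_funTS; exact: mIm.
 + by move=> x _; rewrite lee_fin Him.
 + by rewrite lee_fin invr_ge0 ltW. rewrite mulrC EFinM lee_pmul2l //; first exact: H. by rewrite lte_fin invr_gt0.
Qed.

Hypothesis Hfin : forall r, (mu (`[(- r)%R, r]%classic : set R) < +oo)%E.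

(** Bumps around [K] bound from below the measure of the shrinking neighbourhoods [U n]. Their
    intersection is [K] because [K] is closed, and finiteness of [mu] on bounded sets gives
    continuity from above. *)
Lemma mu_closed_ge K (c e0 r : R) : closed K -> K !=set0 -> (forall k, K k -> `|k| <= r) -> 0 <= c -> 0 < e0 ->
  (forall eps x, 0 < eps -> eps < e0 -> K x -> c <= Im (m (Complex x eps))) ->
  ((c / pi)%:E * leb K <= mu K)%E.
Proof.
move=> cK K0 Kr c0 e00 H.
have mK : measurable (K : set (measurableTypeR R)) by exact: closed_measurable.
have pi0 : 0 < (pi : R) by exact: pi_gt0.
pose U (n : nat) : set R := [set x | bump K n.+1%:R x != 0].
have bc n : continuous (bump K n.+1%:R) by apply: bump_continuous.
have mU n : measurable (U n : set (measurableTypeR R)).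
 have -> : U n = bump K n.+1%:R @^-1` (~` [set 0]).
  by apply/seteqP; split=> x /= /eqP.
 rewrite -[X in measurable X]setTI; apply: (continuous_measurable_fun (bc n)) => //. by apply: measurableC; exact: measurable_set1.
have lowU n : ((c / pi)%:E * leb K <= mu (U n))%E.
 apply: (@le_trans _ _ (\int[mu]_x (bump K n.+1%:R x)%:E)%E); last first.
  rewrite -[X in (_ <= mu X)%E](setIT (U n)) -integral_indic //; apply: ge0_le_integral => //=.
  + by move=> x _; rewrite lee_fin bump_ge0.
  + by apply/measurable_EFinP; apply: continuous_measurable_fun; exact: bc.
  + by apply/measurable_EFinP; exact: measurable_indic.
  + move=> x _; rewrite lee_fin indicE; case: (boolP (x \in U n)) => [_|]; first by rewrite bump_le1.
   by rewrite notin_setE /U /= => /negP; rewrite negbK => /eqP ->.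
 apply: (mu_lower _ _ e00) => [||eps ep0 epe]; [exact: bc|exact: bump_supp Kr|].
 rewrite -integral_cst // [X in (X <= _)%E]integral_mkcond; apply: ge0_le_integral => //=.
 + by move=> x _; apply: erestrict_ge0 => y _; rewrite lee_fin divr_ge0 // ltW.
 + by apply: (iffLR (measurable_restrictT _ _)) => //; exact: measurable_cst.
 + apply/measurable_EFinP; apply: measurable_funM; last exact: measurable_cst.
  by apply: measurable_funM; [apply: continuous_measurable_fun; exact: bc|exact: mIm].
 + move=> x _; rewrite patchE; case: ifPn => [|_].
   by rewrite inE => Kx; rewrite lee_fin bump_in // mul1r ler_wpM2r ?invr_ge0 ?(ltW pi0) // H.
  by rewrite lee_fin !mulr_ge0 ?bump_ge0 ?Him ?invr_ge0 ?(ltW pi0).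
have KU : K = \bigcap_n U n.
 apply/seteqP; split=> x.
  by move=> Kx n _; rewrite /U /= bump_in // oner_eq0.
 move=> hx; apply: cK => B /nbhs_ballP[e /= e1 eB]. pose n := Num.truncn e^-1. have hn : e^-1 < n.+1%:R by exact: truncnS_gt.
 have : dst K x < e.
  rewrite ltNge; apply/negP => h; have := hx n I; rewrite /U /= bump_out ?eqxx //.
  apply: (@le_trans _ _ (e^-1 * e)); first by rewrite mulVf ?gt_eqF. by apply: ler_pM => //; rewrite ?invr_ge0 ltW.
 by move=> /(dst_lt K0)[k Kk hk]; exists k; split=> //; exact: eB.
have finU : (mu (U 0%N) < +oo)%E.
 apply: le_lt_trans (Hfin (r + 1)); apply: le_measure; rewrite ?inE //=.
 move=> x; rewrite /U /= => h; rewrite in_itv /= -ler_norml leNgt; apply: contra h => h.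
 apply/eqP; apply: bump_out; rewrite mul1r leNgt; apply/negP => /(dst_lt K0)[k Kk hk].
 by have := Kr k Kk; have := ler_normD k (x - k); rewrite addrCA subrr addr0; lin.
have cvgU : mu (U n) @[n --> \oo] --> mu (\bigcap_n U n).
 apply: nonincreasing_cvg_mu => //.
  by apply: bigcap_measurable.
 apply/nonincreasing_seqP => n; apply/subsetPset => x; rewrite /U /= => h; apply: contra h => /eqP h.
 have h1 : 1 - n.+1%:R * dst K x <= 0 by rewrite -h /bump le_max lexx orbT.
 apply/eqP; apply: bump_out; have := dst_ge0 K x; rewrite -[n.+2%:R]natr1; lin.
rewrite KU -(cvg_lim _ cvgU) // -KU; apply: lime_ge; first exact: cvgP cvgU.
by apply: nearW.
Qed.

End WeakLimit.

(** * Null sets of the spectral measure *)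

Section Spectral.
Implicit Types (x y s t a e r : R) (K : set R).

Lemma null_cover (B : set R) e : measurable (B : set (measurableTypeR R)) -> leb B = 0%E -> 0 < e ->
  exists a b : nat -> R, B `<=` \bigcup_k `](a k), (b k)[%classic /\
    (\sum_(0 <= k <oo) (Num.max 0 (b k - a k))%:E <= e%:E)%E.
Proof.
move=> mB B0 e0; have : ((wlength idfun)^* B)%mu = 0%E.
 by apply/negligible_outer_measure; exists B; split.
rewrite outer_measure_open_itv_cover => h.
have fin : (ereal_inf [set (\sum_(k <oo) wlength idfun (F k))%E | F in open_itv_cover B] \is a fin_num) by rewrite h.
have [_ /= [F [Fi BF] <-]] := lb_ereal_inf_adherent e0 fin; rewrite h add0e => Fe.
have [a aP] := choice Fi.
exists (fun k => (a k).1), (fun k => (a k).2); split.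
 by apply: subset_trans BF _ => x [k _]; rewrite aP; exists k.
apply: le_trans (ltW Fe); apply: lee_nneseries => // k _; first by rewrite lee_fin le_max lexx.
rewrite aP wlength_itv /= lte_fin; case: ltP => h1 /=; first by rewrite -EFinB lee_fin ge_max lexx andbT subr_ge0 ltW.
by rewrite lee_fin ge_max lexx subr_le0.
Qed.

(** A covering interval of length [len] that meets [B] at [E] lies in [[E - len, E + len]], so an
    ordinary cover of [B] of small total length suffices. *)
Lemma null_of_local (mu : measure (measurableTypeR R) R) (B : set R) (D : R) : measurable (B : set (measurableTypeR R)) ->
  leb B = 0%E -> 0 <= D -> (forall E len, B E -> 0 < len -> len <= 1 / 16 ->
    (mu (`[(E - len)%R, (E + len)%R]%classic : set R) <= (D * len)%:E)%E) -> mu B = 0%E.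
Proof.
move=> mB B0 D0 H; apply/eqP; rewrite eq_le measure_ge0 andbT.
have D1 : 0 < D + 1 by rewrite ltr_wpDl.
suff key e : 0 < e -> e <= 1 / 16 -> (mu B <= (D * e)%:E)%E.
 apply/lee_addgt0Pr => e e0; rewrite add0e. have e1 : 0 < Num.min (e / (D + 1)) (1 / 16) by rewrite lt_min divr_gt0 //= divr_gt0.
 apply: le_trans (key _ e1 _) _; first by rewrite ge_min lexx orbT.
 rewrite lee_fin; apply: (@le_trans _ _ (D * (e / (D + 1)))); first by rewrite ler_wpM2l // ge_min lexx.
 by rewrite mulrA ler_pdivrMr // mulrC ler_wpM2l ?(ltW e0) // lerDl.
move=> e0 e8; have [a [b [Bab sab]]] := null_cover mB B0 e0.
pose l k := Num.max 0 (b k - a k).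
have l0 k : 0 <= l k by rewrite le_max lexx.
have lk k : l k <= 1 / 16.
 apply: le_trans e8; rewrite -lee_fin; apply: le_trans sab.
 apply: (@le_trans _ _ (\sum_(0 <= i < k.+1) (l i)%:E)%E); last by apply: nneseries_lim_ge => i *; rewrite lee_fin.
 by rewrite big_nat_recr //= leeDr // sume_ge0 // => i _; rewrite lee_fin.
pose F k : set R := B `&` `](a k), (b k)[%classic.
have mF k : measurable (F k : set (measurableTypeR R)) by apply: measurableI => //; exact: measurable_itv.
apply: (@le_trans _ _ (\sum_(0 <= k <oo) mu (F k))%E).
 apply: measure_sigma_subadditive => // x Bx; have [k _ kx] := Bab x Bx; by exists k.
apply: (@le_trans _ _ (\sum_(0 <= k <oo) (D%:E * (l k)%:E))%E).
 apply: lee_nneseries => // k _; have [F0|/set0P[E [BE_ Eab]]] := eqVneq (F k) set0.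
  by rewrite F0 measure0 mule_ge0 ?lee_fin.
 move: Eab; rewrite /= in_itv /= => /andP[aE Eb]. have lE : l k = b k - a k by rewrite /l max_r // subr_ge0 ltW // (lt_trans aE).
 have lp : 0 < l k by rewrite lE subr_gt0 (lt_trans aE). apply: le_trans (H E (l k) BE_ lp (lk k)); apply: le_measure; rewrite ?inE //.
 by move=> x [_]; rewrite /= !in_itv /= lE => /andP[h1 h2]; apply/andP; split; lin.
rewrite nneseriesZl; last by move=> k _; rewrite lee_fin.
by rewrite EFinM lee_wpmul2l // lee_fin.
Qed.

Variables (q Kq : R -> R) (Q0 : R).
Hypotheses (Iq : LI q) (aKq : AC Kq (fun x => `|q x|)) (Q00 : 0 <= Q0)
  (uni : forall s, 0 <= s -> Kq (s + 1) - Kq s <= Q0).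
Variables (theta : R) (mu : measure (measurableTypeR R) R).
Hypothesis Hmu : spectral_measure q theta mu.

Lemma cU_mono (A B : R) : 0 <= A -> A <= B -> cU A <= cU B.
Proof.
move=> A0 AB; have h : (2 + A) ^+ 2 <= (2 + B) ^+ 2 by rewrite ler_pXn2r ?nnegrE ?addr_ge0 // ?(le_trans A0) // lerD2l.
have h0 := sqr_ge0 (2 + A); rewrite /cU lerD2r; apply: ler_pM; lin.
Qed.

(** This gathers all that is used about [m]. The bound by [B / Im z] comes from comparing
    [1 + |m|^2 <= cU * TN u] with [Im m = Im z * TN u]. *)
Lemma spectral_setup : exists m d : C -> C,
  [/\ forall z, 0 < Im z -> exists u w, nweyl q theta z (m z) u w,
      forall z, 0 < Im z -> 0 <= Im (m z),
      forall rho : R, exists B : R, forall z, nrm z <= rho -> 0 < Im z -> nrm (m z) <= B / Im z,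
      (forall z w, 0 < Im z -> 0 < Im w -> nsq (m z - m w) <= nsq (z - w) * (Im (m z) / Im z * (Im (m w) / Im w))) /\
      (forall z w, 0 < Im z -> 0 < Im w ->
        nsq (m z - m w - (z - w) * d w) <= nsq (z - w) * (Im (m w) / Im w * mdist z w (m z) (m w))) &
      forall f : R -> R, continuous f -> (exists K : R, forall x, K < `|x| -> f x = 0) ->
      (fun eps : R => (\int[leb]_x (f x * Im (m (Complex x eps)) / pi)%:E)%E) @ 0^'+ --> (\int[mu]_x (f x)%:E)%E].
Proof.
have ex z : exists mz, 0 < Im z -> m_value q theta z mz.
 have [z0|] := ltP 0 (Im z); last by exists 0. by have [mz h] := m_value_exists Iq aKq Q00 uni theta z0; exists mz.
have [m mP] := choice ex.
have nw z : 0 < Im z -> exists u w, nweyl q theta z (m z) u w.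
 by move=> z0; apply: (m_value_nweyl Iq aKq Q00 uni z0); exact: mP.
have [d dP] := m_struct Iq aKq Q00 uni nw.
have him z : 0 < Im z -> 0 <= Im (m z) by move=> z0; have [] := dP z z z0 z0.
exists m, d; split => //.
- move=> rho; exists (cU (Q0 + `|rho|)) => z zr z0; have [u [w nz]] := nw z z0.
 have h1 := nweyl_low Iq aKq Q00 uni nz; have h2 := nweyl_Im Iq aKq Q00 uni nz.
 have [[su Lu] _ _] := nz; have T0 := TN_ge0 (CAC_CLB (proj1 su)) Lu. have h3 : cU (Q0 + nrm z) <= cU (Q0 + `|rho|).
  by apply: cU_mono; [rewrite addr_ge0 // nrm_ge0|rewrite lerD2l; apply: le_trans zr (ler_norm _)].
 have h4 : nsq (m z) * Im z <= cU (Q0 + `|rho|) * nrm (m z).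
  have h5 : nsq (m z) <= cU (Q0 + `|rho|) * TN u.
   by apply: le_trans (_ : 1 + nsq (m z) <= _); [rewrite lerDr|apply: le_trans h1 _; rewrite ler_wpM2r].
  apply: le_trans (ler_wpM2r (ltW z0) h5) _; rewrite -mulrA ler_wpM2l ?(ltW (cU_gt0 _)) // mulrC -h2.
  by apply: le_trans (ler_norm _) (Im_le _).
 rewrite ler_pdivlMr //; have [->|m0] := eqVneq (nrm (m z)) 0; first by rewrite mul0r ltW // cU_gt0.
 have mp : 0 < nrm (m z) by rewrite lt_neqAle nrm_ge0 andbT eq_sym. by rewrite -(ler_pM2r mp) mulrAC -expr2 nrmE.
- by split=> z w z0 w0; have [] := dP z w z0 w0.
- exact: Hmu.
Qed.

Lemma m_line_cont (m d : C -> C) : (forall z, 0 < Im z -> 0 <= Im (m z)) ->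
  (forall rho : R, exists B : R, forall z, nrm z <= rho -> 0 < Im z -> nrm (m z) <= B / Im z) ->
  (forall z w, 0 < Im z -> 0 < Im w -> nsq (m z - m w) <= nsq (z - w) * (Im (m z) / Im z * (Im (m w) / Im w))) ->
  (forall z w, 0 < Im z -> 0 < Im w ->
        nsq (m z - m w - (z - w) * d w) <= nsq (z - w) * (Im (m w) / Im w * mdist z w (m z) (m w))) ->
  forall eps, 0 < eps -> continuous (fun x : R => Im (m (Complex x eps))).
Proof.
move=> him hbd hlip hd eps; move=> e0 x; apply/cvgrPdist_le => e ep.
have [K K0 HK] := m_hol him hbd hlip hd (`|x| + 1 + eps) e0.
have d0 : 0 < Num.min 1 (e / K) by rewrite lt_min ltr01 divr_gt0.
have : \forall t \near x, `|x - t| < Num.min 1 (e / K) by exact: (@cvgr_dist_lt _ R^o _ (nbhs x) _ id x cvg_id _ d0).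
apply: filterS => t; rewrite lt_min => /andP[t1 t2].
have n1 : nrm (Complex x eps) <= `|x| + 1 + eps.
 by apply: le_trans (nrm_ReIm _) _ => /=; rewrite (ger0_norm (ltW e0)) lerD2r lerDl.
have n2 : nrm (Complex t eps) <= `|x| + 1 + eps.
 apply: le_trans (nrm_ReIm _) _ => /=; rewrite (ger0_norm (ltW e0)) lerD2r.
 by have := ler_normD x (t - x); rewrite addrCA subrr addr0 (distrC t); lin.
have [_ h _] := HK _ _ n1 n2 (lexx _) (lexx _).
have -> : Im (m (Complex x eps)) - Im (m (Complex t eps)) = Im (m (Complex x eps) - m (Complex t eps)) by rewrite !CE.
apply: le_trans (Im_le _) _; apply: le_trans h _; rewrite mulrC -ler_pdivlMr //.
apply: le_trans (ltW t2); have -> : Complex x eps - Complex t eps = (x - t)%:C%C.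
 by change (Complex (x - t) (eps - eps) = Complex (x - t) 0); rewrite subrr.
by rewrite nrmC.
Qed.

(** In the cone [|z - E| <= 5 Im z], [BE_m] becomes [1 + |m|^2 <= c Im m], which bounds [Im m] both
    above by [c] and below by [1 / c]. The upper bound reaches [mu] through [strip_bound], the lower
    one through [mu_closed_ge]. *)
Lemma mu_local_bound : (forall r, (mu (`[(- r)%R, r]%classic : set R) < +oo)%E) /\
  (forall M rho : R, 0 <= M -> exists2 D : R, 0 <= D & forall E len, `|E| <= rho -> BE q E M -> 0 < len -> len <= 1 / 8 ->
     (mu (`[(E - len)%R, (E + len)%R]%classic : set R) <= (D * len)%:E)%E) /\
  (forall (M rho : R) K, 0 <= M -> closed K -> K !=set0 -> (forall k, K k -> `|k| <= rho) ->
     K `<=` closure [set E | BE q E M /\ `|E| <= rho] -> exists2 c : R, 0 < c & (c%:E * leb K <= mu K)%E).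
Proof.
have [m [d [nw him hbd [hlip hd] hw]]] := spectral_setup.
have hc := m_line_cont him hbd hlip hd.
have strip a L B : 0 < L -> (forall xi, 0 <= xi -> xi <= L -> Im (m (zp a xi (L / 8))) <= B) ->
  (mu (`[(a + 3 / 8 * L)%R, (a + 5 / 8 * L)%R]%classic : set R) <= (16 / 9 * expR 2 * B * L / pi)%:E)%E.
 move=> L0 hB; apply: (@mu_itv_le m mu him hc hw (a + L / 4) _ _ (a + 3 / 4 * L) _ (L / 8)); [lin|lin|lin|lin|].
 move=> eps e0 e8; have [_ ax] := m_ACx him hbd hlip hd a e0. have aP := AC_prim 0 (AC_LI ax); set P := (fun x => 0 + _) in aP.
 have h := strip_bound him hbd hlip hd L0 e0 (ltW e8) hB aP. have q0 : 0 <= L / 4 by lin. have q1 : L / 4 <= 3 / 4 * L by lin.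
 rewrite (@integral_shift a); last first.
  by apply/measurable_EFinP; apply: measurable_funTS; apply: continuous_measurable_fun; exact: hc.
 rewrite !(addrC a) !addrK. rewrite (_ : (\int[leb]_(x in _) _ = (P (3 / 4 * L) - P (L / 4))%:E)%E) ?lee_fin //.
 rewrite (AC_itv aP q0 q1) /Rint fineK; last exact: integrable_fin_num (LI_sub_itv _ (AC_LI ax) q0).
 by apply: eq_integral => x _; rewrite /zp [a + x]addrC.
have fin r : (mu (`[(- r)%R, r]%classic : set R) < +oo)%E.
 (* The middle quarter of [[- L / 2, L / 2]] is [[- (|r| + 1), |r| + 1]]. *)
 pose L := 8 * (`|r| + 1); have L0 : 0 < L by rewrite mulr_gt0 // ltr_wpDl. have [rho Hr] := zp_bound (- (L / 2)) L (L / 8).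
 have [K K0 HK] := m_hol him hbd hlip hd rho (divr_gt0 L0 (ltr0n R 8)).
 have h : forall xi, 0 <= xi -> xi <= L -> Im (m (zp (- (L / 2)) xi (L / 8))) <= K.
  move=> xi x0 xL; have n : nrm (zp (- (L / 2)) xi (L / 8)) <= rho by apply: Hr => //; lin.
  by have [h _ _] := HK _ _ n n (lexx _) (lexx _); apply: le_trans h; apply: le_trans (Im_le _); exact: ler_norm.
 apply: (@le_lt_trans _ _ (16 / 9 * expR 2 * K * L / pi)%:E); last exact: ltry.
 apply: le_trans (strip _ _ _ L0 h); apply: le_measure; rewrite ?inE; try exact: measurable_itv.
 move=> x; rewrite /= !in_itv /= => /andP[h1 h2]; have := ler_norm r; have : 0 <= `|r| by [].
 by rewrite /L => h3 h4; apply/andP; split; lin.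
split=> //.
have cone E M z B : 0 <= M -> BE q E M -> 0 < Im z -> 0 < nrm (z - E%:C%C) -> nrm (z - E%:C%C) <= 1 -> nrm (z - E%:C%C) <= 5 * Im z -> nrm z <= B ->
  1 + nsq (m z) <= 40 * M * (cU (Q0 + B) + 1) * Im (m z).
 move=> M0 bE z0 d0 d1 d5 zB; have [u [w nz]] := nw z z0.
 have h := BE_m Iq aKq Q00 uni M0 bE nz d0 d1; have h2 := nweyl_Im Iq aKq Q00 uni nz.
 have [[su Lu] _ _] := nz; have T0 := TN_ge0 (CAC_CLB (proj1 su)) Lu.
 apply: le_trans h _; have c1 : cU (Q0 + nrm z) <= cU (Q0 + B) by apply: cU_mono; [rewrite addr_ge0 // nrm_ge0|rewrite lerD2l].
 have c0 := cU_gt0 (Q0 + nrm z). have h3 : nrm (z - E%:C%C) * TN u <= 5 * Im (m z).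
  by rewrite h2 mulrA ler_wpM2r.
 apply: (@le_trans _ _ (8 * M * (cU (Q0 + B) + 1) * (5 * Im (m z)))); last by apply: eqW; ring.
 apply: ler_pM => //; rewrite ?mulr_ge0 ?nrm_ge0 //; first by rewrite addr_ge0 // ltW. by rewrite ler_wpM2l ?mulr_ge0 // lerD2r.
split.
- move=> M rho M0; pose c := 40 * M * (cU (Q0 + (rho + 2)) + 1).
 have c0 : 0 <= c by rewrite !mulr_ge0 // addr_ge0 // ltW // cU_gt0. pose D := 16 / 9 * expR 2 * c * 8 / pi.
 have pi0 : 0 < (pi : R) by exact: pi_gt0.
 have e0 := expR_ge0 (2 : R); exists D; first by rewrite /D divr_ge0 ?(ltW pi0) // -/c; clearbody c; nra.
 (* The segment of width [8 * len] centred at [E] is used at height [len]: its points lie at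
    distance at most [4 * len + len] from [E], which is the origin of the factor 5 in [cone]. *)
 move=> E len Er bE l0 l8; pose L := 8 * len; have L0 : 0 < L by rewrite mulr_gt0.
 have h : forall xi, 0 <= xi -> xi <= L -> Im (m (zp (E - L / 2) xi (L / 8))) <= c.
  move=> xi x0 xL; set z := zp _ _ _. have e1 : z - E%:C%C = Complex (xi - L / 2) len.
   rewrite /z /zp (_ : L / 8 = len); last by rewrite /L; field.
   by change (Complex ((E - L / 2 + xi) - E) (len - 0) = Complex (xi - L / 2) len); congr Complex; ring.
  have iz : Im z = len by rewrite /z Im_zp /L; field. have n1 : nrm (z - E%:C%C) <= 5 * len.
   rewrite e1; apply: le_trans (nrm_ReIm _) _ => /=; rewrite (ger0_norm (ltW l0)).
   have : `|xi - L / 2| <= 4 * len by rewrite ler_norml; apply/andP; split; move: xL; rewrite /L; lin. lin.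
  have n2 : nrm (z - E%:C%C) <= 1 by lin.
  have n0 : 0 < nrm (z - E%:C%C) by apply: lt_le_trans l0 _; rewrite e1; apply: le_trans (Im_le _); rewrite /= ler_norm.
  have n3 : nrm z <= rho + 2.
   by rewrite -(subrK E%:C%C z); apply: le_trans (nrmD _ _) _; rewrite nrmC; lin.
  have z0 : 0 < Im z by rewrite iz. have := cone E M z (rho + 2) M0 bE z0 n0 n2; rewrite iz => /(_ n1 n3) hh.
  have i0 := him z z0; rewrite leNgt; apply/negP => hc'. have h1 : Im (m z) ^+ 2 <= nsq (m z) by rewrite /nsq lerDr sqr_ge0.
  have h2 : Im (m z) ^+ 2 <= c * Im (m z) by rewrite -/c in hh; lin.
  by have := ltr_pM2r (le_lt_trans c0 hc') c (Im (m z)); rewrite hc' -expr2 ltNge h2.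
 apply: le_trans (le_trans _ (strip _ _ _ L0 h)) _; last first.
  by rewrite lee_fin /D /L; apply: eqW; ring.
 apply: le_measure; rewrite ?inE; try exact: measurable_itv. by move=> x; rewrite /= !in_itv /= /L => /andP[h1 h2]; apply/andP; split; lin.
- move=> M rho K M0 cK K0 Kr KA; pose c := 40 * (M + 1) * (cU (Q0 + (rho + 1)) + 1).
 have c0 : 0 < c by rewrite !mulr_gt0 // ?ltr_wpDl // ltW // cU_gt0. have pi0 : 0 < (pi : R) by exact: pi_gt0.
 have low E eps : BE q E M -> `|E| <= rho -> 0 < eps -> eps < 1 -> c^-1 <= Im (m (Complex E eps)).
  move=> bE Er e0 e1; set z := Complex E eps. have dd : z - E%:C%C = eps%:C%C * 'i%C.
   by change (Complex (E - E) (eps - 0) = Complex (eps * 0 - 0 * 1) (eps * 1 + 0 * 0)); congr Complex; ring.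
  have nd : nrm (z - E%:C%C) = eps by rewrite dd nrmM nrmi mulr1 nrmC ger0_norm // ltW.
  have zB : nrm z <= rho + 1 by apply: le_trans (nrm_ReIm _) _ => /=; rewrite (ger0_norm (ltW e0)); lin.
  have := cone E M z (rho + 1) M0 bE; rewrite nd => /(_ e0 e0 (ltW e1)) h.
  have h1 : 1 + nsq (m z) <= 40 * M * (cU (Q0 + (rho + 1)) + 1) * Im (m z) by apply: h => //=; lin.
  have i0 := him z e0; have n0 := nsq_ge0 (m z). rewrite -(ler_pM2l c0) mulfV ?gt_eqF //.
  have : 0 <= 40 * (cU (Q0 + (rho + 1)) + 1) * Im (m z) by rewrite !mulr_ge0 // addr_ge0 // ltW // cU_gt0. rewrite /c; lin.
 exists (c^-1 / pi); first by rewrite divr_gt0 // invr_gt0.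
 apply: (@mu_closed_ge m mu him hc hw fin K c^-1 1 rho) => //; first by rewrite invr_ge0 ltW.
 move=> eps x e0 e1 Kx; rewrite leNgt; apply/negP => hlt.
 have := hc eps e0 x; move=> /cvgrPdist_lt/(_ (c^-1 - Im (m (Complex x eps)))); rewrite subr_gt0 => /(_ hlt) hn.
 have [E [[bE Er] /= hE]] := KA x Kx _ hn. by have := low E eps bE Er e0 e1; move: hE; rewrite ltr_norml => /andP[h1 h2]; lin.
Qed.

(** The energies with constant [n] form a set [A n] about whose measurability nothing is known; both
    local bounds pass to the closed sets [G n], which still cover [B]. *)
Lemma mu_leb_null (B : set R) : measurable (B : set (measurableTypeR R)) -> (forall E, B E -> exists n : nat, BE q E n%:R) ->
  (mu B = 0%E <-> leb B = 0%E).
Proof.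
have [fin [up low]] := mu_local_bound.
move=> mB BB; pose G (n : nat) : set R := closure [set E | BE q E n%:R /\ `|E| <= n%:R] `&` `[(- n%:R)%R, n%:R]%classic.
have cG n : closed (G n) by apply: closedI; [exact: closed_closure|exact: itv_closed].
have mG n : measurable (G n : set (measurableTypeR R)) by exact: closed_measurable.
have BE_mono E M N : M <= N -> BE q E M -> BE q E N.
 move=> MN [p [c [wp [wc [h1 h2 h3 h4 h5]]]]]; exists p, c, wp, wc; split=> // x x0.
 by have [a b] := h5 x x0; split; [exact: le_trans a MN|exact: le_trans b MN].
pose A (n : nat) : set R := [set E | BE q E n%:R /\ `|E| <= n%:R].
have BA E : B E -> exists n, A n E.
 move=> /BB[n hn]; exists (maxn n (Num.truncn `|E|).+1); split.
  by apply: BE_mono hn; rewrite ler_nat leq_maxl.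
 by apply: le_trans (ltW (truncnS_gt _)) _; rewrite ler_nat leq_maxr.
have AG n : A n `<=` G n.
 move=> E hE; split; first exact: subset_closure. by rewrite /= in_itv /= -ler_norml; case: hE.
split=> [muB|lebB].
(* If the part had positive Lebesgue measure, inner regularity would give a compact subset of
   positive measure, and the lower bound would make [mu] charge it. *)
- have part n : leb (B `&` G n) = 0%E.
  apply/eqP; rewrite -measure_le0 leNgt; apply/negP => h. have mBG : measurable (B `&` G n : set (measurableTypeR R)) by exact: measurableI.
  have fBG : (leb (B `&` G n) < +oo)%E.
   apply: le_lt_trans (_ : leb (`[(- n%:R)%R, n%:R]%classic : set R) < +oo)%E.
    by apply: le_measure; rewrite ?inE // => x [_ []].
   by rewrite lebesgue_measure_itv /=; case: ifP => _; rewrite ?ltry.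
  have fn : leb (B `&` G n) \is a fin_num by rewrite ge0_fin_numE. have f0 : 0 < fine (leb (B `&` G n)) by rewrite fine_gt0 // h.
  have [V [cV VB lV]] := lebesgue_regularity_inner mBG fBG f0.
  have mV : measurable (V : set (measurableTypeR R)) by apply: closed_measurable; apply: compact_closed => //; exact: Rhausdorff.
  have V0 : V !=set0.
   apply/set0P/negP => /eqP V0; move: lV; rewrite V0 setD0 fineK // ltxx //.
  have lebV : (0 < leb V)%E.
   rewrite lt0e measure_ge0 andbT; apply/negP => /eqP V00. move: lV; rewrite measureD // (setIidr VB).
   by rewrite [X in (_ - X)%E]V00 sube0 fineK // ltxx.
  have [||c c0] := low n%:R n%:R V (ler0n _ _) (compact_closed (@Rhausdorff R) cV) V0.
   by move=> k /VB[_ [_]]; rewrite /= in_itv /= -ler_norml. by move=> x /VB[_ []].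
  have -> : mu V = 0%E.
   by apply/eqP; rewrite -measure_le0 -muB; apply: le_measure; rewrite ?inE // => x /VB[].
  by rewrite leNgt mule_gt0.
 apply/eqP; rewrite -measure_le0. apply: (@le_trans _ _ (\sum_(0 <= n <oo) leb (B `&` G n))%E).
  apply: measure_sigma_subadditive => //; first by move=> n; exact: measurableI.
  by move=> E BE_; have [n hn] := BA E BE_; exists n => //; split=> //; exact: AG.
 by rewrite eseries0.
- have part n : mu (B `&` G n) = 0%E.
  have [D D0 HD] := up n%:R n%:R (ler0n _ _).
  (* A point of [G n] has a point of [A n] within [len]; doubling the radius transfers the linear
     bound. *)
  have HG E len : G n E -> 0 < len -> len <= 1 / 16 -> (mu (`[(E - len)%R, (E + len)%R]%classic : set R) <= (D * (2 * len))%:E)%E.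
   move=> [clE _] l0 l16; have [E' [[bE Er] /= hE]] := clE _ (nbhsx_ballx E len l0). have l2 : 2 * len <= 1 / 8 by lin.
   apply: le_trans (HD E' (2 * len) Er bE (mulr_gt0 (ltr0n R 2) l0) l2). apply: le_measure; rewrite ?inE; try exact: measurable_itv.
   move: hE; rewrite /ball /= ltr_norml => /andP[a1 a2] x; rewrite /= !in_itv /= => /andP[b1 b2]. by apply/andP; split; lin.
  apply: (@null_of_local mu _ (2 * D)); rewrite ?mulr_ge0 //; first exact: measurableI.
   by apply/eqP; rewrite -measure_le0 -lebB; apply: le_measure; rewrite ?inE //; exact: measurableI.
  move=> E len [_ GE] l0 l8; rewrite (_ : 2 * D * len = D * (2 * len)); last by ring. exact: HG.
 apply/eqP; rewrite -measure_le0. apply: (@le_trans _ _ (\sum_(0 <= n <oo) mu (B `&` G n))%E).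
  apply: measure_sigma_subadditive => //; first by move=> n; exact: measurableI.
  by move=> E BE_; have [n hn] := BA E BE_; exists n => //; split=> //; exact: AG.
 by rewrite eseries0.
Qed.

End Spectral.

(** * Hausdorff null sets and dimension *)

Section Hausdorff.
Implicit Types (x y s d e r : R) (A B Z J : set R).

(** Intervals of length 0 are allowed and cost nothing when [s > 0], so finite covers can be
    padded. *)
Definition hcov s e d A := exists a l : nat -> R,
  [/\ A `<=` \bigcup_k `[(a k)%R, (a k + l k)%R]%classic, forall k, 0 <= l k /\ l k <= d &
      forall N, \sum_(k < N) l k `^ s <= e].

Definition hnull s A := forall e d, 0 < e -> 0 < d -> hcov s e d A.

Lemma hcov_le s e e' d d' A B : e <= e' -> d <= d' -> A `<=` B -> hcov s e d B -> hcov s e' d' A.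
Proof.
move=> ee dd AB [a [l [h1 h2 h3]]]; exists a, l; split; first exact: subset_trans h1.
 by move=> k; have [? ?] := h2 k; split=> //; apply: le_trans dd.
by move=> N; apply: le_trans ee.
Qed.

Lemma hnull_sub s A B : A `<=` B -> hnull s B -> hnull s A.
Proof. by move=> AB hB e d e0 d0; apply: hcov_le (hB e d e0 d0). Qed.

Lemma sum_sub_seq (T : eqType) (u v : seq T) (f : T -> R) : uniq u -> {subset u <= v} -> (forall z : T, 0 <= f z) ->
  \sum_(z <- u) f z <= \sum_(z <- v) f z.
Proof.
move=> + + f0; elim: u v => [|x u IH] v /=; first by rewrite big_nil sumr_ge0.
move=> /andP[xu uu] sv; have xv : x \in v by apply: sv; rewrite mem_head.
rewrite big_cons (big_rem x xv) /= lerD2l; apply: IH => // y yu.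
have yv : y \in v by apply: sv; rewrite inE yu orbT.
by move: yv; rewrite (perm_mem (perm_to_rem xv)) inE => /orP[/eqP yx|//]; rewrite -yx yu in xu.
Qed.

(** The double family of intervals is enumerated by [pickle]; numbers that code no pair give the
    degenerate interval at 0. *)
Lemma hcov_bigcup s e d (eps : nat -> R) (A : nat -> set R) : 0 < s -> 0 <= d -> (forall n, hcov s (eps n) d (A n)) ->
  (forall N, \sum_(n < N) eps n <= e) -> hcov s e d (\bigcup_n A n).
Proof.
move=> s0 d0 H He; have [a Ha] := choice H; have [l Hl] := choice Ha.
pose g (T : Type) (F : nat -> nat -> T) (x0_ : T) (j : nat) := if @pickle_inv (nat * nat)%type j is Some p then F p.1 p.2 else x0_.
exists (g R a 0), (g R l 0); split.
- move=> x [n _ Anx]; have [h _ _] := Hl n; have [k _ hk] := h x Anx.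
 by exists (pickle (n, k)) => //; rewrite /g pickleK_inv.
- by move=> j; rewrite /g; case: pickle_inv => [[n k]|] /=; [have [_ h _] := Hl n|].
- move=> N; pose u := pmap (@pickle_inv (nat * nat)%type) (iota 0 N).
 pose w (p : nat * nat) := l p.1 p.2 `^ s. have w0 p : 0 <= w p by exact: powR_ge0.
 have -> : \sum_(j < N) g R l 0 j `^ s = \sum_(p <- u) w p.
  rewrite -(big_mkord predT (fun j => g R l 0 j `^ s)) /index_iota subn0 /u. elim: (iota 0 N) => [|j r IH] /=; first by rewrite !big_nil.
  rewrite big_cons IH /g /oapp; case: pickle_inv => [p|] /=; first by rewrite big_cons. by rewrite powR0 ?gt_eqF // add0r.
 have uu : uniq u.
  by apply: pmap_uniq (iota_uniq _ _); exact: pickle_invK.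
 have [M HM] : exists M : nat, {subset u <= [seq (n, k) | n <- iota 0 M, k <- iota 0 M]}.
  elim: u {uu} => [|p r [M IH]]; first by exists 0%N. exists (maxn M (maxn p.1.+1 p.2.+1)) => x; rewrite inE => /orP[/eqP->|/IH].
   by apply/allpairsP; exists p; split; rewrite ?mem_iota /= ?add0n; [lia|lia|case: p].
  move=> /allpairsP[y [h1 h2 ->]]; apply/allpairsP; exists y; split=> //; move: h1 h2; rewrite !mem_iota; lia.
 apply: le_trans (sum_sub_seq uu HM w0) _; apply: le_trans (He M).
 rewrite big_allpairs -(big_mkord predT eps) /index_iota subn0; apply: ler_sum => n _.
 by have [_ _ h] := Hl n; rewrite -{1}(subn0 M) -/(index_iota 0 M) big_mkord.
Qed.

Lemma sum_half_pow N : \sum_(n < N) (2^-1 : R) ^+ n.+1 <= 1.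
Proof.
suff -> : \sum_(n < N) (2^-1 : R) ^+ n.+1 = 1 - 2^-1 ^+ N by rewrite gerBl exprn_ge0.
elim: N => [|N IH]; first by rewrite big_ord0 expr0 subrr.
by rewrite big_ord_recr /= IH exprS; field.
Qed.

Lemma hnull_bigcup s (A : nat -> set R) : 0 < s -> (forall n, hnull s (A n)) -> hnull s (\bigcup_n A n).
Proof.
move=> s0 H e d e0 d0; apply: (@hcov_bigcup s e d (fun n => e * 2^-1 ^+ n.+1)) => //; first exact: ltW.
 by move=> n; apply: H => //; rewrite mulr_gt0 // exprn_gt0.
by move=> N; rewrite -mulr_sumr ler_piMr ?(ltW e0) // sum_half_pow.
Qed.

Lemma hnull0 s : 0 < s -> hnull s set0.
Proof.
move=> s0 e d e0 d0; exists (fun=> 0), (fun=> 0); split => //; first by move=> k; split=> //; exact: ltW.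
by move=> N; rewrite powR0 ?gt_eqF // big1 // ltW.
Qed.

Lemma hnullU s A B : 0 < s -> hnull s A -> hnull s B -> hnull s (A `|` B).
Proof.
move=> s0 hA hB; apply: (@hnull_sub s _ (\bigcup_n (if n is 0%N then A else if n is 1%N then B else set0))).
 by move=> x [Ax|Bx]; [exists 0%N|exists 1%N].
by apply: hnull_bigcup => // -[|[|n]] //; exact: hnull0.
Qed.

Lemma hnull_point s x : 0 < s -> hnull s [set x].
Proof.
move=> s0 e d e0 d0; exists (fun=> x), (fun=> 0); split.
- by move=> y ->; exists 0%N => //=; rewrite in_itv /= addr0 lexx.
- by move=> k; split=> //; exact: ltW.
- by move=> N; rewrite powR0 ?gt_eqF // big1 // ltW.
Qed.

(** A Lindelof argument: the rational intervals on which [A] is null are countably many and cover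
    [A]. *)
Lemma hnull_local s A : 0 < s -> (forall x, A x -> exists2 d, 0 < d & hnull s (A `&` oitv x d)) -> hnull s A.
Proof.
move=> s0 H; pose I (j : nat) : set R := if @unpickle (rat * rat)%type j is Some p then `](ratr p.1), (ratr p.2)[%classic else set0.
pose B j : set R := [set x | A x /\ I j x /\ hnull s (A `&` I j)].
apply: (@hnull_sub s _ (\bigcup_j B j)).
 move=> x Ax; have [d d0 hd] := H x Ax. have h1 : x - d < x by rewrite ltrBlDr ltrDl. have h2 : x < x + d by rewrite ltrDl.
 have [a] := rat_in_itvoo h1; have [b] := rat_in_itvoo h2; rewrite !in_itv /= => /andP[b1 b2] /andP[a1 a2].
 have e : I (pickle (a, b)) = `](ratr a), (ratr b)[%classic by rewrite /I pickleK.
 move: (pickle (a, b)) e => j e; exists j => //; split=> //; rewrite e; split; first by rewrite /= in_itv /= a2 b1.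
 apply: hnull_sub hd => y [Ay]; rewrite /= !in_itv /= => /andP[? ?]; split=> //=. by rewrite (lt_trans a1) // (lt_trans _ b2).
apply: hnull_bigcup => // j; have [h|h] := pselect (hnull s (A `&` I j)).
 by apply: hnull_sub h => x [? []].
by apply: (@hnull_sub _ _ set0); [move=> x [_ [_ /h]]|exact: hnull0].
Qed.

Lemma diam_itv (x l : R) : 0 <= l -> (diam `[x, (x + l)%R]%classic <= l%:E)%E.
Proof.
move=> l0; apply: ge_ereal_sup => _ [y + [z + <-]]; rewrite /= !in_itv /= => /andP[? ?] /andP[? ?].
by rewrite lee_fin ler_norml; apply/andP; split; lin.
Qed.

Lemma diam_pow_itv s (x l : R) : 0 <= s -> 0 <= l -> (diam_pow s `[x, (x + l)%R]%classic <= (l `^ s)%:E)%E.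
Proof.
move=> s0 l0; rewrite /diam_pow; case: asboolP => h; first by rewrite lee_fin powR_ge0.
have := diam_itv x l0.
have : (0%E <= diam `[x, (x + l)%R]%classic)%E.
 apply: ereal_sup_ubound; exists x; first by rewrite /= in_itv /= lexx lerDl.
 by exists x; rewrite /= ?in_itv /= ?lexx ?lerDl // subrr normr0.
case: diam => [r| |] //; rewrite !lee_fin => r0 rl.
by apply: ge0_ler_powR => //; rewrite nnegrE.
Qed.

Lemma diam_pow_ge0 s A : (0 <= diam_pow s A)%E.
Proof. by rewrite /diam_pow; case: ifP => // _; case: diam => [r||] //; rewrite lee_fin powR_ge0. Qed.

Lemma hnull_hmeasure s A : 0 < s -> hnull s A -> hmeasure s A = 0%E.
Proof.
move=> s0 hA; have h0 d : 0 < d -> hcontent s d A = 0%E.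
 move=> d0; apply/eqP; rewrite eq_le; apply/andP; split; last first.
  by apply: le_ereal_inf_tmp => _ [F _ <-]; apply: nneseries_ge0 => n *; exact: diam_pow_ge0.
 apply/lee_addgt0Pr => e e0; rewrite add0e. have [a [l [h1 h2 h3]]] := hA e d e0 d0.
 apply: (@le_trans _ _ (\sum_(0 <= n <oo) diam_pow s `[(a n)%R, (a n + l n)%R]%classic)%E).
  apply: ereal_inf_lbound; exists (fun n => `[(a n)%R, (a n + l n)%R]%classic) => //; split=> // n.
  by have [? ?] := h2 n; apply: le_trans (diam_itv _ _) _; rewrite ?lee_fin.
 apply: lime_le; first by apply: is_cvg_nneseries => n *; exact: diam_pow_ge0.
 near=> N; rewrite big_mkord; apply: (@le_trans _ _ (\sum_(k < N) l k `^ s)%:E); last by rewrite lee_fin.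
 by rewrite -sumEFin; apply: lee_sum => k _; apply: diam_pow_itv; [exact: ltW|have [] := h2 k].
rewrite /hmeasure (_ : [set _ | _ in _] = [set 0%E]) ?ereal_sup1 //.
apply/seteqP; split => [_ [d + <-]|_ ->]; first by rewrite /= in_itv /= andbT => /h0.
by exists 1; rewrite /= ?in_itv /= ?ltr01 // h0.
Unshelve. all: by end_near. Qed.

Lemma hdim_le (sigma : R) A : 0 <= sigma -> sigma < 1 -> (forall s, sigma < s -> s <= 1 -> hnull s A) -> (hdim A <= sigma%:E)%E.
Proof.
move=> g0 g1 H; apply/lee_addgt0Pr => e e0.
pose s := Num.min 1 (sigma + e); have sg : sigma < s by rewrite lt_min g1 ltrDl.
have s0 : 0 < s by apply: le_lt_trans g0 sg.
apply: (@le_trans _ _ s%:E); last by rewrite -EFinD lee_fin ge_min lexx orbT.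
apply: ereal_inf_lbound; exists s => //; split; first exact: ltW.
by apply: hnull_hmeasure => //; apply: H => //; rewrite ge_min lexx.
Qed.

Lemma hnull_leb A : hnull 1 A -> exists Z, [/\ measurable (Z : set (measurableTypeR R)), A `<=` Z & leb Z = 0%E].
Proof.
move=> hA; have hh (n : nat) : exists Z, [/\ measurable (Z : set (measurableTypeR R)), A `<=` Z & (leb Z <= (n.+1%:R^-1)%:E)%E].
 have [a [l [h1 h2 h3]]] := hA n.+1%:R^-1 1 ltac:(by rewrite invr_gt0) ltr01.
 exists (\bigcup_k `[(a k)%R, (a k + l k)%R]%classic); split=> //; first by apply: bigcupT_measurable => k; exact: measurable_itv.
 apply: (@le_trans _ _ (\sum_(0 <= k <oo) leb (`[(a k)%R, (a k + l k)%R]%classic : set R))%E).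
  by apply: measure_sigma_subadditive; [move=> k; exact: measurable_itv|apply: bigcupT_measurable => k; exact: measurable_itv|].
 apply: lime_le; first by apply: is_cvg_nneseries.
 near=> N; rewrite big_mkord; apply: (@le_trans _ _ (\sum_(k < N) l k `^ 1)%:E); last by rewrite lee_fin.
 rewrite -sumEFin; apply: lee_sum => k _; have [l0 _] := h2 k. rewrite leb_cc ?lerDl // powRr1 // lee_fin; lin.
have [Z HZ] := choice hh; exists (\bigcap_n Z n); split.
- by apply: bigcapT_measurable => n; have [] := HZ n.
- by move=> x Ax n _; have [_ h _] := HZ n; apply: h.
- apply/eqP; rewrite -measure_le0; apply/lee_addgt0Pr => e e0; rewrite add0e.
 have [mZ _ lZ] := HZ (Num.truncn e^-1). apply: le_trans (_ : leb (Z (Num.truncn e^-1)) <= _)%E.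
  apply: le_measure; rewrite ?inE //; last exact: bigcap_inf. by apply: bigcapT_measurable => n; have [] := HZ n.
 apply: le_trans lZ _; rewrite lee_fin -[leRHS]invrK lef_pV2 ?posrE ?invr_gt0 // ltW //; exact: truncnS_gt.
Unshelve. all: by end_near. Qed.

Lemma uniq_span (h : seq nat) (n : nat) : uniq h -> (forall i j, i \in h -> j \in h -> (i <= j + n)%N) -> (size h <= n.+1)%N.
Proof.
case: h => // x0_ r; set h := _ :: r => uh H.
have ex : exists k, k \in h by exists x0_; rewrite mem_head.
case: (ex_minnP ex) => m mh mm; rewrite -(size_iota m n.+1); apply: uniq_leq_size => // k kh.
by rewrite mem_iota (mm _ kh) addnS ltnS H.
Qed.

Lemma geom_le (r : R) N : 0 <= r -> r < 1 -> \sum_(n < N) r ^+ n <= (1 - r)^-1.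
Proof.
move=> r0 r1; have d0 : 0 < 1 - r by rewrite subr_gt0.
rewrite -(ler_pM2l d0) mulfV ?gt_eqF //.
suff -> : (1 - r) * \sum_(n < N) r ^+ n = 1 - r ^+ N by rewrite gerBl exprn_ge0.
elim: N => [|N IH]; first by rewrite big_ord0 mulr0 expr0 subrr.
by rewrite big_ord_recr /= mulrDr IH exprS; ring.
Qed.

Lemma pow_small (r e : R) m0 : 0 <= r -> r < 1 -> 0 < e -> exists2 m, (m0 <= m)%N & r ^+ m < e.
Proof.
move=> r0 r1 e0; have r1' : `|r| < 1 by rewrite ger0_norm.
have /cvgrPdist_lt/(_ _ e0)[m _ hm] := cvg_expr r1'.
exists (maxn m m0); first exact: leq_maxr.
by have := hm (maxn m m0) (leq_maxl _ _); rewrite /= sub0r normrN ger0_norm // exprn_ge0.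
Qed.

Lemma powRX (a x : R) n : 0 <= a -> (a ^+ n) `^ x = (a `^ x) ^+ n.
Proof. by move=> a0; rewrite -(powR_mulrn n a0) -(powR_mulrn n (powR_ge0 a x)) -!powRrM mulrC. Qed.

Lemma powR_half_lt (x y : R) : x < y -> 2^-1 `^ y < 2^-1 `^ x.
Proof.
move=> xy; have h : (2^-1 : R) != 0 by [].
have -> : y = x + (y - x) by ring.
rewrite powRD ?h ?implybT // -[ltRHS]mulr1 ltr_pM2l ?powR_gt0 //.
have := gt0_ltr_powR (_ : 0 < y - x) (_ : 2^-1 \in Num.nneg) (_ : 1 \in Num.nneg) (_ : 2^-1 < 1).
by rewrite powR1; apply; rewrite ?subr_gt0 ?nnegrE // invf_lt1 // ltr1n.
Qed.

(* Off the limsup over [m] of the sets where the indices with [rho < 2^-m] carry mass at least [2^-(m s')], [sigma < s' < s],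
   the sum converges; since each index only sees boundedly many dyadic cells, that limsup is covered cheaply. *)
Lemma dimension_lemma (T : eqType) (L : nat -> seq T) (a : T -> R) (rho : T -> R -> R) J (b A sigma s : R) (C : nat) :
  0 <= sigma -> sigma < s -> (forall i, 0 <= a i) -> (forall i x, 0 <= rho i x) ->
  (forall N N' (f : T -> R), (N <= N')%N -> (forall i, 0 <= f i) -> \sum_(i <- L N) f i <= \sum_(i <- L N') f i) ->
  (forall N, \sum_(i <- L N) a i <= A) -> (forall x, J x -> b <= x /\ x <= b + 1) ->
  (forall i x y r, J x -> J y -> rho i x < r -> rho i y < r -> `|x - y| <= C%:R * r) ->
  exists2 Z, hnull s Z & forall x, J x -> ~ Z x ->
    (forall N i, i \in L N -> rho i x = 0 -> a i = 0) /\
    exists B : R, forall N, \sum_(i <- L N) a i * (2 / rho i x) `^ sigma <= B.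
Proof.
(* [t], [th] and [tau] are the powers [s'], [s] and [sigma] of [1 / 2]. The ratio [th / t < 1] makes
   the covers summable over levels, and [t / tau < 1] makes the divisor sums converge. *)
move=> g0 gs a0 r0 mono LA Jb Jd; pose s' := (sigma + s) / 2.
have gs' : sigma < s' by rewrite /s'; lin.
have ss' : s' < s by rewrite /s'; lin.
have s0 : 0 < s by lin.
pose k := 2^-1 : R; have k0 : 0 < k by rewrite invr_gt0.
have k1 : k < 1 by rewrite invf_lt1 // ltr1n.
pose t := k `^ s'; pose th := k `^ s; pose tau := k `^ sigma.
have t0 : 0 < t by exact: powR_gt0.
have th0 : 0 < th by exact: powR_gt0.
have tau0 : 0 < tau by exact: powR_gt0.
have tht : th < t by exact: powR_half_lt.
have ttau : t < tau by exact: powR_half_lt.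
have A0 : 0 <= A by apply: le_trans (LA 0%N); rewrite sumr_ge0.
have t1 : t < 1 by rewrite -(powRr0 k); apply: powR_half_lt; lin.
pose bm m x := exists N, t ^+ m <= \sum_(i <- L N | rho i x < k ^+ m) a i.
have cov m : hcov s (C.+1%:R * A * (th / t) ^+ m) (k ^+ m) [set x | J x /\ bm m x].
 have km0 : 0 < k ^+ m by rewrite exprn_gt0. pose cell x := Num.truncn ((x - b) / k ^+ m).
 have cellP x : J x -> (cell x)%:R * k ^+ m <= x - b /\ x - b < (cell x).+1%:R * k ^+ m.
  move=> /Jb[h1 h2]; have h : 0 <= (x - b) / k ^+ m by rewrite divr_ge0 ?subr_ge0 // ltW.
  by have := truncn_itv h; rewrite -/(cell x) ler_pdivlMr // ltr_pdivrMr // => /andP[].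
 pose hits := [seq j <- iota 0 (2 ^ m).+1 | `[< exists2 x, J x /\ bm m x & cell x = j >]].
 have uh : uniq hits by rewrite filter_uniq // iota_uniq.
 have hitP j : exists xN : R * nat, j \in hits -> [/\ J xN.1, t ^+ m <= \sum_(i <- L xN.2 | rho i xN.1 < k ^+ m) a i & cell xN.1 = j].
  have [jh|jh] := boolP (j \in hits); last by exists (0, 0%N).
  by move: jh; rewrite mem_filter => /andP[/asboolP[x [Jx [N hN]] cx] _]; exists (x, N).
 (* Double counting: each hit cell carries mass at least [t ^+ m], and one index contributes to at
    most [C.+1] cells, so [szh] compares with [C.+1] times the total mass. [N] is large enough for
    all the finitely many hit cells at once. *)
 have [xN xNP] := choice hitP. pose N := (\max_(j <- hits) (xN j).2)%N. have szh : (size hits)%:R * t ^+ m <= C.+1%:R * A.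
  apply: (@le_trans _ _ (\sum_(j <- hits) \sum_(i <- L N) (if rho i (xN j).1 < k ^+ m then a i else 0))).
   rewrite -sum1_size natr_sum mulr_suml !big_seq; apply: ler_sum => j jh; rewrite mul1r.
   have [h1 h2 h3] := xNP j jh; apply: le_trans h2 _; rewrite big_mkcond; apply: mono.
    by rewrite /N; apply: leq_bigmax_seq.
   by move=> i; case: ifP.
  rewrite exchange_big /= (mulrC _ A); apply: (@le_trans _ _ (\sum_(i <- L N) a i * C.+1%:R)); last first.
   by rewrite -mulr_suml ler_wpM2r.
  apply: ler_sum => i _; rewrite -big_mkcond /= -big_filter big_const_seq count_predT iter_addr addr0 -[leLHS]mulr_natr.
  rewrite ler_wpM2l // ler_nat; apply: uniq_span; first by rewrite filter_uniq.
  move=> j j'; rewrite (mem_filter _ j hits) (mem_filter _ j' hits) => /andP[h1 /xNP[J1 _ c1]] /andP[h2 /xNP[J2 _ c2]].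
  have := Jd _ _ _ _ J1 J2 h1 h2; have [e1 _] := cellP _ J1; have [_ e2] := cellP _ J2; rewrite c1 in e1; rewrite c2 in e2 => hd.
  have := ler_norm ((xN j).1 - (xN j').1) => hn. have : j%:R * k ^+ m < (C + j'.+1)%:R * k ^+ m by rewrite natrD mulrDl; lin.
  by rewrite ltr_pM2r // ltr_nat addnS ltnS addnC.
 exists (fun j => b + (nth 0%N hits j)%:R * k ^+ m), (fun j => if (j < size hits)%N then k ^+ m else 0); split.
 - move=> x [Jx bx]; have [c1 c2] := cellP x Jx.
  have ch : cell x \in hits.
   rewrite mem_filter; apply/andP; split; first by apply/asboolP; exists x.
   rewrite mem_iota /= add0n ltnS -(ler_nat R) natrX -(ler_pM2r km0) -exprMn mulfV // expr1n.
   by apply: le_trans c1 _; have [_] := Jb x Jx; lin.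
  exists (index (cell x) hits) => //=; rewrite index_mem ch nth_index // in_itv /=.
  by apply/andP; split; move: c2; rewrite -natr1 mulrDl mul1r; lin.
 - by move=> j; case: ifP => _; split=> //; exact: ltW.
 - move=> M; have sz n : \sum_(j < M) (if (j < n)%N then k ^+ m else 0) `^ s <= n%:R * th ^+ m.
   suff -> : \sum_(j < M) (if (j < n)%N then k ^+ m else 0) `^ s = (minn M n)%:R * th ^+ m.
    by rewrite ler_wpM2r ?exprn_ge0 ?(ltW th0) // ler_nat geq_minr.
   elim: M => [|M IH]; first by rewrite big_ord0 min0n mul0r. rewrite big_ord_recr /= IH; case: ltnP => Mn.
    by rewrite (powRX _ _ (ltW k0)) -/th (minn_idPl Mn) -natr1 mulrDl mul1r.
   by rewrite powR0 ?gt_eqF // addr0 (minn_idPr (leq_trans Mn (leqnSn M))).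
  apply: le_trans (sz _) _; rewrite expr_div_n. have -> : (size hits)%:R * th ^+ m = ((size hits)%:R * t ^+ m) * (th ^+ m / t ^+ m).
   by field; rewrite expf_neq0 // gt_eqF.
  by rewrite ler_wpM2r // divr_ge0 // exprn_ge0 // ltW.
exists [set x | J x /\ forall m0, exists2 m, (m0 <= m)%N & bm m x].
 move=> e d e0 d0; pose r := th / t. have rp : 0 <= r by rewrite divr_ge0 // ltW. have r1 : r < 1 by rewrite ltr_pdivrMr // mul1r.
 have [m1 _ hm1] := pow_small 0 (ltW k0) k1 d0. pose K := C.+1%:R * A * (1 - r)^-1 + 1.
 have K0 : 0 < K by rewrite ltr_wpDl // mulr_ge0 ?mulr_ge0 // invr_ge0 subr_ge0 ltW.
 have [m0 m10 hm0] := pow_small m1 rp r1 (divr_gt0 e0 K0). apply: (@hcov_le _ e e d d _ (\bigcup_n [set x | J x /\ bm (m0 + n)%N x])) => //.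
  by move=> x [Jx /(_ m0)[m hm bx]]; exists (m - m0)%N => //=; rewrite subnKC.
 apply: (@hcov_bigcup s e d (fun n => C.+1%:R * A * r ^+ (m0 + n))) => //; first exact: ltW.
  move=> n; apply: hcov_le (cov (m0 + n)%N) => //.
  by apply: le_trans (ltW hm1); apply: ler_wiXn2l; rewrite ?(ltW k0) ?(ltW k1) ?(leq_trans m10 (leq_addr _ _)).
 move=> N; under eq_bigr do rewrite exprD mulrA. rewrite -mulr_sumr; have g := geom_le N rp r1.
 apply: (@le_trans _ _ (C.+1%:R * A * r ^+ m0 * (1 - r)^-1)).
  by rewrite ler_wpM2l // ?mulr_ge0 ?exprn_ge0.
 move: hm0; rewrite ltr_pdivlMr // /K mulrDr mulr1 => h; have := exprn_ge0 m0 rp.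
 have -> : C.+1%:R * A * r ^+ m0 * (1 - r)^-1 = r ^+ m0 * (C.+1%:R * A * (1 - r)^-1) by ring. lin.
(* Off [Z] there is a level [m0] from which on the indices with [rho < k ^+ m] have mass below
   [t ^+ m]; in particular an index with [rho = 0] has weight 0. *)
move=> x Jx nZ; have [m0 Hm0] : exists m0, forall m N, (m0 <= m)%N -> \sum_(i <- L N | rho i x < k ^+ m) a i < t ^+ m.
 apply: contrapT => nex; apply: nZ; split=> // m0; apply: contrapT => nm; apply: nex; exists m0 => m N mm.
 by rewrite ltNge; apply/negP => h; apply: nm; exists m => //; exists N.
have zero N i : i \in L N -> rho i x = 0 -> a i = 0.
 move=> iL ri; apply/eqP; rewrite eq_le a0 andbT leNgt; apply/negP => ai. have [m mm hm] := pow_small m0 (ltW t0) t1 ai.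
 have := Hm0 m N mm; apply/negP; rewrite -leNgt; apply: le_trans (ltW hm) _.
 rewrite big_mkcond (big_rem i) //= ri exprn_gt0 // lerDl sumr_ge0 // => j _; by case: ifP.
split=> //; pose rr := t / tau.
have rr0 : 0 <= rr by rewrite divr_ge0 // ltW.
have rr1 : rr < 1 by rewrite ltr_pdivrMr // mul1r.
exists (2 `^ sigma * (A * tau ^- m0 + tau^-1 * (1 - rr)^-1)) => N.
have [n1 Hn1] : exists n1, forall i, i \in L N -> rho i x != 0 -> k ^+ (m0 + n1) <= rho i x.
 elim: (L N) => [|i l [n1 IH]]; first by exists 0%N. have [ri|ri] := eqVneq (rho i x) 0.
  by exists n1 => j; rewrite inE => /orP[/eqP->|/IH//]; rewrite ri eqxx.
 have rp : 0 < rho i x by rewrite lt_neqAle eq_sym ri r0. have [m mm hm] := pow_small (m0 + n1) (ltW k0) k1 rp.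
 exists (m - m0)%N; rewrite subnKC; last exact: leq_trans (leq_addr _ _) mm.
 move=> j; rewrite inE => /orP[/eqP-> _|/IH h /h]; first exact: ltW. by apply: le_trans; apply: ler_wiXn2l; rewrite ?(ltW k0) ?(ltW k1).
have pw m (y : R) : k ^+ m <= y -> y^-1 `^ sigma <= tau ^- m.
 move=> hy; have kp : 0 < k ^+ m by rewrite exprn_gt0. have yp : 0 < y by apply: lt_le_trans hy.
 rewrite -[leRHS]mul1r ler_pdivlMr ?exprn_gt0 //; apply: (@le_trans _ _ (y^-1 `^ sigma * y `^ sigma)).
  rewrite ler_wpM2l ?powR_ge0 // /tau -(powRX _ _ (ltW k0)). by apply: ge0_ler_powR => //; rewrite nnegrE ltW.
 by rewrite -powRM ?invr_ge0 ?(ltW yp) // mulVf ?gt_eqF // powR1.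
(* A dyadic decomposition of the power [- sigma] of [y]: layer [m0 + j] contributes
   [tau ^- (m0 + j).+1], and the indices reaching it have mass below [t ^+ (m0 + j)], which leaves a
   geometric series of ratio [t / tau]. *)
have pt n (y : R) : k ^+ (m0 + n) <= y -> y^-1 `^ sigma <= tau ^- m0 + \sum_(j < n) (if y < k ^+ (m0 + j) then tau ^- (m0 + j).+1 else 0).
 elim: n => [|n IH] hy.
  rewrite big_ord0 addr0; move: hy; rewrite addn0 => hy. exact: pw.
 rewrite big_ord_recr /= addrA; case: ltP => h; last by rewrite addr0 IH. apply: ler_wpDl; last by rewrite -addnS; exact: pw.
 rewrite addr_ge0 ?invr_ge0 ?exprn_ge0 ?(ltW tau0) // sumr_ge0 // => j _; case: ifP => // _. by rewrite invr_ge0 exprn_ge0 // ltW.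
apply: (@le_trans _ _ (\sum_(i <- L N) 2 `^ sigma * (a i * tau ^- m0 + \sum_(j < n1) (if rho i x < k ^+ (m0 + j) then a i else 0) * tau ^- (m0 + j).+1))).
 rewrite !big_seq; apply: ler_sum => i iL; have [ri|ri] := eqVneq (rho i x) 0.
  rewrite (zero N i) // mul0r mulr_ge0 ?powR_ge0 // addr_ge0 ?mul0r // sumr_ge0 // => j _; by case: ifP; rewrite mul0r.
 have := pt n1 _ (Hn1 i iL ri) => h. rewrite powRM ?invr_ge0 // mulrCA ler_wpM2l ?powR_ge0 //.
 apply: le_trans (ler_wpM2l (a0 i) h) _; rewrite mulrDr lerD2l mulr_sumr; apply: ler_sum => j _. by case: ifP; rewrite ?mulr0 ?mul0r.
rewrite -mulr_sumr ler_wpM2l ?powR_ge0 // big_split /= -mulr_suml; apply: lerD.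
 by rewrite ler_wpM2r // invr_ge0 exprn_ge0 // ltW.
rewrite exchange_big /=; apply: (@le_trans _ _ (\sum_(j < n1) tau^-1 * (rr ^+ m0 * rr ^+ j))).
 apply: ler_sum => j _; rewrite -mulr_suml -big_mkcond /=.
 apply: le_trans (ler_wpM2r _ (ltW (Hm0 (m0 + j)%N N (leq_addr _ _)))) _; first by rewrite invr_ge0 exprn_ge0 // ltW.
 rewrite -exprD /rr expr_div_n exprS; apply: eqW; field. by rewrite expf_neq0 gt_eqF.
rewrite -mulr_sumr ler_wpM2l ?invr_ge0 ?(ltW tau0) // -mulr_sumr.
apply: le_trans (geom_le n1 rr0 rr1); rewrite ler_piMl ?sumr_ge0 //; first by move=> j _; rewrite exprn_ge0.
by rewrite exprn_ile1 // ltW.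
Qed.

End Hausdorff.

(** * The discriminant as a function of the energy *)

Section Floquet.
Implicit Types (x y h E e : R).

(** The rate is the same for all [E] within 1 of [E0]. It serves solutions, with [g = 0], and
    differences of solutions at two energies, with [g = (E - E0) u]. *)
Lemma growth1 (V d d1 g K : R -> R) E E0 (G : R) : AC K (fun x => `|V x| + `|E0| + 3) -> `|E - E0| <= 1 ->
  AC d d1 -> AC d1 (fun x => (V x - E) * d x - g x) ->
  (forall x, 0 <= x -> x <= 1 -> `|g x| <= G) -> forall x, 0 <= x -> x <= 1 ->
  d x ^+ 2 + d1 x ^+ 2 <= expR (K 1 - K 0) * (d 0 ^+ 2 + d1 0 ^+ 2 + G ^+ 2).
Proof.
move=> aK hE ad ad1 hg x x0 x1.
have aN := AC_add (AC_mul ad ad) (AC_mul ad1 ad1).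
have aH := AC_scale (G ^+ 2) AC_id.
have kk y : 0 <= y -> y <= 1 -> 0 <= `|V y| + `|E0| + 3 by move=> _ _; rewrite !addr_ge0.
have G0 : 0 <= G ^+ 2 by exact: sqr_ge0.
have := gronwall aN aK aH (lexx 0) x0 => /(_ _ _ _)/=.
rewrite -!expr2 mulr0 subr0 => h.
apply: (@le_trans _ _ (expR (K x - K 0) * (d 0 ^+ 2 + d1 0 ^+ 2 + G ^+ 2 * x))).
 apply: h => y y0 yx; last 2 first.
 - by rewrite mulr1.
 - by apply: kk => //; exact: le_trans x1. have y1 : y <= 1 by exact: le_trans x1. have gG := hg y y0 y1; have g2 : g y ^+ 2 <= G ^+ 2.
  by rewrite -(real_normK (num_real (g y))) ler_pXn2r ?nnegrE ?(le_trans _ gG).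
 have n1 : `|1 + V y - E| <= `|V y| + `|E0| + 2.
  have := ler_normD 1 (V y - E); rewrite normr1 addrA => t1; have := ler_normB (V y) E => t2.
  by have := ler_normD (E - E0) E0; rewrite subrK => t3; lra.
 have pq : `|2 * (d y * d1 y)| <= d y ^+ 2 + d1 y ^+ 2.
  by rewrite ler_norml; apply/andP; split; have := sqr_ge0 (d y - d1 y); have := sqr_ge0 (d y + d1 y); nra.
 have t1 : (1 + V y - E) * (2 * (d y * d1 y)) <= (`|V y| + `|E0| + 2) * (d y ^+ 2 + d1 y ^+ 2).
  by apply: le_trans (ler_norm _) _; rewrite normrM; apply: ler_pM.
 have t2 : - (2 * (d1 y * g y)) <= d y ^+ 2 + d1 y ^+ 2 + g y ^+ 2 by have := sqr_ge0 (d1 y + g y); have := sqr_ge0 (d y); nra.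
 have -> : d1 y * d y + d y * d1 y + (((V y - E) * d y - g y) * d1 y + d1 y * ((V y - E) * d y - g y)) =
  (1 + V y - E) * (2 * (d y * d1 y)) - 2 * (d1 y * g y) by ring.
 by rewrite mulr1 -!expr2; lra.
apply: ler_pM; rewrite ?expR_ge0 //.
- by rewrite !addr_ge0 ?sqr_ge0 // mulr_ge0.
- rewrite ler_expR lerD2r; apply: (AC_homo aK x0 x1) => y y0 y1; rewrite !addr_ge0 //.
- by rewrite lerD2l ler_piMr.
Qed.

Definition fund (V : R -> R) E (c c1 s s1 : R -> R) : Prop :=
  [/\ AC c c1 /\ AC c1 (fun x => (V x - E) * c x), AC s s1 /\ AC s1 (fun x => (V x - E) * s x),
      c 0 = 1 /\ c1 0 = 0 & s 0 = 0 /\ s1 0 = 1].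

Lemma fund_exists V E : LI V -> exists f : ((R -> R) * (R -> R)) * ((R -> R) * (R -> R)), fund V E f.1.1 f.1.2 f.2.1 f.2.2.
Proof.
move=> IV; have [s [c [s1 [c1 [[as_ as1] [ac ac1] [i1 i2] [i3 i4]]]]]] := sol_scale_bound IV E%:C%C.
exists (((fun x => Re (c x)), (fun x => Re (c1 x))), ((fun x => Re (s x)), (fun x => Re (s1 x)))).
have e (u : R -> C) : (fun x => Re (Qz V E%:C%C x * u x)) =1 (fun x => (V x - E) * Re (u x)).
 by move=> x; rewrite /Qz !CE; ring.
split=> /=; rewrite ?i1 ?i2 ?i3 ?i4 //; split; try by [have [] := ac|have [] := as_].
 by have [h _] := ac1; apply: AC_ext h => // x _; exact: e.
by have [h _] := as1; apply: AC_ext h => // x _; exact: e.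
Qed.

Definition I1 (f : R -> R) : R := Rint `[0, 1] f.

Lemma I1_close (f g : R -> R) e : LI f -> LI g -> (forall x, 0 <= x -> x <= 1 -> `|f x - g x| <= e) -> `|I1 f - I1 g| <= e.
Proof.
move=> If Ig H; have := AC_lip (AC_sub (AC_prim 0 If) (AC_prim 0 Ig)) (lexx 0) ler01 H.
by rewrite !RintI0 !add0r !oppr0 !addr0 mulr1.
Qed.

Variable V : R -> R.
Hypothesis IV : LI V.
Variables (c c1 s s1 : R -> R -> R).
Hypothesis hf : forall E, fund V E (c E) (c1 E) (s E) (s1 E).

(** The trace of the monodromy matrix, whose determinant is 1 by [fund_wr]. *)
Definition disc E : R := c E 1 + s1 E 1.

Lemma fund_wr E x : 0 <= x -> c E x * s1 E x - c1 E x * s E x = 1.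
Proof.
move=> x0; have [[a1 a2] [a3 a4] [i1 i2] [i3 i4]] := hf E.
have aW := AC_sub (AC_mul a1 a4) (AC_mul a2 a3).
have := AC_lip (M := 0) aW (lexx 0) x0; rewrite i1 i2 i3 i4 mulr0 mul0r mul1r subr0 => h.
apply/eqP; rewrite -subr_eq0 -normr_le0; apply: h => y y0 yx.
by rewrite (_ : _ - _ = 0) ?normr0 //; ring.
Qed.

(** Variation of constants over one period with the change of energy as a source. The formula is
    exact, not a linearisation, and [entries] and [disc_diff] inherit this. *)
Lemma var_const E E' (u w : R -> R) : AC u w -> AC w (fun x => (V x - E') * u x) ->
  let al := u 0 + (E' - E) * I1 (fun x => u x * s E x) in
  let be := w 0 - (E' - E) * I1 (fun x => c E x * u x) in
  u 1 = al * c E 1 + be * s E 1 /\ w 1 = al * c1 E 1 + be * s1 E 1.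
Proof.
move=> au aw al be; have [[a1 a2] [a3 a4] [i1 i2] [i3 i4]] := hf E.
have aA := AC_sub (AC_mul au a4) (AC_mul aw a3).
have aB := AC_sub (AC_mul a1 aw) (AC_mul a2 au).
have Iu : LI (fun x => u x * s E x) by apply: LB_LI; apply: LB_mul; [exact: AC_LB au|exact: AC_LB a3].
have Ic : LI (fun x => c E x * u x) by apply: LB_LI; apply: LB_mul; [exact: AC_LB a1|exact: AC_LB au].
have e1 : u 1 * s1 E 1 - w 1 * s E 1 = al.
 have := AC_eq (AC_ext (fun _ _ => erefl) _ aA) (AC_scale (E' - E) (AC_prim 0 Iu)) (lexx 0) ler01.
 move=> h; have {h} := h ltac:(by move=> x _; ring). by rewrite RintI0 i3 i4 /al /I1 => h; lin.
have e2 : c E 1 * w 1 - c1 E 1 * u 1 = be.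
 have := AC_eq (AC_ext (fun _ _ => erefl) _ aB) (AC_scale (- (E' - E)) (AC_prim 0 Ic)) (lexx 0) ler01.
 move=> h; have {h} := h ltac:(by move=> x _; ring). by rewrite RintI0 i1 i2 /be /I1 => h; lin.
have W := fund_wr E ler01; rewrite -e1 -e2.
have e3 : u 1 = u 1 * (c E 1 * s1 E 1 - c1 E 1 * s E 1) by rewrite W mulr1.
have e4 : w 1 = w 1 * (c E 1 * s1 E 1 - c1 E 1 * s E 1) by rewrite W mulr1.
by split; [rewrite {1}e3|rewrite {1}e4]; ring.
Qed.

(** The exact difference quotient of [disc] between [E] and [E'] ([disc_diff]). It takes the place
    of a derivative; its continuity at the diagonal is what gets used. *)
Definition Tq E E' : R := c E 1 * I1 (fun x => s E x * c E' x) - s E 1 * I1 (fun x => c E x * c E' x)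
  + c1 E 1 * I1 (fun x => s E x * s E' x) - s1 E 1 * I1 (fun x => c E x * s E' x).

Lemma I1C (f g : R -> R) : I1 (fun x => f x * g x) = I1 (fun x => g x * f x).
Proof. by congr I1; apply/funext => x; rewrite mulrC. Qed.

Lemma entries E E' : let h := E' - E in
  [/\ c E' 1 = (1 + h * I1 (fun x => s E x * c E' x)) * c E 1 - h * I1 (fun x => c E x * c E' x) * s E 1,
      c1 E' 1 = (1 + h * I1 (fun x => s E x * c E' x)) * c1 E 1 - h * I1 (fun x => c E x * c E' x) * s1 E 1,
      s E' 1 = h * I1 (fun x => s E x * s E' x) * c E 1 + (1 - h * I1 (fun x => c E x * s E' x)) * s E 1 &
      s1 E' 1 = h * I1 (fun x => s E x * s E' x) * c1 E 1 + (1 - h * I1 (fun x => c E x * s E' x)) * s1 E 1].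
Proof.
move=> h; have [[a1 a2] [a3 a4] [i1 i2] [i3 i4]] := hf E'.
have [e1 e2] := var_const E a1 a2; have [e3 e4] := var_const E a3 a4.
rewrite i1 i2 -/h (I1C _ (s E)) in e1 e2; rewrite i3 i4 -/h (I1C _ (s E)) in e3 e4.
by split; [rewrite e1|rewrite e2|rewrite e3|rewrite e4]; ring.
Qed.

Lemma disc_diff E E' : disc E' = disc E + (E' - E) * Tq E E'.
Proof. by have [e1 _ _ e4] := entries E E'; rewrite /disc e1 e4 /Tq; ring. Qed.

Lemma fund_bounds E0 : exists B L : R, [/\ 1 <= B, 0 <= L &
  forall E, `|E - E0| <= 1 -> forall x, 0 <= x -> x <= 1 ->
   [/\ `|c E x| <= B /\ `|c1 E x| <= B, `|s E x| <= B /\ `|s1 E x| <= B,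
       `|c E x - c E0 x| <= L * `|E - E0| /\ `|c1 E x - c1 E0 x| <= L * `|E - E0| &
       `|s E x - s E0 x| <= L * `|E - E0| /\ `|s1 E x - s1 E0 x| <= L * `|E - E0|]].
Proof.
have aK := AC_prim 0 (LI_add (LI_add (LI_norm IV) (LI_cst `|E0|)) (LI_cst 3)).
set K := (fun x => 0 + _) in aK; pose B := expR (K 1 - K 0).
have K0 : K 0 <= K 1 by apply: (AC_homo aK (lexx 0) ler01) => y _ _; rewrite !addr_ge0.
have B1 : 1 <= B by rewrite /B -[leLHS]expR0 ler_expR subr_ge0.
have B0 : 0 <= B by exact: le_trans B1.
have sq (a b X : R) : 0 <= X -> a ^+ 2 + b ^+ 2 <= B * X ^+ 2 -> `|a| <= B * X /\ `|b| <= B * X.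
 move=> X0 h; have h2 : B * X ^+ 2 <= (B * X) ^+ 2 by rewrite exprMn ler_wpM2r ?sqr_ge0 // expr2 ler_peMr.
 have a2 := sqr_ge0 a; have b2 := sqr_ge0 b; have BX : 0 <= B * X by rewrite mulr_ge0.
 by split; rewrite -(ler_pXn2r (ltn0Sn 1)) ?nnegrE // real_normK ?num_real //; lin.
have bd E : `|E - E0| <= 1 -> forall x, 0 <= x -> x <= 1 -> (`|c E x| <= B /\ `|c1 E x| <= B) /\ (`|s E x| <= B /\ `|s1 E x| <= B).
 move=> hE x x0 x1; have [[a1 a2] [a3 a4] [i1 i2] [i3 i4]] := hf E.
 have z0 y : 0 <= y -> y <= 1 -> `|(fun=> 0 : R) y| <= 0 by move=> _ _; rewrite normr0.
 have a2' : AC (c1 E) (fun x => (V x - E) * c E x - (fun=> 0) x) by apply: AC_ext a2 => // y _; rewrite subr0.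
 have a4' : AC (s1 E) (fun x => (V x - E) * s E x - (fun=> 0) x) by apply: AC_ext a4 => // y _; rewrite subr0.
 have h1 := growth1 aK hE a1 a2' z0 x0 x1; have h2 := growth1 aK hE a3 a4' z0 x0 x1.
 move: h1 h2; rewrite i1 i2 i3 i4 -/B => h1 h2; rewrite -(mulr1 B); split; apply: sq => //.
  by apply: le_trans h1 _; apply: eqW; ring.
 by apply: le_trans h2 _; apply: eqW; ring.
exists B, (B * B); split=> //; first by rewrite mulr_ge0.
move=> E hE x x0 x1; have [b1 b2] := bd E hE x x0 x1.
have hE0 : `|E0 - E0| <= 1 by rewrite subrr normr0.
have [[a1 a2] [a3 a4] [i1 i2] [i3 i4]] := hf E.
have [[d1 d2] [d3 d4] [j1 j2] [j3 j4]] := hf E0.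
have dif (u w u0 w0 : R -> R) : AC u w -> AC w (fun x => (V x - E) * u x) -> AC u0 w0 -> AC w0 (fun x => (V x - E0) * u0 x) ->
 u 0 = u0 0 -> w 0 = w0 0 -> (forall y, 0 <= y -> y <= 1 -> `|u y| <= B) ->
 `|u x - u0 x| <= B * B * `|E - E0| /\ `|w x - w0 x| <= B * B * `|E - E0|. move=> au aw au0 aw0 e1 e2 ub.
 have ad1 : AC (fun x => w x - w0 x) (fun x => (V x - E0) * (u x - u0 x) - (E - E0) * u x).
  by apply: AC_ext (AC_sub aw aw0) => // y _; ring.
 have hg y : 0 <= y -> y <= 1 -> `|(E - E0) * u y| <= B * `|E - E0|.
  by move=> y0 y1; rewrite normrM mulrC ler_wpM2r // ub.
 have := growth1 aK hE0 (AC_sub au au0) ad1 hg x0 x1; rewrite e1 e2 !subrr -/B => h. rewrite -mulrA; apply: sq; first by rewrite mulr_ge0.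
 by apply: le_trans h _; apply: eqW; ring.
split=> //; apply: dif => //; rewrite ?i1 ?i2 ?i3 ?i4 ?j1 ?j2 ?j3 ?j4 // => y y0 y1; by have [[? _] [? _]] := bd E hE y y0 y1.
Qed.

Lemma LI_prod (f g f1 g1 : R -> R) : AC f f1 -> AC g g1 -> LI (fun x => f x * g x).
Proof. by move=> h1 h2; apply: LB_LI; apply: LB_mul; [exact: AC_LB h1|exact: AC_LB h2]. Qed.

Lemma I1_lip E0 : exists2 L : R, 0 <= L & forall E E' e, `|E - E0| <= 1 -> `|E' - E0| <= 1 -> `|E - E0| <= e -> `|E' - E0| <= e ->
  [/\ `|I1 (fun x => s E x * c E' x) - I1 (fun x => s E0 x * c E0 x)| <= L * e,
      `|I1 (fun x => c E x * c E' x) - I1 (fun x => c E0 x * c E0 x)| <= L * e,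
      `|I1 (fun x => s E x * s E' x) - I1 (fun x => s E0 x * s E0 x)| <= L * e &
      `|I1 (fun x => c E x * s E' x) - I1 (fun x => c E0 x * s E0 x)| <= L * e].
Proof.
have [B [L [B1 L0 H]]] := fund_bounds E0; exists (2 * B * L); first by rewrite !mulr_ge0 // (le_trans ler01).
have B0 : 0 <= B by exact: le_trans B1.
move=> E E' e h1 h2 h3 h4.
have pr (f g f0 g0 : R -> R) (f' g' f0' g0' : R -> R) : AC f f' -> AC g g' -> AC f0 f0' -> AC g0 g0' ->
 (forall x, 0 <= x -> x <= 1 -> [/\ `|f x| <= B, `|g0 x| <= B, `|f x - f0 x| <= L * `|E - E0| & `|g x - g0 x| <= L * `|E' - E0|]) ->
 `|I1 (fun x => f x * g x) - I1 (fun x => f0 x * g0 x)| <= 2 * B * L * e.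
 move=> af ag af0 ag0 Hx; apply: I1_close; [exact: LI_prod af ag|exact: LI_prod af0 ag0|]. move=> x x0 x1; have [q1 q2 q3 q4] := Hx x x0 x1.
 rewrite (_ : _ - _ = f x * (g x - g0 x) + (f x - f0 x) * g0 x); last by ring. apply: le_trans (ler_normD _ _) _; rewrite !normrM.
 have t1 : `|f x| * `|g x - g0 x| <= B * (L * e) by apply: ler_pM => //; apply: le_trans q4 _; rewrite ler_wpM2l.
 have t2 : `|f x - f0 x| * `|g0 x| <= (L * e) * B by apply: ler_pM => //; apply: le_trans q3 _; rewrite ler_wpM2l. by lin.
have [[a1 _] [a3 _] _ _] := hf E; have [[a1' _] [a3' _] _ _] := hf E'; have [[d1 _] [d3 _] _ _] := hf E0.
have h0 : `|E0 - E0| <= 1 by rewrite subrr normr0.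
split; apply: pr; eauto; move=> x x0 x1; have [[? ?] [? ?] [? ?] [? ?]] := H E h1 x x0 x1;
 have [[? ?] [? ?] [? ?] [? ?]] := H E' h2 x x0 x1; have [[? ?] [? ?] _ _] := H E0 h0 x x0 x1; split=> //.
Qed.

Lemma norm4_le (w x y z M : R) : `|w| <= M -> `|x| <= M -> `|y| <= M -> `|z| <= M -> `|w - x + y - z| <= 4 * M.
Proof.
move=> h1 h2 h3 h4; apply: le_trans (ler_normB _ _) _.
by have := ler_normD (w - x) y; have := ler_normB w x; lin.
Qed.

Lemma Tq_cont E0 e : 0 < e -> exists2 d, 0 < d & forall E E', `|E - E0| <= d -> `|E' - E0| <= d -> `|Tq E E' - Tq E0 E0| <= e.
Proof.
move=> e0; have [B [L [B1 L0 H]]] := fund_bounds E0; have [L' L'0 H'] := I1_lip E0.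
have h0 : `|E0 - E0| <= 1 by rewrite subrr normr0.
pose F := `|I1 (fun x => s E0 x * c E0 x)| + `|I1 (fun x => c E0 x * c E0 x)| + `|I1 (fun x => s E0 x * s E0 x)| + `|I1 (fun x => c E0 x * s E0 x)|.
have F0 : 0 <= F by rewrite !addr_ge0.
pose K := 4 * (B * L' + L * F) + 1; have K0 : 0 < K by rewrite ltr_wpDl // mulr_ge0 // addr_ge0 // mulr_ge0 // (le_trans ler01).
exists (Num.min 1 (e / K)); first by rewrite lt_min ltr01 divr_gt0.
move=> E E'; rewrite !le_min => /andP[h1 h2] /andP[h3 h4].
have [k1 k2 k3 k4] := H' E E' _ h1 h3 h2 h4.
have [[b1 b2] [b3 b4] [l1 l2] [l3 l4]] := H E h1 1 ler01 (lexx 1).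
have e1 : 0 <= e / K by rewrite divr_ge0 // ltW.
have pr (a a0_ i i0_ : R) : `|a| <= B -> `|a - a0_| <= L * `|E - E0| -> `|i - i0_| <= L' * (e / K) -> `|i0_| <= F ->
 `|a * i - a0_ * i0_| <= (B * L' + L * F) * (e / K).
 move=> q1 q2 q3 q4; rewrite (_ : _ - _ = a * (i - i0_) + (a - a0_) * i0_); last by ring.
 apply: le_trans (ler_normD _ _) _; rewrite !normrM mulrDl. apply: lerD; first by rewrite -mulrA; apply: ler_pM.
 rewrite mulrAC; apply: ler_pM => //; apply: le_trans q2 _; by rewrite ler_wpM2l.
have f1 : `|I1 (fun x => s E0 x * c E0 x)| <= F by rewrite /F -!addrA lerDl !addr_ge0.
have f2 : `|I1 (fun x => c E0 x * c E0 x)| <= F by rewrite /F -!addrA addrCA lerDl !addr_ge0.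
have f3 : `|I1 (fun x => s E0 x * s E0 x)| <= F by rewrite /F addrAC lerDr !addr_ge0.
have f4 : `|I1 (fun x => c E0 x * s E0 x)| <= F by rewrite /F lerDr !addr_ge0.
have t1 := pr _ _ _ _ b1 l1 k1 f1; have t2 := pr _ _ _ _ b3 l3 k2 f2.
have t3 := pr _ _ _ _ b2 l2 k3 f3; have t4 := pr _ _ _ _ b4 l4 k4 f4.
have ke : 4 * ((B * L' + L * F) * (e / K)) <= e.
 have KE : 4 * (B * L' + L * F) = K - 1 by rewrite /K addrK. rewrite mulrA KE mulrCA.
 by rewrite ler_piMr ?(ltW e0) // ler_pdivrMr // mul1r gerBl.
apply: le_trans ke; apply: le_trans (norm4_le t1 t2 t3 t4); rewrite /Tq; apply: eqW.
by congr `|_|; ring.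
Qed.

End Floquet.

(** * Bands, band edges and Floquet solutions *)

Section Discriminant.
Implicit Types (x y h E e : R).

(** With [p = a - d] the last hypothesis reads [b A - k S = p G], while trace and determinant give
    [p ^+ 2 <= - 4 b k]. Squaring yields [p ^+ 2 * (A * S) <= p ^+ 2 * G ^+ 2], so [p = 0]. In use:
    where [|D| <= 2] and the derivative of [D] vanishes, the monodromy matrix is plus or minus the
    identity, that is, a gap is closed. *)
Lemma quad_zero (A S G a b k d : R) : 0 < A -> 0 < S -> G ^+ 2 < A * S -> a * d - k * b = 1 -> (a + d) ^+ 2 <= 4 ->
  a * G - b * A + k * S - d * G = 0 -> [/\ b = 0, k = 0, d = a & a ^+ 2 = 1].
Proof.
move=> A0 S0 GAS det tr h; pose p := a - d.
have e1 : b * A - k * S = p * G by rewrite /p; lin.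
have e2 : p ^+ 2 <= - (4 * (b * k)).
 have -> : p ^+ 2 = (a + d) ^+ 2 - 4 * (a * d) by rewrite /p; ring. have -> : a * d = 1 + b * k by rewrite -det; ring. lin.
have e3 : (p * G) ^+ 2 = (b * A + k * S) ^+ 2 - 4 * (b * k) * (A * S) by rewrite -e1; ring.
have AS : 0 < A * S by rewrite mulr_gt0.
have e4 : p ^+ 2 * (A * S) <= p ^+ 2 * G ^+ 2.
 rewrite -exprMn e3; have h1 : p ^+ 2 * (A * S) <= - (4 * (b * k)) * (A * S) by rewrite ler_pM2r. by have := sqr_ge0 (b * A + k * S); lin.
have p0 : p = 0.
 apply/eqP; rewrite -sqrf_eq0 eq_le sqr_ge0 andbT leNgt; apply/negP => p2. by move: e4; rewrite ler_pM2l // leNgt GAS.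
have bk : b * k <= 0 by move: e2; rewrite p0 expr0n /=; lin.
have e5 : b * A = k * S by move: e1; rewrite p0 mul0r; lin.
have b0 : b = 0.
 apply/eqP; rewrite -sqrf_eq0 eq_le sqr_ge0 andbT leNgt; apply/negP => b2. have h1 : 0 < b ^+ 2 * A by rewrite mulr_gt0.
 have h2 : b ^+ 2 * A = (b * k) * S by rewrite expr2 -mulrA e5; ring. have : b * k * S <= 0 by rewrite pmulr_lle0. by rewrite -h2 leNgt h1.
have k0 : k = 0 by move/eqP: e5; rewrite b0 mul0r eq_sym mulf_eq0 (gt_eqF S0) orbF => /eqP.
have da : d = a by move: p0; rewrite /p; lin.
by split=> //; rewrite -det da k0 mul0r subr0 expr2.
Qed.

(** At a closed gap the discriminant will differ from plus or minus 2 by this quantity in modulus.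
    It is close to [hh ^+ 2] times the Gram determinant [A * S - G ^+ 2], hence positive and
    small. *)
Lemma edge_small (A S G L : R) : 0 < A -> 0 < S -> G ^+ 2 < A * S -> 0 <= L -> exists2 d : R, 0 < d /\ d <= 1 &
  forall hh x y z w : R, 0 < `|hh| -> `|hh| < d -> `|x - G| <= L * `|hh| -> `|y - G| <= L * `|hh| ->
  `|w - A| <= L * `|hh| -> `|z - S| <= L * `|hh| ->
  0 < hh ^+ 2 * (z * w - x * y) /\ hh ^+ 2 * (z * w - x * y) < 4.
Proof.
move=> A0 S0 G0 L0.
 pose B := A + S + `|G| + L + 1; have B1 : 1 <= B by rewrite lerDr !addr_ge0 // ltW.
 pose Dt := A * S - G ^+ 2; have Dt0 : 0 < Dt by rewrite subr_gt0. have B0 : 0 < B by lin. have Gn : 0 <= `|G| by [].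
 have AB : A <= B by rewrite /B; lin. have SB : S <= B by rewrite /B; lin. have GB : `|G| <= B by rewrite /B; lin.
 have LB_ : L <= B by rewrite /B; lin. pose d := Num.min 1 (Num.min (Dt / (16 * B ^+ 2)) (1 / (8 * B ^+ 2))).
 have BB : 0 < B ^+ 2 by rewrite exprn_gt0. have d0 : 0 < d by rewrite !lt_min ltr01 !divr_gt0 //= mulr_gt0.
exists d; first by split=> //; rewrite ge_min lexx.
move=> hh x y z w hE; rewrite !lt_min => /andP[h1 /andP[h2 h3]] k1 k4 k2 k3.
  have L1 : L * `|hh| <= B * `|hh| by rewrite ler_wpM2r. have eps : 0 <= B * `|hh| by rewrite mulr_ge0 // ltW.
  have zw : `|z * w - S * A| <= 3 * B * (B * `|hh|).
   rewrite (_ : _ - _ = (z - S) * w + S * (w - A)); last by ring. apply: le_trans (ler_normD _ _) _; rewrite !normrM (gtr0_norm S0).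
   have wB : `|w| <= 2 * B.
    have := ler_normD (w - A) A; rewrite subrK (gtr0_norm A0). have : B * `|hh| <= B by rewrite ler_piMr // ltW. lin.
   have t1 : `|z - S| * `|w| <= (B * `|hh|) * (2 * B) by apply: ler_pM => //; lin.
   have t2 : S * `|w - A| <= B * (B * `|hh|) by apply: ler_pM => //; [exact: ltW|lin]. lin.
  have xy : `|x * y - G ^+ 2| <= 3 * B * (B * `|hh|).
   rewrite (_ : _ - _ = (x - G) * y + G * (y - G)); last by ring. apply: le_trans (ler_normD _ _) _; rewrite !normrM.
   have wB : `|y| <= 2 * B.
    have := ler_normD (y - G) G; rewrite subrK. have : B * `|hh| <= B by rewrite ler_piMr // ltW. lin.
   have t1 : `|x - G| * `|y| <= (B * `|hh|) * (2 * B) by apply: ler_pM => //; lin.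
   have t2 : `|G| * `|y - G| <= B * (B * `|hh|) by apply: ler_pM => //; lin. lin.
  have small : 6 * B * (B * `|hh|) <= Dt / 2.
   have := ltW h2; rewrite ler_pdivlMr ?mulr_gt0 // => hq. have : 0 <= `|hh| * B ^+ 2 by rewrite mulr_ge0 // ltW.
   rewrite expr2 in hq *; lin.
  have Dlo : Dt / 2 <= z * w - x * y.
   move: zw xy; rewrite !ler_norml => /andP[? ?] /andP[? ?]; rewrite /Dt (mulrC A) in small *; lin.
  have Dhi : z * w - x * y <= 2 * Dt.
   move: zw xy; rewrite !ler_norml => /andP[? ?] /andP[? ?]; rewrite /Dt (mulrC A) in small *; lin.
  have hp : 0 < hh ^+ 2 by rewrite -real_normK ?num_real // exprn_gt0.
  have p1 : 0 < hh ^+ 2 * (z * w - x * y) by rewrite mulr_gt0 // (lt_le_trans _ Dlo) // divr_gt0. have p2 : hh ^+ 2 * (z * w - x * y) < 4.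
   have q1 : Dt <= B ^+ 2.
    by rewrite expr2; apply: (@le_trans _ _ (A * S)); [rewrite /Dt gerBl sqr_ge0|apply: ler_pM => //; exact: ltW].
   have q2 : hh ^+ 2 <= `|hh| by rewrite -real_normK ?num_real // expr2 ler_piMr // ltW.
   have q3 : hh ^+ 2 * (z * w - x * y) <= `|hh| * (2 * B ^+ 2).
    apply: ler_pM => //; [exact: sqr_ge0|by rewrite -(pmulr_rge0 _ hp) ltW|]. by apply: le_trans Dhi _; rewrite ler_pM2l.
   move: (ltW h3); rewrite ler_pdivlMr ?mulr_gt0 // => q4; lin.
by split.
Qed.

Variables (V Kv : R -> R) (Q0 : R).
Hypotheses (IV : LI V) (aKv : AC Kv (fun x => `|V x|)) (Q00 : 0 <= Q0)
  (uni : forall s, 0 <= s -> Kv (s + 1) - Kv s <= Q0) (per : forall x, 0 <= x -> V (x + 1) = V x).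
Variables (c c1 s s1 : R -> R -> R).
Hypothesis hf : forall E, fund V E (c E) (c1 E) (s E) (s1 E).
Notation D := (disc c s1).

Lemma I1_lin (a b : R) (f g : R -> R) : LI f -> LI g -> I1 (fun x => a * f x + b * g x) = a * I1 f + b * I1 g.
Proof.
move=> If Ig; have h := AC_add (AC_scale a (AC_prim 0 If)) (AC_scale b (AC_prim 0 Ig)).
by rewrite /I1 (Rint_prim h ler01) !RintI0; ring.
Qed.

Lemma sol_cast E (u w : R -> R) : AC u w -> AC w (fun x => (V x - E) * u x) ->
  sol (Qz V E%:C%C) (fun x => (u x)%:C%C) (fun x => (w x)%:C%C).
Proof.
move=> au aw; split; first exact: CAC_real.
apply: CAC_ext (CAC_real aw) => // x _.
by change (Complex ((V x - E) * u x) 0 = (Complex (V x) 0 - Complex E 0) * Complex (u x) 0);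
 apply: C_eq; rewrite !CE; rewrite /=; ring.
Qed.

(** The right-hand side is the squared norm on [[0, 1]] of the solution [al c + be s], which
    vanishes only for zero Cauchy data. *)
Lemma gram_pos E (al be : R) : (al != 0) || (be != 0) ->
  0 < al ^+ 2 * I1 (fun x => c E x * c E x) + 2 * al * be * I1 (fun x => s E x * c E x) + be ^+ 2 * I1 (fun x => s E x * s E x).
Proof.
move=> ab; have [[a1 a2] [a3 a4] [i1 i2] [i3 i4]] := hf E.
pose u x := al * c E x + be * s E x; pose w x := al * c1 E x + be * s1 E x.
have au : AC u w by apply: AC_add; apply: AC_scale.
have aw : AC w (fun x => (V x - E) * u x).
 by apply: AC_ext (AC_add (AC_scale al a2) (AC_scale be a4)) => // x _; rewrite /u; ring.
have su := sol_cast au aw.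
have Icc := LI_prod a1 a1; have Isc := LI_prod a3 a1; have Iss := LI_prod a3 a3.
have e : N2 (fun x => (u x)%:C%C) 1 = al ^+ 2 * I1 (fun x => c E x * c E x) + 2 * al * be * I1 (fun x => s E x * c E x) + be ^+ 2 * I1 (fun x => s E x * s E x).
 rewrite -I1_lin // -[X in _ + X]mul1r -[X in X + _]mul1r. rewrite -(mul1r (I1 _)) mulrA mulr1.
 have h := I1_lin 1 (be ^+ 2) (LI_add (LI_scale (al ^+ 2) Icc) (LI_scale (2 * al * be) Isc)) Iss.
 rewrite !mul1r; rewrite mul1r in h; rewrite -h /N2 /I1; congr Rint; apply/funext => x. by rewrite /nsq ReC ImC /u; ring.
rewrite -e lt_neqAle N2_ge0 ?andbT //; last exact: CAC_CLB (proj1 su).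
apply/negP => /eqP /esym N0; have := N2_eq0 IV aKv Q00 uni su (lexx 1) N0.
rewrite /U2 /nsq !ReC !ImC /u /w i1 i2 i3 i4 => h.
have h1 := sqr_ge0 al; have h2 := sqr_ge0 be.
have [hal hbe] : al ^+ 2 = 0 /\ be ^+ 2 = 0.
 by move: h; rewrite !mulr0 !mulr1 add0r addr0 expr0n /= !addr0 => h; split; lin.
by move/eqP: hal; move/eqP: hbe; rewrite !sqrf_eq0 => /eqP b0 /eqP a0; move: ab; rewrite a0 b0 eqxx.
Qed.

Lemma gram E : [/\ 0 < I1 (fun x => c E x * c E x), 0 < I1 (fun x => s E x * s E x) &
  I1 (fun x => s E x * c E x) ^+ 2 < I1 (fun x => c E x * c E x) * I1 (fun x => s E x * s E x)].
Proof.
set A := I1 (fun x => c E x * c E x); set S := I1 (fun x => s E x * s E x); set G := I1 (fun x => s E x * c E x).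
have A0 : 0 < A.
 have := gram_pos E (al := 1) (be := 0); rewrite oner_eq0 /= => /(_ isT). by rewrite expr1n expr0n /= mulr0 !mul0r !addr0 mul1r.
have S0 : 0 < S.
 have := gram_pos E (al := 0) (be := 1); rewrite oner_eq0 orbT => /(_ isT). by rewrite expr1n expr0n /= mulr0 !mul0r !add0r mul1r.
split=> //; have := gram_pos E (al := G) (be := - A); rewrite oppr_eq0 (gt_eqF A0) orbT => /(_ isT).
rewrite -/A -/S -/G (_ : _ + _ = A * (A * S - G ^+ 2)); last by ring.
by rewrite pmulr_rgt0 // subr_gt0.
Qed.

Lemma Tq_diag E : Tq c c1 s s1 E E = c E 1 * I1 (fun x => s E x * c E x) - s E 1 * I1 (fun x => c E x * c E x)
  + c1 E 1 * I1 (fun x => s E x * s E x) - s1 E 1 * I1 (fun x => s E x * c E x).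
Proof. by rewrite /Tq (I1C (c E) (s E)). Qed.

Lemma Tq_neq0 E : D E ^+ 2 <= 4 -> Tq c c1 s s1 E E = 0 -> [/\ s E 1 = 0, c1 E 1 = 0, s1 E 1 = c E 1 & c E 1 ^+ 2 = 1].
Proof.
rewrite Tq_diag => h1 h2; have [A0 S0 G0] := gram E.
exact: quad_zero A0 S0 G0 (fund_wr hf E ler01) h1 h2.
Qed.

Lemma sqr_le4 (x : R) : `|x| <= 2 -> x ^+ 2 <= 4.
Proof. by move=> h; rewrite -real_normK ?num_real //; have : 0 <= `|x| by []; nra. Qed.

(** Inside a band the monodromy matrix is not plus or minus the identity, so [Tq] is nonzero at [E0]
    and keeps half its size nearby. The resulting speed of [D] is what separates energies in the
    small-divisor argument. *)
Lemma disc_elliptic E0 : `|D E0| < 2 -> exists d k b : R, [/\ 0 < d, 0 < k, b < 2 &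
  forall E E', `|E - E0| <= d -> `|E' - E0| <= d -> `|D E| <= b /\ k * `|E - E'| <= `|D E - D E'|].
Proof.
move=> h0; have T0 : Tq c c1 s s1 E0 E0 != 0.
 apply/eqP => /(Tq_neq0 (sqr_le4 (ltW h0)))[_ _ e1 e2]. move: h0; rewrite /disc e1 => h; have : `|c E0 1| < 1.
  by move: h; rewrite -mulr2n normrMn; lra.
 move=> h'; have : `|c E0 1| ^+ 2 < 1 by rewrite expr_lt1. by rewrite real_normK ?num_real // e2 ltxx.
set T := `|Tq c c1 s s1 E0 E0|; have Tp : 0 < T by rewrite normr_gt0.
have [d d0 Hd] := Tq_cont IV hf E0 (divr_gt0 Tp (ltr0n R 2)).
pose eta := (2 - `|D E0|) / 2; have eta0 : 0 < eta by rewrite /eta; lra.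
have T2 : 0 < 2 * T by lra.
pose d' := Num.min d (eta / (2 * T)).
have d'0 : 0 < d' by rewrite lt_min d0 divr_gt0.
exists d', (T / 2), (2 - eta); split=> //; [lra|lra|].
move=> E E'; rewrite !le_min => /andP[h1 h2] /andP[h3 h4].
have lo E1 E2 : `|E1 - E0| <= d -> `|E2 - E0| <= d -> T / 2 <= `|Tq c c1 s s1 E1 E2| /\ `|Tq c c1 s s1 E1 E2| <= 2 * T.
 move=> k1 k2; have := Hd E1 E2 k1 k2 => k3. rewrite /T; move: k3; rewrite -/T; set t := Tq _ _ _ _ _ _; set t0_ := Tq _ _ _ _ E0 E0 => k3.
 have t1 : T <= `|t| + `|t - t0_| by have := ler_normD t (t0_ - t); rewrite addrCA subrr addr0 (distrC t0_).
 have t2 : `|t| <= T + `|t - t0_| by have := ler_normD t0_ (t - t0_); rewrite addrCA subrr addr0. by rewrite -/T; split; lra.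
split; last first.
 rewrite (disc_diff hf E' E) addrAC subrr add0r normrM mulrC ler_wpM2l //; by have [] := lo E' E h3 h1.
rewrite (disc_diff hf E0 E); apply: le_trans (ler_normD _ _) _; rewrite normrM.
have [_ t] := lo E0 E ltac:(by rewrite subrr normr0 ltW) h1.
have : `|E - E0| * `|Tq c c1 s s1 E0 E| <= (eta / (2 * T)) * (2 * T) by apply: ler_pM.
by rewrite divfK ?gt_eqF // /eta; lra.
Qed.

(** If [Tq] vanishes at [E0], the gap is closed and [|D| < 2] on both sides; otherwise [D] crosses
    plus or minus 2 with nonzero speed. *)
Lemma disc_edge E0 : `|D E0| = 2 -> (exists2 d : R, 0 < d & forall E, 0 < `|E - E0| -> `|E - E0| < d -> `|D E| != 2) /\
  (forall e, 0 < e -> exists2 E, `|E - E0| < e & `|D E| < 2).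
Proof.
move=> h0; have D4 : D E0 ^+ 2 <= 4 by apply: sqr_le4; rewrite h0.
have [T0|T0] := eqVneq (Tq c c1 s s1 E0 E0) 0.
- have [b0 k0 da a2] := Tq_neq0 D4 T0; have [A0 S0 G0] := gram E0; have [L L0 HL] := I1_lip IV hf E0.
 have [d [d0 d1] Hd] := edge_small A0 S0 G0 L0. have key E : 0 < `|E - E0| -> `|E - E0| < d -> `|D E| < 2.
  move=> hE h1; have h1' : `|E - E0| <= 1 by apply: le_trans (ltW h1) d1. have z0 : `|E0 - E0| <= 1 by rewrite subrr normr0.
  have z1 : `|E0 - E0| <= `|E - E0| by rewrite subrr normr0. have [k1 k2 k3 k4] := HL E0 E `|E - E0| z0 h1' z1 (lexx _).
  have [f1 f2 f3 f4] := entries hf E0 E. have W := fund_wr hf E ler01.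
  rewrite (I1C (c E0) (s E0)) in k4; have [p1 p2] := Hd _ _ _ _ _ hE h1 k1 k4 k2 k3.
  move: p1 p2 f1 f2 f3 f4; set x := I1 _; set y := I1 _; set z := I1 _; set w := I1 _; set hh := E - E0; set a := c E0 1.
  clearbody x y z w hh => p1 p2 f1 f2 f3 f4. rewrite f1 f2 f3 f4 b0 k0 da -/a in W; rewrite -/a in a2.
  (* Determinant 1 at [E] turns the first-order change of the trace into a second-order one. *)
  have tr : hh * (z - w) = hh ^+ 2 * (z * w - x * y).
   have : a ^+ 2 * ((1 + hh * z) * (1 - hh * w) + hh ^+ 2 * (x * y)) = 1 by rewrite -[RHS]W; ring.
   rewrite a2 mul1r => hW; apply/eqP; rewrite -subr_eq0; apply/eqP.
   rewrite [LHS](_ : _ = (1 + hh * z) * (1 - hh * w) + hh ^+ 2 * (x * y) - 1); last by ring. by rewrite hW subrr.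
  have DE : D E = a * (2 - hh ^+ 2 * (x * y - z * w)).
   rewrite /disc f1 f4 b0 k0 da -/a (_ : 2 - _ = 2 + hh * (z - w)); last by rewrite tr; ring. by ring.
  have an : `|a| = 1 by apply/eqP; rewrite -(@eqrXn2 _ 2) // expr1n real_normK ?num_real // a2.
  rewrite DE normrM an mul1r ltr_norml; apply/andP; split; lin.
 split; first by exists d => // E e1 e2; rewrite lt_eqF // key.
 move=> e e0; pose h := Num.min d e / 2; have h1 : 0 < h by rewrite /h divr_gt0 // lt_min d0.
 have hm : h < Num.min d e by rewrite /h ltr_pdivrMr // ltr_pMr ?ltr1n // lt_min d0.
 exists (E0 + h); first rewrite addrAC subrr add0r (gtr0_norm h1).
  by apply: lt_le_trans hm _; rewrite ge_min lexx orbT.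
 apply: key; rewrite addrAC subrr add0r (gtr0_norm h1) //. by apply: lt_le_trans hm _; rewrite ge_min lexx.
- set T := Tq c c1 s s1 E0 E0 in T0; have Tp : 0 < `|T| by rewrite normr_gt0.
 have [d d0 Hd] := Tq_cont IV hf E0 (divr_gt0 Tp (ltr0n R 2)).
 pose d' := Num.min d (1 / `|T|); have d'0 : 0 < d' by rewrite lt_min d0 divr_gt0.
 have key E : `|E - E0| < d' -> exists2 t : R, D E = D E0 + (E - E0) * t & [/\ 0 < t * T, `|t| <= 2 * `|T| & `|(E - E0) * t| <= 2].
  rewrite lt_min => /andP[h1 h2]; exists (Tq c c1 s s1 E0 E); first exact: disc_diff.
  have := Hd E0 E ltac:(by rewrite subrr normr0 ltW) (ltW h1); rewrite -/T; set t := Tq _ _ _ _ _ _ => ht.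
  have t2 : `|t| <= 2 * `|T| by have := ler_normD (t - T) T; rewrite subrK; lin. split=> //.
   have : `|(t - T) * T| <= `|T| ^+ 2 / 2 by rewrite normrM expr2 mulrAC ler_wpM2r.
   rewrite real_normK ?num_real // ler_norml => /andP[k1 _]. have : 0 < T ^+ 2 by rewrite -real_normK ?num_real // exprn_gt0.
   by move: k1; rewrite mulrBl -expr2; lin.
  rewrite normrM; have : `|E - E0| * `|t| <= (1 / `|T|) * (2 * `|T|) by apply: ler_pM => //; exact: ltW.
  by rewrite mulrCA mul1r mulVf ?gt_eqF // mulr1.
 have Dc : D E0 = 2 \/ D E0 = -2.
  by have [p|p] := lerP 0 (D E0); [left|right]; move: h0; rewrite ?(ger0_norm p) ?(ltr0_norm p); lin.
 split.
  exists d' => // E e1 e2; have [t -> [tT _ t2]] := key E e2. apply/eqP => e3; have n0 : (E - E0) * t != 0.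
   rewrite mulf_neq0 //; first by rewrite -normr_gt0. by apply/eqP => t0; move: tT; rewrite t0 mul0r ltxx.
  move: t2 e3 n0; case: Dc => ->; rewrite ler_norml => /andP[k1 k2].
   have -> : `|2 + (E - E0) * t| = 2 + (E - E0) * t by rewrite ger0_norm //; lin. by move=> k3 /eqP; apply; lin.
  have -> : `| -2 + (E - E0) * t| = 2 - (E - E0) * t by rewrite ler0_norm; lin. by move=> k3 /eqP; apply; lin.
 move=> e e0; pose h := Num.min d' e / 2; have h1 : 0 < h by rewrite /h divr_gt0 // lt_min d'0.
 (* The sign of the step [sg] is chosen on the side where [|D|] decreases. *)
 have hm : h < Num.min d' e by rewrite /h ltr_pdivrMr // ltr_pMr ?ltr1n // lt_min d'0. pose sg := if 0 < D E0 * T then - h else h.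
 have sgn : `|sg| = h by rewrite /sg; case: ifP => _; rewrite ?normrN gtr0_norm. exists (E0 + sg); first rewrite addrAC subrr add0r sgn.
  by apply: lt_le_trans hm _; rewrite ge_min lexx orbT.
 have hd' : `|E0 + sg - E0| < d' by rewrite addrAC subrr add0r sgn; apply: lt_le_trans hm _; rewrite ge_min lexx.
 have [t -> [tT _]] := key _ hd'; rewrite addrAC subrr add0r => t2. have neg : sg * t * D E0 < 0.
  have D0 : D E0 != 0 by case: Dc => ->; rewrite ?oppr_eq0 pnatr_eq0. have TT : 0 < T ^+ 2 by rewrite -real_normK ?num_real // exprn_gt0.
  have e1 : sg * (D E0 * T) < 0.
   rewrite /sg; case: ifP => hp; first by rewrite mulNr oppr_lt0 mulr_gt0. have : D E0 * T < 0 by rewrite lt_neqAle mulf_neq0 //= leNgt hp.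
   by move=> h3; rewrite pmulr_rlt0.
  have : (sg * t * D E0) * T ^+ 2 < 0.
   by rewrite (_ : _ * _ = (sg * (D E0 * T)) * (t * T)); [rewrite pmulr_llt0|ring].
  by rewrite pmulr_llt0.
 move: t2 neg; rewrite ler_norml ltr_norml => /andP[k1 k2]; case: Dc => ->; rewrite ?mulrN ?oppr_lt0 => neg; apply/andP; split; lin.
Qed.

Lemma sol_shift1 (E : C) u w : sol (Qz V E) u w -> sol (Qz V E) (fun x => u (x + 1)) (fun x => w (x + 1)).
Proof.
move=> [a1 a2]; split; first exact: CAC_shift a1.
by apply: CAC_ext (CAC_shift ler01 a2) => // x x0; rewrite /Qz per.
Qed.

(** The hypothesis is the characteristic equation of the monodromy matrix. An eigenvector gives
    Cauchy data multiplied by [lam] over one period, and uniqueness of solutions extends this to all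
    [x]. *)
Lemma floquet_eigen E (lam : C) : lam ^+ 2 - (D E)%:C%C * lam + 1 = 0 -> exists phi w,
  [/\ sol (Qz V E%:C%C) phi w, U2 phi w 0 != 0 &
      forall x, 0 <= x -> phi (x + 1) = lam * phi x /\ w (x + 1) = lam * w x].
Proof.
move=> hl; have [[a1 a2] [a3 a4] [i1 i2] [i3 i4]] := hf E.
have W : (c E 1)%:C%C * (s1 E 1)%:C%C - (c1 E 1)%:C%C * (s E 1)%:C%C = 1 by rewrite -!rmorphM -rmorphB (fund_wr hf E ler01).
have DE : (D E)%:C%C = (c E 1)%:C%C + (s1 E 1)%:C%C by rewrite -rmorphD.
move: W DE; set a := (c E 1)%:C%C; set d := (s1 E 1)%:C%C; set k := (c1 E 1)%:C%C; set b := (s E 1)%:C%C => W DE.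
rewrite DE in hl.
(* Either [(b, lam - a)] or [(lam - d, k)] is an eigenvector unless it is zero; if both are, the
   matrix is scalar and [(1, 0)] will do. *)
have [X [Y [XY e1 e2]]] : exists X Y : C, [/\ (X != 0) || (Y != 0), X * a + Y * b = lam * X & X * k + Y * d = lam * Y].
 have [b0|b0] := boolP ((b != 0) || (lam - a != 0)).
  exists b, (lam - a); split=> //; first by ring. apply/eqP; rewrite -subr_eq0; apply/eqP.
  have -> : b * k + (lam - a) * d - lam * (lam - a) = - (lam ^+ 2 - (a + d) * lam + 1) - (a * d - k * b - 1) by ring.
  by rewrite hl W subrr oppr0 addr0.
 move: b0; rewrite negb_or !negbK => /andP[/eqP b0 /eqP la]. have [k0|k0] := boolP ((lam - d != 0) || (k != 0)).
  exists (lam - d), k; split=> //; last by ring. apply/eqP; rewrite -subr_eq0; apply/eqP.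
  have -> : (lam - d) * a + k * b - lam * (lam - d) = - (lam ^+ 2 - (a + d) * lam + 1) - (a * d - k * b - 1) by ring.
  by rewrite hl W subrr oppr0 addr0.
 move: k0; rewrite negb_or !negbK => /andP[_ /eqP k0]. exists 1, 0; split; first by rewrite oner_eq0.
  by rewrite mul1r mul0r addr0 mulr1; apply/eqP; rewrite eq_sym -subr_eq0 la.
 by rewrite mul1r mul0r k0 addr0 mulr0.
have sc := sol_cast a1 a2; have ss := sol_cast a3 a4.
have sp := sol_lin X Y sc ss; exists (fun x => X * (c E x)%:C%C + Y * (s E x)%:C%C), (fun x => X * (c1 E x)%:C%C + Y * (s1 E x)%:C%C).
split=> //.
 rewrite /U2 i1 i2 i3 i4 !mulr0 !mulr1 addr0 add0r; apply/negP => /eqP h. have h1 := nsq_ge0 X; have h2 := nsq_ge0 Y.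
 have X0 : nsq X = 0 by lin. have Y0 : nsq Y = 0 by lin. by move: XY; rewrite (nsq_eq0 X0) (nsq_eq0 Y0) eqxx.
move=> x x0; have s0 := sol_lin lam 0 sp sp.
have := sol_unique (Qz_CLI IV E%:C%C) (sol_shift1 sp) s0.
rewrite !mul0r !addr0 !add0r i1 i2 i3 i4 !mulr0 !mulr1 addr0 add0r => h.
have [h1 h2] := h e1 e2 x x0; split; [rewrite h1|rewrite h2]; by rewrite mul0r addr0.
Qed.

End Discriminant.

(** * Exponential dichotomy in the gaps *)

Section Hyperbolic.
Implicit Types (x y s t e : R).

(** Sources are only locally square-integrable, because in [ess_spec] they come from images of
    domain elements under [H]. *)
Definition sqint (g : R -> C) := CLI g /\ LI (fun x => nsq (g x)).

Lemma N2_ac g : sqint g -> AC (N2 g) (fun x => nsq (g x)).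
Proof. by move=> [_ h]; apply: AC_ext (AC_prim 0 h) => // x x0; rewrite add0r. Qed.
Lemma sqint_CLB g : CLB g -> sqint g.
Proof. by move=> h; split; [exact: CLB_CLI|exact: LB_LI (CLB_nsq h)]. Qed.

Lemma sqint_add g h : sqint g -> CLB h -> sqint (fun x => g x + h x).
Proof.
move=> [g1 g2] hb; have hC := CLB_CLI hb; split; first exact: CLI_add.
have [[gr gi] [hr hi]] := (g1, hb).
have l1 := LI_add (LI_mulLB gr hr) (LI_mulLB gi hi).
apply: LI_ext (LI_add (LI_add g2 (LB_LI (CLB_nsq hb))) (LI_scale 2 l1)) => x x0.
by rewrite /nsq ReD ImD; ring.
Qed.

Lemma sqint_mono g s t : sqint g -> 0 <= s -> s <= t -> N2 g s <= N2 g t.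
Proof. by move=> h s0 st; apply: (AC_homo (N2_ac h) s0 st) => *; exact: nsq_ge0. Qed.

Lemma l1_l2 g (Kg : R -> R) s : sqint g -> AC Kg (fun x => nrm (g x)) -> 0 <= s ->
  (Kg (s + 1) - Kg s) ^+ 2 <= N2 g (s + 1) - N2 g s.
Proof.
move=> hg aK s0; have s1 : s <= s + 1 by rewrite lerDl.
have K0 : Kg s <= Kg (s + 1) by apply: (AC_homo aK s0 s1) => *; exact: nrm_ge0.
have := sqint_mono hg s0 s1 => N0.
rewrite -[leRHS]mulr1; apply: optim_le => //; rewrite ?subr_ge0 // => tau tau0.
have aT := AC_add (AC_scale tau (N2_ac hg)) (AC_scale tau^-1 AC_id).
have := AC_le (AC_scale 2 aK) aT s0 s1; rewrite !mulr1 => h.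
have -> : 2 * (Kg (s + 1) - Kg s) = 2 * Kg (s + 1) - 2 * Kg s by ring.
apply: le_trans (h _) _ => [x _ _|]; last by apply: eqW; ring.
rewrite -nrmE; have := sqr_ge0 (tau * nrm (g x) - 1); rewrite sqrrB expr1n mulr1 exprMn => h2.
by rewrite -(ler_pM2l tau0) mulrDr mulfV ?gt_eqF //; lin.
Qed.

(** Together with [rec_unstable] this is the discrete dichotomy: a quantity contracting forwards is
    summable in terms of its first value, one contracting backwards in terms of its last. *)
Lemma rec_stable (p e : nat -> R) k X n : (forall j, 0 <= p j) -> (forall j, (X <= j)%N -> p j.+1 <= k * p j + e j) ->
  (1 - k) * \sum_(X <= j < X + n) p j <= p X + \sum_(X <= j < X + n) e j.
Proof.
move=> p0 H; suff : (1 - k) * \sum_(X <= j < X + n) p j + p (X + n)%N <= p X + \sum_(X <= j < X + n) e j.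
 by have := p0 (X + n)%N; lin.
elim: n => [|n IH]; first by rewrite addn0 !big_geq // mulr0 add0r addr0.
rewrite addnS !big_nat_recr ?leq_addr //= mulrDr.
by have := H (X + n)%N (leq_addr _ _); lin.
Qed.

Lemma rec_unstable (p e : nat -> R) k X n : (forall j, 0 <= p j) -> 0 <= k -> k <= 1 -> (forall j, (X <= j)%N -> p j <= k * p j.+1 + e j) ->
  (1 - k) * \sum_(X <= j < X + n) p j <= p (X + n)%N + \sum_(X <= j < X + n) e j.
Proof.
move=> p0 k0 k1 H; suff : (1 - k) * \sum_(X <= j < X + n) p j + k * p X <= k * p (X + n)%N + \sum_(X <= j < X + n) e j.
 by have := p0 (X + n)%N; have := p0 X; nra.
elim: n => [|n IH]; first by rewrite addn0 !big_geq // mulr0 add0r addr0.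
rewrite addnS !big_nat_recr ?leq_addr //= mulrDr.
by have := H (X + n)%N (leq_addr _ _); lin.
Qed.

Lemma nsqD_weight (a b : C) t : 0 < t -> nsq (a + b) <= (1 + t) * nsq a + (1 + t^-1) * nsq b.
Proof.
move=> t0; have key x y : (x + y) ^+ 2 <= (1 + t) * x ^+ 2 + (1 + t^-1) * y ^+ 2.
 rewrite -(ler_pM2l t0) mulrDr !mulrA (mulrDr t 1 t^-1) mulfV ?gt_eqF // mulr1. by have := sqr_ge0 (t * x - y); nra.
by rewrite /nsq ReD ImD; have := key (Re a) (Re b); have := key (Im a) (Im b); lin.
Qed.

Variables (V Kv : R -> R) (Q0 : R).
Hypotheses (IV : LI V) (aKv : AC Kv (fun x => `|V x|)) (Q00 : 0 <= Q0)
  (uni : forall s, 0 <= s -> Kv (s + 1) - Kv s <= Q0) (per : forall x, 0 <= x -> V (x + 1) = V x).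

Lemma per_nat (n : nat) x : 0 <= x -> V (n%:R + x) = V x.
Proof.
move=> x0; elim: n => [|n IH]; first by rewrite add0r.
by rewrite -natr1 addrAC per ?IH // addr_ge0.
Qed.

Definition floq E0 (lam : C) (phi w : R -> C) := [/\ sol (Qz V E0%:C%C) phi w, U2 phi w 0 != 0 &
  forall x, 0 <= x -> phi (x + 1) = lam * phi x /\ w (x + 1) = lam * w x].

(** Eigenvectors for distinct eigenvalues are independent: a vanishing Wronskian would make every
    product of the two Cauchy data invariant under replacing [l1] by [l2], hence 0. *)
Lemma floq_indep E0 l1 l2 phi w phi2 w2 : floq E0 l1 phi w -> floq E0 l2 phi2 w2 -> l1 != l2 -> Wr phi w phi2 w2 0 != 0.
Proof.
move=> [s1 n1 m1] [s2 n2 m2] l12; apply/eqP => W0.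
have e0 : phi 0 * w2 0 = w 0 * phi2 0 by apply/eqP; rewrite -subr_eq0; apply/eqP.
have [p1 q1] := m1 0 (lexx 0); have [p2 q2] := m2 0 (lexx 0); rewrite add0r in p1 q1 p2 q2.
have dl : l2 - l1 != 0 by rewrite subr_eq0 eq_sym.
have kill (a b : C) : l2 * (a * b) = l1 * (a * b) -> a * b = 0.
 move=> h; have : (l2 - l1) * (a * b) = 0 by rewrite mulrBl h subrr. by move/eqP; rewrite mulf_eq0 (negbTE dl) => /eqP.
have CQ := Qz_CLI IV E0%:C%C.
have [h1 h2] : phi 0 * phi2 0 = 0 /\ phi 0 * w2 0 = 0.
 have := sol_unique CQ (sol_lin (phi 0) 0 s2 s2) (sol_lin (phi2 0) 0 s1 s1).
 rewrite !mul0r !addr0 => h; have := h (mulrC _ _) ltac:(by rewrite e0 mulrC) 1 ler01.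
 rewrite !mul0r !addr0 p1 q1 p2 q2 => -[a1 a2]; split; apply: kill.
  by rewrite mulrCA a1; ring.
 by rewrite mulrCA a2 e0; ring.
have [h3 h4] : w 0 * phi2 0 = 0 /\ w 0 * w2 0 = 0.
 have := sol_unique CQ (sol_lin (w 0) 0 s2 s2) (sol_lin (w2 0) 0 s1 s1).
 rewrite !mul0r !addr0 => h; have := h ltac:(by rewrite -e0 mulrC) (mulrC _ _) 1 ler01.
 rewrite !mul0r !addr0 p1 q1 p2 q2 => -[a1 a2]; split; apply: kill.
  by rewrite mulrCA a1 -e0; ring.
 by rewrite mulrCA a2; ring.
move/negP: n1; apply; apply/eqP; move/eqP: h1; move/eqP: h2; move/eqP: h3; move/eqP: h4.
rewrite !mulf_eq0; have [z1|z1] := eqVneq (phi2 0) 0; have [z2|z2] := eqVneq (w2 0) 0.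
- by move: n2; rewrite /U2 z1 z2 /nsq /= expr0n /= !addr0 eqxx.
- by rewrite !orbF => /eqP a1 _ /eqP a2 _; rewrite /U2 a1 a2 /nsq /= expr0n /= !addr0.
- by rewrite !orbF => _ /eqP a1 _ /eqP a2; rewrite /U2 a1 a2 /nsq /= expr0n /= !addr0.
- by rewrite !orbF => /eqP a1 _ /eqP a2 _; rewrite /U2 a1 a2 /nsq /= expr0n /= !addr0.
Qed.

(** [u n * wp 0 - w n * phi 0] is the Wronskian at [n] with the Floquet solution restarted there.
    Over one period it is divided by [lam], up to the integral of [h * phi]. *)
Lemma floq_step E0 lam phi wp : floq E0 lam phi wp -> exists2 B : R, 0 <= B &
  forall h u w, solg (Qz V E0%:C%C) h u w -> sqint h -> forall n : nat,
  nsq (lam * (u n.+1%:R * wp 0 - w n.+1%:R * phi 0) - (u n%:R * wp 0 - w n%:R * phi 0)) <= B * (N2 h n.+1%:R - N2 h n%:R).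
Proof.
move=> [[s1 s2] n1 m1]; have [B B0 HB] := CLB_bound (CAC_CLB s1) ler01.
exists (B ^+ 2); first exact: sqr_ge0.
move=> h u w [a1 a2] hh n; have n0 : 0 <= n%:R :> R by [].
have aF := CAC_sub (CAC_mul (CAC_shift n0 a1) s2) (CAC_mul (CAC_shift n0 a2) s1).
have aK := AC_prim 0 (LI_nrm (proj1 hh)); set K := (fun x => 0 + _) in aK.
have [p1 q1] := m1 0 (lexx 0); rewrite add0r in p1 q1.
have := CAC_le_nrm aF (AC_scale B (AC_shift n0 aK)) (lexx 0) ler01.
rewrite p1 q1 !add0r [1 + n%:R]addrC natr1 => HH.
rewrite (_ : lam * _ - _ = u n.+1%:R * (lam * wp 0) - w n.+1%:R * (lam * phi 0) - (u n%:R * wp 0 - w n%:R * phi 0)); last by ring.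
rewrite -nrmE; have {}HH := HH _.
apply: (@le_trans _ _ ((B * K n.+1%:R - B * K n%:R) ^+ 2)).
 rewrite ler_pXn2r ?nnegrE ?nrm_ge0 //.
  apply: HH => x x0 x1; rewrite (addrC x) /Qz per_nat //. rewrite (_ : _ - _ = h (n%:R + x) * phi x); last by rewrite /Qz; ring.
  by rewrite nrmM mulrC ler_wpM2r ?nrm_ge0 ?HB.
 rewrite -mulrBr mulr_ge0 // subr_ge0; apply: (AC_homo aK n0) => [|*]; last exact: nrm_ge0. by rewrite ler_nat.
rewrite -mulrBr exprMn ler_wpM2l ?sqr_ge0 // -natr1; exact: l1_l2.
Qed.

(** The Wronskians [P], [P2] with the two Floquet solutions are coordinates of [(u, w)]; one
    contracts forwards and the other backwards, so the sum over a range of periods is controlled by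
    its two ends and the source. *)
Lemma hyper_sum E0 (lam : R) phi wp phi2 wp2 : 1 < `|lam| -> floq E0 lam%:C%C phi wp -> floq E0 lam^-1%:C%C phi2 wp2 ->
  exists2 B : R, 0 <= B & forall h u w, solg (Qz V E0%:C%C) h u w -> sqint h -> forall X n : nat,
  \sum_(X <= j < X + n) U2 u w j%:R <= B * (U2 u w X%:R + U2 u w (X + n)%:R + (N2 h (X + n)%:R - N2 h X%:R)).
Proof.
move=> l1 f1 f2; have [B1 B10 H1] := floq_step f1; have [B2 B20 H2] := floq_step f2.
set L := `|lam| in l1; have L0 : 0 < L by lin.
have lam0 : lam != 0 by rewrite -normr_gt0.
have l12 : lam%:C%C != (lam^-1)%:C%C :> C.
 apply/eqP => /complexI e; have : `|lam| * `|lam| = 1 by rewrite {2}e -normrM mulfV // normr1. by move: l1; rewrite /L; nra.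
have W0 := floq_indep f1 f2 l12; set Wv := Wr _ _ _ _ 0 in W0.
have nW : 0 < nsq Wv by rewrite lt_neqAle nsq_ge0 andbT eq_sym; apply/eqP => /nsq_eq0 h; move: W0; rewrite h eqxx.
pose F1 := U2 phi wp 0; pose F2 := U2 phi2 wp2 0.
have F10 : 0 <= F1 := U2_ge0 _ _ _. have F20 : 0 <= F2 := U2_ge0 _ _ _.
pose k := L^-1; have k0 : 0 < k by rewrite invr_gt0.
have k1 : k < 1 by rewrite invf_lt1.
pose c1 := (1 + (L - 1)^-1) * (k ^+ 2 * B1); pose c2 := (1 + (L - 1)^-1) * B2.
have L1 : 0 < L - 1 by lin.
have iL : 0 <= (L - 1)^-1 by rewrite invr_ge0 ltW.
have c10 : 0 <= c1 by rewrite mulr_ge0 ?addr_ge0 // mulr_ge0 // sqr_ge0.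
have c20 : 0 <= c2 by rewrite mulr_ge0 ?addr_ge0.
pose Ct := (2 * (F1 + F2) / nsq Wv) / (1 - k) * (2 * (F1 + F2) + c1 + c2).
have k1' : 0 < 1 - k by lin.
have F12 : 0 <= 2 * (F1 + F2) by rewrite mulr_ge0 // addr_ge0.
have Ct0 : 0 <= Ct.
 have d1 : 0 <= 2 * (F1 + F2) / nsq Wv by rewrite divr_ge0 // ltW. have d2 : 0 <= 2 * (F1 + F2) + c1 + c2 by rewrite !addr_ge0.
 by apply: mulr_ge0 => //; rewrite divr_ge0 // ltW.
exists Ct => // h u w sg hh X n.
pose P j := u j%:R * wp 0 - w j%:R * phi 0; pose P2 j := u j%:R * wp2 0 - w j%:R * phi2 0.
pose a j := N2 h j.+1%:R - N2 h j%:R.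
have a0 j : 0 <= a j by rewrite subr_ge0 sqint_mono // ler_nat.
have tele m : \sum_(X <= j < X + m) a j = N2 h (X + m)%:R - N2 h X%:R.
 elim: m => [|m IH]; first by rewrite addn0 big_geq // subrr. by rewrite addnS big_nat_recr ?leq_addr //= IH /a; ring.
have lk : nsq lam%:C%C = L ^+ 2 by rewrite -nrmE nrmC.
have ik : nsq (lam^-1)%:C%C = k ^+ 2 by rewrite -nrmE nrmC normfV.
have r1 j : (X <= j)%N -> nsq (P j.+1) <= k * nsq (P j) + c1 * a j.
 move=> _; have := H1 h u w sg hh j; rewrite -/(P j) -/(P j.+1) -/(a j) => d1.
 have e1 : nsq (lam%:C%C * P j.+1) <= L * nsq (P j) + (1 + (L - 1)^-1) * nsq (lam%:C%C * P j.+1 - P j).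
  by rewrite -{1}(subrKC (P j) (lam%:C%C * P j.+1)); apply: le_trans (nsqD_weight _ _ L1) _; rewrite (subrKC 1 L).
 have e2 : L ^+ 2 * nsq (P j.+1) <= L * nsq (P j) + (1 + (L - 1)^-1) * (B1 * a j).
  by rewrite -lk -nsqM; apply: le_trans e1 _; rewrite lerD2l ler_wpM2l // addr_ge0.
 have k2 : 0 < k ^+ 2 by rewrite exprn_gt0. have := ler_wpM2l (ltW k2) e2; rewrite mulrA -exprMn mulVf ?gt_eqF // expr1n mul1r => e3.
 apply: le_trans e3 _; rewrite mulrDr /c1; apply: eqW. have kL : k ^+ 2 * L = k by rewrite expr2 -mulrA mulVf ?mulr1 // gt_eqF.
 by rewrite (mulrA _ L) kL; ring.
have r2 j : (X <= j)%N -> nsq (P2 j) <= k * nsq (P2 j.+1) + c2 * a j.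
 move=> _; have := H2 h u w sg hh j; rewrite -/(P2 j) -/(P2 j.+1) -/(a j) => d1.
 have e1 : nsq (P2 j) <= L * nsq ((lam^-1)%:C%C * P2 j.+1) + (1 + (L - 1)^-1) * nsq ((lam^-1)%:C%C * P2 j.+1 - P2 j).
  rewrite -{1}(subKr ((lam^-1)%:C%C * P2 j.+1) (P2 j)); apply: le_trans (nsqD_weight _ _ L1) _. by rewrite (subrKC 1 L) nsqN.
 rewrite nsqM ik in e1; apply: le_trans e1 _; apply: lerD.
  by rewrite mulrA expr2 mulrA mulfV ?gt_eqF // mul1r.
 by rewrite /c2 -mulrA ler_wpM2l // addr_ge0.
have s1 := rec_stable n (fun j => nsq_ge0 (P j)) r1.
have s2 := rec_unstable n (fun j => nsq_ge0 (P2 j)) (ltW k0) (ltW k1) r2.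
rewrite -!mulr_sumr tele in s1 s2.
have bP j : nsq (P j) <= 2 * F1 * U2 u w j%:R.
 rewrite /P; apply: le_trans (nsqD_le _ _) _; rewrite nsqN !nsqM /F1 /U2.
 have := nsq_ge0 (u j%:R); have := nsq_ge0 (w j%:R); have := nsq_ge0 (phi 0); have := nsq_ge0 (wp 0); nra.
have bP2 j : nsq (P2 j) <= 2 * F2 * U2 u w j%:R.
 rewrite /P2; apply: le_trans (nsqD_le _ _) _; rewrite nsqN !nsqM /F2 /U2.
 have := nsq_ge0 (u j%:R); have := nsq_ge0 (w j%:R); have := nsq_ge0 (phi2 0); have := nsq_ge0 (wp2 0); nra.
have bU j : U2 u w j%:R <= 2 * (F1 + F2) / nsq Wv * (nsq (P j) + nsq (P2 j)).
 rewrite mulrAC ler_pdivlMr //. have e1 : u j%:R * Wv = P2 j * phi 0 - P j * phi2 0 by rewrite /P /P2 /Wv /Wr; ring.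
 have e2 : w j%:R * Wv = P2 j * wp 0 - P j * wp2 0 by rewrite /P /P2 /Wv /Wr; ring. rewrite /U2 mulrDl -!nsqM e1 e2.
 have t1 := nsqD_le (P2 j * phi 0) (- (P j * phi2 0)); have t2 := nsqD_le (P2 j * wp 0) (- (P j * wp2 0)).
 rewrite !nsqN !nsqM in t1 t2; rewrite /F1 /F2 /U2.
 have := nsq_ge0 (P j); have := nsq_ge0 (P2 j); have := nsq_ge0 (phi 0); have := nsq_ge0 (wp 0); have := nsq_ge0 (phi2 0); have := nsq_ge0 (wp2 0).
 move: t1 t2; set x1 := nsq (phi 0); set x2 := nsq (wp 0); set x3 := nsq (phi2 0); set x4 := nsq (wp2 0); set y1 := nsq (P j); set y2 := nsq (P2 j).
 move=> t1 t2 h1 h2 h3 h4 h5 h6; have : 0 <= y1 * (x1 + x2) + y2 * (x3 + x4) by rewrite addr_ge0 // mulr_ge0 // addr_ge0. lin.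
set S1 := \sum_(X <= j < X + n) nsq (P j) in s1; set S2 := \sum_(X <= j < X + n) nsq (P2 j) in s2.
set A := N2 h (X + n)%:R - N2 h X%:R in s1 s2 *.
have A0 : 0 <= A by rewrite subr_ge0 sqint_mono // ler_nat leq_addr.
apply: (@le_trans _ _ (2 * (F1 + F2) / nsq Wv * (S1 + S2))).
 by rewrite -big_split mulr_sumr; apply: ler_sum => j _; exact: bU.
set Z := _ + _ + A.
have -> : Ct * Z = 2 * (F1 + F2) / nsq Wv * (((2 * (F1 + F2) + c1 + c2) * Z) / (1 - k)) by rewrite /Ct; ring.
apply: ler_wpM2l; first by rewrite divr_ge0 // ltW.
rewrite ler_pdivlMr // mulrC /Z.
have U0 := U2_ge0 u w X%:R; have Un := U2_ge0 u w (X + n)%:R.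
have := bP X; have := bP2 (X + n)%N; set x := U2 u w X%:R in U0 *; set y := U2 u w (X + n)%:R in Un *.
move=> q1 q2; rewrite mulrDr.
apply: (@le_trans _ _ (2 * F1 * x + c1 * A + (2 * F2 * y + c2 * A))); first by lin.
have : 0 <= (F1 + F2) * A by rewrite mulr_ge0 // addr_ge0.
have : 0 <= (c1 + c2) * (x + y) by rewrite mulr_ge0 // addr_ge0.
have : 0 <= F1 * y + F2 * x by rewrite addr_ge0 // mulr_ge0.
lin.
Qed.

End Hyperbolic.

(** * The space [L2] on the half-line *)

Section SquareIntegrableHalfline.
Implicit Types (f g : R -> R) (x y s t e E : R).

Lemma L2_intble f : L2 f -> leb.-integrable (@halfline R) (EFin \o (fun x => f x ^+ 2)).
Proof.
move=> [mf hf]; apply/integrableP; split.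
 by apply/measurable_EFinP; apply: measurable_funX.
by under eq_integral => x _ do rewrite /= ger0_norm ?sqr_ge0 //.
Qed.

Lemma halfline_sub x : `[0, x]%classic `<=` @halfline R.
Proof. by move=> y; rewrite /halfline /= !in_itv /= andbT => /andP[]. Qed.

Lemma L2_LI f : L2 f -> LI f /\ LI (fun x => f x ^+ 2).
Proof.
move=> hf; have h2 : LI (fun x => f x ^+ 2).
 move=> x x0; apply: integrableS (L2_intble hf) => //; [exact: meas_half|exact: halfline_sub].
split=> // x x0; have [mf _] := hf.
apply: (le_integrable _ _ _ (LI_add (LI_cst 1) h2 x0)) => //.
 by apply/measurable_EFinP; apply: measurable_funS mf; [exact: meas_half|exact: halfline_sub].
move=> y _ /=; rewrite lee_fin [leRHS]ger0_norm ?addr_ge0 ?sqr_ge0 //.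
by rewrite -(real_normK (num_real (f y))); have := sqr_ge0 (`|f y| - 1); nra.
Qed.

Lemma L2_lin f g (k : R) : L2 f -> L2 g -> L2 (fun x => f x + k * g x).
Proof.
move=> hf hg; have [mf _] := hf; have [mg _] := hg.
have mfg : measurable_fun (@halfline R) (fun x => f x + k * g x).
 by apply: measurable_funD => //; apply: measurable_funM => //; exact: measurable_cst.
split=> //.
have i1 := integrableD meas_half (integrableZl meas_half 2 (L2_intble hf)) (integrableZl meas_half (2 * k ^+ 2) (L2_intble hg)).
move/integrableP: i1 => [_]; apply: le_lt_trans; apply: ge0_le_integral => //.
- exact: meas_half.
- by move=> x _; rewrite lee_fin sqr_ge0.
- by apply/measurable_EFinP; apply: measurable_funX.
- apply: measurableT_comp => //; apply/measurable_EFinP; apply: measurable_funD; apply: measurable_funM; try exact: measurable_cst; exact: measurable_funX.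
- move=> x _; change (((f x + k * g x) ^+ 2)%:E <= (`|2 * f x ^+ 2 + (2 * k ^+ 2) * g x ^+ 2|)%:E)%E; rewrite lee_fin.
 have := sqr_ge0 (f x); have := sqr_ge0 (k * g x) => h1 h2; rewrite [leRHS]ger0_norm; last by lin.
 by have := sqr_ge0 (f x - k * g x); rewrite !sqrrD !sqrrN; lin.
Qed.

Lemma N2_le_Rint (a b : R -> R) x : L2 a -> L2 b -> 0 <= x ->
  N2 (fun y => Complex (a y) (b y)) x <= Rint (@halfline R) (fun y => a y ^+ 2 + b y ^+ 2).
Proof.
move=> ha hb x0; have [_ a2] := L2_LI ha; have [_ b2] := L2_LI hb.
have i1 := integrableD meas_half (L2_intble ha) (L2_intble hb).
have aP := AC_prim 0 (LI_add a2 b2).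
have p0 y : 0 <= y -> 0 <= a y ^+ 2 + b y ^+ 2 by rewrite addr_ge0 ?sqr_ge0.
have fk : (\int[leb]_(y in @halfline R) (a y ^+ 2 + b y ^+ 2)%:E)%E \is a fin_num by exact: (integrable_fin_num meas_half i1).
have := halfline_ge aP p0 _ x0; rewrite RintI0 addr0 add0r => /(_ erefl).
by rewrite -(fineK fk) lee_fin.
Qed.

End SquareIntegrableHalfline.

(** * Real Floquet multipliers *)

Section Roots.
Lemma hyp_root (D : R) : 2 < `|D| -> exists2 lam : R, 1 < `|lam| & lam ^+ 2 - D * lam + 1 = 0.
Proof.
have pos (d : R) : 2 < d -> exists2 lam : R, 1 < lam & lam ^+ 2 - d * lam + 1 = 0.
 move=> h; have h4 : 0 <= d ^+ 2 - 4 by nra. have s0 := sqrtr_ge0 (d ^+ 2 - 4); exists ((d + Num.sqrt (d ^+ 2 - 4)) / 2); first by lin.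
 have s2 := sqr_sqrtr h4; set s := Num.sqrt _ in s0 s2 *. rewrite (_ : _ + 1 = (s ^+ 2 - (d ^+ 2 - 4)) / 4); last by field.
 by rewrite s2 subrr mul0r.
have [d0|d0] := lerP 0 D; [rewrite (ger0_norm d0)|rewrite (ltr0_norm d0)] => h; have [l l1 hl] := pos _ h.
 by exists l => //; rewrite gtr0_norm // (lt_trans ltr01).
by exists (- l); [rewrite normrN gtr0_norm // (lt_trans ltr01)|rewrite -hl; ring].
Qed.
End Roots.

(** * Floquet data in a gap, and Cauchy data along weakly null sequences *)

Section EssentialSpectrum.
Implicit Types (x y s t e E : R).

Lemma fund_family (V : R -> R) : LI V -> exists c c1 s s1 : R -> R -> R, forall E, fund V E (c E) (c1 E) (s E) (s1 E).
Proof.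
move=> IV; have [f hf] := choice (fun E => fund_exists E IV).
by exists (fun E => (f E).1.1), (fun E => (f E).1.2), (fun E => (f E).2.1), (fun E => (f E).2.2).
Qed.

Lemma hyp_floq (V : R -> R) (IV : LI V) (per : forall x, 0 <= x -> V (x + 1) = V x)
  (c c1 s s1 : R -> R -> R) : (forall E, fund V E (c E) (c1 E) (s E) (s1 E)) ->
  forall E0, 2 < `|disc c s1 E0| -> exists (lam : R) phi wp phi2 wp2,
    [/\ 1 < `|lam|, floq V E0 lam%:C%C phi wp & floq V E0 lam^-1%:C%C phi2 wp2].
Proof.
move=> hf E0 /hyp_root[lam l1 hl].
have l0 : lam != 0 by rewrite -normr_gt0 (lt_trans ltr01).
have h1 : lam%:C%C ^+ 2 - (disc c s1 E0)%:C%C * lam%:C%C + 1 = 0 :> C.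
 by rewrite -rmorphXn -rmorphM -rmorphB -(rmorph1 (real_complex R)) -rmorphD hl.
have hl2 : lam^-1 ^+ 2 - disc c s1 E0 * lam^-1 + 1 = 0.
 by rewrite (_ : _ + 1 = (lam ^+ 2 - disc c s1 E0 * lam + 1) / lam ^+ 2); [rewrite hl mul0r|field].
have h2 : lam^-1%:C%C ^+ 2 - (disc c s1 E0)%:C%C * lam^-1%:C%C + 1 = 0 :> C.
 by rewrite -rmorphXn -rmorphM -rmorphB -(rmorph1 (real_complex R)) -rmorphD hl2.
have [p [w [a1 a2 a3]]] := floquet_eigen IV per hf h1; have [p2 [w2 [b1 b2 b3]]] := floquet_eigen IV per hf h2.
by exists lam, p, w, p2, w2.
Qed.

Variables (q Kq : R -> R) (Q1 : R).
Hypotheses (Iq : LI q) (aKq : AC Kq (fun x => `|q x|)) (Q10 : 0 <= Q1)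
  (uniq : forall s, 0 <= s -> Kq (s + 1) - Kq s <= Q1).

(** Along a weakly null sequence of approximate eigenfunctions the Cauchy data at 0 tend to 0. On
    [[0, 1]] such a function is [al c + be s] up to a remainder whose square is of order [del], and
    pairing with [c] and [s] recovers [al] and [be] by inverting the Gram matrix. *)
Lemma weak_coeff E : exists (c s : R -> R) (Cst : R), [/\ LB c, LB s, 0 <= Cst & forall a w f (del : R),
  AC a w -> AC w (fun t => q t * a t - f t) -> LI f -> LI (fun x => (f x - E * a x) ^+ 2) ->
  I1 (fun x => (f x - E * a x) ^+ 2) <= del ->
  a 0 ^+ 2 + w 0 ^+ 2 <= Cst * (I1 (fun x => a x * c x) ^+ 2 + I1 (fun x => a x * s x) ^+ 2 + del)].
Proof.
have [c [c1 [s [s1 hf]]]] := fund_family Iq.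
have [A0 S0 G0] := gram Iq aKq Q10 uniq hf E; have [[a1 a2] [a3 a4] [i1 i2] [i3 i4]] := hf E.
set A := I1 (fun x => c E x * c E x) in A0 G0; set S := I1 (fun x => s E x * s E x) in S0 G0.
set G := I1 (fun x => s E x * c E x) in G0; pose Dt := A * S - G ^+ 2; have Dt0 : 0 < Dt by rewrite subr_gt0.
have [K aK K0] := sol_CLI_K (Qz_CLI Iq E%:C%C).
pose Ek := expR (K 1 - K 0); have Ek0 : 0 < Ek by exact: expR_gt0.
pose B := A + S + `|G| + 1; have Gn : 0 <= `|G| by [].
have AB : A <= B by rewrite /B; lin.
have SB : S <= B by rewrite /B; lin.
have GB : `|G| <= B by rewrite /B; lin.
have B1 : 1 <= B by rewrite /B; lin.
exists (c E), (s E), (16 * B ^+ 3 * (Ek + 1) / Dt ^+ 2); split.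
- exact: AC_LB a1.
- exact: AC_LB a3.
- apply: divr_ge0; last exact: sqr_ge0.
 apply: mulr_ge0; last by rewrite addr_ge0 // ltW. by apply: mulr_ge0 => //; rewrite exprn_ge0 // (le_trans ler01).
move=> a w f del aa aw If Ig hdel; set al := a 0; set be := w 0.
pose r x := a x - (al * c E x + be * s E x); pose r1 x := w x - (al * c1 E x + be * s1 E x).
pose g x := f x - E * a x.
have ar : AC r r1 by apply: AC_sub => //; apply: AC_add; apply: AC_scale.
have ar1 : AC r1 (fun x => (q x - E) * r x - g x).
 by apply: AC_ext (AC_sub aw (AC_add (AC_scale al a2) (AC_scale be a4))) => // x _; rewrite /r /g; ring.
have Ig1 : LI g by apply: LI_sub => //; apply: LI_scale; exact: AC_LI aa.
have sgr : solg (Qz q E%:C%C) (fun x => (g x)%:C%C) (fun x => (r x)%:C%C) (fun x => (r1 x)%:C%C).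
 split; first exact: CAC_real. apply: CAC_ext (CAC_real ar1) => // x _; rewrite /Qz. by rewrite rmorphB rmorphM rmorphB.
have sqg : sqint (fun x => (g x)%:C%C).
 split; first exact: CLI_real. by apply: LI_ext Ig => x _; rewrite /nsq ReC ImC expr0n /= addr0.
have Ng x : 0 <= x -> x <= 1 -> N2 (fun x => (g x)%:C%C) x <= del.
 move=> x0 x1; apply: le_trans (sqint_mono sqg x0 x1) _; apply: le_trans hdel.
 by rewrite /N2 /I1; apply: eqW; congr Rint; apply/funext => y; rewrite /nsq ReC ImC expr0n /= addr0.
have del0 : 0 <= del by apply: le_trans (Ng 0 (lexx 0) ler01); rewrite N2_0.
have rb x : 0 <= x -> x <= 1 -> r x ^+ 2 <= Ek * del.
 move=> x0 x1; have [gr _] := solg_growth sgr aK (N2_ac sqg) (lexx 0) x0.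
 apply: (@le_trans _ _ (U2 (fun x => (r x)%:C%C) (fun x => (r1 x)%:C%C) x)).
  by rewrite /U2 /nsq !ReC !ImC expr0n /= !addr0 lerDl sqr_ge0.
 apply: le_trans gr _; rewrite {1}/U2 {1}/r {1}/r1 i1 i2 i3 i4 !mulr0 !mulr1 addr0 add0r !subrr N2_0.
 rewrite {1 2}/nsq ReC ImC expr0n /= !add0r subr0; apply: ler_pM => //; rewrite ?expR_ge0 //.
 - by have := sqint_mono sqg (lexx 0) x0; rewrite N2_0.
 - by rewrite ler_expR lerD2r; apply: (AC_homo aK x0 x1) => y *; rewrite addr_ge0 ?nrm_ge0.
 - exact: Ng.
have Irr : LI (fun x => r x * r x) := LI_prod ar ar.
have CS (v v1 : R -> R) : AC v v1 -> I1 (fun x => r x * v x) ^+ 2 <= (Ek * del) * I1 (fun x => v x * v x).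
 move=> av; have Irv : LI (fun x => r x * v x) := LI_prod ar av.
 have aF : CAC (fun x => (0 + Rint `[0, x] (fun y => r y * v y))%:C%C) (fun x => (r x)%:C%C * (v x)%:C%C).
  by apply: CAC_ext (CAC_real (AC_prim 0 Irv)) => // x _; rewrite rmorphM.
 have := CS_le (CAC_CLB (CAC_real ar)) (CAC_CLB (CAC_real av)) aF ler01.
 rewrite RintI0 add0r addr0 subr0 {1}/nsq ReC ImC expr0n /= addr0 => h; apply: le_trans h _.
 have sq (p : R -> R) : N2 (fun x => (p x)%:C%C) 1 = I1 (fun x => p x * p x).
  by rewrite /N2 /I1; congr Rint; apply/funext => y; rewrite /nsq ReC ImC expr0n /= addr0.
 rewrite !sq; apply: ler_wpM2r.
  rewrite -sq; apply: N2_ge0 => //; exact: CAC_CLB (CAC_real av).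
 have := Rint_le Irr (LI_scale (Ek * del) (LI_cst 1)) ler01; rewrite -/(I1 _) => hh; apply: le_trans (hh _) _.
  by move=> x x0 x1; rewrite mulr1 -expr2 rb.
 by rewrite (Rint_scale _ (LI_cst 1) ler01) (Rint_prim AC_id ler01) subr0 mulr1.
have CSc := CS _ _ a1; have CSs := CS _ _ a3; rewrite -/A in CSc; rewrite -/S in CSs.
set x := I1 (fun x => a x * c E x); set y := I1 (fun x => a x * s E x).
set p := I1 (fun x => r x * c E x) in CSc; set z := I1 (fun x => r x * s E x) in CSs.
have ex : x = p + al * A + be * G.
 rewrite /p /A /G /x. have := I1_lin 1 1 (LI_prod ar a1) (LI_add (LI_scale al (LI_prod a1 a1)) (LI_scale be (LI_prod a3 a1))).
 rewrite !mul1r (I1_lin al be (LI_prod a1 a1) (LI_prod a3 a1)) addrA => <-; congr I1; apply/funext => t; rewrite /r; ring.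
have ey : y = z + al * G + be * S.
 rewrite /z /S /G /y. have := I1_lin 1 1 (LI_prod ar a3) (LI_add (LI_scale al (LI_prod a3 a1)) (LI_scale be (LI_prod a3 a3))).
 rewrite !mul1r (I1_lin al be (LI_prod a3 a1) (LI_prod a3 a3)) addrA => <-; congr I1; apply/funext => t; rewrite /r; ring.
have eal : al * Dt = S * (x - p) - G * (y - z) by rewrite ex ey /Dt; ring.
have ebe : be * Dt = A * (y - z) - G * (x - p) by rewrite ex ey /Dt; ring.
have d2 : 0 < Dt ^+ 2 by rewrite exprn_gt0.
rewrite mulrAC ler_pdivlMr // mulrDl -!exprMn eal ebe.
have sq4 (k1 k2 m1 m2 M : R) : `|k1| <= B -> `|k2| <= B -> m1 ^+ 2 + m2 ^+ 2 <= M -> (k1 * m1 - k2 * m2) ^+ 2 <= 2 * B ^+ 2 * M.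
 move=> h1 h2 h3; have B0 : 0 <= B by exact: le_trans B1.
 have q1 : k1 ^+ 2 <= B ^+ 2 by rewrite -(real_normK (num_real k1)) ler_pXn2r ?nnegrE.
 have q2 : k2 ^+ 2 <= B ^+ 2 by rewrite -(real_normK (num_real k2)) ler_pXn2r ?nnegrE.
 have q3 : k1 ^+ 2 * m1 ^+ 2 <= B ^+ 2 * m1 ^+ 2 by rewrite ler_wpM2r ?sqr_ge0.
 have q4 : k2 ^+ 2 * m2 ^+ 2 <= B ^+ 2 * m2 ^+ 2 by rewrite ler_wpM2r ?sqr_ge0.
 have q5 : (k1 * m1 - k2 * m2) ^+ 2 <= 2 * (k1 ^+ 2 * m1 ^+ 2 + k2 ^+ 2 * m2 ^+ 2).
  by have := sqr_ge0 (k1 * m1 + k2 * m2); rewrite sqrrB sqrrD !exprMn; lin.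
 have q6 : B ^+ 2 * (m1 ^+ 2 + m2 ^+ 2) <= B ^+ 2 * M by rewrite ler_wpM2l ?sqr_ge0. lin.
pose M := 2 * (x ^+ 2 + y ^+ 2 + 2 * (Ek * del * B)).
have Ed : 0 <= Ek * del by rewrite mulr_ge0 // ltW.
have hM : (x - p) ^+ 2 + (y - z) ^+ 2 <= M.
 have t1 : Ek * del * A <= Ek * del * B by rewrite ler_wpM2l. have t2 : Ek * del * S <= Ek * del * B by rewrite ler_wpM2l.
 have := sqr_ge0 (x + p); have := sqr_ge0 (y + z); rewrite /M !sqrrB !sqrrD; lin.
have nA : `|A| <= B by rewrite gtr0_norm.
have nS : `|S| <= B by rewrite gtr0_norm.
have f1 := sq4 S G _ _ M nS GB hM; rewrite [X in X <= _]addrC in hM.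
have f2 := sq4 A G _ _ M nA GB hM.
apply: le_trans (lerD f1 f2) _.
have -> : 2 * B ^+ 2 * M + 2 * B ^+ 2 * M = 8 * B ^+ 2 * (x ^+ 2 + y ^+ 2) + 16 * B ^+ 3 * Ek * del by rewrite /M; ring.
have b2 : 0 <= B ^+ 2 by exact: sqr_ge0.
have b3 : B ^+ 2 <= B ^+ 3 by rewrite (exprS B 2) ler_peMl.
have xy : 0 <= x ^+ 2 + y ^+ 2 by rewrite addr_ge0 ?sqr_ge0.
have b30 : 0 <= B ^+ 3 by exact: le_trans b3.
rewrite (_ : _ * _ * (_ + del) = 16 * (B ^+ 3 * (x ^+ 2 + y ^+ 2)) + 16 * B ^+ 3 * Ek * del + 16 * (B ^+ 3 * Ek * (x ^+ 2 + y ^+ 2)) + 16 * (B ^+ 3 * del)); last by ring.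
have u1 : B ^+ 2 * (x ^+ 2 + y ^+ 2) <= B ^+ 3 * (x ^+ 2 + y ^+ 2) by rewrite ler_wpM2r.
have u2 : 0 <= B ^+ 3 * Ek * (x ^+ 2 + y ^+ 2) by rewrite mulr_ge0 // mulr_ge0 // ltW.
have u3 : 0 <= B ^+ 3 * del by rewrite mulr_ge0.
have u4 : 0 <= B ^+ 2 * (x ^+ 2 + y ^+ 2) by rewrite mulr_ge0.
lin.
Qed.

End EssentialSpectrum.

(** * Functions cut off to an interval *)

Section Truncation.
Implicit Types (x y s t e E T : R) (f g : R -> R).

Lemma halfline_trunc (F : R -> \bar R) T : (forall x, T < x -> F x = 0%E) ->
  (\int[leb]_(x in @halfline R) F x = \int[leb]_(x in `[0%R, T]%classic) F x)%E.
Proof.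
move=> h; rewrite -(setIidr (@halfline_sub T)) integral_mkcondr; apply: eq_integral => x /set_mem.
rewrite /halfline /= in_itv /= andbT => x0; rewrite patchE; case: ifPn => //.
by rewrite notin_setE /= in_itv /= x0 /= => /negP; rewrite -ltNge => /h.
Qed.

Lemma L2_trunc f T : 0 <= T -> LB f -> (forall x, T < x -> f x = 0) -> L2 f.
Proof.
move=> T0 bf h; split; first by apply: meas_ray => x x0; have [] := bf x x0.
rewrite (@halfline_trunc _ T) => [|x Tx]; last by rewrite h // expr0n.
have := LB_LI (LB_mul bf bf) T0; rewrite /=; move/integrableP => [_]; apply: le_lt_trans.
by apply: eqW; apply: eq_integral => x _ /=; rewrite -expr2 ger0_norm ?sqr_ge0.
Qed.

Lemma LB_indic (s t : R) : LB (fun x => \1_(`[s, t]%classic) x : R).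
Proof.
move=> x x0; split; first by apply: measurable_indic; exact: measurable_itv.
by exists 1 => y _ _; rewrite indicE; case: (_ \in _); rewrite ?normr1 ?normr0.
Qed.

(** The vanishing of [f] at the ends gives continuity of the zero extension. The derivative has to
    vanish there as well because [AC_lip] compares derivatives at every point, ends included. *)
Lemma AC_restrict f g (s t : R) : 0 <= s -> s <= t -> AC f g -> f s = 0 -> f t = 0 -> g s = 0 -> g t = 0 ->
  AC (fun x => \1_(`[s, t]%classic) x * f x) (fun x => \1_(`[s, t]%classic) x * g x).
Proof.
move=> s0 st af fs ft gs gt_; have t0 : 0 <= t by exact: le_trans st.
have aF := AC_prim 0 (LB_mulLI (LB_indic s t) (proj1 af)); set F := (fun x => 0 + _) in aF.
have ind x : s <= x -> x <= t -> \1_(`[s, t]%classic) x = 1 :> R by move=> h1 h2; rewrite indicE mem_set //= in_itv /= h1 h2.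
have out x : ~~ ((s <= x) && (x <= t)) -> \1_(`[s, t]%classic) x = 0 :> R.
 by move=> h; rewrite indicE memNset //= in_itv /=; exact/negP.
have F0 : F 0 = 0 by rewrite /F RintI0 addr0.
have Fl x : 0 <= x -> x <= s -> F x = 0.
 move=> x0 xs; have := AC_lip (M := 0) aF (lexx 0) x0; rewrite F0 subr0 mul0r => h. apply/eqP; rewrite -normr_le0; apply: h => y y0 yx.
 have [ys|ys] := leP s y; last by rewrite out ?mul0r ?normr0 // negb_and -ltNge ys.
 by rewrite (_ : y = s) ?gs ?mulr0 ?normr0 //; apply/eqP; rewrite eq_le ys (le_trans yx).
have Fm x : s <= x -> x <= t -> F x = f x.
 move=> sx xt; have := AC_lip (M := 0) (AC_sub aF af) s0 sx; rewrite mul0r (Fl s s0 (lexx s)) fs subr0 => h.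
 apply/eqP; rewrite -subr_eq0 -normr_le0; move: h; rewrite subr0; apply=> y y0 yx. by rewrite ind ?(le_trans yx) // mul1r subrr normr0.
have Fr x : t <= x -> F x = 0.
 move=> tx; have := AC_lip (M := 0) aF t0 tx; rewrite (Fm t st (lexx t)) ft subr0 mul0r => h.
 apply/eqP; rewrite -normr_le0; apply: h => y ty yx.
 have [yt|yt] := leP y t; last by rewrite out ?mul0r ?normr0 // negb_and -!ltNge yt orbT.
 by rewrite (_ : y = t) ?gt_ ?mulr0 ?normr0 //; apply/eqP; rewrite eq_le ty yt.
apply: AC_ext aF => // x x0; have [sx|xs] := leP s x; last by rewrite Fl ?(ltW xs) // out ?mul0r // negb_and -ltNge xs.
by have [xt|xt] := leP x t; [rewrite Fm // ind ?mul1r|rewrite Fr ?(ltW xt) // out ?mul0r // negb_and -!ltNge xt orbT].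
Qed.

Lemma CAC_restrict (f g : R -> C) (s t : R) : 0 <= s -> s <= t -> CAC f g -> f s = 0 -> f t = 0 -> g s = 0 -> g t = 0 ->
  CAC (fun x => (\1_(`[s, t]%classic) x : R)%:C%C * f x) (fun x => (\1_(`[s, t]%classic) x : R)%:C%C * g x).
Proof.
move=> s0 st [af ag] e1 e2 e3 e4; split.
 have h := AC_restrict s0 st af; rewrite e1 e2 e3 e4 in h.
 by apply: AC_ext (h erefl erefl erefl erefl) => x _; rewrite ReM ReC ImC mul0r subr0.
have h := AC_restrict s0 st ag; rewrite e1 e2 e3 e4 in h.
by apply: AC_ext (h erefl erefl erefl erefl) => x _; rewrite ImM ReC ImC mul0r addr0.
Qed.

End Truncation.

(** * Polynomial cutoffs, and multipliers on the unit circle *)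

Section PolynomialCutoff.
Implicit Types (x r : R).
(** [X0] is the cube of the parabola with zeros [r] and [5 r], so that two derivatives vanish at the
    ends. It is at least [r ^+ 6] in the middle, while its derivatives are of order [r ^+ 5] (the
    second even [r ^+ 4], weakened by [1 <= r]); the quotient [1 / r] will make the cutoff error
    small. *)
Lemma poly_cutoff : exists2 Z : R, 0 <= Z & forall r, 1 <= r -> exists X0 X1 X2 : R -> R,
  [/\ [/\ AC X0 X1, AC X1 X2 & LB X2], forall x, x = r \/ x = 5 * r -> [/\ X0 x = 0, X1 x = 0 & X2 x = 0],
      forall x, 2 * r <= x -> x <= 4 * r -> r ^+ 12 <= X0 x ^+ 2 &
      forall x, r <= x -> x <= 5 * r -> (2 * X1 x) ^+ 2 <= (Z * r ^+ 5) ^+ 2 /\ X2 x ^+ 2 <= (Z * r ^+ 5) ^+ 2].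
Proof.
have [Z [Z0 Z1 Z2]] : exists Z : R, [/\ 0 <= Z, 2 * (3 * (16 ^+ 2 * 4)) <= Z & 6 * (16 * 4 ^+ 2) + 6 * 16 ^+ 2 <= Z].
 by exists (2 * (3 * (16 ^+ 2 * 4)) + (6 * (16 * 4 ^+ 2) + 6 * 16 ^+ 2)); split; lin.
exists Z => // r r1; have r0 : 0 < r by apply: lt_le_trans r1.
pose t := 5 * r; pose P x := (x - r) * (t - x); pose P1 x := t + r - 2 * x.
have aP : AC P P1.
 have h := AC_mul (AC_sub AC_id (AC_cst r)) (AC_sub (AC_cst t) AC_id). by apply: AC_ext h => x _ //; rewrite /P1; ring.
have aP1 : AC P1 (fun=> -2).
 have h := AC_sub (AC_cst (t + r)) (AC_scale 2 AC_id). by apply: AC_ext h => x _ //; ring.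
pose X0 x := P x ^+ 3; pose X1 x := 3 * P x ^+ 2 * P1 x; pose X2 x := 6 * P x * P1 x ^+ 2 - 6 * P x ^+ 2.
have aX0 : AC X0 X1.
 by apply: AC_ext (AC_mul (AC_mul aP aP) aP) => x _; rewrite /X0 /X1; ring.
have aX1 : AC X1 X2.
 by apply: AC_ext (AC_scale 3 (AC_mul (AC_mul aP aP) aP1)) => x _; rewrite /X1 /X2; ring.
have aX2 : LB X2.
 have bP := AC_LB aP; have bP1 := AC_LB aP1.
 apply: LB_ext (LB_sub (LB_mul (LB_mul (LB_cst 6) bP) (LB_mul bP1 bP1)) (LB_mul (LB_cst 6) (LB_mul bP bP))) => x _. by rewrite /X2; ring.
have Pz x : x = r \/ x = t -> P x = 0 by case=> ->; rewrite /P subrr ?mul0r ?mulr0.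
have Xz x : x = r \/ x = t -> [/\ X0 x = 0, X1 x = 0 & X2 x = 0].
 by move=> /Pz z; rewrite /X0 /X1 /X2 z !expr0n /= !(mulr0, mul0r) subr0.
exists X0, X1, X2; split=> // [x x2 x4|x rx xt].
 have hp : r ^+ 2 <= P x by rewrite expr2 /P; apply: ler_pM; rewrite ?(ltW r0) // /t; clear -x2 x4; lin.
 by rewrite /X0 -exprM (exprM r 2 6) ler_pXn2r ?nnegrE ?sqr_ge0 // (le_trans _ hp) ?sqr_ge0.
have bnd0 : 0 <= Z * r ^+ 5 by apply: mulr_ge0 => //; rewrite exprn_ge0 // ltW.
have r00 : 0 <= r by exact: ltW.
have xl : 0 <= x - r by rewrite subr_ge0.
have xr : 0 <= t - x by rewrite subr_ge0.
have Pn : `|P x| <= 16 * r ^+ 2.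
 rewrite ger0_norm; last by rewrite mulr_ge0. have : P x <= (4 * r) * (4 * r) by apply: ler_pM => //; rewrite /t; clear -rx xt; lin.
 by rewrite expr2; lin.
have P1n : `|P1 x| <= 4 * r by rewrite ler_norml /P1; apply/andP; split; rewrite /t; clear -rx xt; lin.
have PP : `|P x| ^+ 2 <= (16 * r ^+ 2) ^+ 2 by rewrite ler_pXn2r ?nnegrE // mulr_ge0 ?sqr_ge0.
have x1b : (2 * X1 x) ^+ 2 <= (Z * r ^+ 5) ^+ 2.
 rewrite -(real_normK (num_real (2 * X1 x))) ler_pXn2r ?nnegrE //.
 rewrite /X1 -(mulrA 3) normrM (normrM 3) (normrM (P x ^+ 2)) normrX !normr_nat.
 have : `|P x| ^+ 2 * `|P1 x| <= (16 * r ^+ 2) ^+ 2 * (4 * r) by apply: ler_pM; rewrite ?sqr_ge0.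
 rewrite (_ : (16 * r ^+ 2) ^+ 2 * (4 * r) = 16 ^+ 2 * 4 * r ^+ 5); last by ring.
 have : 2 * (3 * (16 ^+ 2 * 4)) * r ^+ 5 <= Z * r ^+ 5 by rewrite ler_wpM2r // exprn_ge0.
 move: (`|P x| ^+ 2 * `|P1 x|) (r ^+ 5) => v5 r5; lin.
have x2b : X2 x ^+ 2 <= (Z * r ^+ 5) ^+ 2.
 rewrite -(real_normK (num_real (X2 x))) ler_pXn2r ?nnegrE //.
 apply: le_trans (ler_normB _ _) _; rewrite -(mulrA 6) (normrM 6) (normrM (P x)) (normrM 6) !normrX !normr_nat.
 have p2 : `|P1 x| ^+ 2 <= (4 * r) ^+ 2 by rewrite ler_pXn2r ?nnegrE // mulr_ge0.
 have : `|P x| * `|P1 x| ^+ 2 <= (16 * r ^+ 2) * (4 * r) ^+ 2 by apply: ler_pM; rewrite ?sqr_ge0.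
 rewrite (_ : (16 * r ^+ 2) * (4 * r) ^+ 2 = 16 * 4 ^+ 2 * r ^+ 4); last by ring.
 have : `|P x| ^+ 2 <= 16 ^+ 2 * r ^+ 4 by apply: le_trans PP _; apply: eqW; ring.
 have : (6 * (16 * 4 ^+ 2) + 6 * 16 ^+ 2) * r ^+ 4 <= Z * r ^+ 5.
  have r40 : 0 <= r ^+ 4 by rewrite exprn_ge0. have r45 : r ^+ 4 <= r ^+ 5 by rewrite (exprS r 4) ler_peMl.
  by apply: (@le_trans _ _ (Z * r ^+ 4)); [rewrite ler_wpM2r|rewrite ler_wpM2l].
 move: (`|P x| ^+ 2) (`|P x| * `|P1 x| ^+ 2) (r ^+ 4) (Z * r ^+ 5) => v2 v3 r4 zr; lin.
by split.
Qed.
Lemma per_bound (f : R -> R) (B : R) : (forall x, 0 <= x -> f (x + 1) = f x) -> (forall x, 0 <= x -> x <= 1 -> f x <= B) ->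
  forall x, 0 <= x -> f x <= B.
Proof.
move=> pf h x x0; have : x <= (Num.truncn x).+1%:R by apply: ltW; exact: truncnS_gt.
move: (Num.truncn x) => n0_; elim: n0_ x x0 => [|n IH] x x0 hx; first exact: h.
have [x1|x1] := leP x 1; first exact: h.
rewrite -(subrK 1 x) pf ?IH // ?subr_ge0 ?(ltW x1) //.
by move: hx; rewrite -natr1 lerBlDr.
Qed.

Lemma edge_root (d : R) : `|d| <= 2 -> exists2 lam : C, lam ^+ 2 - d%:C%C * lam + 1 = 0 &
  [/\ nrm lam = 1, Re lam = d / 2 & Im lam = Num.sqrt (1 - d ^+ 2 / 4)].
Proof.
move=> hd; have d4 : d ^+ 2 <= 4 by exact: sqr_le4.
have h0 : 0 <= 1 - d ^+ 2 / 4 by lra.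
have s2 := sqr_sqrtr h0; set y := Num.sqrt _ in s2 *.
exists (Complex (d / 2) y); last split=> //.
- rewrite expr2; change (Complex (d / 2 * (d / 2) - y * y - (d * (d / 2) - 0 * y) + 1) (d / 2 * y + y * (d / 2) - (d * y + 0 * (d / 2)) + 0) = Complex 0 0).
 by congr Complex; [rewrite -(expr2 y) s2|]; field.
- by rewrite /= exprMn s2 (_ : _ + _ = 1) ?sqrtr1 //; field.
Qed.

Lemma trunc_Rint (f : R -> R) T : 0 <= T -> LI f -> (forall x, T < x -> f x = 0) ->
  (\int[leb]_(x in @halfline R) (f x)%:E = (Rint `[0, T] f)%:E)%E.
Proof.
move=> T0 If h; rewrite (@halfline_trunc _ T) => [|x Tx]; last by rewrite h.
by rewrite /Rint fineK //; exact: (integrable_fin_num _ (If T T0)).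
Qed.

End PolynomialCutoff.

(** * Locally null sets *)

Section NullCover.
Implicit Types (x d : R) (A : set R).
Lemma measure_null_local (mu : measure (measurableTypeR R) R) A : measurable (A : set (measurableTypeR R)) ->
  (forall x, A x -> exists2 d : R, 0 < d & mu (oitv x d) = 0%E) -> mu A = 0%E.
Proof.
move=> mA H; pose I (j : nat) : set R := if @pickle_inv (rat * rat)%type j is Some p then `](ratr p.1), (ratr p.2)[%classic else set0.
have mI j : measurable (I j : set (measurableTypeR R)).
 by rewrite /I; case: pickle_inv => [p|]; [exact: measurable_itv|exact: measurable0].
pose J j : set R := if `[< mu (I j) = 0%E >] then I j else set0.
have mJ j : measurable (J j : set (measurableTypeR R)) by rewrite /J; case: ifP => _; [exact: mI|exact: measurable0].
have AJ : A `<=` \bigcup_j J j.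
 move=> x Ax; have [d d0 hd] := H x Ax. have h1 : x - d < x by rewrite ltrBlDr ltrDl. have h2 : x < x + d by rewrite ltrDl.
 have [a] := rat_in_itvoo h1; have [b] := rat_in_itvoo h2; rewrite !in_itv /= => /andP[b1 b2] /andP[a1 a2].
 have : I (pickle (a, b)) = `](ratr a), (ratr b)[%classic by rewrite /I pickleK_inv.
 move: (pickle (a, b)) => j e; exists j => //; rewrite /J asboolT ?e; first by rewrite /= in_itv /= a2 b1.
 apply/eqP; rewrite -measure_le0 -hd; apply: le_measure; rewrite ?inE; try exact: measurable_itv.
 by move=> y; rewrite /= !in_itv /= => /andP[? ?]; rewrite (lt_trans a1) // (lt_trans _ b2).
apply/eqP; rewrite -measure_le0; apply: (@le_trans _ _ (\sum_(0 <= j <oo) mu (J j))%E).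
 exact: measure_sigma_subadditive.
rewrite eseries0 // => j _ _; rewrite /J; case: asboolP => // _; exact: measure0.
Qed.
End NullCover.

(** * Point masses in the gaps *)

Section Gap.
Implicit Types (x y s t e E : R).
Variables (q Kq : R -> R) (Q1 : R).
Hypotheses (Iq : LI q) (aKq : AC Kq (fun x => `|q x|)) (Q10 : 0 <= Q1)
  (uniq : forall s, 0 <= s -> Kq (s + 1) - Kq s <= Q1).
Variable theta : R.

(** A quarter turn of the boundary condition replaces [m] by [- 1 / m], so that large values of [m]
    can be treated as small ones. *)
Lemma nweyl_rot z (m : C) u w : nweyl q theta z m u w -> m != 0 ->
  nweyl q (theta + pi / 2) z (- m^-1) (fun x => - m^-1 * u x) (fun x => - m^-1 * w x).
Proof.
move=> [hw hb ha] m0; split; first exact: weyl_scale.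
 move: ha hb; rewrite /bca /bcb cosDpihalf sinDpihalf rmorphN => ha hb.
 rewrite (_ : _ - _ = m^-1 * (w 0 * (cos theta)%:C%C + u 0 * (sin theta)%:C%C)); last by ring. by rewrite ha mulVf.
move: ha hb; rewrite /bca /bcb cosDpihalf sinDpihalf rmorphN => ha hb.
rewrite (_ : _ + _ = - m^-1 * (u 0 * (cos theta)%:C%C - w 0 * (sin theta)%:C%C)); last by ring.
by rewrite hb mulr1.
Qed.

Variables (E0 r0 Cst : R).
Hypotheses (r00 : 0 < r0) (r01 : r0 <= 1) (C0 : 0 <= Cst)
  (Hest : forall (z : C) (g u w : R -> C) (Gam : R), nrm (z - E0%:C%C) <= r0 ->
   solg (Qz q z) g u w -> sqint g -> L2b u -> (forall x, 0 <= x -> N2 g x <= Gam) ->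
   forall x, 0 <= x -> N2 u x <= Cst * (U2 u w 0 + Gam)).

Lemma gap_TN th z m u w : nweyl q th z m u w -> nrm (z - E0%:C%C) <= r0 -> TN u <= Cst * (1 + nsq m).
Proof.
move=> [[su Lu] hb ha] hz; apply: TN_le; first exact: CAC_CLB (proj1 su).
have cg : CLB (fun=> 0 : C) by exact: CLB_cst.
have := Hest hz (sol_solg su) (sqint_CLB cg) Lu (Gam := 0); rewrite (bc_U2 th) ha hb addr0 addrC.
rewrite (_ : nsq (1 : C) = 1); last by rewrite /nsq Re1 Im1 expr1n expr0n /= addr0.
apply=> x x0; have := AC_lip (M := 0) (N2_AC cg) (lexx 0) x0; rewrite N2_0 subr0 mul0r => h.
by apply: le_trans (ler_norm _) (h _) => y _ _; rewrite /nsq Re0 Im0 expr0n /= addr0 normr0.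
Qed.

(** Orthogonality of eigenfunctions in quantitative form. If [m] and [m1] are small, the two Weyl
    solutions are nearly orthogonal and [u - u1] has norm bounded below. But [u - u1] solves the
    equation at [z] with source [(z - z1) u1] and small Cauchy data, so [Hest] bounds its norm by
    the distance of the energies. *)
Lemma gap_sep th z z1 m m1 u w u1 w1 : 0 < Im z -> Im z1 = Im z -> nrm (z - E0%:C%C) <= r0 -> nrm (z1 - E0%:C%C) <= r0 ->
  nweyl q th z m u w -> nweyl q th z1 m1 u1 w1 -> nsq m <= 1 -> nsq m1 <= 1 -> 0 < `|Re z - Re z1| ->
  2 / cU (Q1 + (`|E0| + 1)) - 2 * (nrm m + nrm m1) / `|Re z - Re z1| <= Cst * (nsq (m - m1) + (Re z - Re z1) ^+ 2 * (Cst * 2)).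
Proof.
move=> z0 iz hz hz1 nu nu1 ml ml1 dd; set d := Re z - Re z1 in dd *.
have z10 : 0 < Im z1 by rewrite iz.
have [bv Lv hv] := nweyl_dist Iq aKq Q10 uniq z0 z10 nu nu1.
have zz : z - z1 = d%:C%C by apply: C_eq; rewrite ?(ReD, ImD, ReN, ImN) ?ReC ?ImC ?iz ?subrr.
have lo zz_ mm uu ww : nrm (zz_ - E0%:C%C) <= r0 -> nweyl q th zz_ mm uu ww -> 1 / cU (Q1 + (`|E0| + 1)) <= TN uu.
 move=> hzz nn; have h := nweyl_low Iq aKq Q10 uniq nn. have zn : nrm zz_ <= `|E0| + 1.
  by rewrite -(subrK E0%:C%C zz_); apply: le_trans (nrmD _ _) _; rewrite nrmC addrC lerD2l (le_trans hzz).
 rewrite ler_pdivrMr ?cU_gt0 //; apply: (@le_trans _ _ (1 + nsq mm)); first by rewrite lerDl nsq_ge0.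
 apply: le_trans h _; have [[su Lu] _ _] := nn; rewrite mulrC ler_wpM2l ?(TN_ge0 (CAC_CLB (proj1 su)) Lu) //.
 by apply: cU_mono; [rewrite addr_ge0 // nrm_ge0|rewrite lerD2l].
have low : 2 / cU (Q1 + (`|E0| + 1)) - 2 * (nrm m + nrm m1) / `|d| <= TN (fun x => u x - u1 x).
 rewrite hv /mdist (nweyl_Im Iq aKq Q10 uniq nu) (nweyl_Im Iq aKq Q10 uniq nu1). rewrite [Im z * _]mulrC [Im z1 * _]mulrC !mulfK ?gt_eqF //.
 have := lo _ _ _ _ hz nu; have := lo _ _ _ _ hz1 nu1. have : `|Re ((m - conj m1) / (z - conj z1))| <= (nrm m + nrm m1) / `|d|.
  apply: le_trans (Re_le _) _; rewrite nrmM; apply: ler_pM; rewrite ?nrm_ge0 //.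
   by apply: le_trans (nrmB _ _) _; rewrite nrmJ.
  have dn : `|d| <= nrm (z - conj z1) by apply: le_trans (Re_le _); rewrite ReD ReN ReJ.
  have np : 0 < nrm (z - conj z1) by exact: lt_le_trans dd dn. have -> : nrm (z - conj z1)^-1 = (nrm (z - conj z1))^-1.
   have nz : z - conj z1 != 0 by rewrite -nrm_gt0. by apply: (mulfI (lt0r_neq0 np)); rewrite -nrmM mulfV // mulfV ?gt_eqF // nrm1.
  by rewrite lef_pV2.
 by rewrite ler_norml => /andP[_ h] h1 h2; lin.
apply: le_trans low _; have [[[su1 su2] Lu] hb ha] := nu; have [[[sv1 sv2] Lu1] hb1 ha1] := nu1.
have bu1 := CAC_CLB sv1.
have sg : solg (Qz q z) (fun x => d%:C%C * u1 x) (fun x => u x - u1 x) (fun x => w x - w1 x).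
 split; first exact: CAC_sub su1 sv1. by apply: CAC_ext (CAC_sub su2 sv2) => // x _; rewrite -zz /Qz; ring.
have bg : CLB (fun x => d%:C%C * u1 x) by apply: CLB_mul => //; exact: CLB_cst.
have e0 : U2 (fun x => u x - u1 x) (fun x => w x - w1 x) 0 = nsq (m - m1).
 rewrite (bc_U2 th); have -> : bca th (fun x => u x - u1 x) (fun x => w x - w1 x) = m - m1.
  by rewrite -ha -ha1 /bca; ring.
 have -> : bcb th (fun x => u x - u1 x) (fun x => w x - w1 x) = 0.
  by rewrite -[RHS](subrr 1) -{1}hb -hb1 /bcb; ring.
 by rewrite /nsq Re0 Im0 expr0n /= !addr0.
apply: TN_le => // x x0; rewrite -e0; apply: (Hest hz sg (sqint_CLB bg) Lv) => // y y0.
have -> : N2 (fun x => d%:C%C * u1 x) y = d ^+ 2 * N2 u1 y.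
 rewrite /N2 -(Rint_scale _ (LB_LI (CLB_nsq bu1)) y0); congr Rint; apply/funext => s. by rewrite nsqM /nsq ReC ImC expr0n /= addr0.
rewrite ler_wpM2l ?sqr_ge0 //; apply: le_trans (N2_le_TN bu1 Lu1 y0) _.
apply: le_trans (gap_TN nu1 hz1) _; rewrite ler_wpM2l //; lin.
Qed.

Variable mu : measure (measurableTypeR R) R.
Hypothesis Hmu : spectral_measure q theta mu.

(** Call [E] singular if [|m|] tends to infinity vertically above it. By [gap_sep], applied to
    [- 1 / m], there is at most one singular energy near [E0]. Near any other energy [m] is bounded,
    so [Im m] tends to 0 and [mu] vanishes. *)
Lemma gap_null : exists d P0 : R, 0 < d /\ mu (oitv E0 d `\` [set P0]) = 0%E.
Proof.
have [m [d0_ [nw him hbd [hlip hd] hw]]] := spectral_setup Iq aKq Q10 uniq Hmu.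
have hc := m_line_cont him hbd hlip hd.
have near x y : `|x - E0| <= r0 / 2 -> 0 < y -> y <= r0 / 2 -> nrm (Complex x y - E0%:C%C) <= r0.
 move=> h1 y0 h2; apply: le_trans (nrm_ReIm _) _; rewrite ReD ReN ReC ImD ImN ImC /= subr0 (gtr0_norm y0); lin.
have TB z : 0 < Im z -> nrm (z - E0%:C%C) <= r0 -> Im (m z) <= Im z * (Cst * (1 + nsq (m z))).
 move=> z0 hz; have [u [w nu]] := nw z z0; rewrite (nweyl_Im Iq aKq Q10 uniq nu) ler_pM2l //; exact: gap_TN nu hz.
pose sing E := forall B : R, exists2 e0 : R, 0 < e0 & forall e : R, 0 < e -> e < e0 -> B < nrm (m (Complex E e)).
have reg E : `|E - E0| < r0 / 2 -> ~ sing E -> exists2 d : R, 0 < d & mu (oitv E d) = 0%E.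
 (* Not being singular only bounds [m] at some heights arbitrarily close to 0; the Lipschitz
    estimate from such a height spreads the bound to a neighbourhood. *)
 move=> hE ns; have [B HB] : exists B : R, forall e0 : R, 0 < e0 -> exists e : R, [/\ 0 < e, e < e0 & nrm (m (Complex E e)) <= B].
  apply: contrapT => h; apply: ns => B; apply: contrapT => h2; apply: h; exists B => e0 p0.
  apply: contrapT => h3; apply: h2; exists e0 => // e e1 e2; rewrite ltNge; apply/negP => h4; apply: h3; by exists e.
 pose K := Cst ^+ 2 * (1 + B ^+ 2); have K0 : 0 <= K by rewrite mulr_ge0 ?sqr_ge0 // addr_ge0 ?sqr_ge0.
 pose B1 := 4 * B ^+ 2 + 1; have B10 : 0 <= B1 by rewrite addr_ge0 // mulr_ge0 // sqr_ge0.
 pose rho : R := Num.min (r0 / 2 - `|E - E0|) (1 / (8 * (K + 1))). have K1 : 0 < 8 * (K + 1) by rewrite mulr_gt0 // ltr_wpDl.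
 have rho0 : 0 < rho by rewrite lt_min subr_gt0 hE divr_gt0. have rho1 : rho <= r0 / 2 - `|E - E0| by rewrite ge_min lexx.
 have rho2 : rho <= 1 / (8 * (K + 1)) by rewrite ge_min lexx orbT. have nE : 0 <= `|E - E0| by []. clearbody rho; have rr := r01.
 (* With [(2 rho)^2 K <= 1 / 4] the multiple of [1 + |m|^2] produced by the Lipschitz estimate is
    absorbed. *)
 have rhoK : (2 * rho) ^+ 2 * K <= 1 / 4.
  have h1 : rho * (8 * (K + 1)) <= 1 by rewrite -ler_pdivlMr. have h2 : rho <= 1 by move: rho1; lin.
  have h3 : rho ^+ 2 * K <= rho * K by rewrite ler_wpM2r // expr2 ler_piMl // ltW.
  rewrite exprMn; have : 0 <= rho * K by rewrite mulr_ge0 // ltW. nra.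
 have bound x y : `|x - E| <= rho -> 0 < y -> y <= rho / 2 -> Im (m (Complex x y)) <= y * (Cst * (1 + B1)).
  move=> hx y0 yr; have [e [e0 er mB]] := HB (rho / 2) (half_gt0 rho0). have n1 : nrm (Complex x y - E0%:C%C) <= r0.
   apply: near => //; last by move: rho1; lin. by have := ler_normD (x - E) (E - E0); rewrite addrA subrK; lin.
  have n2 : nrm (Complex E e - E0%:C%C) <= r0 by apply: near; [exact: ltW|exact: e0|move: rho1; lin].
  have t1 := TB (Complex x y) y0 n1; have t2 := TB (Complex E e) e0 n2. have := hlip (Complex x y) (Complex E e) y0 e0.
  set M := nsq (m (Complex x y)) in t1 *; rewrite /= in t1 t2 *.
  have mB2 : nsq (m (Complex E e)) <= B ^+ 2 by rewrite -nrmE ler_pXn2r ?nnegrE ?nrm_ge0 ?(le_trans (nrm_ge0 _) mB).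
  have dz : nsq (Complex x y - Complex E e) <= (2 * rho) ^+ 2.
   rewrite -nrmE ler_pXn2r ?nnegrE ?nrm_ge0 ?mulr_ge0 ?(ltW rho0) //; apply: le_trans (nrm_ReIm _) _.
   rewrite ReD ReN ImD ImN /=; have : `|y - e| <= rho by rewrite ler_norml; apply/andP; split; lin. by lin.
  have s1 : Im (m (Complex x y)) / y <= Cst * (1 + M) by rewrite ler_pdivrMr // mulrC.
  have s2 : Im (m (Complex E e)) / e <= Cst * (1 + B ^+ 2).
   by rewrite ler_pdivrMr // mulrC; apply: le_trans t2 _; rewrite ler_pM2l // ler_wpM2l // lerD2l.
  have M0 : 0 <= M by exact: nsq_ge0. have p1 : 0 <= Im (m (Complex x y)) / y by rewrite divr_ge0 ?(ltW y0) // him.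
  have p2 : 0 <= Im (m (Complex E e)) / e by rewrite divr_ge0 ?(ltW e0) // him. set X := nsq (m (Complex x y) - m (Complex E e)) => hX.
  have hX2 : X <= 1 / 4 * (1 + M).
   apply: le_trans hX _; apply: (@le_trans _ _ ((2 * rho) ^+ 2 * ((Cst * (1 + M)) * (Cst * (1 + B ^+ 2))))).
    exact: ler_pM (nsq_ge0 _) (mulr_ge0 p1 p2) dz (ler_pM p1 p2 s1 s2).
   rewrite (_ : _ * (_ * _) = (2 * rho) ^+ 2 * K * (1 + M)); last by rewrite /K; ring. by rewrite ler_wpM2r // addr_ge0.
  have MX : M <= 2 * (X + B ^+ 2).
   rewrite /M -(subrK (m (Complex E e)) (m (Complex x y))); apply: le_trans (nsqD_le _ _) _. by rewrite ler_wpM2l // lerD2l.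
  have : M <= B1 by rewrite /B1; lin. move=> MB; apply: le_trans t1 _; rewrite ler_pM2l // ler_wpM2l // lerD2l //.
 exists (rho / 4); first by rewrite divr_gt0. apply/eqP; rewrite -measure_le0.
 suff key (eta : R) : 0 < eta -> (mu (`](E - rho / 4)%R, (E + rho / 4)%R[%classic : set R) <= eta%:E)%E.
  by apply/lee_addgt0Pr => eta eta0; rewrite add0e; exact: key.
 move=> eta0. have pi0 : 0 < (pi : R) by exact: pi_gt0. pose G := Cst * (1 + B1); have G0 : 0 <= G by rewrite mulr_ge0 // addr_ge0.
 pose ep : R := Num.min (rho / 2) (eta * pi / (2 * rho * (G + 1))). have RG : 0 < 2 * rho * (G + 1) by rewrite !mulr_gt0 // ltr_wpDl.
 have ep0 : 0 < ep by rewrite lt_min !divr_gt0 // mulr_gt0.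
 apply: le_trans (_ : mu (`[(E - rho / 2)%R, (E + rho / 2)%R]%classic : set R) <= _)%E.
  apply: le_measure; rewrite ?inE; try exact: measurable_itv. by move=> x; rewrite /= !in_itv /= => /andP[h1 h2]; apply/andP; split; lin.
 rewrite (_ : eta = (eta * pi) / pi); last by rewrite mulfK // gt_eqF.
 apply: (@mu_itv_le m mu him hc hw (E - rho) _ _ (E + rho) _ ep) => //; [lin|lin|lin|].
 move=> eps e0 ee; have ER : E - rho <= E + rho by lin. have e1 : eps < rho / 2 by apply: lt_le_trans ee _; rewrite ge_min lexx.
 have e2 : eps * (2 * rho * (G + 1)) < eta * pi.
  by rewrite -ltr_pdivlMr //; apply: lt_le_trans ee _; rewrite ge_min lexx orbT.
 apply: (@le_trans _ _ (\int[leb]_(x in `[(E - rho)%R, (E + rho)%R]%classic) (eps * G)%:E)%E).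
  apply: ge0_le_integral => //; try exact: measurable_itv.
  - by move=> x _; rewrite lee_fin him.
  - by apply/measurable_EFinP; apply: measurable_funTS; apply: continuous_measurable_fun; exact: hc.
  - move=> x; rewrite /= in_itv /= => /andP[h1 h2]; rewrite lee_fin; apply: bound => //; last exact: ltW.
   by rewrite ler_norml; apply/andP; split; lin.
 rewrite integral_cst //= leb_cc // -EFinM lee_fin; apply: le_trans (ltW e2). rewrite (_ : eps * G * _ = eps * (2 * rho * G)); last by ring.
 by apply: ler_wpM2l; [exact: ltW|apply: ler_wpM2l; [rewrite mulr_ge0 // ltW|rewrite lerDl]].
have uniqs E E' : `|E - E0| < r0 / 2 -> `|E' - E0| < r0 / 2 -> sing E -> sing E' -> E != E' ->
 2 / cU (Q1 + (`|E0| + 1)) <= 2 * Cst ^+ 2 * (E - E') ^+ 2. move=> h1 h2 s1 s2 EE; have dd : 0 < `|E - E'| by rewrite normr_gt0 subr_eq0.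
 suff key (eta : R) : 0 < eta -> 2 / cU (Q1 + (`|E0| + 1)) <= 2 * Cst ^+ 2 * (E - E') ^+ 2 + eta.
  by apply/ler_addgt0Pr => eta eta0; exact: key.
 (* [k] bounds [1 / |m|] at both energies, and the errors in [gap_sep] add up to at most
    [k * T <= eta]. *)
 move=> eta0. pose T := 4 / `|E - E'| + 4 * Cst + 1; have T0 : 0 < T by rewrite ltr_wpDl // addr_ge0 ?divr_ge0 ?mulr_ge0.
 pose k : R := Num.min 1 (eta / T); have k0 : 0 < k by rewrite lt_min ltr01 divr_gt0. have k1 : k <= 1 by rewrite ge_min lexx.
 have kT : k * T <= eta by rewrite -ler_pdivlMr // ge_min lexx orbT. have [e1 e10 H1] := s1 k^-1; have [e2 e20 H2] := s2 k^-1.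
 pose e : R := Num.min (Num.min e1 e2) r0 / 2. have m0 : 0 < Num.min (Num.min e1 e2) r0 by rewrite !lt_min e10 e20.
 have e0 : 0 < e by rewrite divr_gt0. have el : e < Num.min (Num.min e1 e2) r0 by rewrite ltr_pdivrMr // ltr_pMr ?ltr1n.
 move: (el); rewrite !lt_min => /andP[/andP[l1 l2] _]. have er : e <= r0 / 2 by rewrite ler_wpM2r // ge_min lexx orbT.
 pose z := Complex E e; pose z1 := Complex E' e. have big : k^-1 < nrm (m z) := H1 e e0 l1. have big1 : k^-1 < nrm (m z1) := H2 e e0 l2.
 have ki : 0 < k^-1 by rewrite invr_gt0. have mz : m z != 0 by rewrite -nrm_gt0 (lt_trans ki).
 have mz1 : m z1 != 0 by rewrite -nrm_gt0 (lt_trans ki). have iz : 0 < Im z by []. have iz1 : 0 < Im z1 by [].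
 have [u [w nu]] := nw z iz; have [u1 [w1 nu1]] := nw z1 iz1. have inv (y : C) : y != 0 -> k^-1 < nrm y -> nrm (- y^-1) <= k.
  move=> y0 h; have np : 0 < nrm y by rewrite nrm_gt0.
  rewrite nrmN -(ler_pM2r np) -nrmM mulVf // nrm1 -(mulVf (lt0r_neq0 k0)) mulrC ler_pM2l //; exact: ltW.
 have i1 := inv _ mz big; have i2 := inv _ mz1 big1.
 have sq (y : C) : nrm y <= k -> nsq y <= k ^+ 2 by move=> h; rewrite -nrmE ler_pXn2r ?nnegrE ?nrm_ge0 // ltW.
 have kk : k ^+ 2 <= k by rewrite expr2 ler_piMl // ltW.
 have := gap_sep iz (erefl : Im z1 = Im z) (near _ _ (ltW h1) e0 er) (near _ _ (ltW h2) e0 er) (nweyl_rot nu mz) (nweyl_rot nu1 mz1).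
 have q1 := sq _ i1; have q2 := sq _ i2. move=> h; have {}h := h (le_trans q1 (le_trans kk k1)) (le_trans q2 (le_trans kk k1)) dd.
 have b1 : 2 * (nrm (- (m z)^-1) + nrm (- (m z1)^-1)) / `|E - E'| <= 4 / `|E - E'| * k.
  rewrite [leRHS]mulrAC ler_pM2r ?invr_gt0 //; lin.
 have b2 : nsq (- (m z)^-1 - - (m z1)^-1) <= 4 * k.
  by have := nsqD_le (- (m z)^-1) (- - (m z1)^-1); rewrite (nsqN (- (m z1)^-1)); lin.
 have b3 : Cst * nsq (- (m z)^-1 - - (m z1)^-1) <= Cst * (4 * k) by rewrite ler_wpM2l.
 have e1_ : 4 / `|E - E'| * k + Cst * (4 * k) <= k * T by rewrite /T; lin. move: h; rewrite /= mulrDr => h; clearbody T k; lin.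
pose kap := 2 / cU (Q1 + (`|E0| + 1)); have kap0 : 0 < kap by rewrite divr_gt0 // cU_gt0.
have CC : 0 < 16 * (Cst ^+ 2 + 1) by rewrite mulr_gt0 // ltr_wpDl // sqr_ge0.
pose d : R := Num.min (r0 / 2) (kap / (16 * (Cst ^+ 2 + 1))).
have d0 : 0 < d by rewrite lt_min (divr_gt0 r00 (ltr0n R 2)) (divr_gt0 kap0 CC).
have d1 : d <= r0 / 2 by rewrite ge_min lexx.
have d2 : d * (16 * (Cst ^+ 2 + 1)) <= kap by rewrite -ler_pdivlMr // ge_min lexx orbT.
clearbody d; have rr := r01.
have [P0 HP] : exists P0, forall E, `|E - E0| < d -> E != P0 -> ~ sing E.
 have [[P [hP sP]]|nP] := pselect (exists P, `|P - E0| < d /\ sing P); last first.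
  by exists E0 => E hE _ sE; apply: nP; exists E.
 exists P => E hE EP sE; have := uniqs E P (lt_le_trans hE d1) (lt_le_trans hP d1) sE sP EP; rewrite -/kap. apply/negP; rewrite -ltNge.
 have : `|E - P| <= 2 * d by have := ler_normB (E - E0) (P - E0); rewrite opprB addrA subrK; lin.
 rewrite -(real_normK (num_real (E - P))) => hh. have h2 : `|E - P| ^+ 2 <= (2 * d) ^+ 2 by rewrite ler_pXn2r ?nnegrE // mulr_ge0 // ltW.
 have h3 : Cst ^+ 2 * `|E - P| ^+ 2 <= Cst ^+ 2 * (2 * d) ^+ 2 by rewrite ler_wpM2l ?sqr_ge0.
 have h4 : Cst ^+ 2 * d ^+ 2 <= Cst ^+ 2 * d by rewrite ler_wpM2l ?sqr_ge0 // expr2 ler_piMr ?(ltW d0) //; lin. rewrite exprMn in h3; lin.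
exists d, P0; split=> //; apply: measure_null_local.
 by apply: measurableD; [exact: measurable_itv|exact: measurable_set1].
move=> E [hE EP]; have hE' : `|E - E0| < d by move: hE; rewrite /= in_itv /= ltr_distl => /andP[-> ->].
apply: reg; first exact: lt_le_trans hE' d1.
by apply: HP => //; apply/eqP => h; apply: EP.
Qed.

End Gap.

(** * Coefficients of bounded variation *)

Section BoundedVariation.
Implicit Types (x y s t e : R).

(** [T z] is the supremum of the variation sums over partitions ending at [z]; partitions are
    infinite increasing sequences, as in [var_oo]. *)
Lemma bv_exists (g : R -> C) (M : R) : (var_oo g <= M%:E)%E -> exists T : R -> R,
  [/\ forall x, 0 <= T x, forall x, T x <= M & forall x y, 0 < x -> x <= y -> T x <= T y /\ nrm (g y - g x) <= T y - T x].
Proof.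
move=> hM; pose B z : set R := [set v | exists n (r : nat -> R), [/\ 0 < r 0%N, forall i, r i < r i.+1, r n = z &
 v = \sum_(i < n) nrm (g (r i.+1) - g (r i))]].
have BM z v : B z v -> v <= M.
 move=> [n [r [r0 ri _ ->]]]; rewrite -lee_fin; apply: le_trans hM. by apply: ereal_sup_ubound; exists n => //; exists r.
have B0 z : 0 < z -> B z 0.
 move=> z0; exists 0%N, (fun i => z + i%:R); split; rewrite ?addr0 ?big_ord0 //. by move=> i; rewrite -natr1 addrA ltrDl.
have ext z y v : z < y -> B z v -> B y (v + nrm (g y - g z)).
 (* The partition is prolonged by the point [y]; after that it continues in unit steps merely to
    remain strictly increasing. *)
 move=> zy [n [r [r0 ri rn ->]]]. pose r' i := if (i <= n)%N then r i else y + (i - n.+1)%:R. exists n.+1, r'; split.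
 - by rewrite /r'.
 - move=> i; rewrite /r'; have [lt|gt_|->] := ltngtP i n; first exact: ri.
   by rewrite ltrD2l ltr_nat; lia.
  by rewrite subnn addr0 rn.
 - by rewrite /r' ltnn subnn addr0.
 - rewrite big_ord_recr /=; congr (_ + _); last by rewrite /r' ltnn leqnn subnn addr0 rn.
  by apply: eq_bigr => i _; rewrite /r' (ltn_ord i) (ltnW (ltn_ord i)).
have sB z : 0 < z -> has_sup (B z) by move=> z0; split; [exists 0; exact: B0|exists M => v; exact: BM].
have T0 z : 0 < z -> 0 <= sup (B z) by move=> z0; apply: ub_le_sup; [by case: (sB z z0)|exact: B0].
have M0 : 0 <= M by apply: BM (B0 1 ltr01).
exists (fun z => if 0 < z then sup (B z) else 0); split.
- by move=> x; case: ifP => // /T0.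
- by move=> x; case: ifP => // x0; apply: ge_sup; [exists 0; exact: B0|move=> v; exact: BM].
- move=> x y x0 xy; rewrite x0 (lt_le_trans x0 xy).
 have [->|nxy] := eqVneq x y; first by rewrite !subrr nrm0. have lt : x < y by rewrite lt_neqAle nxy.
 have h : sup (B x) <= sup (B y) - nrm (g y - g x).
  apply: ge_sup; first by exists 0; exact: B0. move=> v Bv; rewrite lerBrDr; apply: ub_le_sup; first by case: (sB y (lt_trans x0 lt)).
  exact: ext.
 by have := nrm_ge0 (g y - g x); split; lin.
Qed.

(** The coefficients are controlled on [(0, oo)] only; the value 0 elsewhere gives a function
    measurable and bounded on every [[0, x]]. *)
Definition pos_part (g : R -> C) x : C := if 0 < x then g x else 0.

(* [g] and its Steklov average [gt x = int_x^(x+1) g] differ, as does the derivative [gt'] from [0],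
   by at most the increment [T (x + 1) - T x] of the variation, which is integrable. *)
Lemma bv_lp (g : R -> C) (M Mp : R) (p : nat) : (0 < p)%N -> (var_oo g <= M%:E)%E -> 0 <= M -> 0 <= Mp ->
  (\int[leb]_(x in @posline R) (nrm (g x) ^+ p)%:E <= Mp%:E)%E ->
  let K := (M + Mp + 1) + 2 ^+ p * (Mp + (M + 1) ^+ p * M) + M in
  exists (gt gt1 : R -> C) (de De y Y : R -> R),
  [/\ CLB (pos_part g) /\ (forall x, 0 < x -> nrm (g x) <= K),
      CAC gt gt1 /\ (forall x, 0 <= x -> nrm (gt x) <= K),
      (forall e, 0 < e -> exists X : R, forall x, 0 < x -> X <= x -> nrm (g x) <= e /\ nrm (gt x) <= e),
      [/\ AC De de, forall x, 0 <= x -> 0 <= de x, forall x, 0 <= x -> De x - De 0 <= K &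
        forall x, 0 < x -> nrm (gt x - g x) <= de x /\ nrm (gt1 x) <= de x] &
      [/\ AC Y y, forall x, 0 <= x -> 0 <= y x, forall x, 0 <= x -> Y x - Y 0 <= K & forall x, 0 < x -> nrm (gt x) ^+ p <= y x]].
Proof.
move=> p0 hv M0 Mp0 hp K; have [T [T0 TM Tg]] := bv_exists hv.
have gM x y : 0 < x -> 0 < y -> nrm (g y - g x) <= M.
 move=> x0 y0; have [xy|yx] := leP x y; first by have [_ h] := Tg x y x0 xy; have := T0 x; have := TM y; lin.
 by have [_ h] := Tg y x y0 (ltW yx); rewrite -nrmN opprB; have := T0 y; have := TM x; lin.
pose K1 := M + nrm (g 1) ; have K10 : 0 <= K1 by rewrite addr_ge0 // nrm_ge0.
have gK1 x : 0 < x -> nrm (g x) <= K1.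
 move=> x0; rewrite -(subrK (g 1) (g x)); apply: le_trans (nrmD _ _) _; rewrite lerD2r; exact: gM.
have mono (f : R -> R) : (forall x y, 0 < x -> x <= y -> f x <= f y) -> (forall x, 0 < x -> 0 <= f x) ->
  measurable_fun setT (fun x => if 0 < x then f x else 0 : R).
 move=> fm f0; apply: nondecreasing_measurable => // x y xy. case: ifP => x0; first by rewrite (lt_le_trans x0 xy) fm.
 by case: ifP => // /f0.
have mT : measurable_fun setT (fun x => if 0 < x then T x else 0 : R).
 by apply: mono => // x y x0 xy; have [] := Tg x y x0 xy.
(* On [(0, oo)] the real and imaginary parts of [g] are differences of the increasing functions
   [T + f (g) + K1] and [T + K1], hence measurable. *)
have meas (f : C -> R) : (forall a b : C, f (a - b) = f a - f b) -> (forall a, `|f a| <= nrm a) ->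
  LB (fun x => f (pos_part g x)).
 move=> fB fn x x0; split; last first.
  exists K1 => y _ _; apply: le_trans (fn _) _; rewrite /pos_part; case: ifP => [/gK1//|_]; by rewrite nrm0.
 apply: measurable_funTS. have m1 : measurable_fun setT (fun x => if 0 < x then T x + f (g x) + K1 else 0 : R).
  apply: mono => [a b a0 ab|a a0].
   have [_ h] := Tg a b a0 ab; have := fn (g b - g a); rewrite fB ler_norml => /andP[h1 _]; rewrite lerD2r; lin.
  by have := fn (g a); rewrite ler_norml => /andP[h1 _]; have := gK1 a a0; have := T0 a; lin.
 have m2 : measurable_fun setT (fun x => if 0 < x then T x + K1 else 0 : R).
  apply: mono => [a b a0 ab|a a0]; first by have [h _] := Tg a b a0 ab; rewrite lerD2r. by rewrite addr_ge0.
 have f0 : f 0 = 0 by rewrite -(subrr (0 : C)) fB subrr. apply: eq_measurable_fun (measurable_funB m1 m2) => z _ /=; rewrite /pos_part.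
 by case: ifP => _; [ring|rewrite f0 subrr].
have Lg : CLB (pos_part g).
 split; apply: meas => *; rewrite ?ReD ?ReN ?ImD ?ImN //; [exact: Re_le|exact: Im_le].
have LT : LB (fun x => if 0 < x then T x else 0).
 by move=> x x0; split; [exact: measurable_funTS|exists M => y _ _; case: ifP => _; rewrite ?normr0 // ger0_norm].
set T_ := fun x => if 0 < x then T x else 0 in LT mT.
have LP : LB (fun x => nrm (pos_part g x) ^+ p).
 move=> x x0; have mn := LI_meas (LI_nrm (CLB_CLI Lg)) x0; have [B B0 hh] := CLB_bound Lg x0. split; first exact: measurable_funX.
 exists (B ^+ p) => y y0 yx; rewrite ger0_norm ?exprn_ge0 ?nrm_ge0 //. by rewrite lerXn2r ?nnegrE ?nrm_ge0 // hh.
have aY := AC_prim 0 (LB_LI LP); set Y0 := (fun x => 0 + _) in aY.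
have Y00 : Y0 0 = 0 by rewrite /Y0 RintI0 addr0.
have YM x : 0 <= x -> Y0 x <= Mp.
 move=> x0; rewrite -lee_fin -(itv_Rint_le aY _ Y00 x0); last by move=> y _; rewrite exprn_ge0 // nrm_ge0.
 apply: le_trans hp; rewrite integral_mkcond [leRHS]integral_mkcond. apply: ge0_le_integral => //.
 - by move=> y _; rewrite patchE; case: ifP => // _; rewrite lee_fin exprn_ge0 // nrm_ge0.
 - apply/(measurable_restrictT _ (measurable_itv `[0, x])).
  by apply/measurable_EFinP; have [] := LP x x0.
 - apply/(measurable_restrictT _ (measurable_itv `]0, +oo[)).
  apply/measurable_EFinP; apply: measurable_funX. apply: (@eq_measurable_fun _ _ _ _ _ (fun x => nrm (pos_part g x))).
   by move=> z /set_mem; rewrite /posline /= in_itv /= andbT /pos_part => ->.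
  apply: (@measurable_funS _ _ _ _ (@halfline R)); first exact: meas_half.
   by move=> z; rewrite /posline /halfline /= !in_itv /= !andbT => /ltW.
  by apply: meas_ray => z z0; exact: LI_meas (LI_nrm (CLB_CLI Lg)) _ z0.
 - move=> y _; rewrite !patchE; case: ifP => [|_]; last by case: ifP => // _; rewrite lee_fin exprn_ge0 // nrm_ge0.
  move=> /set_mem; rewrite in_cc0 => /andP[y0 yx]; rewrite /pos_part.
  have [yp|yn] := ltP 0 y; first by rewrite mem_set ?/posline /= ?in_itv /= ?yp.
  rewrite nrm0 expr0n (gtn_eqF p0) /=; case: ifP => // _; by rewrite lee_fin exprn_ge0 // nrm_ge0.
(* A larger value would keep [|g|] above [Mp + 1 >= 1] throughout [(0, oo)], against the [L^p] bound
   already on [[1, 2]]. *)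
have gb x : 0 < x -> nrm (g x) <= M + Mp + 1.
 move=> x0; rewrite leNgt; apply/negP => h. have lo y : 1 <= y -> y <= 2 -> Mp + 1 <= nrm (pos_part g y) ^+ p.
  move=> y1 y2; have y0 : 0 < y by lin. rewrite /pos_part y0; have h1 : Mp + 1 <= nrm (g y).
   have := gM y x y0 x0 => h1; have := nrmD (g x - g y) (g y); rewrite subrK => h2; lin.
  apply: (le_trans h1); rewrite -(prednK p0) exprS ler_peMr ?nrm_ge0 // exprn_ege1 //. lin.
 have one2 : 1 <= 2 :> R by rewrite ler1n. have := AC_le (AC_scale (Mp + 1) AC_id) aY ler01 one2 => h2.
 have : (Mp + 1) * 2 - (Mp + 1) * 1 <= Y0 2 - Y0 1 by apply: h2 => y y1 y2; rewrite mulr1 lo. have := YM 2 (ler0n _ _); have : 0 <= Y0 1.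
  by rewrite -Y00; apply: (AC_homo aY (lexx 0) ler01) => *; rewrite exprn_ge0 // nrm_ge0.
 lin.
have [G aG _] := CAC_prim 0 (CLB_CLI Lg).
pose gt x := G (x + 1) - G x; pose gt1 x := pos_part g (x + 1) - pos_part g x.
have agt : CAC gt gt1 := CAC_sub (CAC_shift ler01 aG) aG.
have gtb x : 0 <= x -> nrm (gt x) <= M + Mp + 1.
 move=> x0; have x1 : x <= x + 1 by rewrite lerDl.
 have := CAC_le_nrm aG (AC_scale (M + Mp + 1) AC_id) x0 x1; rewrite -mulrBr [x + 1 - x]addrAC subrr add0r => h.
 apply: le_trans (h _) _; last by rewrite mulr1. move=> y _ _; rewrite mulr1 /pos_part; case: ifP => [/gb//|_]; rewrite nrm0 !addr_ge0 //.
pose de x := T_ (x + 1) - T_ x.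
have T1 x : 0 <= T_ x <= M by rewrite /T_; case: ifP => _; rewrite ?T0 ?TM ?lexx.
have de0 x : 0 <= x -> 0 <= de x.
 move=> x0; rewrite /de /T_ (_ : 0 < x + 1); last by rewrite ltr_wpDl. case: ifP => xp; last by rewrite subr0.
 have x1 : x <= x + 1 by rewrite lerDl. by rewrite subr_ge0; have [] := Tg x (x + 1) xp x1.
have deM x : de x <= M by rewrite /de; have /andP[h1 h2] := T1 (x + 1); have /andP[h3 h4] := T1 x; lin.
have aT := AC_prim 0 (LB_LI LT); set TT := (fun x => 0 + _) in aT.
have aDe := AC_sub (AC_shift ler01 aT) aT; rewrite -/(de _) in aDe.
pose De x := TT (x + 1) - TT x.
(* The integral of [T (x + 1) - T x] telescopes to a difference of integrals of [T] over two unit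
   intervals. *)
have DeM x : 0 <= x -> De x - De 0 <= M.
 move=> x0; have x1 : x <= x + 1 by rewrite lerDl.
 have h1 := AC_le aT (AC_scale M AC_id) x0 x1; rewrite -mulrBr [x + 1 - x]addrAC subrr add0r !mulr1 in h1. have h3 : 0 <= De 0.
  rewrite /De add0r subr_ge0; apply: (AC_homo aT (lexx 0) ler01) => y _ _; by have /andP[] := T1 y.
 have : De x <= M by apply: h1 => y _ _; have /andP[] := T1 y. lin.
have dif x : 0 < x -> nrm (gt x - g x) <= de x /\ nrm (gt1 x) <= de x.
 move=> x0; have x1 : x <= x + 1 by rewrite lerDl. have xp : 0 < x + 1 by rewrite ltr_wpDl // ltW.
 have deE : de x = T (x + 1) - T x by rewrite /de /T_ x0 xp. split; last by rewrite deE /gt1 /pos_part x0 xp; have [] := Tg x (x + 1) x0 x1.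
 have aF := CAC_sub aG (CAC_scale (g x) (CAC_real (@AC_id))). have := CAC_le_nrm aF (AC_scale (de x) AC_id) (ltW x0) x1.
 rewrite -mulrBr [x + 1 - x]addrAC subrr add0r mulr1. rewrite (_ : _ - _ - _ = gt x - g x); last by rewrite /gt rmorphD; ring.
 apply=> y xy y1; rewrite mulr1 /pos_part (lt_le_trans x0 xy) deE.
 have [_ h] := Tg x y x0 xy; have [h2 _] := Tg y (x + 1) (lt_le_trans x0 xy) y1. by apply: le_trans h _; rewrite lerD2r.
have ayp := AC_scale (2 ^+ p) (AC_add aY (AC_scale ((M + 1) ^+ p) aDe)).
exists gt, gt1, de, De, (fun x => 2 ^+ p * (nrm (pos_part g x) ^+ p + (M + 1) ^+ p * de x)), (fun x => 2 ^+ p * (Y0 x + (M + 1) ^+ p * De x)).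
have M1 : 0 <= (M + 1) ^+ p by rewrite exprn_ge0 // addr_ge0.
have two0 : 0 <= 2 ^+ p :> R by rewrite exprn_ge0.
have q0 : 0 <= 2 ^+ p * (Mp + (M + 1) ^+ p * M) by rewrite mulr_ge0 // addr_ge0 // mulr_ge0.
split.
- split=> // x x0; apply: le_trans (gb x x0) _; rewrite /K; lin.
- split=> // x x0; apply: le_trans (gtb x x0) _; rewrite /K; lin.
- move=> e e0; have hs : has_sup [set z | exists n : nat, z = T n.+1%:R].
  by split; [exists (T 1), 0%N|exists M => _ [n ->]].
 have e2 : 0 < e / 2 by rewrite divr_gt0. have [_ [N ->] hN] := sup_adherent e2 hs.
 have Ttail x y : N.+1%:R <= x -> x <= y -> T y - T x <= e / 2.
  move=> Nx xy; have [h1 _] := Tg N.+1%:R x (ltr0Sn _ _) Nx. have yn : y <= (Num.truncn y).+1%:R by apply: ltW; exact: truncnS_gt.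
  have y0 : 0 < y by apply: lt_le_trans (le_trans Nx xy). have [h2 _] := Tg y _ y0 yn.
  have : T (Num.truncn y).+1%:R <= sup [set z | exists n : nat, z = T n.+1%:R].
   by apply: ub_le_sup; [case: hs|exists (Num.truncn y)].
  lin.
 have gd x : N.+1%:R <= x -> nrm (g x) <= e.
  move=> Nx; rewrite leNgt; apply/negP => h. have x0 : 0 < x by apply: lt_le_trans Nx. have ep : 0 < (e / 2) ^+ p by rewrite exprn_gt0.
  (* If [|g x| > e] in the region where [T] varies by at most [e / 2], then [|g| >= e / 2] from [x]
     on, and an interval of length [L] exceeds the [L^p] bound. *)
  pose L := (Mp + 1) / (e / 2) ^+ p; have L0 : 0 <= L by rewrite divr_ge0 ?addr_ge0 // ltW. have xL : x <= x + L by rewrite lerDl.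
  have := AC_le (AC_scale ((e / 2) ^+ p) AC_id) aY (ltW x0) xL => h2. have : (e / 2) ^+ p * (x + L) - (e / 2) ^+ p * x <= Y0 (x + L) - Y0 x.
   apply: h2 => y xy _; rewrite mulr1 /pos_part (lt_le_trans x0 xy). rewrite lerXn2r ?nnegrE ?nrm_ge0 ?(ltW e2) //.
   have [_ h3] := Tg x y x0 xy; have := Ttail x y Nx xy => h4. have := nrmB (g y - g x) (g y); rewrite addrAC subrr add0r nrmN => h5; lin.
  rewrite -mulrBr addrAC subrr add0r /L mulrCA mulfV ?gt_eqF // mulr1. have := YM (x + L) (le_trans (ltW x0) xL); have : 0 <= Y0 x.
   by rewrite -Y00; apply: (AC_homo aY (lexx 0) (ltW x0)) => *; rewrite exprn_ge0 // nrm_ge0.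
  lin.
 exists N.+1%:R => x x0 Nx; split; first exact: gd. have x1 : x <= x + 1 by rewrite lerDl.
 have := CAC_le_nrm aG (AC_scale e AC_id) (ltW x0) x1; rewrite -mulrBr [x + 1 - x]addrAC subrr add0r mulr1; apply.
 by move=> y xy _; rewrite /pos_part (lt_le_trans x0 xy) gd // (le_trans Nx).
- split=> // x x0; apply: le_trans (DeM x x0) _; rewrite /K; lin.
- split=> // [x x0|x x0|x x0].
 + by rewrite mulr_ge0 // addr_ge0 ?exprn_ge0 ?nrm_ge0 // mulr_ge0 // de0.
 + rewrite -mulrBr; apply: (@le_trans _ _ (2 ^+ p * (Mp + (M + 1) ^+ p * M))); last by rewrite /K; lin.
  rewrite ler_wpM2l // Y00; have := YM x x0. have : (M + 1) ^+ p * (De x - De 0) <= (M + 1) ^+ p * M by rewrite ler_wpM2l // DeM. lin.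
 + have [h1 _] := dif x x0; have h2 : nrm (gt x) <= nrm (g x) + de x.
   by rewrite -(subrK (g x) (gt x)); apply: le_trans (nrmD _ _) _; rewrite addrC lerD2l.
  have d0 := de0 x (ltW x0); rewrite /pos_part x0. have dM := deM x; have nt := nrm_ge0 (gt x); have ng := nrm_ge0 (g x).
  have dp : de x ^+ p <= (M + 1) ^+ p * de x.
   rewrite -(prednK p0) exprSr ler_wpM2r //; apply: (@le_trans _ _ ((M + 1) ^+ p.-1)).
    by rewrite lerXn2r ?nnegrE //; lin.
   by rewrite exprS ler_peMl ?exprn_ge0 //; lin.
  have d1 : 0 <= de x ^+ p by rewrite exprn_ge0. have g1 : 0 <= nrm (g x) ^+ p by rewrite exprn_ge0.
  have m0 : 0 <= (M + 1) ^+ p * de x by rewrite mulr_ge0. have [le|/ltW le] := leP (nrm (g x)) (de x).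
   apply: (@le_trans _ _ ((2 * de x) ^+ p)); first by rewrite lerXn2r ?nnegrE //; lin. by rewrite exprMn ler_wpM2l //; lin.
  apply: (@le_trans _ _ ((2 * nrm (g x)) ^+ p)); first by rewrite lerXn2r ?nnegrE //; lin. by rewrite exprMn ler_wpM2l //; lin.
Qed.

End BoundedVariation.

(** * Words, quasi-periodic functions and small divisors *)

Section Words.
Implicit Types (x y s t : R) (u v : seq nat).

Fixpoint words (N k : nat) : seq (seq nat) :=
  if k is k'.+1 then [seq l :: u | l <- iota 0 N, u <- words N k'] else [:: [::]].

Lemma words_cons (A : nmodType) N k (F : seq nat -> A) :
  \sum_(u <- words N k.+1) F u = \sum_(l <- iota 0 N) \sum_(u <- words N k) F (l :: u).
Proof. by rewrite /= big_allpairs_dep. Qed.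

Lemma size_words N k u : u \in words N k -> size u = k.
Proof. by elim: k u => [|k IH] u /=; [rewrite inE => /eqP ->|case/allpairsP => -[l v] /= [_ /IH h ->] /=; rewrite h]. Qed.

(** Cutting a word at position [i] is a bijection onto pairs of words; this handles the quadratic
    term of the Riccati equation. *)
Lemma words_split (A : pzRingType) N i k (F G : seq nat -> A) :
  \sum_(u <- words N (i + k)) F (take i u) * G (drop i u) = (\sum_(u <- words N i) F u) * \sum_(u <- words N k) G u.
Proof.
elim: i F => [|i IH] F.
 by rewrite add0n /= big_seq1 mulr_sumr; apply: eq_bigr => u _; rewrite take0 drop0.
rewrite addSn !words_cons mulr_suml; apply: eq_bigr => l _.
by rewrite -(IH (fun u => F (l :: u))).
Qed.

Lemma words_prod N k (a : nat -> R) :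
  \sum_(u <- words N k) \prod_(l <- u) a l = (\sum_(l <- iota 0 N) a l) ^+ k.
Proof.
elim: k => [|k IH]; first by rewrite /= big_seq1 big_nil.
rewrite words_cons exprS -IH mulr_suml; apply: eq_bigr => l _.
by rewrite mulr_sumr; apply: eq_bigr => u _; rewrite big_cons.
Qed.

Lemma words_mono N N' k (f : seq nat -> R) : (N <= N')%N -> (forall u, 0 <= f u) ->
  \sum_(u <- words N k) f u <= \sum_(u <- words N' k) f u.
Proof.
move=> NN f0; elim: k f f0 => [|k IH] f f0 //; rewrite !words_cons -(subnKC NN) iotaD big_cat /= add0n.
rewrite -[leLHS]addr0 lerD ?sumr_ge0 // => [|l _]; last by rewrite sumr_ge0.
by apply: ler_sum => l _; rewrite subnKC // IH.
Qed.

Lemma le_sum_mem (T : eqType) (r : seq T) a (f : T -> R) : a \in r -> (forall i, 0 <= f i) -> f a <= \sum_(i <- r) f i.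
Proof. by move=> ar f0; rewrite (big_rem a) //= lerDl sumr_ge0. Qed.

Lemma nrm_sum (I : Type) (r : seq I) (P : pred I) (F : I -> C) : nrm (\sum_(i <- r | P i) F i) <= \sum_(i <- r | P i) nrm (F i).
Proof.
elim/big_ind2: _ => //; first by rewrite nrm0.
by move=> a b c d h1 h2; apply: le_trans (nrmD _ _) _; exact: lerD.
Qed.

Lemma nrm_prod (I : Type) (r : seq I) (F : I -> C) : nrm (\prod_(i <- r) F i) = \prod_(i <- r) nrm (F i).
Proof. by elim/big_ind2: _ => [|a b c d <- <-|//]; rewrite ?nrm1 ?nrmM. Qed.
Lemma CLB_sub (f g : R -> C) : CLB f -> CLB g -> CLB (fun x => f x - g x).
Proof. by move=> hf hg; apply: CLB_ext (CLB_add hf (CLB_mul (CLB_cst (-1)) hg)) => x _; rewrite mulN1r. Qed.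

Lemma CLB_sum (I : Type) (r : seq I) (P : pred I) (F : I -> R -> C) : (forall i, P i -> CLB (F i)) -> CLB (fun x => \sum_(i <- r | P i) F i x).
Proof.
move=> h; elim: r => [|i r IH]; first by apply: CLB_ext (CLB_cst 0) => x _; rewrite big_nil.
case Pi: (P i); last by apply: CLB_ext IH => x _; rewrite big_cons Pi.
by apply: CLB_ext (CLB_add (h i Pi) IH) => x _; rewrite big_cons Pi.
Qed.

Lemma CAC_sum (I : eqType) (r : seq I) (F G : I -> R -> C) : (forall i, i \in r -> CAC (F i) (G i)) ->
  CAC (fun x => \sum_(i <- r) F i x) (fun x => \sum_(i <- r) G i x).
Proof.
elim: r => [|a r IH] h.
 by apply: CAC_ext (CAC_real (AC_cst 0)) => x _; rewrite big_nil rmorph0.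
apply: (CAC_ext _ _ (CAC_add (h a (mem_head _ _)) (IH _))) => [x _|x _|i ir]; rewrite ?big_cons //.
by apply: h; rewrite inE ir orbT.
Qed.

Lemma qp_bound (h : R -> C) (mu : C) (B : R) : nrm mu = 1 -> (forall x, 0 <= x -> h (x + 1) = mu * h x) ->
  (forall x, 0 <= x -> x <= 1 -> nrm (h x) <= B) -> forall x, 0 <= x -> nrm (h x) <= B.
Proof.
move=> mu1 hp hB; apply: (per_bound (f := fun x => nrm (h x))) => // x x0.
by rewrite hp // nrmM mu1 mul1r.
Qed.

(** The constant [(G 1 - G 0) / (mu - 1)] is the one that gives the primitive the multiplier [mu],
    and it is the source of the small divisor. The final bound uses [1 <= 2 / |mu - 1|] to merge two
    terms. *)
Lemma qp_prim (F : R -> C) (mu : C) : CLI F -> nrm mu = 1 -> mu != 1 -> (forall x, 0 <= x -> F (x + 1) = mu * F x) ->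
  exists h, [/\ CAC h F, forall x, 0 <= x -> h (x + 1) = mu * h x &
    forall m : R, 0 <= m -> (forall x, 0 <= x -> nrm (F x) <= m) -> forall x, 0 <= x -> nrm (h x) <= m * (2 * (2 / nrm (mu - 1)))].
Proof.
move=> IF mu1 mun Fp; have [G aG _] := CAC_prim 0 IF.
have d0 : 0 < nrm (mu - 1) by rewrite nrm_gt0 subr_eq0.
pose h x := (G 1 - G 0) / (mu - 1) + (G x - G 0).
have ah : CAC h F.
 apply: CAC_ext (CAC_add (CAC_real (AC_cst 0)) (CAC_add aG (CAC_scale ((G 1 - G 0) / (mu - 1) - G 0) (CAC_real (AC_cst 1))))) => x _.
  by rewrite /h rmorph0 rmorph1 mulr1; ring.
 by rewrite rmorph0 mulr0 add0r addr0.
have hp x : 0 <= x -> h (x + 1) = mu * h x.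
 move=> x0; have a2 : CAC (fun x => h (x + 1) - mu * h x) (fun=> 0).
  apply: CAC_ext (CAC_sub (CAC_shift ler01 ah) (CAC_scale mu ah)) => // y y0. by rewrite Fp // subrr.
 apply/eqP; rewrite -subr_eq0 (CAC_const a2 (lexx 0) x0) add0r /h !subrr addr0. by apply/eqP; field; rewrite subr_eq0.
exists h; split=> // m m0 Fm; apply: (qp_bound mu1 hp) => x x0 x1.
have GI y : 0 <= y -> y <= 1 -> nrm (G y - G 0) <= m.
 move=> y0 y1; have := CAC_le_nrm aG (AC_scale m AC_id) (lexx 0) y0 => H. apply: le_trans (H _) _; first by move=> z z0 _; rewrite mulr1 Fm.
 by rewrite mulr0 subr0 ler_piMr.
have m2 : nrm (mu - 1) <= 2 by apply: le_trans (nrmB _ _) _; rewrite mu1 nrm1.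
apply: le_trans (nrmD _ _) _; rewrite nrmM.
have e1 : nrm (mu - 1) * nrm (mu - 1)^-1 = 1 by rewrite -nrmM mulfV ?nrm1 // subr_eq0.
have -> : nrm (mu - 1)^-1 = (nrm (mu - 1))^-1 by apply: (mulfI (lt0r_neq0 d0)); rewrite e1 mulfV // gt_eqF.
have i1 : 1 <= 2 / nrm (mu - 1) by rewrite ler_pdivlMr // mul1r.
have v0 : 0 <= (nrm (mu - 1))^-1 by rewrite invr_ge0 ltW.
have h1 := ler_wpM2r v0 (GI 1 ler01 (lexx 1)).
have h2 := ler_wpM2l m0 i1; have := GI x x0 x1; lin.
Qed.

Definition infs u : seq (seq nat) := [seq take j (drop i u) | i <- iota 0 (size u).+1, j <- iota 0 (size u).+1].

Lemma mem_infs v u : infix v u -> v \in infs u.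
Proof.
move=> /infixP[p [q ->]]; apply/allpairsP; exists (size p, size v).
rewrite !mem_iota !size_cat drop_size_cat //= take_size_cat //.
by split=> //; lia.
Qed.

Variables (A B : R -> C) (mu0 : C) (e : nat -> R -> C) (c : nat -> C) (a0 : R) (n0 : nat).
Hypotheses (A_CLB : CLB A) (B_CLB : CLB B) (e_CLB : forall l, CLB (e l)) (a00 : 0 <= a0) (mu01 : nrm mu0 = 1)
  (Aa : forall x, 0 <= x -> nrm (A x) <= a0) (Ba : forall x, 0 <= x -> nrm (B x) <= a0)
  (e1 : forall l x, nrm (e l x) = 1) (Ap : forall x, 0 <= x -> A (x + 1) = A x)
  (Bp : forall x, 0 <= x -> B (x + 1) = mu0 * B x) (ep : forall l x, 0 <= x -> e l (x + 1) = e l 1 * e l x).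

(** The multiplier of [H_u] over one period: one factor from [B] and one from the exponential of
    each letter. *)
Definition wmu u : C := mu0 * \prod_(l <- u) e l 1.
Definition cw u : C := \prod_(l <- u) c l.
Hypothesis good : forall u, (size u <= n0)%N -> cw u != 0 -> wmu u != 1.

(** The coefficient of the word [l :: v] when [i V (B - 2 A w + conj B w ^+ 2)] is expanded, with
    [V] a sum over letters and [w] a sum over words. In the quadratic term [v] is cut into two
    nonempty words. *)
Definition wrhs (H : seq nat -> R -> C) u x : C := if u is l :: v then
  c l * e l x * ('i%C * (if v is [::] then B x
    else conj (B x) * (\sum_(1 <= i < size v) H (take i v) x * H (drop i v) x) - 2 * A x * H v x)) else 0.

(** [Y] has to bound the divisors of all infixes of [u], because the recursion for [H_u] runs
    through infixes. The first alternative concerns words with zero coefficient, whose divisors are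
    not controlled; the bound then says [H_u = 0]. *)
Definition wbound (H : seq nat -> R -> C) (K : R) u := forall Y : R, 1 <= Y ->
  cw u = 0 \/ (forall v, infix v u -> 2 / nrm (wmu v - 1) <= Y) -> forall x, 0 <= x -> nrm (H u x) <= K * nrm (cw u) * Y ^+ size u.

Lemma cw_cat u v : cw (u ++ v) = cw u * cw v.
Proof. by rewrite /cw big_cat. Qed.
Lemma nrm_wmu u : nrm (wmu u) = 1.
Proof. by rewrite /wmu nrmM mu01 mul1r nrm_prod big1. Qed.
Lemma wmu_cons l u : wmu (l :: u) = e l 1 * wmu u.
Proof. by rewrite /wmu big_cons; ring. Qed.
(** The factor [conj B] carries [conj mu0], which cancels one of the two [mu0] of the pieces; so all
    terms of [wrhs] share one multiplier. *)
Lemma wmu_split u i : mu0 * conj mu0 = 1 -> conj mu0 * (wmu (take i u) * wmu (drop i u)) = wmu u.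
Proof. by move=> h; rewrite /wmu -{3}(cat_take_drop i u) big_cat /= -[LHS]mul1r -h; ring: h. Qed.

(** Induction on the length: [wrhs] for [l :: v] involves only words no longer than [v] and has
    multiplier [wmu (l :: v)], so [qp_prim] integrates it at the price of one more factor [Y]. *)
Lemma word_functions n : (n <= n0)%N -> exists (H : seq nat -> R -> C) (K : R), [/\ 1 <= K, H [::] = (fun=> 1) &
  forall u, (size u <= n)%N -> wbound H K u /\
    ((0 < size u)%N -> CAC (H u) (wrhs H u) /\ forall x, 0 <= x -> H u (x + 1) = wmu u * H u x)].
Proof.
have mm : mu0 * conj mu0 = 1.
 apply: C_eq; rewrite !CE; last by ring. by have := nrmE mu0; rewrite mu01 /nsq; lra.
elim: n => [_|n IH nn].
 exists (fun _ _ => 1), 1; split=> // -[|//] _; split=> // Y _ _ x _. by rewrite /cw big_nil !nrm1 !mul1r.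
have [H [K [K1 H0 HP]]] := IH (ltnW nn); have K0 : 0 <= K by lra.
(* The three summands bound the terms of [wrhs] in [B], in the at most [n] cuts of the quadratic
   part, and in [A]. *)
pose K2 := a0 + a0 * (n%:R * (K * K)) + 2 * a0 * K.
have k1 : 0 <= a0 * (n%:R * (K * K)) by rewrite !mulr_ge0.
have k2 : 0 <= 2 * a0 * K by rewrite !mulr_ge0.
have K20 : 0 <= K2 by rewrite !addr_ge0.
have step u : exists h, size u = n.+1 -> [/\ CAC h (wrhs H u), forall x, 0 <= x -> h (x + 1) = wmu u * h x &
  wbound (fun _ => h) (2 * K2) u].
 case: u => [|l v]; first by exists (fun=> 0).
 have [/eqP sv|nsv] := boolP (size v == n); last by exists (fun=> 0) => -[] /eqP; rewrite (negbTE nsv).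
 have CH u : (size u <= n)%N -> CLB (H u).
  case: u => [_|k u hu]; first by rewrite H0; exact: CLB_cst. by have [_ /(_ isT)[/CAC_CLB]] := HP _ hu.
 have sz i : (size (take i v) <= n)%N /\ (size (drop i v) <= n)%N.
  by rewrite size_take_min size_drop sv; split; lia.
 have IF : CLI (wrhs H (l :: v)).
  apply: CLB_CLI; apply: CLB_mul; first exact: CLB_mul (CLB_cst _) (e_CLB l). apply: CLB_mul (CLB_cst _) _; case: v sv sz => [//|k v] sv sz.
  apply: CLB_sub; last by apply: CLB_mul (CLB_mul (CLB_cst _) A_CLB) (CH _ _); rewrite sv.
  apply: CLB_mul (CLB_conj B_CLB) _; apply: CLB_sum => i _; have [? ?] := sz i. by apply: CLB_mul; exact: CH.
 (* With zero coefficient each term of the right-hand side contains a factor with zero coefficient,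
    so [H_u = 0] works even in the resonant case [wmu u = 1]. *)
 have [c0|cn0] := eqVneq (cw (l :: v)) 0.
  exists (fun=> 0) => _; split=> [|x _|Y _ _ x _]; rewrite ?mulr0 // ?c0 ?nrm0 ?mulr0 ?mul0r //.
  apply: CAC_ext (CAC_real (AC_cst 0)) => // x x0. have Hz u : (size u <= n)%N -> cw u = 0 -> H u x = 0.
   move=> su cu; apply/eqP; rewrite -nrm_eq0 eq_le nrm_ge0 andbT.
   by have [hb _] := HP u su; have := hb 1 (lexx 1) (or_introl cu) x x0; rewrite cu nrm0 mulr0 mul0r.
  rewrite rmorph0 /wrhs; move: c0; rewrite /cw big_cons => /eqP; rewrite mulf_eq0 => /orP[/eqP->|/eqP c0].
   by rewrite !mul0r.
  case: v sv sz IF c0 => [|k v] sv sz _ c0; first by move: c0; rewrite big_nil => /eqP; rewrite oner_eq0.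
  rewrite Hz ?sv // mulr0 subr0 big1 ?mulr0 // => i _; have [z1 z2] := sz i.
  have /eqP : cw (take i (k :: v)) * cw (drop i (k :: v)) = 0 by rewrite -cw_cat cat_take_drop.
  by rewrite mulf_eq0 => /orP[]/eqP h; rewrite (Hz _ _ h) ?mul0r ?mulr0.
 have Fp x : 0 <= x -> wrhs H (l :: v) (x + 1) = wmu (l :: v) * wrhs H (l :: v) x.
  move=> x0; rewrite wmu_cons /wrhs ep //; case: v sv sz IF cn0 => [|k v] sv sz _ _.
   by rewrite Bp // /wmu big_nil; ring.
  have u0 : (0 < size (k :: v))%N by []. set u := k :: v in sv sz u0 *; clearbody u. rewrite Ap // Bp // rmorphM.
  have -> : H u (x + 1) = wmu u * H u x by have [_ /(_ u0)[_ ->]] := HP u (eq_leq sv).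
  have -> : conj mu0 * conj (B x) * \sum_(1 <= i < size u) H (take i u) (x + 1) * H (drop i u) (x + 1) =
    wmu u * (conj (B x) * \sum_(1 <= i < size u) H (take i u) x * H (drop i u) x).
   rewrite !mulr_sumr; apply: eq_big_nat => i /andP[i1 i2]; have [z1 z2] := sz i.
   have [_ [|_ ->//]] := HP _ z1; first by rewrite size_take i2. have [_ [|_ ->//]] := HP _ z2; first by rewrite size_drop subn_gt0.
   by rewrite -(wmu_split u i mm); ring.
  by ring.
 have [h [ah hp hb]] := qp_prim IF (nrm_wmu _) (good (u := l :: v) ltac:(by rewrite /= sv) cn0) Fp.
 exists h => _; split=> // Y Y1 [c0|hY] x x0; first by rewrite c0 eqxx in cn0. have Y0 : 0 <= Y by lra.
 have m0 : 0 <= K2 * nrm (cw (l :: v)) * Y ^+ n by rewrite !mulr_ge0 ?nrm_ge0 ?exprn_ge0. apply: le_trans (hb _ m0 _ x x0) _.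
  move=> y y0; rewrite /wrhs /cw big_cons -/(cw v) !nrmM e1 nrmi mulr1 mul1r.
  rewrite (_ : K2 * (nrm (c l) * nrm (cw v)) * Y ^+ n = nrm (c l) * (K2 * (nrm (cw v) * Y ^+ n))); last by ring.
  rewrite ler_wpM2l ?nrm_ge0 //; case: v sv sz {IF cn0 Fp hb m0 ah hp} hY => [|k v] sv sz hY.
   rewrite /cw big_nil nrm1 mul1r -sv expr0 mulr1; apply: le_trans (Ba y0) _; rewrite /K2 -addrA lerDl. exact: addr_ge0.
  set u := k :: v in sv sz hY *. have bH v' : (size v' <= n)%N -> infix v' u -> nrm (H v' y) <= K * nrm (cw v') * Y ^+ size v'.
   move=> sv' iv'; have [hb _] := HP v' sv'; apply: (hb Y Y1 _ y y0); right=> v2 iv2; apply: hY.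
   by apply: infix_trans iv2 (infix_trans iv' _); exact: infix_cons.
  set T := nrm (cw u) * Y ^+ n; have T0 : 0 <= T by rewrite mulr_ge0 ?nrm_ge0 ?exprn_ge0. apply: le_trans (nrmB _ _) _; rewrite !nrmM nrmJ.
  have h2 : nrm (A y) * nrm (H u y) <= a0 * (K * T).
   by apply: ler_pM; rewrite ?nrm_ge0 ?Aa // /T -sv mulrA; apply: bH; rewrite ?sv ?infix_refl.
  have h1 : nrm (B y) * nrm (\sum_(1 <= i < size u) H (take i u) y * H (drop i u) y) <= a0 * (n%:R * (K * K * T)).
   apply: ler_pM; rewrite ?nrm_ge0 ?Ba //; apply: le_trans (nrm_sum _ _ _) _. apply: (@le_trans _ _ (\sum_(1 <= i < size u) K * K * T)).
    apply: ler_sum_nat => i /andP[i1 i2]; have [z1 z2] := sz i; rewrite nrmM.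
    rewrite (_ : K * K * T = (K * nrm (cw (take i u)) * Y ^+ size (take i u)) * (K * nrm (cw (drop i u)) * Y ^+ size (drop i u))).
     apply: ler_pM; rewrite ?nrm_ge0 //; apply: bH => //; first exact: infix_take. exact: infix_drop.
    by rewrite /T -sv -{1 2}(cat_take_drop i u) cw_cat size_cat exprD nrmM; ring.
   rewrite sumr_const_nat -[leLHS]mulr_natl; apply: ler_wpM2r; first exact: mulr_ge0 (mulr_ge0 K0 K0) T0. by rewrite ler_nat sv leq_subr.
  rewrite (_ : nrm (2 : C) = 2); last by rewrite -(rmorph_nat (@real_complex R)) nrmC ger0_norm. have := mulr_ge0 a00 T0; rewrite /K2; lra.
 rewrite /= sv exprS; have := hY _ (infix_refl _); set d := 2 / _ => dY.
 have -> : 2 * K2 * nrm (cw (l :: v)) * (Y * Y ^+ n) = (K2 * nrm (cw (l :: v)) * Y ^+ n) * (2 * Y) by ring.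
 by rewrite ler_wpM2l // ler_pM2l.
have [f fP] := choice step.
exists (fun u => if (size u <= n)%N then H u else f u), (K + 2 * K2); split=> //; first by lra.
move=> u su.
have rE : forall x, wrhs (fun u => if (size u <= n)%N then H u else f u) u x = wrhs H u x.
 move=> x; rewrite /wrhs; case: u su => [//|l [//|k v]] su; have sv : (size (k :: v) <= n)%N by [].
 rewrite sv; congr (_ * (_ * (_ * _ - _))); apply: eq_bigr => i _.
 have -> : (size (take i (k :: v)) <= n)%N by rewrite size_take_min; apply: leq_trans (geq_minr _ _) sv.
 by have -> : (size (drop i (k :: v)) <= n)%N by rewrite size_drop; apply: leq_trans (leq_subr _ _) sv.
have [sn|sn] := leqP (size u) n.
 have [hb hr] := HP u sn; split.
  move=> Y Y1 hY x x0; rewrite sn; apply: le_trans (hb Y Y1 hY x x0) _; rewrite -!mulrA ler_wpM2r ?lerDl //; last lra.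
  by rewrite mulr_ge0 ?nrm_ge0 ?exprn_ge0 //; lra.
 move=> /hr [h1 h2]; split; first by apply: CAC_ext h1 => x x0; rewrite ?sn // rE. by move=> x x0; rewrite h2.
have [h1 h2 hb] := fP u (eqP (ltac:(by rewrite eqn_leq su sn) : size u == n.+1)).
have sN : (size u <= n)%N = false by rewrite leqNgt sn.
split.
 move=> Y Y1 hY x x0; rewrite sN; apply: le_trans (hb Y Y1 hY x x0) _; rewrite -[leLHS]mulrA -[leRHS]mulrA ler_wpM2r ?lerDr //.
 by rewrite mulr_ge0 ?nrm_ge0 ?exprn_ge0 //; lra.
move=> _; split; first by apply: CAC_ext h1 => x x0; rewrite ?sN // rE.
by move=> x x0; rewrite h2.
Qed.

End Words.

(** * The approximate solution of the Riccati equation *)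

Section Riccati.
Implicit Types (x y s t : R) (u v : seq nat) (N k i j l : nat).

(** An [L^1] bound by [K] on [(0, oo)], expressed by a majorant [g] with primitive [F] of total
    increase at most [K]: the form in which the Gronwall inequalities take an error term. *)
Definition ctrl (K : R) (f : R -> C) := exists F g : R -> R, [/\ AC F g, forall x, 0 <= x -> 0 <= g x,
  forall x, 0 <= x -> F x - F 0 <= K & forall x, 0 < x -> nrm (f x) <= g x].

Lemma ctrl_le (c K : R) (f h : R -> C) : 0 <= c -> (forall x, 0 < x -> nrm (h x) <= c * nrm (f x)) -> ctrl K f -> ctrl (c * K) h.
Proof.
move=> c0 hf [F [g [aF g0 FK fg]]]; exists (fun x => c * F x), (fun x => c * g x); split.
- exact: AC_scale.
- by move=> x x0; rewrite mulr_ge0 // g0.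
- by move=> x x0; rewrite -mulrBr ler_wpM2l // FK.
- by move=> x x0; apply: le_trans (hf x x0) _; rewrite ler_wpM2l // fg.
Qed.

Lemma ctrl_weak (K L : R) (f : R -> C) : K <= L -> ctrl K f -> ctrl L f.
Proof. by move=> KL [F [g [a b h d]]]; exists F, g; split=> // x x0; exact: le_trans (h x x0) KL. Qed.
Lemma ctrl_ext (K : R) (f h : R -> C) : (forall x, 0 < x -> f x = h x) -> ctrl K f -> ctrl K h.
Proof. by move=> e [F [g [a b c d]]]; exists F, g; split=> // x x0; rewrite -e // d. Qed.
Lemma ctrl0 : ctrl 0 (fun=> 0).
Proof. by exists (fun=> 0), (fun=> 0); split=> [||x _|x _]; rewrite ?subrr ?nrm0 //; exact: AC_cst. Qed.

Lemma ctrl_add (K L : R) (f h : R -> C) : ctrl K f -> ctrl L h -> ctrl (K + L) (fun x => f x + h x).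
Proof.
move=> [F [g [aF g0 FK fg]]] [F' [g' [aF' g0' FK' fg']]]; exists (fun x => F x + F' x), (fun x => g x + g' x); split.
- exact: AC_add.
- by move=> x x0; rewrite addr_ge0 ?g0 ?g0'.
- by move=> x x0; have := FK x x0; have := FK' x x0; lin.
- by move=> x x0; apply: le_trans (nrmD _ _) _; rewrite lerD ?fg ?fg'.
Qed.

Lemma ctrl_sum (I : eqType) (r : seq I) (K : I -> R) (f : I -> R -> C) : (forall i : I, i \in r -> ctrl (K i) (f i)) ->
  ctrl (\sum_(i <- r) K i) (fun x => \sum_(i <- r) f i x).
Proof.
elim: r => [|a r IH] h; first by rewrite big_nil; apply: ctrl_ext ctrl0 => x _; rewrite big_nil.
rewrite big_cons; apply: (ctrl_ext (f := fun x => f a x + \sum_(i <- r) f i x)) => [x _|]; first by rewrite big_cons.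
by apply: ctrl_add; [apply: h; rewrite mem_head|apply: IH => i ir; apply: h; rewrite inE ir orbT].
Qed.

Definition uctrl (f : nat -> R -> C) := exists K : R, forall N, ctrl K (f N).

Lemma uctrl_add (f h : nat -> R -> C) : uctrl f -> uctrl h -> uctrl (fun N x => f N x + h N x).
Proof. by move=> [K hK] [L hL]; exists (K + L) => N; exact: ctrl_add. Qed.
Lemma uctrl_ext (f h : nat -> R -> C) : (forall N x, 0 < x -> f N x = h N x) -> uctrl f -> uctrl h.
Proof. by move=> e [K hK]; exists K => N; apply: ctrl_ext (hK N) => x; exact: e. Qed.
Lemma uctrl_mul (c : R) (f h : nat -> R -> C) : 0 <= c -> (forall N x, 0 < x -> nrm (h N x) <= c * nrm (f N x)) -> uctrl f -> uctrl h.
Proof. by move=> c0 e [K hK]; exists (c * K) => N; apply: ctrl_le (hK N) => // x; exact: e. Qed.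

Lemma uctrl_sum (I : eqType) (r : seq I) (P : pred I) (f : I -> nat -> R -> C) : (forall i : I, i \in r -> P i -> uctrl (f i)) ->
  uctrl (fun N x => \sum_(i <- r | P i) f i N x).
Proof.
elim: r => [|a r IH] h; first by exists 0 => N; apply: ctrl_ext ctrl0 => x _; rewrite big_nil.
have h' : uctrl (fun N x => \sum_(i <- r | P i) f i N x) by apply: IH => i ir; apply: h; rewrite inE ir orbT.
case Pa: (P a); last by apply: uctrl_ext h' => N x _; rewrite big_cons Pa.
by apply: uctrl_ext (uctrl_add (h a (mem_head _ _) Pa) h') => N x _; rewrite big_cons Pa.
Qed.

(** Summing over pairs instead of total lengths shows which products in [ww ^+ 2] are reproduced by
    the truncated recursion. *)
Lemma cauchy_sum (A : nmodType) (F : nat -> nat -> A) n :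
  \sum_(1 <= k < n) \sum_(1 <= i < k) F i (k - i)%N = \sum_(1 <= i < n.+1) \sum_(1 <= j < n.+1 | (i + j < n)%N) F i j.
Proof.
transitivity (\sum_(1 <= k < n) \sum_(1 <= i < n.+1 | (i < k)%N) F i (k - i)%N).
 apply: eq_big_nat => k /andP[k1 kn]; rewrite (big_nat_widen _ _ n.+1); last by rewrite leqW // ltnW. by apply: eq_bigl.
rewrite (exchange_big_dep_nat xpredT) //=; apply: eq_big_nat => i /andP[i1 i2].
transitivity (\sum_(1 + i <= k < n) F i (k - i)%N).
 by rewrite add1n [RHS](big_nat_widenl _ 1).
rewrite big_addn (big_nat_widen _ _ n.+1) ?leqW ?leq_subr //; apply: eq_big => [j|j _]; last by rewrite addnK.
by rewrite ltn_subRL addnC.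
Qed.

Lemma uniform_small (g : nat -> R -> C) N (r : R) :
  (forall l (d : R), 0 < d -> exists X : R, forall x, 0 < x -> X <= x -> nrm (g l x) <= d) -> 0 < r ->
  exists X : R, forall l x, (l < N)%N -> 0 < x -> X <= x -> nrm (g l x) <= r.
Proof.
move=> h r0; elim: N => [|N [X hX]]; first by exists 0.
have [X' hX'] := h N r r0; exists (Num.max X X') => l x; rewrite ltnS leq_eqVlt ge_max.
by move=> /orP[/eqP->|lL] x0 /andP[h1 h2]; [exact: hX'|exact: hX].
Qed.

Variables (gt gt1 : nat -> R -> C) (Kg : R) (n0 : nat).
Hypotheses (Kg1 : 1 <= Kg) (agt : forall l, CAC (gt l) (gt1 l)) (gtK : forall l x, 0 <= x -> nrm (gt l x) <= Kg)
  (cgt1 : forall l, ctrl Kg (gt1 l)) (cgtp : forall l, ctrl Kg (fun x => (nrm (gt l x) ^+ n0.+1)%:C%C)).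

Definition Gam u x : C := \prod_(l <- u) gt l x.
Fixpoint Gam1 u x : C := if u is l :: v then gt1 l x * Gam v x + gt l x * Gam1 v x else 0.

Lemma Kg0 : 0 <= Kg. Proof. exact: le_trans ler01 Kg1. Qed.

Lemma Gam_CAC u : CAC (Gam u) (Gam1 u).
Proof.
elim: u => [|l u IH].
 by apply: CAC_ext (CAC_real (AC_cst 1)) => x _; rewrite /Gam ?big_nil ?rmorph1 ?rmorph0.
by apply: CAC_ext (CAC_mul (agt l) IH) => x _ //; rewrite /Gam big_cons.
Qed.

Lemma Gam_le u x : 0 <= x -> nrm (Gam u x) <= Kg ^+ size u.
Proof.
move=> x0; elim: u => [|l u IH]; first by rewrite /Gam big_nil nrm1.
by rewrite /Gam big_cons nrmM exprS ler_pM ?nrm_ge0 ?gtK.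
Qed.

Lemma Gam1_ctrl u : ctrl ((size u)%:R * Kg ^+ size u) (Gam1 u).
Proof.
elim: u => [|l u IH]; first by rewrite mul0r; exact: ctrl0.
have h1 : ctrl (Kg ^+ size u * Kg) (fun x => gt1 l x * Gam u x).
 apply: ctrl_le (cgt1 l); first by rewrite exprn_ge0 // Kg0. by move=> x x0; rewrite nrmM mulrC ler_wpM2r ?nrm_ge0 // Gam_le // ltW.
have h2 : ctrl (Kg * ((size u)%:R * Kg ^+ size u)) (fun x => gt l x * Gam1 u x).
 by apply: ctrl_le IH; [exact: Kg0|move=> x x0; rewrite nrmM ler_wpM2r ?nrm_ge0 // gtK // ltW].
by apply: ctrl_weak (ctrl_add h1 h2); rewrite /= -natr1 exprS; lra.
Qed.

Lemma prod_le_pow (l : nat) u (a : nat -> R) : (forall i, 0 <= a i) -> exists2 j, j \in l :: u & \prod_(i <- l :: u) a i <= a j ^+ (size u).+1.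
Proof.
move=> a0; elim: u l => [|k u IH] l; first by exists l; rewrite ?mem_head // big_seq1 expr1.
have [j ju hj] := IH k; rewrite big_cons.
have [le|/ltW le] := leP (a l) (a j).
 by exists j; [rewrite inE ju orbT|rewrite exprS ler_pM // prodr_ge0].
exists l; first exact: mem_head.
rewrite exprS ler_wpM2l //; apply: le_trans hj _.
by rewrite lerXn2r ?nnegrE.
Qed.

(** A product of at least [n0 + 1 = p] factors is at most a constant times the [p]-th power of its
    largest factor, and these powers are integrable. *)
Lemma Gam_ctrl u : (n0 < size u)%N -> ctrl (Kg ^+ size u * \sum_(l <- u) Kg) (Gam u).
Proof.
move=> su; have Kp : 0 <= Kg ^+ size u by rewrite exprn_ge0 // Kg0.
apply: (ctrl_le Kp _ (ctrl_sum (r := u) (fun l _ => cgtp l))) => x x0.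
rewrite -rmorph_sum nrmC ger0_norm ?sumr_ge0 // => [|l _]; last by rewrite exprn_ge0 // nrm_ge0.
case: u su Kp => [//|k u] su Kp.
have [j ju hj] := prod_le_pow k u (fun i => nrm_ge0 (gt i x)); rewrite /Gam nrm_prod; apply: le_trans hj _.
apply: (@le_trans _ _ (Kg ^+ size (k :: u) * nrm (gt j x) ^+ n0.+1)); last first.
 rewrite ler_wpM2l //; apply: (le_sum_mem (f := fun l => nrm (gt l x) ^+ n0.+1) ju) => i. by rewrite exprn_ge0 // nrm_ge0.
rewrite (_ : (size u).+1 = size (k :: u) - n0.+1 + n0.+1)%N; last by rewrite subnK.
rewrite exprD; apply: ler_wpM2r; first by rewrite exprn_ge0 // nrm_ge0.
apply: (@le_trans _ _ (Kg ^+ (size (k :: u) - n0.+1))); first by rewrite lerXn2r ?nnegrE ?nrm_ge0 ?Kg0 ?gtK // ltW.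
by rewrite ler_weXn2l // leq_subr.
Qed.

Variables (A B : R -> C) (e : nat -> R -> C) (c : nat -> C) (a0 : R) (H : seq nat -> R -> C) (wt : seq nat -> R) (Bw Bc : R).
Hypotheses (a00 : 0 <= a0) (Aa : forall x, 0 <= x -> nrm (A x) <= a0) (Ba : forall x, 0 <= x -> nrm (B x) <= a0)
  (e1 : forall l x, nrm (e l x) = 1) (H0 : H [::] = (fun=> 1))
  (aH : forall u, (0 < size u)%N -> (size u <= n0)%N -> CAC (H u) (wrhs A B e c H u))
  (wt0 : forall u, 0 <= wt u) (Hwt : forall u x, (size u <= n0)%N -> 0 <= x -> nrm (H u x) <= wt u)
  (wtB : forall N k, (k <= n0)%N -> \sum_(u <- words N k) wt u <= Bw)
  (cB : forall N, \sum_(l <- iota 0 N) nrm (c l) <= Bc) (n00 : (0 < n0)%N).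

Definition W N k x : C := \sum_(u <- words N k) Gam u x * H u x.
Definition VN N x : C := \sum_(l <- iota 0 N) c l * e l x * gt l x.
Definition ww N x : C := \sum_(1 <= k < n0.+1) W N k x.
Definition dG N k x : C := \sum_(u <- words N k) Gam1 u x * H u x.
Definition ww1 N x : C := \sum_(1 <= k < n0.+1) \sum_(u <- words N k) (Gam1 u x * H u x + Gam u x * wrhs A B e c H u x).
Definition ric x (z : C) : C := B x - 2 * A x * z + conj (B x) * z ^+ 2.

Lemma W0 N x : W N 0 x = 1.
Proof. by rewrite /W /= big_seq1 H0 /Gam big_nil mulr1. Qed.

Lemma w_CAC N : CAC (ww N) (ww1 N).
Proof.
apply: CAC_sum => k; rewrite mem_index_iota ltnS => /andP[k1 k2]; apply: CAC_sum => u /size_words su.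
by apply: CAC_mul (Gam_CAC u) (aH _ _); rewrite su.
Qed.

(** The first letters factor out as [i V_N], and cutting the remaining word turns the quadratic part
    into the products [W i * W (k - i)]. *)
Lemma w1_words N k x : \sum_(u <- words N k.+1) Gam u x * wrhs A B e c H u x =
  'i%C * VN N x * (if k is 0 then B x else conj (B x) * (\sum_(1 <= i < k) W N i x * W N (k - i) x) - 2 * A x * W N k x).
Proof.
rewrite words_cons -[RHS]mulrA [RHS]mulrCA /VN mulr_suml; apply: eq_bigr => l _.
case: k => [|k]; first by rewrite /= big_seq1 /Gam big_seq1; ring.
transitivity (\sum_(u <- words N k.+1) c l * e l x * gt l x * 'i%C *
  (conj (B x) * (\sum_(1 <= i < k.+1) (Gam (take i u) x * H (take i u) x) * (Gam (drop i u) x * H (drop i u) x)) - 2 * A x * (Gam u x * H u x))).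
 apply: eq_big_seq => u /size_words su.
 have E1 : \sum_(1 <= i < k.+1) (Gam (take i u) x * H (take i u) x) * (Gam (drop i u) x * H (drop i u) x) =
   Gam u x * \sum_(1 <= i < k.+1) H (take i u) x * H (drop i u) x.
  rewrite mulr_sumr; apply: eq_bigr => i _. have -> : Gam u x = Gam (take i u) x * Gam (drop i u) x by rewrite /Gam -big_cat cat_take_drop.
  by ring.
 have E2 : wrhs A B e c H (l :: u) x = c l * e l x * ('i%C * (conj (B x) * (\sum_(1 <= i < k.+1) H (take i u) x * H (drop i u) x) - 2 * A x * H u x)).
  by move: su; case: u {E1} => // a u su; rewrite /wrhs su.
 by rewrite E1 E2 {1}/Gam big_cons -/(Gam u x); ring.
rewrite -mulr_sumr sumrB -!mulr_sumr exchange_big -/(W N k.+1 x).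
rewrite (_ : \sum_(1 <= i < k.+1) _ = \sum_(1 <= i < k.+1) W N i x * W N (k.+1 - i) x); first by ring.
apply: eq_big_nat => i /andP[i1 i2].
rewrite -[X in words N X](subnKC (ltnW i2)) (words_split _ _ _ (fun u => Gam u x * H u x) (fun u => Gam u x * H u x)).
by rewrite /W.
Qed.

(** The truncated series solves the Riccati equation except for [dG], where a [gt] is
    differentiated, and for products of total length at least [n0], which the truncation does not
    reproduce; with the factor [VN] these contain at least [n0 + 1 = p] factors [gt]. Writing the
    linear one as [W n0 * W 0], with [W 0 = 1], gives all of them the same shape. *)
Lemma w1E N x : ww1 N x = 'i%C * VN N x * ric x (ww N x) + (\sum_(1 <= k < n0.+1) dG N k x +
  'i%C * VN N x * (2 * A x * (W N n0 x * W N 0 x) -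
    conj (B x) * \sum_(1 <= i < n0.+1) \sum_(1 <= j < n0.+1 | (n0 <= i + j)%N) W N i x * W N j x)).
Proof.
have -> : ww1 N x = \sum_(1 <= k < n0.+1) dG N k x + \sum_(1 <= k < n0.+1) \sum_(u <- words N k) Gam u x * wrhs A B e c H u x.
 by rewrite -big_split /=; apply: eq_bigr => k _; rewrite big_split.
have -> : \sum_(1 <= k < n0.+1) \sum_(u <- words N k) Gam u x * wrhs A B e c H u x =
  'i%C * VN N x * (B x + \sum_(1 <= k < n0) (conj (B x) * (\sum_(1 <= i < k) W N i x * W N (k - i) x) - 2 * A x * W N k x)).
 rewrite big_add1 succnK (big_ltn n00) w1_words mulrDr mulr_sumr; congr (_ + _). by apply: eq_big_nat => -[//|k] _; rewrite w1_words.
rewrite big_split /= sumrN -!mulr_sumr (cauchy_sum (fun i j => W N i x * W N j x)).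
have e2 : ww N x = \sum_(1 <= k < n0) W N k x + W N n0 x by rewrite /ww big_nat_recr.
have e3 : ww N x ^+ 2 = \sum_(1 <= i < n0.+1) \sum_(1 <= j < n0.+1 | (i + j < n0)%N) W N i x * W N j x +
  \sum_(1 <= i < n0.+1) \sum_(1 <= j < n0.+1 | (n0 <= i + j)%N) W N i x * W N j x.
 rewrite expr2 {1}/ww mulr_suml -big_split /=; apply: eq_bigr => i _; rewrite mulr_sumr (bigID (fun j => (i + j < n0)%N)) /=.
 by congr (_ + _); apply: eq_bigl => j; rewrite -leqNgt.
rewrite /ric e3 W0 [in RHS]e2.
by move: (\sum_(1 <= k < n0) W N k x) (\sum_(1 <= i < n0.+1) \sum_(1 <= j < n0.+1 | _) _) (\sum_(1 <= i < n0.+1) \sum_(1 <= j < n0.+1 | _) _) => S1 S2 S3; ring.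
Qed.

Lemma tri_ctrl i j : (i <= n0)%N -> (j <= n0)%N -> (n0 <= i + j)%N -> uctrl (fun N x => VN N x * (W N i x * W N j x)).
Proof.
move=> ii jj ij; pose K := Kg ^+ (i + j).+1 * \sum_(l <- nseq (i + j).+1 0%N) Kg.
have K0 : 0 <= K by rewrite mulr_ge0 ?exprn_ge0 ?sumr_ge0 ?Kg0 // => *; exact: Kg0.
exists (Bc * (Bw * Bw) * K) => N.
have KE u v l : size u = i -> size v = j -> ctrl K (Gam (l :: u ++ v)).
 move=> su sv; apply: ctrl_weak (@Gam_ctrl (l :: u ++ v) _); last by rewrite /= size_cat su sv ltnS.
 by rewrite /K !big_const_seq !count_predT /= size_cat size_nseq su sv.
pose T l u v x := c l * e l x * (H u x * H v x) * Gam (l :: u ++ v) x.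
have cT l u v : u \in words N i -> v \in words N j -> ctrl (nrm (c l) * (wt u * wt v) * K) (T l u v).
 move=> /size_words su /size_words sv; apply: ctrl_le (KE u v l su sv); first by rewrite !mulr_ge0 ?nrm_ge0.
 by move=> x x0; rewrite /T !nrmM e1 mulr1 ler_wpM2r ?nrm_ge0 // ler_wpM2l ?nrm_ge0 // ler_pM ?nrm_ge0 // Hwt ?su ?sv // ltW.
have := ctrl_sum (r := iota 0 N) (fun l _ => ctrl_sum (r := words N i) (fun u hu => ctrl_sum (r := words N j) (fun v hv => cT l u v hu hv))).
move=> h; apply: ctrl_weak (ctrl_ext _ h) => [|x x0].
 have -> : \sum_(l <- iota 0 N) \sum_(u <- words N i) \sum_(v <- words N j) nrm (c l) * (wt u * wt v) * K =
  (\sum_(l <- iota 0 N) nrm (c l)) * ((\sum_(u <- words N i) wt u) * (\sum_(v <- words N j) wt v)) * K.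
  rewrite -mulrA mulr_suml; apply: eq_bigr => l _; rewrite !mulr_suml mulr_sumr; apply: eq_bigr => u _.
  by rewrite !mulr_sumr mulr_suml mulr_sumr; apply: eq_bigr => v _; ring.
 have p0 k : 0 <= \sum_(u <- words N k) wt u by rewrite sumr_ge0.
 by rewrite ler_wpM2r // ler_pM ?sumr_ge0 ?mulr_ge0 ?cB // => [l _|]; rewrite ?nrm_ge0 // ler_pM ?wtB.
rewrite /VN mulr_suml; apply: eq_bigr => l _; rewrite /W mulr_suml mulr_sumr; apply: eq_bigr => u _.
by rewrite !mulr_sumr; apply: eq_bigr => v _; rewrite /T /Gam big_cons big_cat /=; ring.
Qed.

Lemma w1_ctrl : uctrl (fun N x => ww1 N x - 'i%C * VN N x * ric x (ww N x)).
Proof.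
apply: (uctrl_ext (f := fun N x => \sum_(1 <= k < n0.+1) dG N k x +
  ('i%C * 2 * A x * (VN N x * (W N n0 x * W N 0 x)) + (- 'i%C * conj (B x)) *
  \sum_(1 <= i < n0.+1) \sum_(1 <= j < n0.+1 | (n0 <= i + j)%N) VN N x * (W N i x * W N j x)))).
 move=> N x x0; rewrite w1E [RHS]addrC addKr; congr (_ + _).
 have -> : \sum_(1 <= i < n0.+1) \sum_(1 <= j < n0.+1 | (n0 <= i + j)%N) VN N x * (W N i x * W N j x) =
   VN N x * \sum_(1 <= i < n0.+1) \sum_(1 <= j < n0.+1 | (n0 <= i + j)%N) W N i x * W N j x.
  by rewrite mulr_sumr; apply: eq_bigr => i _; rewrite mulr_sumr.
 by move: (\sum_(1 <= i < n0.+1) _) => S; ring.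
apply: uctrl_add.
 apply: uctrl_sum => k; rewrite mem_index_iota ltnS => /andP[_ kn] _; exists (Bw * (k%:R * Kg ^+ k)) => N.
 have := ctrl_sum (r := words N k) (K := fun u => wt u * (k%:R * Kg ^+ k)) (f := fun u x => Gam1 u x * H u x) => h.
 apply: (ctrl_weak _ (h _)) => [|u /size_words su].
  by rewrite -mulr_suml ler_wpM2r ?wtB // mulr_ge0 ?exprn_ge0 ?Kg0.
 rewrite -su; apply: ctrl_le (Gam1_ctrl u) => // x x0. by rewrite nrmM mulrC ler_wpM2r ?nrm_ge0 // Hwt ?su // ltW.
apply: uctrl_add.
 apply: (uctrl_mul (c := 2 * a0)) (tri_ctrl (leqnn n0) (leq0n n0) (leq_addr 0 n0)); first by rewrite mulr_ge0.
 move=> N x x0; rewrite !nrmM nrmi mul1r (_ : nrm (2 : C) = 2); last by rewrite -(rmorph_nat (@real_complex R)) nrmC ger0_norm.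
 by rewrite -!nrmM ler_wpM2r ?nrm_ge0 // ler_wpM2l // Aa // ltW.
apply: (uctrl_mul (c := a0) (f := fun N x => \sum_(1 <= i < n0.+1) \sum_(1 <= j < n0.+1 | (n0 <= i + j)%N) VN N x * (W N i x * W N j x))) => //.
 by move=> N x x0; rewrite nrmM ler_wpM2r ?nrm_ge0 // nrmM nrmN nrmi mul1r nrmJ Ba // ltW.
apply: uctrl_sum => i; rewrite mem_index_iota ltnS => /andP[_ ii] _.
apply: uctrl_sum => j; rewrite mem_index_iota ltnS => /andP[_ jj] ij; exact: tri_ctrl.
Qed.

Hypothesis gt_small : forall l (d : R), 0 < d -> exists X : R, forall x, 0 < x -> X <= x -> nrm (gt l x) <= d.

(** The sums over words increase with [N] and are bounded, so beyond some [L] further letters add at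
    most [d], uniformly in [N]. *)
Lemma words_tail (d : R) : 0 < d -> exists L, forall N k, (k <= n0)%N -> \sum_(u <- words N k) wt u <= \sum_(u <- words L k) wt u + d.
Proof.
move=> d0; suff key m : exists L, forall N k, (k < m)%N -> (k <= n0)%N -> \sum_(u <- words N k) wt u <= \sum_(u <- words L k) wt u + d.
 by have [L hL] := key n0.+1; exists L => N k kn; exact: hL.
elim: m => [|m [L hL]]; first by exists 0%N.
have [mn|mn] := leqP m n0; last first.
 by exists L => N k; rewrite ltnS leq_eqVlt => /orP[/eqP->|km kn]; [rewrite leqNgt mn|exact: hL].
have hs : has_sup [set z | exists N, z = \sum_(u <- words N m) wt u].
 by split; [exists (\sum_(u <- words 0 m) wt u), 0%N|exists Bw => _ [N ->]; exact: wtB].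
have [_ [L' ->] hL'] := sup_adherent d0 hs.
have up N : \sum_(u <- words N m) wt u <= sup [set z | exists N, z = \sum_(u <- words N m) wt u].
 by apply: ub_le_sup; [case: hs|exists N].
exists (maxn L L') => N k; rewrite ltnS leq_eqVlt => /orP[/eqP->|km] kn.
 by have := words_mono m (leq_maxr L L') wt0; have := up N; lra.
by have := words_mono k (leq_maxl L L') wt0; have := hL N k km kn; lra.
Qed.

(** Words containing a letter beyond [L] have small total weight; in the others the first letter is
    one of finitely many, whose [gt] tends to 0. Hence the smallness is uniform in [N]. *)
Lemma w_small (d : R) : 0 < d -> exists X : R, forall N x, 0 < x -> X <= x -> nrm (ww N x) <= d.
Proof.
move=> d0; have Kn0 : 0 <= Kg ^+ n0 by rewrite exprn_ge0 // Kg0.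
have Bw0 : 0 <= Bw by apply: le_trans (wtB 0 (leq0n n0)); rewrite sumr_ge0.
pose D := n0%:R * (Kg ^+ n0 * (1 + Bw)) + 1; have D0 : 0 < D by rewrite ltr_wpDl // !mulr_ge0 // addr_ge0.
pose r := d / D; have r0 : 0 < r by rewrite divr_gt0.
have [L hL] := words_tail r0.
have [X hX] := uniform_small L gt_small r0.
exists X => N x x0 Xx; have x0' := ltW x0.
apply: le_trans (nrm_sum _ _ _) _; apply: (@le_trans _ _ (\sum_(1 <= k < n0.+1) Kg ^+ n0 * (r + r * Bw))); last first.
 have -> : d = r * D by rewrite /r divfK // gt_eqF. by rewrite sumr_const_nat subSS subn0 -[leLHS]mulr_natl /D; have := ltW r0; lin.
apply: ler_sum_nat => k /andP[k1 k2]; apply: le_trans (nrm_sum _ _ _) _; rewrite ltnS in k2.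
have dom u : size u = k -> nrm (Gam u x * H u x) <= Kg ^+ n0 * wt u.
 move=> su; rewrite nrmM ler_pM ?nrm_ge0 //; last by rewrite Hwt ?su. by apply: le_trans (Gam_le u x0') _; rewrite ler_weXn2l ?su.
have small M u : (M <= L)%N -> u \in words M k -> nrm (Gam u x * H u x) <= Kg ^+ n0 * (r * wt u).
 move=> ML uM; have su := size_words uM; case: k k1 {dom} k2 su uM => [//|k] _ k2 su /allpairsP[[l v] /= [lM vM E]].
 move: su; rewrite E => -[sv]; rewrite nrmM mulrA ler_pM ?nrm_ge0 //; last by rewrite Hwt //= sv.
 rewrite /Gam big_cons nrmM mulrC ler_pM ?nrm_ge0 //.
  by apply: le_trans (Gam_le v x0') _; rewrite sv ler_weXn2l // ltnW.
 by apply: hX => //; rewrite mem_iota add0n in lM; exact: leq_trans (andP lM).2 ML.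
have sumL M : (M <= L)%N -> \sum_(u <- words M k) nrm (Gam u x * H u x) <= Kg ^+ n0 * (r * Bw).
 move=> ML; apply: (@le_trans _ _ (\sum_(u <- words M k) Kg ^+ n0 * (r * wt u))).
  by rewrite big_seq [leRHS]big_seq; apply: ler_sum => u; exact: small.
 by rewrite -!mulr_sumr ler_wpM2l // ler_wpM2l ?wtB // ltW.
have [NL|/ltnW LN] := leqP N L; first by apply: le_trans (sumL N NL) _; rewrite ler_wpM2l // lerDr ltW.
(* [f] is the slack in [dom]. Being nonnegative, its sum increases with [N], which transfers the
   tail bound from the weights to the terms themselves. *)
pose f u := if size u == k then Kg ^+ n0 * wt u - nrm (Gam u x * H u x) else 0.
have f0 u : 0 <= f u by rewrite /f; case: eqP => // su; rewrite subr_ge0 dom.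
have fE M : \sum_(u <- words M k) f u = Kg ^+ n0 * (\sum_(u <- words M k) wt u) - \sum_(u <- words M k) nrm (Gam u x * H u x).
 by rewrite mulr_sumr -sumrB; apply: eq_big_seq => u /size_words su; rewrite /f su eqxx.
have := words_mono k LN f0; rewrite !fE; have := sumL L (leqnn L); have := ler_wpM2l Kn0 (hL N k k2); lin.
Qed.

End Riccati.

(** * Boundedness of solutions inside a band *)

Section Elliptic.
Implicit Types (x y s t : R).

Lemma two_C : (2 : C) = (2 : R)%:C%C.
Proof. by rewrite rmorph_nat. Qed.

(* [CE] itself rewrites ['i] with the rules for real constants. *)
Definition CEi := (@ReD, @ImD, @ReN, @ImN, @ReM, @ImM, @ReJ, @ImJ, @Rei, @Imi, @ReC, @ImC, @Re1, @Im1).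

Lemma Re_conj_mul (m Y : C) : Re (conj Y * (m * Y)) = Re m * nsq Y.
Proof. by rewrite !CE /nsq; ring. Qed.

Lemma conj_rhs (v a : R) (b z : C) :
  conj ('i%C * v%:C%C * (b * conj z - a%:C%C * z)) = - 'i%C * v%:C%C * (conj b * z - a%:C%C * conj z).
Proof. by apply: C_eq; rewrite !CEi; ring. Qed.

(** After multiplication by [conj w] the [A] term is purely imaginary, and the other two combine
    into a multiple of [1 - |w|^2]: the exact Riccati flow preserves the unit disc. *)
Lemma ric_Re (V a : R) (B w : C) :
  Re (conj w * ('i%C * V%:C%C * (B - 2 * a%:C%C * w + conj B * w ^+ 2))) = V * Im (w * conj B) * (1 - nsq w).
Proof. by rewrite two_C expr2 !CEi /nsq; ring. Qed.

Lemma ric_le (A B : R -> C) (a0 x : R) (z : C) : 0 <= a0 -> nrm (A x) <= a0 -> nrm (B x) <= a0 -> nrm z <= 1 / 2 ->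
  nrm (ric A B x z) <= 3 * a0.
Proof.
move=> a00 hA hB hz; apply: le_trans (nrmD _ _) _; apply: le_trans (lerD (nrmB _ _) (lexx _)) _.
rewrite expr2 !nrmM nrmJ two_C nrmC ger0_norm //; have z0 := nrm_ge0 z.
have p1 : nrm (A x) * nrm z <= a0 * (1 / 2) by apply: ler_pM; rewrite ?nrm_ge0.
have p2 : nrm z * nrm z <= 1 by nra.
have p3 : nrm (B x) * (nrm z * nrm z) <= a0 * 1 by apply: ler_pM; rewrite ?nrm_ge0 // mulr_ge0.
lin.
Qed.

(* With [k = -2 V Im (w conj B)], both [|zeta - w conj zeta|^2] and [1 - |w|^2] have logarithmic derivative [k]
   up to an integrable error, so their quotient stays bounded although [k] need not be integrable. *)
Lemma riccati_bound (V Ar : R -> R) (B zeta w w1 : R -> C) (F g : R -> R) (K X x : R) :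
  LI V -> CLB B -> CAC zeta (fun t => 'i%C * (V t)%:C%C * (B t * conj (zeta t) - (Ar t)%:C%C * zeta t)) ->
  CAC w w1 -> AC F g -> 0 <= X -> X <= x -> (forall t, X <= t -> t <= x -> nrm (w t) <= 1 / 2) ->
  (forall t, X <= t -> t <= x -> nrm (w1 t - 'i%C * (V t)%:C%C * ric (fun t => (Ar t)%:C%C) B t (w t)) <= g t) ->
  F x - F X <= K -> nsq (zeta x) <= 32 * expR (6 * K) * nsq (zeta X).
Proof.
move=> IV LB_ az aw aF X0 Xx w2 eg FK.
pose k t := - 2 * (V t * Im (w t * conj (B t))).
have Ik : LI k.
 have Lw := CLB_mul (CAC_CLB aw) (CLB_conj LB_); apply: LI_scale; apply: LI_mulLB => //; by case: Lw.
have aK := AC_prim 0 Ik; set Kk := (fun t => 0 + _) in aK.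
pose Y t := zeta t - w t * conj (zeta t).
have aY : CAC Y _ := CAC_sub az (CAC_mul aw (CAC_conj az)).
have wn t : X <= t -> t <= x -> nsq (w t) <= 1 / 4.
 by move=> h1 h2; have := w2 t h1 h2; have := nrm_ge0 (w t); rewrite -nrmE; nra.
have zY t : X <= t -> t <= x -> nrm (zeta t) <= 2 * nrm (Y t).
 move=> h1 h2; have : nrm (zeta t) <= nrm (Y t) + nrm (w t * conj (zeta t)).
  by have := nrmD (Y t) (w t * conj (zeta t)); rewrite subrK.
 by rewrite nrmM nrmJ; have := w2 t h1 h2; have := nrm_ge0 (zeta t); nra.
have hY : nsq (Y x) <= expR ((Kk x + 4 * F x) - (Kk X + 4 * F X)) * nsq (Y X).
 apply: (gronwall0 (CAC_nsq aY) (AC_add aK (AC_scale 4 aF)) X0 Xx) => t h1 h2.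
 have -> : 'i%C * (V t)%:C%C * (B t * conj (zeta t) - (Ar t)%:C%C * zeta t) -
   (w1 t * conj (zeta t) + w t * conj ('i%C * (V t)%:C%C * (B t * conj (zeta t) - (Ar t)%:C%C * zeta t))) =
   'i%C * (V t)%:C%C * (w t * conj (B t) - (Ar t)%:C%C) * Y t -
   (w1 t - 'i%C * (V t)%:C%C * ric (fun t => (Ar t)%:C%C) B t (w t)) * conj (zeta t).
  by rewrite conj_rhs /Y /ric; ring.
 rewrite mulrBr ReD ReN Re_conj_mul.
 have -> : Re ('i%C * (V t)%:C%C * (w t * conj (B t) - (Ar t)%:C%C)) = - (V t * Im (w t * conj (B t))) by rewrite !CEi; ring.
 have := Re_nrm_le (Y t) ((w1 t - 'i%C * (V t)%:C%C * ric (fun t => (Ar t)%:C%C) B t (w t)) * conj (zeta t)).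
 rewrite nrmM nrmJ; have := eg t h1 h2; set E := nrm (_ - _) => Eg; set P := Re (conj (Y t) * _) => h3.
 have h4 : nrm (Y t) * (E * nrm (zeta t)) <= 2 * (g t * nsq (Y t)).
  rewrite -nrmE; have := zY t h1 h2; have y0 := nrm_ge0 (Y t); have z0 := nrm_ge0 (zeta t); have E0 : 0 <= E := nrm_ge0 _ => h.
  have h5 : E * nrm (zeta t) <= g t * (2 * nrm (Y t)) by apply: ler_pM. by have := ler_wpM2l y0 h5; lin.
 have := ler_norm (- P); rewrite normrN /k; lin.
have hq : 1 - nsq (w X) <= expR (- ((Kk x - 2 * F x) - (Kk X - 2 * F X))) * (1 - nsq (w x)).
 have aq := AC_opp (AC_sub (AC_cst 1) (CAC_nsq aw)). have := gronwall0 aq (AC_sub aK (AC_scale 2 aF)) X0 Xx => H.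
 have : - (1 - nsq (w x)) <= expR ((Kk x - 2 * F x) - (Kk X - 2 * F X)) * - (1 - nsq (w X)).
  apply: H => t h1 h2. have -> : w1 t = (w1 t - 'i%C * (V t)%:C%C * ric (fun t => (Ar t)%:C%C) B t (w t)) +
    'i%C * (V t)%:C%C * ric (fun t => (Ar t)%:C%C) B t (w t) by rewrite subrK.
  rewrite mulrDr ReD ric_Re; have := Re_nrm_le (w t) (w1 t - 'i%C * (V t)%:C%C * ric (fun t => (Ar t)%:C%C) B t (w t)).
  have := eg t h1 h2; set E := nrm (w1 t - _) => Eg; set P := Re _ => h3.
  have h4 : nrm (w t) * E <= 1 / 2 * g t by apply: ler_pM; rewrite ?nrm_ge0 // w2. have g0 : 0 <= g t by apply: le_trans Eg; exact: nrm_ge0.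
  have h5 := ler_wpM2l g0 (wn t h1 h2). have := ler_norm P; rewrite /k; lin.
 rewrite mulrN lerN2 => h; rewrite expRN -(ler_pM2l (expR_gt0 ((Kk x - 2 * F x) - (Kk X - 2 * F X)))) mulrA mulfV ?mul1r // gt_eqF ?expR_gt0 //.
have xx := lexx x; have XX := lexx X.
have q1 : 3 / 4 <= expR (- ((Kk x - 2 * F x) - (Kk X - 2 * F X))).
 apply: le_trans (_ : 1 - nsq (w X) <= _); first by have := wn X XX Xx; lin.
 apply: le_trans hq _; rewrite ler_piMr ?expR_ge0 //; have := nsq_ge0 (w x); lin.
(* The exponents [Kk + 4 F] and [- (Kk - 2 F)] add up to [6 F]: the uncontrolled part [Kk]
   cancels. *)
have q2 : expR ((Kk x + 4 * F x) - (Kk X + 4 * F X)) <= 2 * expR (6 * K).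
 have e0 := expR_gt0 ((Kk x + 4 * F x) - (Kk X + 4 * F X)). have h := ler_wpM2l (ltW e0) q1; rewrite -expRD in h.
 have : expR ((Kk x + 4 * F x) - (Kk X + 4 * F X) + - ((Kk x - 2 * F x) - (Kk X - 2 * F X))) <= expR (6 * K) by rewrite ler_expR; lin. lin.
have YX : nsq (Y X) <= 4 * nsq (zeta X).
 have : nrm (Y X) <= 2 * nrm (zeta X).
  by apply: le_trans (nrmB _ _) _; rewrite nrmM nrmJ; have := w2 X XX Xx; have := nrm_ge0 (zeta X); nra.
 by rewrite -!nrmE; have := nrm_ge0 (Y X); nra.
have zx : nsq (zeta x) <= 4 * nsq (Y x) by have := zY x Xx xx; rewrite -!nrmE; have := nrm_ge0 (zeta x); nra.
have := ler_wpM2r (nsq_ge0 (Y X)) q2; have := ler_wpM2l (ltW (expR_gt0 (6 * K))) YX; have := hY; lin.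
Qed.

Variables (V Kv q : R -> R) (Q0 E : R) (lam : C) (phi w : R -> C) (Wp : R -> R).
Hypotheses (IV : LI V) (fl : floq V E lam phi w) (lam1 : nrm lam = 1) (lamI : Im lam != 0)
  (Iq : LI q) (qE : forall x, 0 <= x -> q x = V x + Wp x).

(** [2 om i] is the Wronskian of [conj phi] and [phi], nonzero because the multipliers [conj lam]
    and [lam] differ. *)
Definition om : R := Im (conj (phi 0) * w 0).
Definition cA x : R := nsq (phi x) / (2 * om).
Definition cB x : C := conj (phi x) ^+ 2 * ((2 * om)^-1)%:C%C.

Lemma floq_conj : floq V E (conj lam) (fun x => conj (phi x)) (fun x => conj (w x)).
Proof.
have [[a1 a2] n m] := fl; split.
- split; first exact: CAC_conj.
 by apply: CAC_ext (CAC_conj a2) => // x _; rewrite /Qz; apply: C_eq; rewrite !CEi; ring.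
- by rewrite /U2 !nsqJ.
- by move=> x x0; have [-> ->] := m x x0; rewrite !rmorphM.
Qed.

Lemma om_neq0 : om != 0.
Proof.
have lc : conj lam != lam.
 apply: contraNneq lamI => h; have : Im (conj lam) = Im lam by rewrite h. by rewrite ImJ => h2; apply/eqP; lra.
have := floq_indep IV floq_conj fl lc; apply: contraNneq; rewrite /Wr /om => h.
by apply/eqP; apply: C_eq; move: h; rewrite !CE => h; [ring|lra].
Qed.

Lemma om_wr x : 0 <= x -> conj (phi x) * w x - conj (w x) * phi x = (2 * om)%:C%C * 'i%C.
Proof.
move=> x0; have [s1 _ _] := floq_conj; have [s2 _ _] := fl.
have := Wr_const s1 s2 x0; rewrite /Wr => ->; rewrite /om.
by apply: C_eq; rewrite !CEi; ring.
Qed.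

Lemma zeta_facts (u : R -> R) : rsol q E u -> exists zeta : R -> C,
  CAC zeta (fun t => 'i%C * (Wp t)%:C%C * (cB t * conj (zeta t) - (cA t)%:C%C * zeta t)) /\
  forall x, 0 <= x -> u x = Im (phi x * zeta x) / om.
Proof.
move=> /rsol_sol[u1 [au au1]]; have [[a1 a2] _ _] := fl.
pose zeta x := conj (phi x) * (u1 x)%:C%C - conj (w x) * (u x)%:C%C.
have o0 := om_neq0.
have o2 : (2 * om)%:C%C * ((2 * om)^-1)%:C%C = 1 :> C by rewrite -rmorphM mulfV // mulf_neq0.
have ux x : 0 <= x -> (u x)%:C%C * 'i%C * (2 * om)%:C%C = phi x * zeta x - conj (phi x * zeta x).
 move=> x0; rewrite -mulrA ['i%C * _]mulrC -(om_wr x0) /zeta. by apply: C_eq; rewrite !CEi; ring.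
have ii : 'i%C * 'i%C = -1 :> C by apply: C_eq; rewrite !CEi; ring.
exists zeta; split.
 apply: CAC_ext (CAC_sub (CAC_mul (CAC_conj a1) au1) (CAC_mul (CAC_conj a2) au)) => // x x0.
 transitivity (conj (phi x) * (Wp x)%:C%C * (u x)%:C%C).
  by rewrite /Qz qE //; apply: C_eq; rewrite !CEi; ring.
 have e1 : (u x)%:C%C = - 'i%C * ((2 * om)^-1)%:C%C * (phi x * zeta x - conj (phi x * zeta x)).
  rewrite -(ux x x0); transitivity (- ('i%C * 'i%C) * ((2 * om)%:C%C * ((2 * om)^-1)%:C%C) * (u x)%:C%C); last by ring.
  by rewrite ii o2; ring.
 rewrite e1 /cB /cA; have -> : (nsq (phi x) / (2 * om))%:C%C = conj (phi x) * phi x * ((2 * om)^-1)%:C%C.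
  by rewrite rmorphM; congr (_ * _); apply: C_eq; rewrite !CE /nsq; ring.
 by rewrite rmorphM; ring.
move=> x x0; have := congr1 (@complex.Im R) (ux x x0); move: (zeta x) => z; rewrite !CEi => h.
have : u x * om = Re (phi x) * Im z + Im (phi x) * Re z by lin.
by move=> <-; rewrite mulfK.
Qed.

Lemma phi_bound : exists2 P : R, 0 <= P & forall x, 0 <= x -> nrm (phi x) <= P.
Proof.
have [[a1 _] _ m] := fl; have [P P0 hP] := CLB_bound (CAC_CLB a1) ler01.
by exists P => // x x0; apply: (qp_bound lam1 _ hP x0) => y y0; have [] := m y y0.
Qed.

Lemma coef_facts : [/\ CLB (fun x => (cA x)%:C%C), CLB cB, exists2 a0 : R, 0 <= a0 &
    (forall x, 0 <= x -> nrm ((cA x)%:C%C : C) <= a0 /\ nrm (cB x) <= a0),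
  forall x, 0 <= x -> cA (x + 1) = cA x & forall x, 0 <= x -> cB (x + 1) = conj lam ^+ 2 * cB x].
Proof.
have [[a1 _] _ m] := fl; have Lp := CAC_CLB a1; have [P P0 hP] := phi_bound; split.
- by apply: CLB_real; apply: LB_ext (LB_mul (CLB_nsq Lp) (LB_cst (2 * om)^-1)).
- by apply: CLB_ext (CLB_mul (CLB_mul (CLB_conj Lp) (CLB_conj Lp)) (CLB_cst ((2 * om)^-1)%:C%C)) => x _; rewrite /cB expr2.
- exists (P ^+ 2 * `|(2 * om)^-1|) => [|x x0]; first by rewrite mulr_ge0 // sqr_ge0.
 have h : nrm (phi x) ^+ 2 <= P ^+ 2 by rewrite lerXn2r ?nnegrE ?nrm_ge0 ?hP.
 by rewrite /cA /cB expr2 !nrmM !nrmJ !nrmC -expr2 normrM -nrmE ger0_norm ?sqr_ge0 // !ler_wpM2r.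
- by move=> x x0; rewrite /cA; have [-> _] := m x x0; rewrite nsqM -[nsq lam]nrmE lam1 expr1n mul1r.
- by move=> x x0; rewrite /cB; have [-> _] := m x x0; rewrite rmorphM; ring.
Qed.

Lemma nrm_expmi (a : R) : nrm (expmi a) = 1.
Proof. by rewrite /expmi /= sqrrN cos2Dsin2 sqrtr1. Qed.
Lemma expmiD (a b : R) : expmi (a + b) = expmi a * expmi b :> C.
Proof. by rewrite /expmi cosD sinD; apply: C_eq; rewrite !(ReM, ImM) /=; ring. Qed.

Lemma expmi_CLB (a : R) : CLB (fun x => expmi (a * x)).
Proof.
have k (f : R -> R) : continuous f -> (forall x, `|f x| <= 1) -> LB (fun x => f (a * x)).
 move=> cf f1 x x0; split; last by exists 1 => y _ _. apply: measurable_funTS; apply: continuous_measurable_fun => y.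
 apply: (@continuous_comp _ _ _ (fun x => a * x) f); last exact: cf. exact: mulrl_continuous.
split; first by apply: k (@continuous_cos R) _ => y; rewrite ler_norml cos_geN1 cos_le1.
by apply: LB_opp; apply: k (@continuous_sin R) _ => y; rewrite ler_norml sin_geN1 sin_le1.
Qed.

(** All that is asked of the energy is that the divisors of the infixes of each word are bounded by
    a [Yw u] for which the weights [|c_u|] times the power [|u|] of [Yw u] are summable. *)
Lemma bounded_solutions (gam gt gt1 : nat -> R -> C) (Kg Bc B' : R) (n0 : nat) (freq : nat -> R) (c : nat -> C) (Yw : seq nat -> R) :
  let e l x := expmi (freq l * x) in
  1 <= Kg -> (forall l, CAC (gt l) (gt1 l)) -> (forall l x, 0 <= x -> nrm (gt l x) <= Kg) ->
  (forall l, ctrl Kg (gt1 l)) -> (forall l, ctrl Kg (fun x => (nrm (gt l x) ^+ n0.+1)%:C%C)) ->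
  (forall l (d : R), 0 < d -> exists X : R, forall x, 0 < x -> X <= x -> nrm (gt l x) <= d) ->
  (forall l, ctrl Kg (fun x => gt l x - gam l x)) -> (0 < n0)%N -> LI Wp ->
  (forall d : R, 0 < d -> exists N, forall x, 0 < x -> nrm ((Wp x)%:C%C - \sum_(l <- iota 0 N) c l * e l x * gam l x) <= d) ->
  (forall u, (size u <= n0)%N -> cw c u != 0 -> wmu (conj lam ^+ 2) e u != 1) ->
  (forall u, 1 <= Yw u) -> (forall u v, (size u <= n0)%N -> cw c u != 0 -> infix v u -> 2 / nrm (wmu (conj lam ^+ 2) e v - 1) <= Yw u) ->
  (forall N k, (k <= n0)%N -> \sum_(u <- words N k) nrm (cw c u) * Yw u ^+ size u <= B') ->
  (forall N, \sum_(l <- iota 0 N) nrm (c l) <= Bc) ->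
  forall u, rsol q E u -> exists M : R, forall x, 0 <= x -> `|u x| <= M.
Proof.
move=> e Kg1 agt gtK cgt1 cgtp gts cde n00 IW Vapp good Y1 Yb wtB' cBc u /zeta_facts[zeta [az uz]].
have [LA LB_ [a0 a00 ab] Ap Bp] := coef_facts.
have mu1 : nrm (conj lam ^+ 2) = 1 by rewrite expr2 nrmM nrmJ lam1 mulr1.
have e1 l x : nrm (e l x) = 1 by exact: nrm_expmi.
have ep l x : 0 <= x -> e l (x + 1) = e l 1 * e l x by move=> _; rewrite /e mulrDr expmiD mulrC.
have [H [K [K1 H0 HP]]] := word_functions LA LB_ (fun l => expmi_CLB (freq l)) a00 mu1 (fun x h => proj1 (ab x h)) (fun x h => proj2 (ab x h))
 e1 (fun x h => congr1 (fun r : R => r%:C%C) (Ap x h)) Bp ep good (leqnn n0).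
have K0 : 0 <= K by lin.
pose wt v := K * (nrm (cw c v) * Yw v ^+ size v).
have wt0 v : 0 <= wt v by rewrite !mulr_ge0 ?nrm_ge0 ?exprn_ge0 //; have := Y1 v; lin.
have Hwt v x : (size v <= n0)%N -> 0 <= x -> nrm (H v x) <= wt v.
 move=> sv x0; rewrite /wt mulrA; have [hb _] := HP v sv.
 apply: (hb (Yw v) (Y1 v) _ x x0); have [c0|c0] := eqVneq (cw c v) 0; first by left. by right=> v'; exact: Yb.
have wtB N k : (k <= n0)%N -> \sum_(v <- words N k) wt v <= K * B' by move=> kn; rewrite -mulr_sumr ler_wpM2l // wtB'.
have aH v : (0 < size v)%N -> (size v <= n0)%N -> CAC (H v) (wrhs (fun x => (cA x)%:C%C) cB e c H v).
 by move=> v0 vn; have [_ /(_ v0)[]] := HP v vn.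
have half0 : 0 < 1 / 2 :> R by lin.
have [X1 hX1] := w_small Kg1 gtK wt0 Hwt wtB gts half0.
have [K2 hK2] := w1_ctrl Kg1 gtK cgt1 cgtp a00 (fun x h => proj1 (ab x h)) (fun x h => proj2 (ab x h)) e1 H0 wt0 Hwt wtB cBc n00.
pose X : R := Num.max X1 1; have X0 : 0 < X by rewrite lt_max ltr01 orbT.
have XX1 : X1 <= X by rewrite le_max lexx.
clearbody X.
pose K3 := K2 + 3 * a0 * (Bc * Kg + 1).
have zb x : X <= x -> nsq (zeta x) <= 32 * expR (6 * K3) * nsq (zeta X).
 (* The point [x] is fixed before the truncation. A uniform error [d = 1 / (1 + x)] integrates to at
    most 1 over [[X, x]], and the resulting constant [K3] depends on neither [N] nor [x]. *)
 move=> Xx; have x0 : 0 <= x by lin. pose d : R := (1 + x)^-1; have d0 : 0 < d by rewrite invr_gt0; lin.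
 have dx : d * x <= 1 by rewrite /d mulrC ler_pdivrMr; lin. clearbody d.
 have [N hN] := Vapp d d0; have [F1 [g1 [aF1 g10 FK1 fg1]]] := hK2 N.
 have c2 : ctrl (\sum_(l <- iota 0 N) nrm (c l) * Kg) (fun x => \sum_(l <- iota 0 N) (c l * e l x * (gt l x - gam l x))).
  apply: ctrl_sum => l _; apply: ctrl_le (cde l); first exact: nrm_ge0. by move=> t _; rewrite !nrmM e1 mulr1.
 have [F2 [g2 [aF2 g20 FK2 fg2]]] := c2. have a3 : 0 <= 3 * a0 by rewrite mulr_ge0.
 have aF := AC_add aF1 (AC_scale (3 * a0) (AC_add aF2 (AC_scale d (@AC_id)))).
 apply: (riccati_bound IW LB_ az (w_CAC agt aH N) aF (ltW X0) Xx) => [t Xt tx|t Xt tx|].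
 - by apply: hX1; lin.
 - have t0 : 0 < t by lin.
  rewrite (_ : _ - _ = (ww1 gt gt1 n0 (fun x => (cA x)%:C%C) cB e c H N t - 'i%C * VN gt e c N t * ric (fun x => (cA x)%:C%C) cB t (ww gt n0 H N t)) +
   'i%C * (\sum_(l <- iota 0 N) (c l * e l t * (gt l t - gam l t)) - ((Wp t)%:C%C - \sum_(l <- iota 0 N) c l * e l t * gam l t)) * ric (fun x => (cA x)%:C%C) cB t (ww gt n0 H N t)); last first.
   have -> : \sum_(l <- iota 0 N) (c l * e l t * (gt l t - gam l t)) = VN gt e c N t - \sum_(l <- iota 0 N) c l * e l t * gam l t.
    by rewrite /VN -sumrB; apply: eq_bigr => l _; ring.
   by ring.
  apply: le_trans (nrmD _ _) _; apply: lerD; first exact: fg1. rewrite !nrmM nrmi mul1r mulrC; apply: ler_pM; rewrite ?nrm_ge0 //.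
   by have [hA hB] := ab t (ltW t0); apply: ric_le => //; apply: hX1; lin.
  by apply: le_trans (nrmB _ _) _; rewrite mulr1 lerD ?fg2 ?hN.
 - have m1 : F1 0 <= F1 X by apply: (AC_homo aF1 (lexx 0) (ltW X0)) => t t0 _; exact: g10.
  have m2 : F2 0 <= F2 X by apply: (AC_homo aF2 (lexx 0) (ltW X0)) => t t0 _; exact: g20.
  have := FK1 x x0; have := FK2 x x0; rewrite -mulr_suml => k2 k1.
  have k3 : (\sum_(l <- iota 0 N) nrm (c l)) * Kg <= Bc * Kg by rewrite ler_wpM2r ?cBc //; lin.
  have dX : 0 <= d * X by rewrite mulr_ge0 // ltW. have k4 : F2 x + d * x - (F2 X + d * X) <= Bc * Kg + 1 by lin.
  have := ler_wpM2l a3 k4; rewrite /K3; lin.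
have [Mz Mz0 hMz] := CLB_bound (CAC_CLB az) (ltW X0).
have [P P0 hP] := phi_bound.
pose M2 := 32 * expR (6 * K3) * nsq (zeta X).
have M20 : 0 <= M2 by rewrite !mulr_ge0 ?expR_ge0 ?nsq_ge0.
exists (P * (Mz + (M2 + 1)) / `|om|) => x x0; rewrite uz // normrM normfV ler_wpM2r ?invr_ge0 //.
apply: le_trans (Im_le _) _; rewrite nrmM ler_pM ?nrm_ge0 ?hP //.
have [xX|/ltW Xx] := leP x X; first by have := hMz x x0 xX; lin.
have := zb x Xx; rewrite -/M2 -nrmE; have := nrm_ge0 (zeta x); have := sqr_ge0 (nrm (zeta x) - 1); nra.
Qed.

End Elliptic.

(** * The exceptional set inside a band *)

Section ExceptionalSet.
Implicit Types (x y s : R) (u v : seq nat).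

(** The power [fa] of each [t i] is at most [A], so [t i] is at most a constant times that power. *)
Lemma sum_root (T : eqType) (r : seq T) (t : T -> R) (fa A : R) : 0 < fa -> fa <= 1 -> (forall i, 0 <= t i) ->
  \sum_(i <- r) t i `^ fa <= A -> \sum_(i <- r) t i <= A `^ ((1 - fa) / fa) * A.
Proof.
move=> f0 f1 t0 hA; apply: (@le_trans _ _ (\sum_(i <- r) A `^ ((1 - fa) / fa) * t i `^ fa)); last first.
 by rewrite -mulr_sumr ler_wpM2l // powR_ge0.
rewrite big_seq [leRHS]big_seq; apply: ler_sum => i ir.
have hi : t i `^ fa <= A by apply: le_trans hA; apply: (le_sum_mem (f := fun i => t i `^ fa) ir) => j; exact: powR_ge0.
have e0 : 0 <= (1 - fa) / fa by rewrite divr_ge0 ?subr_ge0 // ltW.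
have [->|tn] := eqVneq (t i) 0; first by rewrite mulr_ge0 ?powR_ge0.
rewrite -{1}[t i]powRr1 // -{1}(subrK fa 1) powRD; last by rewrite tn implybT.
rewrite ler_wpM2r ?powR_ge0 //.
have -> : t i `^ (1 - fa) = (t i `^ fa) `^ ((1 - fa) / fa) by rewrite -powRrM mulrCA mulfV ?mulr1 // gt_eqF.
by apply: ge0_ler_powR => //; rewrite nnegrE ?powR_ge0 // (le_trans _ hi) ?powR_ge0.
Qed.

Lemma nrm_cw_powR (c : nat -> C) u (fa : R) : nrm (cw c u) `^ fa = \prod_(l <- u) nrm (c l) `^ fa.
Proof.
elim: u => [|l u IH]; first by rewrite /cw !big_nil nrm1 powR1.
by rewrite big_cons -IH /cw big_cons nrmM powRM ?nrm_ge0.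
Qed.

Lemma mem_words N u : all (fun l => (l < N)%N) u -> u \in words N (size u).
Proof.
elim: u => [|l u IH] //= /andP[lN /IH h].
by apply/allpairsP; exists (l, u); split; rewrite ?mem_iota.
Qed.

Lemma size_infs u : size (infs u) = ((size u).+1 * (size u).+1)%N.
Proof. by rewrite size_allpairs !size_iota. Qed.

(** Pairs of a word and one of its infixes, listed with repetition: the word supplies the weight,
    the infix the divisor. *)
Definition wpairs (n N : nat) := [seq (u, v) | u <- flatten [seq words N k | k <- iota 0 n.+1], v <- infs u].

Lemma wpairs_sum n N (f : seq nat * seq nat -> R) :
  \sum_(i <- wpairs n N) f i = \sum_(k <- iota 0 n.+1) \sum_(u <- words N k) \sum_(v <- infs u) f (u, v).
Proof. by rewrite big_allpairs_dep big_flatten big_map. Qed.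

(** The divisor of an infix depends on the energy only through the square of the multiplier, turned
    by a fixed unit number; so energies making the same divisor small have close multipliers. *)
Lemma rho_sep (z z' om : C) (r : R) : nrm om = 1 -> nrm (conj z * om - 1) < r -> nrm (conj z' * om - 1) < r -> nrm (z - z') <= 2 * r.
Proof.
move=> o1 h1 h2; have -> : nrm (z - z') = nrm (conj (z - z') * om) by rewrite nrmM o1 mulr1 nrmJ.
rewrite (_ : conj (z - z') * om = (conj z * om - 1) - (conj z' * om - 1)); last by rewrite rmorphB; ring.
by apply: le_trans (nrmB _ _) _; lin.
Qed.

Variables (V Kv : R -> R) (Q0 : R).
Hypotheses (IV : LI V) (aKv : AC Kv (fun x => `|V x|)) (Q00 : 0 <= Q0)
  (uni : forall s, 0 <= s -> Kv (s + 1) - Kv s <= Q0) (per : forall x, 0 <= x -> V (x + 1) = V x).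
Variables (q Wp : R -> R).
Hypotheses (Iq : LI q) (qE : forall x, 0 <= x -> q x = V x + Wp x) (IW : LI Wp).
Variables (f1 f2 f3 f4 : R -> R -> R).
Hypothesis hf : forall E, fund V E (f1 E) (f2 E) (f3 E) (f4 E).
Notation D := (disc f1 f4).
Variables (gam gt gt1 : nat -> R -> C) (Kg Ac fa : R) (n0 : nat) (freq : nat -> R) (c : nat -> C).
Notation e := (fun l x => expmi (freq l * x)).
Hypotheses (Kg1 : 1 <= Kg) (agt : forall l, CAC (gt l) (gt1 l)) (gtK : forall l x, 0 <= x -> nrm (gt l x) <= Kg)
  (cgt1 : forall l, ctrl Kg (gt1 l)) (cgtp : forall l, ctrl Kg (fun x => (nrm (gt l x) ^+ n0.+1)%:C%C))
  (gts : forall l (d : R), 0 < d -> exists X : R, forall x, 0 < x -> X <= x -> nrm (gt l x) <= d)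
  (cde : forall l, ctrl Kg (fun x => gt l x - gam l x)) (n00 : (0 < n0)%N)
  (Vapp : forall d : R, 0 < d -> exists N, forall x, 0 < x -> nrm ((Wp x)%:C%C - \sum_(l <- iota 0 N) c l * e l x * gam l x) <= d)
  (fa0 : 0 < fa) (fa1 : fa <= 1) (cA_ : forall N, \sum_(l <- iota 0 N) nrm (c l) `^ fa <= Ac).

(** The multiplier on the upper half of the unit circle, given by a formula so that values at
    different energies can be compared. *)
Definition lamE E : C := Complex (D E / 2) (Num.sqrt (1 - D E ^+ 2 / 4)).
Definition rhoE (i : seq nat * seq nat) E : R := nrm (wmu (conj (lamE E) ^+ 2) e i.2 - 1).

Lemma lamE_root E : `|D E| < 2 -> [/\ lamE E ^+ 2 - (D E)%:C%C * lamE E + 1 = 0, nrm (lamE E) = 1 & Im (lamE E) != 0].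
Proof.
move=> h; have [lam hl [l1 h1 h2]] := edge_root (ltW h); have e1 : lamE E = lam by apply: C_eq.
split; rewrite ?e1 // h2 gt_eqF // sqrtr_gt0.
have : D E ^+ 2 < 2 ^+ 2 by rewrite -real_normK ?num_real // ltrXn2r // nnegrE.
by lra.
Qed.

Definition unbounded E := ~ (forall u : R -> R, rsol q E u -> exists M : R, forall x, 0 <= x -> `|u x| <= M).

Lemma wpairs_sum_le N : \sum_(i <- wpairs n0 N) nrm (cw c i.1) `^ fa <= \sum_(k <- iota 0 n0.+1) (k.+1 * k.+1)%:R * Ac ^+ k.
Proof.
rewrite wpairs_sum; apply: ler_sum => k _ /=.
have -> : \sum_(u <- words N k) \sum_(v <- infs u) nrm (cw c u) `^ fa = (k.+1 * k.+1)%:R * \sum_(u <- words N k) \prod_(l <- u) nrm (c l) `^ fa.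
 rewrite mulr_sumr; apply: eq_big_seq => u /size_words su.
 by rewrite big_const_seq count_predT size_infs su iter_addr_0 nrm_cw_powR mulr_natl.
rewrite words_prod ler_wpM2l // lerXn2r ?nnegrE ?cA_ ?sumr_ge0 // => [l _|]; first exact: powR_ge0.
by apply: le_trans (cA_ 0); rewrite big_nil.
Qed.

(** With [sg = n0 * fa], [Yw u] is the [sg]-norm of the inverse divisors of [u], with a 1 added
    under the root. Since [|u| <= n0], the power [fa] of the weight of [u] is at most that of
    [|c_u|] times 1 plus the sum of the powers [sg] of the inverse divisors. The hypotheses sum
    these over words, and [sum_root] removes the exponent. *)
Lemma bounded_of_sums E (B : R) : `|D E| < 2 ->
  (forall N i, i \in wpairs n0 N -> rhoE i E = 0 -> nrm (cw c i.1) `^ fa = 0) ->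
  (forall N, \sum_(i <- wpairs n0 N) nrm (cw c i.1) `^ fa * (2 / rhoE i E) `^ (n0%:R * fa) <= B) -> ~ unbounded E.
Proof.
move=> hD r0 hB; apply; have [hl l1 lI] := lamE_root hD.
have [phi [w fl]] := floquet_eigen IV per hf hl.
pose sg : R := n0%:R * fa; have sg0 : 0 < sg by rewrite mulr_gt0 // ltr0n.
pose Sg u := \sum_(v <- infs u) (2 / rhoE (u, v) E) `^ sg.
have Sg0 u : 0 <= Sg u by rewrite sumr_ge0 // => v _; exact: powR_ge0.
pose Yw u := (1 + Sg u) `^ sg^-1.
have Y1 u : 1 <= Yw u.
 have e1 : (1 : R) `^ sg^-1 = 1 by rewrite powR1.
 rewrite /Yw -[leLHS]e1; apply: ge0_ler_powR; rewrite ?nnegrE ?invr_ge0 ?(ltW sg0) ?addr_ge0 //. by rewrite lerDl.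
pose A1 := \sum_(k <- iota 0 n0.+1) (k.+1 * k.+1)%:R * Ac ^+ k.
have Tb N k : (k <= n0)%N -> \sum_(u <- words N k) (nrm (cw c u) * Yw u ^+ size u) `^ fa <= A1 + B.
 move=> kn; apply: (@le_trans _ _ (\sum_(u <- words N k) nrm (cw c u) `^ fa * (1 + Sg u))).
  rewrite big_seq [leRHS]big_seq; apply: ler_sum => u /size_words su; have Y0 := le_trans ler01 (Y1 u).
  rewrite powRM ?nrm_ge0 ?exprn_ge0 // ler_wpM2l ?powR_ge0 // su. apply: (@le_trans _ _ ((Yw u ^+ n0) `^ fa)).
   by apply: ge0_ler_powR; rewrite ?nnegrE ?exprn_ge0 ?(ltW fa0) // ler_weXn2l.
  rewrite -(powR_mulrn n0 Y0) -powRrM -/sg /Yw -powRrM mulVf ?gt_eqF // powRr1 // addr_ge0 //.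
 have -> : \sum_(u <- words N k) nrm (cw c u) `^ fa * (1 + Sg u) =
   \sum_(u <- words N k) nrm (cw c u) `^ fa + \sum_(u <- words N k) \sum_(v <- infs u) nrm (cw c u) `^ fa * (2 / rhoE (u, v) E) `^ sg.
  by rewrite -big_split /=; apply: eq_bigr => u _; rewrite mulrDr mulr1 /Sg mulr_sumr.
 have kin : k \in iota 0 n0.+1 by rewrite mem_iota add0n ltnS kn. apply: lerD.
  apply: le_trans (wpairs_sum_le N); rewrite wpairs_sum.
  apply: (le_trans _ (le_sum_mem (f := fun k => \sum_(u <- words N k) \sum_(v <- infs u) nrm (cw c (u, v).1) `^ fa) kin _)).
   apply: ler_sum => u _ /=; rewrite big_const_seq count_predT size_infs iter_addr_0 -mulr_natl. by rewrite ler_peMl ?powR_ge0 // ler1n.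
  by move=> i; rewrite !sumr_ge0 // => u _; rewrite sumr_ge0 // => v _; exact: powR_ge0.
 apply: le_trans (hB N); rewrite wpairs_sum.
 apply: (le_trans _ (le_sum_mem (f := fun k => \sum_(u <- words N k) \sum_(v <- infs u) nrm (cw c (u, v).1) `^ fa * (2 / rhoE (u, v) E) `^ sg) kin _)) => //.
 by move=> i; rewrite !sumr_ge0 // => u _; rewrite sumr_ge0 // => v _; rewrite mulr_ge0 ?powR_ge0.
have inP u v : (size u <= n0)%N -> infix v u -> exists N, (u, v) \in wpairs n0 N.
 move=> su iv; exists (\max_(l <- u) l).+1; apply/allpairsPdep; exists u, v; split=> //; last exact: mem_infs.
 apply/flattenP; exists (words (\max_(l <- u) l).+1 (size u)).
  by apply/mapP; exists (size u) => //; rewrite mem_iota add0n ltnS.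
 apply: mem_words; apply/allP => l lu; rewrite ltnS; exact: (@leq_bigmax_seq _ u xpredT (fun l => l)).
have rpos u v : (size u <= n0)%N -> cw c u != 0 -> infix v u -> 0 < rhoE (u, v) E.
 move=> su c0 iv; rewrite lt_neqAle nrm_ge0 andbT eq_sym; apply: contra_neq c0 => /eqP/eqP rz.
 have [N uN] := inP u v su iv; have /eqP := r0 N _ uN rz; rewrite powR_eq0 => /andP[/eqP/eqP + _]. by rewrite nrm_eq0 => /eqP.
apply: (bounded_solutions (Yw := Yw) (n0 := n0) IV fl l1 lI qE Kg1 agt gtK cgt1 cgtp gts cde n00 IW Vapp _ Y1 _ (B' := (A1 + B) `^ ((1 - fa) / fa) * (A1 + B))).
- move=> u su c0; have := rpos u u su c0 (infix_refl u); rewrite /rhoE /= => h.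
 by apply: contraTneq h => ->; rewrite subrr nrm0 ltxx.
- move=> u v su c0 iv; have rp := rpos u v su c0 iv; rewrite -/(rhoE (u, v) E).
 have d0 : 0 <= 2 / rhoE (u, v) E by rewrite divr_ge0 // ltW.
 have -> : 2 / rhoE (u, v) E = ((2 / rhoE (u, v) E) `^ sg) `^ sg^-1 by rewrite -powRrM mulfV ?gt_eqF // powRr1.
 apply: ge0_ler_powR; rewrite ?nnegrE ?powR_ge0 ?invr_ge0 ?(ltW sg0) ?addr_ge0 //.
 have := le_sum_mem (f := fun v => (2 / rhoE (u, v) E) `^ sg) (mem_infs iv) (fun v => powR_ge0 _ _). by rewrite -/(Sg u); lin.
- by move=> N k kn; apply: sum_root => // [u|]; [rewrite mulr_ge0 ?nrm_ge0 // exprn_ge0 // (le_trans ler01)|exact: Tb].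
- by move=> N; apply: sum_root (cA_ N) => // l; exact: nrm_ge0.
Qed.

(** [lamE ^+ 2] moves with definite speed: the real part of [lamE] is [D / 2], whose speed is
    bounded below, and the imaginary part stays above [y0]. This is the separation required by
    [dimension_lemma], with [Cn] just above [2 / (k * y0)]. *)
Lemma elliptic_local E0 s : n0%:R * fa < s -> `|D E0| < 2 ->
  exists2 d : R, 0 < d & hnull s ([set E | unbounded E] `&` oitv E0 d).
Proof.
move=> fs hD; have [d1 [k [b [d10 k0 b2 hd]]]] := disc_elliptic IV aKv Q00 uni hf hD.
pose d : R := Num.min d1 (1 / 2); have d0 : 0 < d by rewrite lt_min d10 divr_gt0.
have dd1 : d <= d1 by rewrite ge_min lexx.
have d2 : d <= 1 / 2 by rewrite ge_min lexx orbT.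
clearbody d; pose J E := `|E - E0| < d.
have Jin E : J E -> `|E - E0| <= d1 by move=> h; apply: le_trans (ltW h) dd1.
have b0 : 0 <= b by have [h _] := hd E0 E0 ltac:(by rewrite subrr normr0 ltW) ltac:(by rewrite subrr normr0 ltW); apply: le_trans (normr_ge0 _) h.
pose y0 : R := Num.sqrt (1 - b ^+ 2 / 4); have y00 : 0 < y0 by rewrite sqrtr_gt0; nra.
have yE E : J E -> y0 <= Im (lamE E).
 move=> JE; have [h _] := hd E E (Jin E JE) (Jin E JE); rewrite ler_wsqrtr // lerB // ler_wpM2r //.
 by rewrite -[leLHS]real_normK ?num_real // lerXn2r ?nnegrE.
have sep E E' : J E -> J E' -> k * y0 * `|E - E'| <= nrm (lamE E ^+ 2 - lamE E' ^+ 2).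
 move=> JE JE'; have [_ h] := hd E E' (Jin E JE) (Jin E' JE'). rewrite subr_sqr nrmM. have h1 : `|D E - D E'| / 2 <= nrm (lamE E - lamE E').
  by apply: le_trans (Re_le _); rewrite ReD ReN /= -mulrBl normrM (ger0_norm (_ : 0 <= 2^-1)) // invr_ge0.
 have h2 : 2 * y0 <= nrm (lamE E + lamE E').
  by apply: le_trans (Im_le _); apply: le_trans (ler_norm _); rewrite ImD; have := yE E JE; have := yE E' JE'; lin.
 apply: (@le_trans _ _ ((`|D E - D E'| / 2) * (2 * y0))); first by have := ler_wpM2r (ltW y00) h; lin.
 by apply: ler_pM => //; rewrite ?divr_ge0 ?mulr_ge0 // ltW.
have sg0 : 0 <= n0%:R * fa by rewrite mulr_ge0 // ltW.
pose Cn := (Num.truncn (2 / (k * y0))).+1.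
have ky : 0 < k * y0 by rewrite mulr_gt0.
have hd2 : forall (i : seq nat * seq nat) x y r, J x -> J y -> rhoE i x < r -> rhoE i y < r -> `|x - y| <= Cn%:R * r.
 move=> i x y r Jx Jy h1 h2; have o1 : nrm (\prod_(l <- i.2) e l 1) = 1 by rewrite nrm_prod big1 // => l _; exact: nrm_expmi.
 have h := sep x y Jx Jy; move: h1 h2; rewrite /rhoE /wmu -!rmorphXn => h1 h2. have r0 : 0 <= r by apply: le_trans (nrm_ge0 _) (ltW h1).
 have := le_trans h (rho_sep o1 h1 h2); rewrite -ler_pdivlMl // => h3; apply: le_trans h3 _.
 rewrite mulrA ler_wpM2r //; apply: ltW; rewrite mulrC; exact: truncnS_gt.
have mono N N' (f : seq nat * seq nat -> R) : (N <= N')%N -> (forall i, 0 <= f i) -> \sum_(i <- wpairs n0 N) f i <= \sum_(i <- wpairs n0 N') f i.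
 move=> NN f0; rewrite !wpairs_sum; apply: ler_sum => k' _; apply: words_mono => // u; exact: sumr_ge0.
have Jb x : J x -> E0 - 1 / 2 <= x /\ x <= E0 - 1 / 2 + 1 by rewrite /J ltr_norml => /andP[h1 h2]; split; lin.
have [Z hZ HZ] := @dimension_lemma _ (wpairs n0) (fun i => nrm (cw c i.1) `^ fa) rhoE J _ _ _ s Cn sg0 fs
 (fun i => powR_ge0 _ _) (fun i x => nrm_ge0 _) mono wpairs_sum_le Jb hd2.
exists d => //; apply: hnull_sub hZ => E [uE]; rewrite /= in_itv /= => /andP[h1 h2].
have JE : J E by rewrite /J ltr_norml; apply/andP; split; lin.
apply: contrapT => nZ; have [r0 [B hB]] := HZ E JE nZ.
by apply: bounded_of_sums r0 hB uE; have [h _] := hd E E (Jin E JE) (Jin E JE); apply: le_lt_trans h b2.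
Qed.

End ExceptionalSet.

(** * The decaying part of the potential *)

Section DecayingPotential.
Implicit Types (x d : R) (l n N : nat).

Lemma tail_small (a : nat -> R) (A d : R) : (forall l, 0 <= a l) -> (forall N, \sum_(l <- iota 0 N) a l <= A) -> 0 < d ->
  exists N, forall n, (N <= n)%N -> \sum_(l <- iota N (n - N)) a l <= d.
Proof.
move=> a0 aA d0; pose S := [set z | exists N, z = \sum_(l <- iota 0 N) a l].
have hs : has_sup S by split; [exists (\sum_(l <- iota 0 0) a l), 0%N|exists A => _ [N ->]; exact: aA].
have [_ [N ->] hN] := sup_adherent d0 hs; exists N => n Nn.
have : \sum_(l <- iota 0 n) a l <= sup S by apply: ub_le_sup; [case: hs|exists n].
by rewrite -(subnKC Nn) iotaD big_cat /= add0n subnKC //; lin.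
Qed.

Lemma sum_ord_iota (A : nmodType) n (F : nat -> A) : \sum_(l < n) F l = \sum_(l <- iota 0 n) F l.
Proof. by rewrite -(big_mkord xpredT) /index_iota subn0. Qed.
Lemma Re_sum (I : Type) (r : seq I) (F : I -> C) : Re (\sum_(i <- r) F i) = \sum_(i <- r) Re (F i).
Proof. by elim/big_rec2: _ => // i a b _ <-; rewrite ReD. Qed.
Lemma Im_sum (I : Type) (r : seq I) (F : I -> C) : Im (\sum_(i <- r) F i) = \sum_(i <- r) Im (F i).
Proof. by elim/big_rec2: _ => // i a b _ <-; rewrite ImD. Qed.

Variables (V : R -> R) (c : nat -> C) (freq : nat -> R) (gam : nat -> R -> C) (Kg Bc : R).
Hypotheses (hV : forall x, 0 < x ->
     (fun n => \sum_(l < n) Re (c l * expmi (freq l * x) * gam l x)) @ \oo --> V x /\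
     (fun n => \sum_(l < n) Im (c l * expmi (freq l * x) * gam l x)) @ \oo --> (0 : R))
  (Kg1 : 1 <= Kg) (gK : forall l x, 0 < x -> nrm (gam l x) <= Kg) (cB_ : forall N, \sum_(l <- iota 0 N) nrm (c l) <= Bc)
  (Lg : forall l, CLB (pos_part (gam l)))
  (gsm : forall l d, 0 < d -> exists X : R, forall x, 0 < x -> X <= x -> nrm (gam l x) <= d).
Notation term := (fun l x => c l * expmi (freq l * x) * gam l x).

Lemma term_le l x : 0 < x -> nrm (term l x) <= nrm (c l) * Kg.
Proof. by move=> x0; rewrite !nrmM nrm_expmi mulr1 ler_wpM2l ?nrm_ge0 // gK. Qed.

(** [sum |c_l|] is finite and the [gamma_l] are uniformly bounded, so the convergence is uniform on
    [(0, oo)]. *)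
Lemma potential_approx d : 0 < d -> exists N, forall x, 0 < x -> nrm ((V x)%:C%C - \sum_(l <- iota 0 N) term l x) <= d.
Proof.
move=> d0; have K0 : 0 < Kg := lt_le_trans ltr01 Kg1.
pose d' := d / (4 * Kg); have d'0 : 0 < d' by rewrite divr_gt0 // mulr_gt0.
have [N hN] := tail_small (fun l => nrm_ge0 (c l)) cB_ d'0; exists N => x x0.
have dK : d' * Kg = d / 4 by rewrite /d'; field; rewrite gt_eqF.
have tl n : (N <= n)%N -> nrm (\sum_(l <- iota 0 n) term l x - \sum_(l <- iota 0 N) term l x) <= d / 4.
 move=> Nn; rewrite -{1}(subnKC Nn) iotaD big_cat /= add0n addrAC subrr add0r -dK.
 apply: le_trans (nrm_sum _ _ _) _; apply: (@le_trans _ _ (\sum_(l <- iota N (n - N)) nrm (c l) * Kg)).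
  by apply: ler_sum => l _; exact: term_le.
 by rewrite -mulr_suml ler_wpM2r ?hN // ltW.
have d4 : 0 < d / 4 by rewrite divr_gt0.
have [/cvgrPdist_le h1 /cvgrPdist_le h2] := hV x0.
have [N1 _ H1] := h1 _ d4; have [N2 _ H2] := h2 _ d4.
pose n := maxn N (maxn N1 N2).
have := tl n (leq_maxl _ _); have := H1 n; have := H2 n; rewrite /= sub0r normrN => k2 k1 k3.
have {}k1 := k1 ltac:(by rewrite /n /=; lia); have {}k2 := k2 ltac:(by rewrite /n /=; lia).
rewrite (sum_ord_iota n (fun l => Re (term l x))) -Re_sum in k1.
rewrite (sum_ord_iota n (fun l => Im (term l x))) -Im_sum in k2.
rewrite -(subrK (\sum_(l <- iota 0 n) term l x) ((V x)%:C%C)) -addrA.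
apply: le_trans (nrmD _ _) _; apply: le_trans (lerD (nrm_ReIm _) k3) _.
by rewrite ReD ReN ReC ImD ImN ImC sub0r normrN; lin.
Qed.

Lemma potential_bound x : 0 < x -> `|V x| <= Bc * Kg + 1.
Proof.
move=> x0; have [N hN] := potential_approx ltr01; have := hN x x0 => h.
have h2 : nrm (\sum_(l <- iota 0 N) term l x) <= Bc * Kg.
 apply: le_trans (nrm_sum _ _ _) _; apply: (@le_trans _ _ (\sum_(l <- iota 0 N) nrm (c l) * Kg)).
  by apply: ler_sum => l _; exact: term_le.
 by rewrite -mulr_suml ler_wpM2r ?cB_ // (le_trans ler01).
rewrite -nrmC -(subrK (\sum_(l <- iota 0 N) term l x) ((V x)%:C%C)); apply: le_trans (nrmD _ _) _; lin.
Qed.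

Lemma potential_decay d : 0 < d -> exists X : R, forall x, 0 <= x -> X <= x -> `|V x| <= d.
Proof.
move=> d0; have d2 : 0 < d / 2 by rewrite divr_gt0.
have [N hN] := potential_approx d2.
have Bc0 : 0 <= Bc by apply: le_trans (cB_ 0); rewrite big_nil.
pose r := (d / 2) / (Bc + 1); have r0 : 0 < r by rewrite divr_gt0 //; lin.
have [X hX] := uniform_small N gsm r0.
exists (Num.max X 1) => x _; rewrite ge_max => /andP[Xx x1]; have x0 : 0 < x by lin.
have h2 : nrm (\sum_(l <- iota 0 N) term l x) <= d / 2.
 apply: le_trans (nrm_sum _ _ _) _; apply: (@le_trans _ _ (\sum_(l <- iota 0 N) nrm (c l) * r)).
  rewrite big_seq [leRHS]big_seq; apply: ler_sum => l; rewrite mem_iota add0n => /= lN.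
  by rewrite !nrmM nrm_expmi mulr1 ler_wpM2l ?nrm_ge0 // hX.
 rewrite -mulr_suml; apply: (@le_trans _ _ ((Bc + 1) * r)); last by rewrite /r mulrC divfK // gt_eqF //; lin.
 by rewrite ler_wpM2r ?(ltW r0) //; have := cB_ N; lin.
have := hN x x0 => h.
rewrite -nrmC -(subrK (\sum_(l <- iota 0 N) term l x) ((V x)%:C%C)); apply: le_trans (nrmD _ _) _; lin.
Qed.

Lemma potential_LB : LB V.
Proof.
have L0 : LB (fun x => if 0 < x then V x else 0).
 move=> x x0; split; last first.
  exists (Bc * Kg + 1) => y _ _; case: ifP => [/potential_bound //|_]; rewrite normr0.
  exact: le_trans (normr_ge0 _) (potential_bound ltr01).
 apply: (@measurable_fun_cvg _ _ _ _ (fun n y => \sum_(l <- iota 0 n) Re (c l * expmi (freq l * y) * pos_part (gam l) y))) => [n|y].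
  have L : CLB (fun y => \sum_(l <- iota 0 n) c l * expmi (freq l * y) * pos_part (gam l) y).
   by apply: CLB_sum => l _; apply: CLB_mul (Lg l); apply: CLB_mul (expmi_CLB _); exact: CLB_cst.
  have [mL _] := proj1 L x x0; apply: eq_measurable_fun mL => y _; by rewrite Re_sum.
 rewrite /= in_itv /= => /andP[y0 _]; case: ifP => yp.
  have [h _] := hV yp; apply: cvg_trans h; apply: near_eq_cvg; near=> n. by rewrite /pos_part yp -(sum_ord_iota n (fun l => Re (term l y))).
 rewrite (_ : (fun _ => _) = fun=> 0); first exact: cvg_cst. by apply/funext => n; rewrite big1 // => l _; rewrite /pos_part yp mulr0.
(* The series says nothing about [V 0]; this value is added back as a multiple of the indicator of
   the point 0. *)
apply: LB_ext (LB_add L0 (LB_mul (LB_cst (V 0)) (LB_indic 0 0))) => x x0.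
rewrite /= indicE; case: ltP => [xp|xn].
 by rewrite memNset ?mulr0 ?addr0 //= in_itv /= => /andP[_]; rewrite leNgt xp.
by have -> : x = 0 by [apply/eqP; rewrite eq_le xn x0]; rewrite mem_set /= ?in_itv /= ?lexx // mulr1 add0r.
Unshelve. all: by end_near.
Qed.

End DecayingPotential.

(** * Essential spectrum and spectral measure of the perturbed operator *)

Section SpectralSets.
Notation meas := (measurable : set (set (measurableTypeR R))).
Implicit Types (x y s t e E : R).

Lemma itv_open_sub (x y d : R) : `|y - x| < d -> exists2 d' : R, 0 < d' & (oitv y d') `<=` `](x - d)%R, (x + d)%R[%classic.
Proof.
move=> h; exists (d - `|y - x|); first by rewrite subr_gt0.
move=> z /=; rewrite !in_itv /= => /andP[z1 z2]; have := ler_norm (y - x); have := ler_norm (- (y - x)); rewrite normrN => a b.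
by apply/andP; split; lin.
Qed.

Lemma measure_subU0 (nu : measure (measurableTypeR R) R) (A B C : set R) : meas A -> meas B -> meas C ->
  (forall x, A x -> B x \/ C x) -> nu B = 0%E -> nu C = 0%E -> nu A = 0%E.
Proof.
move=> mA mB mC AB B0 C0; have mBC : meas (B `|` C) by exact: measurableU.
have h : nu (B `|` C) = 0%E by apply: etrans B0; exact: measureU0.
exact: (subset_measure0 (mu := nu) mA mBC AB h).
Qed.

Lemma itv_norm (x y d : R) : (oitv x d) y <-> `|y - x| < d.
Proof. by rewrite /= in_itv /= ltr_norml; split=> /andP[a b]; apply/andP; split; lin. Qed.

Variables (V Kv : R -> R) (Q0 : R).
Hypotheses (IV : LI V) (aKv : AC Kv (fun x => `|V x|)) (Q00 : 0 <= Q0)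
  (uni : forall s, 0 <= s -> Kv (s + 1) - Kv s <= Q0) (per : forall x, 0 <= x -> V (x + 1) = V x).
Variables (q Kq W : R -> R) (Q1 : R).
Hypotheses (qE : forall x, 0 <= x -> q x = V x + W x) (BW : LB W)
  (Wsm : forall e, 0 < e -> exists X : R, forall x, 0 <= x -> X <= x -> `|W x| <= e)
  (Iq : LI q) (aKq : AC Kq (fun x => `|q x|)) (Q10 : 0 <= Q1)
  (uniq : forall s, 0 <= s -> Kq (s + 1) - Kq s <= Q1).

Lemma U2_decay z g u w e : solg (Qz q z) g u w -> sqint g -> L2b u -> L2b g -> 0 < e ->
  exists N, forall n, (N <= n)%N -> U2 u w n%:R <= e.
Proof.
move=> sg hg [Mu hu] [Mg hgb] e0; have aK := AC_prim 0 (LI_nrm (proj1 hg)); set Kg := (fun x => 0 + _) in aK.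
have hu' := CAC_CLB (proj1 sg); have c0 := cU_gt0 (Q1 + nrm z).
pose f x := N2 u x + N2 g x.
have [|n|N HN] := nat_incr_small (f := f) (M := Mu + Mg) (e := e / cU (Q1 + nrm z)) _ _ (divr_gt0 e0 c0).
- by move=> n; apply: lerD; [exact: hu|exact: hgb].
- by apply: lerD; [apply: N2_mono|apply: sqint_mono] => //; rewrite ler_nat.
exists N => n Nn; have n0 : 0 <= n%:R :> R by [].
have n1 : n%:R <= n%:R + 1 :> R by rewrite lerDl.
have := unit_z Iq aKq Q10 uniq sg aK n0 (lexx _) n1 => h; apply: le_trans h _.
have := HN n Nn; rewrite ler_pdivlMr // mulrC => h; apply: le_trans h; rewrite ler_pM2l // /f -natr1.
have := l1_l2 hg aK n0; lin.
Qed.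

(** Perturbation and change of energy are moved into the source of the periodic equation, where
    their smallness allows them to be absorbed. *)
Lemma source_change (E0 : R) z g u w : solg (Qz q z) g u w -> sqint g ->
  let h := fun x => g x + (z - E0%:C%C - (W x)%:C%C) * u x in
  [/\ solg (Qz V E0%:C%C) h u w, sqint h & forall x e, nrm (z - E0%:C%C) <= e -> `|W x| <= e ->
   nsq (h x) <= 2 * nsq (g x) + 8 * e ^+ 2 * nsq (u x)].
Proof.
move=> [a1 a2] hg h; split.
- split=> //; apply: CAC_ext a2 => // x x0; rewrite /h /Qz (qE x0) rmorphD; ring.
- apply: sqint_add => //; apply: CLB_mul; last exact: CAC_CLB a1.
 apply: CLB_ext (CLB_add (CLB_cst (z - E0%:C%C)) (CLB_real (LB_opp BW))) => x _; by rewrite rmorphN.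
- move=> x e h1 h2; apply: le_trans (nsqD_le _ _) _; rewrite mulrDr lerD2l nsqM.
 have e0 : 0 <= e by apply: le_trans h2. have : nsq (z - E0%:C%C - (W x)%:C%C) <= 4 * e ^+ 2.
  rewrite -nrmE (_ : 4 * e ^+ 2 = (2 * e) ^+ 2); last by ring.
  rewrite ler_pXn2r ?nnegrE ?nrm_ge0 ?mulr_ge0 //; apply: le_trans (nrmB _ _) _; rewrite nrmC; lin.
 have := nsq_ge0 (u x); nra.
Qed.

(** Up to [X] plain growth bounds suffice. Beyond [X] one has [|W| <= e], and in [hyper_sum] for the
    periodic operator the extra source is at most half of the left-hand side. The right end of the
    range disappears in the limit because [u] and [g] are square-integrable. *)
Lemma hyper_est (E0 lam : R) phi wp phi2 wp2 : 1 < `|lam| -> floq V E0 lam%:C%C phi wp -> floq V E0 lam^-1%:C%C phi2 wp2 ->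
  exists r0 Cst : R, [/\ 0 < r0, r0 <= 1, 0 <= Cst & forall z g u w Gam, nrm (z - E0%:C%C) <= r0 ->
   solg (Qz q z) g u w -> sqint g -> L2b u -> (forall x, 0 <= x -> N2 g x <= Gam) ->
   forall x, 0 <= x -> N2 u x <= Cst * (U2 u w 0 + Gam)].
Proof.
move=> l1 f1 f2; have [B B0 HB] := hyper_sum IV per l1 f1 f2.
pose ka := 2 + (Q0 + `|E0|); pose C5 := expR ka * (B + 1).
have C50 : 0 < C5 by rewrite mulr_gt0 ?expR_gt0 // ltr_wpDl.
(* The factor [8 e ^+ 2] comes from [source_change] and [C5] from the dichotomy; their product is at
   most [1 / 2]. *)
pose e := Num.min 1 (1 / (16 * C5)); have e0 : 0 < e by rewrite lt_min ltr01 divr_gt0 // mulr_gt0.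
have e1 : e <= 1 by rewrite ge_min lexx.
have e2 : 8 * e ^+ 2 * C5 <= 1 / 2.
 have h : e * (16 * C5) <= 1.
  have : e <= 1 / (16 * C5) by rewrite ge_min lexx orbT. by rewrite ler_pdivlMr // mulr_gt0.
 have h2 : e ^+ 2 * C5 <= e * C5 by rewrite ler_pM2r // expr2 ler_piMl // ltW. lin.
have [X0 HX0] := Wsm e0; pose X := (Num.truncn X0).+1.
have HX x : X%:R <= x -> `|W x| <= e.
 move=> hx; apply: HX0; first by apply: le_trans hx. by apply: le_trans hx; apply: ltW; exact: truncnS_gt.
have aG := AC_add AC_id (AC_scale 1 (AC_add aKq (AC_scale (`|E0| + 2) AC_id))).
pose Gx := expR (2 * X%:R + (Kq X%:R - Kq 0) + (`|E0| + 1) * X%:R); have G0 : 0 < Gx by exact: expR_gt0.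
exists e, (X%:R * Gx + 2 * C5 * (Gx + 2)); split=> //.
 by rewrite addr_ge0 ?mulr_ge0 ?addr_ge0 ?(ltW C50) ?(ltW G0).
move=> z g u w Gam hz sg hg hu hG; have Gam0 : 0 <= Gam by apply: le_trans (hG 0 (lexx 0)); rewrite N2_0.
have bu := CAC_CLB (proj1 sg).
have [sh sqh hh] := source_change E0 sg hg; set h := fun x => _ in sh sqh hh.
have U00 := U2_ge0 u w 0.
have zE : nrm z <= `|E0| + 1.
 by rewrite -(subrK E0%:C%C z); apply: le_trans (nrmD _ _) _; rewrite nrmC addrC lerD2l (le_trans hz).
have [Kz aKz _] := sol_CLI_K (Qz_CLI Iq z).
have grow x : 0 <= x -> x <= X%:R -> U2 u w x <= Gx * (U2 u w 0 + Gam).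
 move=> x0 xX; have [gr _] := solg_growth sg aKz (N2_ac hg) (lexx 0) x0.
 apply: le_trans gr _; rewrite N2_0 subr0; apply: ler_pM; first exact: expR_ge0.
 - by rewrite addr_ge0 ?U2_ge0 //; have := sqint_mono hg (lexx 0) x0; rewrite N2_0.
 - rewrite ler_expR.
  have aT := AC_add aKq (AC_scale (`|E0| + 3) AC_id). have := AC_le aKz aT (lexx 0) x0; rewrite mulr0 addr0 mulr1 => hk.
  apply: (@le_trans _ _ (Kq x + (`|E0| + 3) * x - Kq 0)).
   apply: hk => y y0 yx; apply: le_trans (lerD (lexx 2) (nrmB _ _)) _; rewrite nrmC; lin.
  have := AC_homo aKq x0 xX (fun y _ _ => normr_ge0 _) => m1. have : (`|E0| + 3) * x <= (`|E0| + 3) * X%:R by rewrite ler_wpM2l // addr_ge0.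
  lin.
 - by rewrite lerD2l hG.
have NX : N2 u X%:R <= X%:R * Gx * (U2 u w 0 + Gam).
 have X00 : 0 <= X%:R :> R by []. have := AC_le (N2_AC bu) (AC_scale (Gx * (U2 u w 0 + Gam)) AC_id) (lexx 0) X00.
 rewrite N2_0 mulr0 !subr0 mulr1 => hN; apply: le_trans (hN _) _; last by apply: eqW; ring.
 by move=> x x0 xX; apply: le_trans (grow x x0 xX); rewrite lerDl nsq_ge0.
have [Kz0 aKz0 _] := sol_CLI_K (Qz_CLI IV E0%:C%C).
have unitU (j : nat) : N2 u j.+1%:R - N2 u j%:R <= expR ka * (U2 u w j%:R + (N2 h j.+1%:R - N2 h j%:R)).
 have j0 : 0 <= j%:R :> R by []. have j1 : j%:R <= j.+1%:R :> R by rewrite ler_nat.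
 have := AC_le (N2_AC bu) (AC_scale (expR ka * (U2 u w j%:R + (N2 h j.+1%:R - N2 h j%:R))) AC_id) j0 j1.
 rewrite mulr1 -mulrBr (_ : j.+1%:R - j%:R = 1) ?mulr1; last by rewrite -natr1; ring.
 apply=> x x0 xj; have x00 : 0 <= x by exact: le_trans x0. apply: (@le_trans _ _ (U2 u w x)); first by rewrite lerDl nsq_ge0.
 have [gr _] := solg_growth sh aKz0 (N2_ac sqh) j0 x0; apply: le_trans gr _; apply: ler_pM; rewrite ?expR_ge0 //.
 - by rewrite addr_ge0 ?U2_ge0 // subr_ge0 sqint_mono.
 - rewrite ler_expR; have aT := AC_add aKv (AC_scale (2 + `|E0|) AC_id).
  have := AC_le aKz0 aT j0 x0; rewrite mulr1 => hk; apply: le_trans (hk _) _.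
   move=> y y0 yx; apply: le_trans (lerD (lexx 2) (nrmB _ _)) _; rewrite !nrmC; lin.
  have jx : x <= j%:R + 1 by rewrite natr1. have m1 := AC_homo aKv x00 jx (fun y _ _ => normr_ge0 _); have m2 := uni j0.
  have : (2 + `|E0|) * (x - j%:R) <= (2 + `|E0|) * 1 by rewrite ler_wpM2l ?addr_ge0 //; lin. rewrite /ka; lin.
 - by rewrite lerD2l lerD2r sqint_mono.
have main n : N2 u (X + n)%:R - N2 u X%:R <= 2 * C5 * (U2 u w X%:R + U2 u w (X + n)%:R + 2 * Gam).
 set S := N2 u (X + n)%:R - N2 u X%:R; set A := N2 h (X + n)%:R - N2 h X%:R. have XX : X%:R <= (X + n)%:R :> R by rewrite ler_nat leq_addr.
 have X00 : 0 <= X%:R :> R by []. have S1 : S <= expR ka * (\sum_(X <= j < X + n) U2 u w j%:R + A).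
  rewrite /S /A; elim: n {S A XX} => [|m IH]; first by rewrite addn0 big_geq // !subrr addr0 mulr0.
  by rewrite addnS big_nat_recr ?leq_addr //=; have := unitU (X + m)%N; lin.
 have A0 : 0 <= A by rewrite subr_ge0 sqint_mono. have S0 : 0 <= S by rewrite subr_ge0 N2_mono. have A1 : A <= 2 * Gam + 8 * e ^+ 2 * S.
  have aT := AC_add (AC_scale 2 (N2_ac hg)) (AC_scale (8 * e ^+ 2) (N2_AC bu)).
  have := AC_le (N2_ac sqh) aT X00 XX => hA; apply: le_trans (hA _) _.
   by move=> x Xx _; apply: hh; rewrite ?HX.
  have := hG (X + n)%:R (ler0n _ _); have := sqint_mono hg (lexx 0) X00; rewrite N2_0 /S; lin.
 have HS := HB h u w sh sqh X n; rewrite -/A in HS. have U0 := U2_ge0 u w X%:R; have Un := U2_ge0 u w (X + n)%:R.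
 have S2 : S <= C5 * (U2 u w X%:R + U2 u w (X + n)%:R + A).
  apply: le_trans S1 _; rewrite /C5 -mulrA ler_wpM2l ?expR_ge0 // mulrDl mul1r; lin.
 have S3 : C5 * A <= C5 * (2 * Gam) + (8 * e ^+ 2 * C5) * S.
  by rewrite (_ : _ + _ = C5 * (2 * Gam + 8 * e ^+ 2 * S)); [rewrite ler_pM2l|ring].
 have S4 : (8 * e ^+ 2 * C5) * S <= 1 / 2 * S by rewrite ler_wpM2r. rewrite mulrDr in S2; lin.
move=> x x0; apply/ler_addgt0Pr => d d0.
have [N HN] := U2_decay sg hg hu (ex_intro _ Gam hG) (divr_gt0 d0 (mulr_gt0 (ltr0n R 2) C50)).
pose n := maxn N (Num.truncn x).+1.
have xn : x <= (X + n)%:R.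
 by apply: le_trans (ltW (truncnS_gt x)) _; rewrite ler_nat (leq_trans (leq_maxr N _)) // leq_addl.
have Nn : (N <= X + n)%N by rewrite (leq_trans (leq_maxl N (Num.truncn x).+1)) // leq_addl.
have := HN _ Nn; rewrite ler_pdivlMr ?(mulr_gt0 (ltr0n R 2) C50) // => hd.
have m := main n; have gX := grow X%:R (ler0n _ _) (lexx _).
apply: le_trans (N2_mono bu x0 xn) _.
have p1 : 2 * C5 * U2 u w X%:R <= 2 * C5 * (Gx * (U2 u w 0 + Gam)) by rewrite ler_wpM2l // mulr_ge0 // ltW.
have p2 : 0 <= C5 * U2 u w 0 by rewrite mulr_ge0 // ltW.
lin.
Qed.

Variables (c c1 s s1 : R -> R -> R).
Hypothesis hf : forall E, fund V E (c E) (c1 E) (s E) (s1 E).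
Notation D := (disc c s1).

(** In a gap [hyper_est] bounds the norm by the Cauchy data and the residual. Along a singular
    sequence both tend to 0, the data by [weak_coeff], while the norm is 1. *)
Lemma ess_le2 theta E : ess_spec q theta E -> `|D E| <= 2.
Proof.
move=> [a [b [fa [fb [dom nor weak res]]]]]; rewrite leNgt; apply/negP => D2.
have [lam [phi [wp [phi2 [wp2 [l1 f1 f2]]]]]] := hyp_floq IV per hf D2.
have [r0 [Cst [r00 _ C0 HH]]] := hyper_est l1 f1 f2.
have [k [l [C1 [Bk Bl C10 HC]]]] := weak_coeff Iq aKq Q10 uniq E.
(* Cut off to [[0, 1]], the functions of [weak_coeff] become test functions for weak convergence. *)
pose tr (v : R -> R) x : R := \1_(`[0, 1]%classic) x * v x.
have trL v : LB v -> L2 (tr v).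
 move=> bv; apply: (L2_trunc ler01); first exact: LB_mul (LB_indic 0 1) bv.
 by move=> x x1; rewrite /tr indicE memNset ?mul0r //= in_itv /= => /andP[_]; rewrite leNgt x1.
have trI (u v : R -> R) : Rint (@halfline R) (fun x => u x * tr v x) = I1 (fun x => u x * v x).
 rewrite /Rint (@halfline_trunc _ 1) => [|x x1]; last first.
  by rewrite /tr indicE memNset ?mul0r ?mulr0 //= in_itv /= => /andP[_]; rewrite leNgt x1.
 by congr fine; apply: eq_integral => x xx; rewrite /tr indicE xx mul1r.
pose M := 6 * C1 + 1; have M0 : 0 < M by rewrite ltr_wpDl // mulr_ge0.
pose eta := Num.min 1 (1 / (2 * ((Cst + 1) * M))).
have CM : 0 < 2 * ((Cst + 1) * M) by rewrite mulr_gt0 // mulr_gt0 // ltr_wpDl.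
have eta0 : 0 < eta by rewrite lt_min ltr01 divr_gt0.
have eta1 : eta <= 1 by rewrite ge_min lexx.
have eta2 : eta * (2 * ((Cst + 1) * M)) <= 1.
 have : eta <= 1 / (2 * ((Cst + 1) * M)) by rewrite ge_min lexx orbT. by rewrite ler_pdivlMr.
have [ck dk] := weak _ (trL _ Bk); have [cl dl] := weak _ (trL _ Bl).
have near0 (f : nat -> R) : f @ \oo --> (0 : R) -> \forall n \near \oo, `|f n| <= eta.
 move=> /cvgrPdist_le/(_ eta eta0); apply: filterS => n; by rewrite sub0r normrN.
have [n [[[n1 n2] [n3 n4]] n5]] : exists n, ((`|Rint (@halfline R) (fun x => a n x * tr k x)| <= eta /\ `|Rint (@halfline R) (fun x => b n x * tr k x)| <= eta) /\
  (`|Rint (@halfline R) (fun x => a n x * tr l x)| <= eta /\ `|Rint (@halfline R) (fun x => b n x * tr l x)| <= eta)) /\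
  `|Rint (@halfline R) (fun x => (fa n x - E * a n x) ^+ 2 + (fb n x - E * b n x) ^+ 2)| <= eta.
 have h : \forall n \near \oo, ((`|Rint (@halfline R) (fun x => a n x * tr k x)| <= eta /\ `|Rint (@halfline R) (fun x => b n x * tr k x)| <= eta) /\
  (`|Rint (@halfline R) (fun x => a n x * tr l x)| <= eta /\ `|Rint (@halfline R) (fun x => b n x * tr l x)| <= eta)) /\
  `|Rint (@halfline R) (fun x => (fa n x - E * a n x) ^+ 2 + (fb n x - E * b n x) ^+ 2)| <= eta.
  exact: filterI (filterI (filterI (near0 _ ck) (near0 _ dk)) (filterI (near0 _ cl) (near0 _ dl))) (near0 _ res).
 by have [N _ hN] := h; exists N; apply: hN => /=.
have [[wa [+ La Lfa _]] [wb [+ Lb Lfb _]]] := dom n; move=> /solvesP[aa aw] /solvesP[ab abw].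
rewrite !trI in n1 n2 n3 n4; set del := Rint _ _ in n5.
pose ga x := fa n x - E * a n x; pose gb x := fb n x - E * b n x.
have Lg (f v : R -> R) : L2 f -> L2 v -> L2 (fun x => f x - E * v x).
 by move=> h1 h2; have := L2_lin (- E) h1 h2; under [X in L2 X]eq_fun do rewrite mulNr.
have Lga : L2 ga by exact: Lg. have Lgb : L2 gb by exact: Lg.
have [Iga Iga2] := L2_LI Lga; have [Igb Igb2] := L2_LI Lgb.
pose u x := Complex (a n x) (b n x); pose w x := Complex (wa x) (wb x); pose g x := Complex (ga x) (gb x).
have sg : solg (Qz q E%:C%C) g u w.
 split; first by split. split; [apply: AC_ext aw => // x _|apply: AC_ext abw => // x _]; rewrite /g /u /Qz.
  by rewrite -rmorphB ReD ReN ReM ReC ImC mul0r subr0 /ga /=; ring.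
 by rewrite -rmorphB ImD ImN ImM ReC ImC mul0r addr0 /gb /=; ring.
have sqg : sqint g by split; [split|apply: LI_ext (LI_add Iga2 Igb2)].
have Ng x : 0 <= x -> N2 g x <= del by move=> x0; apply: N2_le_Rint.
have del0 : 0 <= del by apply: le_trans (Ng 0 (lexx 0)); rewrite N2_0.
have hu : L2b u.
 exists 1 => x x0; apply: le_trans (N2_le_Rint La Lb x0) _. by rewrite /Rint; have := nor n => ->.
have d1 : del <= eta by rewrite -(ger0_norm del0).
have coef (v wv f : R -> R) : AC v wv -> AC wv (fun t => q t * v t - f t) -> L2 (fun x => f x - E * v x) -> LI f ->
 (forall x, (f x - E * v x) ^+ 2 <= nsq (g x)) -> `|I1 (fun x => v x * k x)| <= eta -> `|I1 (fun x => v x * l x)| <= eta -> v 0 ^+ 2 + wv 0 ^+ 2 <= 3 * C1 * eta.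
 move=> h1 h2 h3 h4 h5 h6 h7; have [_ h8] := L2_LI h3. have h9 : I1 (fun x => (f x - E * v x) ^+ 2) <= del.
  apply: le_trans (Ng 1 ler01); apply: (Rint_le h8 (proj2 sqg) ler01) => x _ _; exact: h5.
 apply: le_trans (HC _ _ _ _ h1 h2 h4 h8 h9) _; rewrite -mulrA mulrCA; apply: ler_wpM2l => //.
 have sq (p : R) : `|p| <= eta -> p ^+ 2 <= eta.
  move=> hp; rewrite -(real_normK (num_real p)) expr2; apply: le_trans (hp); rewrite ler_piMr //; exact: le_trans hp eta1.
 have := sq _ h6; have := sq _ h7; lin.
have LIf (f : R -> R) : L2 f -> LI f by case/L2_LI.
have c3 := coef _ _ _ aa aw Lga (LIf _ Lfa) (fun x => ltac:(by rewrite /nsq /g /= lerDl sqr_ge0)) n1 n3.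
have c4 := coef _ _ _ ab abw Lgb (LIf _ Lfb) (fun x => ltac:(by rewrite /nsq /g /= lerDr sqr_ge0)) n2 n4.
have U0 : U2 u w 0 <= 6 * C1 * eta by rewrite /U2 /nsq /u /w /=; lin.
have z0 : nrm (E%:C%C - E%:C%C) <= r0 by rewrite subrr nrm0 ltW.
have HN := HH _ _ _ _ _ z0 sg sqg hu Ng.
have bd : Cst * (U2 u w 0 + del) <= 1 / 2.
 have h1 : U2 u w 0 + del <= M * eta by rewrite /M; lin. have h2 : Cst * (U2 u w 0 + del) <= Cst * (M * eta) by rewrite ler_wpM2l.
 have : 0 <= M * eta by rewrite mulr_ge0 // ltW. lin.
have := halfline_le (M := 1 / 2) (N2_AC (CAC_CLB (proj1 sg))) (fun y _ => nsq_ge0 _) (N2_0 _) (fun x h => le_trans (HN x h) bd).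
by rewrite [X in (X <= _)%E](nor n) lee_fin => h; lin.
Qed.

Lemma sq_tail (g : R -> R) (G : R -> R) TG e : AC G (fun x => g x ^+ 2) -> (forall x, 0 <= x -> G x <= TG) -> 0 < e ->
  exists N : nat, forall x y, N%:R <= x -> x <= y -> G y - G x <= e.
Proof.
move=> aG hG e0; pose A : set R := [set z | exists n : nat, z = G n%:R].
have hs : has_sup A.
 by split; [exists (G 0), 0%N|exists TG => _ [n ->]; exact: hG].
have [_ [N ->] hN] := sup_adherent e0 hs; exists N => x y Nx xy.
have x0 : 0 <= x by exact: le_trans Nx.
have m1 := AC_homo aG (ler0n R N) Nx (fun z _ _ => sqr_ge0 _).
pose n := (Num.truncn y).+1; have yn : y <= n%:R by apply: ltW; exact: truncnS_gt.
have m2 := AC_homo aG (le_trans x0 xy) yn (fun z _ _ => sqr_ge0 _).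
have : G n%:R <= sup A by apply: ub_le_sup; [by case: hs|exists n].
lin.
Qed.

(** Cauchy-Schwarz for a function of norm at most 1 living on [(x0_, t]], against the small tail of
    [g]. *)
Lemma weak_tail (a g A G : R -> R) (x0_ t e : R) : LB a -> LI g -> 0 <= x0_ -> x0_ <= t ->
  (forall x, x <= x0_ -> a x = 0) -> (forall x, t < x -> a x = 0) -> 0 < e ->
  AC A (fun x => a x ^+ 2) -> AC G (fun x => g x ^+ 2) -> A t - A x0_ <= 1 -> G t - G x0_ <= e ^+ 2 ->
  `|Rint (@halfline R) (fun x => a x * g x)| <= e.
Proof.
move=> ba Ig n0 nt a0 at_ e0 aA aG hA hG; have t0 : 0 <= t by apply: le_trans nt.
have aF := AC_prim 0 (LB_mulLI ba Ig).
have -> : Rint (@halfline R) (fun x => a x * g x) = Rint `[0, t] (fun x => a x * g x).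
 by rewrite /Rint (@halfline_trunc _ t) // => x tx; rewrite at_ // mul0r.
rewrite (Rint_prim aF t0); set F := (fun x => 0 + _) in aF *.
have F1 : F x0_ = F 0.
 have := AC_lip (M := 0) aF (lexx 0) n0; rewrite mul0r => h.
 by apply/eqP; rewrite -subr_eq0 -normr_le0; apply: h => y y0 yx; rewrite a0 // mul0r normr0.
change (`|F t - F 0| <= e); rewrite -F1; have aT := AC_add (AC_scale (e / 2) aA) (AC_scale (e^-1 / 2) aG).
apply: le_trans (AC_norm_le aF aT n0 nt _) _.
 move=> x _ _; rewrite normrM -(real_normK (num_real (a x))) -(real_normK (num_real (g x))).
 have := sqr_ge0 (e * `|a x| - `|g x|) => h; rewrite -(ler_pM2l e0) mulrDr.
 rewrite (_ : e * (e^-1 / 2 * _) = `|g x| ^+ 2 / 2); last by field; rewrite gt_eqF. move: h; rewrite sqrrB exprMn; lin.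
have -> : e / 2 * A t + e^-1 / 2 * G t - (e / 2 * A x0_ + e^-1 / 2 * G x0_) = e / 2 * (A t - A x0_) + e^-1 / 2 * (G t - G x0_) by ring.
have h1 : e / 2 * (A t - A x0_) <= e / 2 * 1 by rewrite ler_wpM2l // divr_ge0 // ltW.
have h2 : e^-1 / 2 * (G t - G x0_) <= e^-1 / 2 * e ^+ 2 by rewrite ler_wpM2l // divr_ge0 // invr_ge0 ltW.
have h3 : e^-1 / 2 * e ^+ 2 = e / 2 by field; rewrite gt_eqF.
lin.
Qed.

(** A Floquet solution with [|lam| = 1] has the same mass in every period. Cut off to [[m, 5 m]] and
    normalised, it is an approximate eigenfunction: one error comes from [W], small far out, the
    other, of relative size [1 / m], from derivatives of the cutoff. *)
Lemma cutoff E lam phi wp : floq V E lam phi wp -> nrm lam = 1 -> exists2 K : R, 0 <= K &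
  forall m : nat, (0 < m)%N -> exists u w g,
  [/\ [/\ CAC u w, CAC w (fun x => Qz q E%:C%C x * u x - g x) & CLB g],
      [/\ forall x, x <= m%:R -> u x = 0, forall x, 5 * m%:R < x -> u x = 0 /\ g x = 0 & w 0 = 0] &
      N2 u (5 * m%:R) = 1 /\ forall e, (forall x, m%:R <= x -> `|W x| <= e) -> N2 g (5 * m%:R) <= 2 * e ^+ 2 + K / m%:R ^+ 2].
Proof.
move=> [sp n0 mul] l1; have [ap1 ap2] := sp; have bp := CAC_CLB ap1; have bw := CAC_CLB ap2.
have nl : nsq lam = 1 by rewrite -nrmE l1 expr1n.
have [Bp Bp0 HBp] := CLB_bound bp ler01; have [Bw Bw0 HBw] := CLB_bound bw ler01.
pose B := Bp ^+ 2 + Bw ^+ 2; have B0 : 0 <= B by rewrite addr_ge0 ?sqr_ge0.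
have UB x : 0 <= x -> U2 phi wp x <= B.
 apply: per_bound x => x x0; first by have [e1 e2] := mul x x0; rewrite /U2 e1 e2 !nsqM nl !mul1r.
 by move=> x1; apply: lerD; rewrite -nrmE ler_pXn2r ?nnegrE ?nrm_ge0 //; [exact: HBp|exact: HBw].
pose k0 := N2 phi 1; have k00 : 0 < k0.
 rewrite lt_neqAle N2_ge0 // andbT eq_sym; apply/eqP => h. by move/eqP: n0; apply; apply: (N2_eq0 IV aKv Q00 uni sp (lexx 1)).
have cell x : 0 <= x -> N2 phi (x + 1) - N2 phi x = k0.
 move=> x0; have aN := N2_AC bp; have := AC_lip (M := 0) (AC_sub (AC_shift ler01 aN) aN) (lexx 0) x0.
 rewrite N2_0 subr0 add0r mul0r => h; apply/eqP; rewrite -subr_eq0 -normr_le0; apply: h => y y0 yx.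
 by have [-> _] := mul y y0; rewrite nsqM nl mul1r subrr normr0.
have cells x (j : nat) : 0 <= x -> N2 phi (x + j%:R) - N2 phi x = j%:R * k0.
 move=> x0; elim: j => [|j IH]; first by rewrite addr0 subrr mul0r.
 by rewrite -natr1 addrA mulrDl mul1r -IH; have := cell (x + j%:R) (addr_ge0 x0 (ler0n _ _)); lin.
have [Z Z0 HZ] := @poly_cutoff.
pose K1 := 2 * (Z ^+ 2 * B); have K10 : 0 <= K1 by apply: mulr_ge0 => //; apply: mulr_ge0 => //; exact: sqr_ge0.
exists (5 * K1 / k0); first by rewrite divr_ge0 ?mulr_ge0 // ltW.
move=> m m0; set r := m%:R; have r1 : 1 <= r :> R by rewrite ler1n.
have r0 : 0 < r by lin.
pose t := 5 * r; have [X0 [X1 [X2 [[aX0 aX1 aX2] Xz Xlo Xhi]]]] := HZ r r1.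
have rt : r <= t by rewrite /t ler_peMl ?ler1n // ltW.
have r00 : 0 <= r by exact: ltW.
pose h0 x := (X0 x)%:C%C * phi x; pose h1 x := (X1 x)%:C%C * phi x + (X0 x)%:C%C * wp x.
pose h2 x := (X2 x)%:C%C * phi x + (X1 x)%:C%C * wp x + ((X1 x)%:C%C * wp x + (X0 x)%:C%C * (Qz V E%:C%C x * phi x)).
have ah0 : CAC h0 h1 by exact: CAC_mul (CAC_real aX0) ap1.
have ah1 : CAC h1 h2 by apply: CAC_add; apply: CAC_mul => //; exact: CAC_real.
have [z1 z2 z3] := Xz r (or_introl erefl); have [z4 z5 z6] := Xz t (or_intror erefl).
pose ind x : C := (\1_(`[r, t]%classic) x : R)%:C%C.
have hz : [/\ h0 r = 0, h0 t = 0, h1 r = 0 & h1 t = 0] by rewrite /h0 /h1 z1 z2 z4 z5 !mul0r addr0.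
have hz2 : h2 r = 0 /\ h2 t = 0 by rewrite /h2 z1 z2 z3 z4 z5 z6 !mul0r !addr0.
have [y1 y2 y3 y4] := hz; have [y5 y6] := hz2.
have au0 := CAC_restrict r00 rt ah0 y1 y2 y3 y4; have aw0 := CAC_restrict r00 rt ah1 y3 y4 y5 y6.
pose g0 x := ind x * ((W x * X0 x - X2 x)%:C%C * phi x - (2 * X1 x)%:C%C * wp x).
pose u0 x := ind x * h0 x; pose w0 x := ind x * h1 x.
have aw1 : CAC w0 (fun x => Qz q E%:C%C x * u0 x - g0 x).
 apply: CAC_ext aw0 => // x x0; rewrite /u0 /g0 /h0 /h2 /Qz (qE x0) -/(ind x).
 have -> : (W x * X0 x - X2 x)%:C%C = (W x)%:C%C * (X0 x)%:C%C - (X2 x)%:C%C :> C by rewrite -rmorphM -rmorphB.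
 have -> : (2 * X1 x)%:C%C = 2 * (X1 x)%:C%C :> C by rewrite rmorphM rmorph_nat.
 have -> : (V x + W x)%:C%C = (V x)%:C%C + (W x)%:C%C :> C by rewrite -rmorphD.
 by move: (X0 x)%:C%C (X1 x)%:C%C (X2 x)%:C%C (V x)%:C%C (W x)%:C%C E%:C%C (ind x) (phi x) (wp x) => *; ring.
have bi : CLB ind by apply: CLB_real; exact: LB_indic.
have bg : CLB g0.
 apply: CLB_mul => //; apply: CLB_ext (CLB_add (CLB_mul (CLB_real (LB_sub (LB_mul BW (AC_LB aX0)) aX2)) bp) (CLB_mul (CLB_real (LB_opp (LB_mul (LB_cst 2) (AC_LB aX1)))) bw)) => x _.
 by rewrite rmorphN mulNr.
have ind1 x : r <= x -> x <= t -> ind x = 1 by move=> a1 a2; rewrite /ind indicE mem_set //= in_itv /= a1 a2.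
have indl x : x < r -> ind x = 0 by move=> a1; rewrite /ind indicE memNset //= in_itv /= => /andP[]; rewrite leNgt a1.
have indr x : t < x -> ind x = 0 by move=> a1; rewrite /ind indicE memNset //= in_itv /= => /andP[_]; rewrite leNgt a1.
have t0 : 0 <= t by exact: le_trans rt.
set nu := N2 u0 t; have bu0 : CLB u0 by exact: CAC_CLB au0.
have nu_lo : r ^+ 12 * (2 * r * k0) <= nu.
 have r2 : 0 <= 2 * r by lin. have q1 : 2 * r <= 4 * r by rewrite ler_pM2r // ler_nat. have r2r : r <= 2 * r by rewrite ler_peMl // ler1n.
 have q2 : 4 * r <= t by rewrite /t ler_pM2r // ler_nat. have := AC_le (AC_scale (r ^+ 12) (N2_AC bp)) (N2_AC bu0) r2 q1 => hle.
 have e1 := cells (2 * r) (2 * m)%N r2; rewrite natrM -/r (_ : 2 * r + 2 * r = 4 * r) in e1; last by ring.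
 have := N2_mono bu0 (le_trans r2 q1) q2; have := N2_mono bu0 (lexx 0) r2; rewrite N2_0 -/nu.
 have : r ^+ 12 * N2 phi (4 * r) - r ^+ 12 * N2 phi (2 * r) <= N2 u0 (4 * r) - N2 u0 (2 * r).
  apply: hle => x x2 x4; rewrite /u0 ind1 ?mul1r /h0 ?nsqM; [|exact: le_trans x2|exact: le_trans q2].
  by rewrite ler_wpM2r ?nsq_ge0 // /nsq ReC ImC expr0n /= addr0 Xlo.
 by rewrite -mulrBr e1 => g1 g2 g3; apply: le_trans g1 (le_trans _ g3); rewrite gerBl.
have nu0 : 0 < nu by apply: lt_le_trans nu_lo; rewrite !mulr_gt0 ?exprn_gt0.
have g_hi e : (forall x, r <= x -> `|W x| <= e) -> N2 g0 t <= 2 * e ^+ 2 * nu + 2 * K1 * r ^+ 10 * t.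
 move=> We. have := AC_le (N2_AC bg) (AC_add (AC_scale (2 * e ^+ 2) (N2_AC bu0)) (AC_scale (2 * K1 * r ^+ 10) AC_id)) (lexx 0) t0.
 rewrite !N2_0 !mulr0 !addr0 !subr0 mulr1; apply=> x x0 xt. have rr : 0 <= r ^+ 10 by rewrite exprn_ge0.
 have pos : 0 <= 2 * e ^+ 2 * nsq (u0 x) + 2 * K1 * r ^+ 10.
  apply: addr_ge0; apply: mulr_ge0; rewrite ?nsq_ge0 //; apply: mulr_ge0 => //; exact: sqr_ge0.
 have [rx|xr] := leP r x; last by rewrite /g0 indl // mul0r /nsq Re0 Im0 expr0n /= addr0. rewrite /g0 /u0 ind1 // !mul1r.
 rewrite (_ : _ - _ = (W x)%:C%C * h0 x - ((X2 x)%:C%C * phi x + (2 * X1 x)%:C%C * wp x)); last first.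
  have -> : (W x * X0 x - X2 x)%:C%C = (W x)%:C%C * (X0 x)%:C%C - (X2 x)%:C%C :> C by rewrite -rmorphM -rmorphB.
  by rewrite /h0; move: (X0 x)%:C%C (2 * X1 x)%:C%C (X2 x)%:C%C (W x)%:C%C (phi x) (wp x) => *; ring.
 apply: le_trans (nsqD_le _ _) _; rewrite nsqN mulrDr; apply: lerD.
  rewrite -mulrA ler_pM2l // nsqM ler_wpM2r ?nsq_ge0 // -nrmE nrmC. by rewrite ler_pXn2r ?nnegrE ?We ?(le_trans _ (We x rx)).
 rewrite -mulrA ler_pM2l //; apply: le_trans (nsqD_le _ _) _; rewrite !nsqM.
 have nC (z : R) : nsq z%:C%C = z ^+ 2 by rewrite /nsq ReC ImC expr0n /= addr0.
 rewrite !nC; have UBx := UB x x0; have np := nsq_ge0 (phi x); have nw := nsq_ge0 (wp x). have [x1b x2b] := Xhi x rx xt.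
 have a1 : (2 * X1 x) ^+ 2 * nsq (wp x) <= (Z * r ^+ 5) ^+ 2 * nsq (wp x) by rewrite ler_wpM2r.
 have a2 : X2 x ^+ 2 * nsq (phi x) <= (Z * r ^+ 5) ^+ 2 * nsq (phi x) by rewrite ler_wpM2r.
 have a3 : (Z * r ^+ 5) ^+ 2 * (nsq (phi x) + nsq (wp x)) <= (Z * r ^+ 5) ^+ 2 * B by rewrite ler_wpM2l ?sqr_ge0.
 rewrite (_ : K1 * r ^+ 10 = 2 * ((Z * r ^+ 5) ^+ 2 * B)); last by rewrite /K1; ring.
 rewrite ler_pM2l //; apply: le_trans a3; rewrite (mulrDr ((Z * r ^+ 5) ^+ 2)); exact: lerD a2 a1.
pose k := (Num.sqrt nu)^-1; have k2 : k ^+ 2 = nu^-1 by rewrite exprVn sqr_sqrtr // ltW.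
have nsc (v : R -> C) x : 0 <= x -> CLB v -> N2 (fun x => k%:C%C * v x) x = nu^-1 * N2 v x.
 move=> x0 bv; rewrite /N2 -k2 -(Rint_scale _ (LB_LI (CLB_nsq bv)) x0); congr Rint; apply/funext => y.
 by rewrite nsqM /nsq !ReC !ImC expr0n /= addr0.
exists (fun x => k%:C%C * u0 x), (fun x => k%:C%C * w0 x), (fun x => k%:C%C * g0 x); split.
- split; first exact: CAC_scale au0.
  by apply: CAC_ext (CAC_scale k%:C%C aw1) => // x _; ring.
 exact: CLB_mul (CLB_cst _) bg.
- split=> [x xr|x tx|].
 + have [->|xr'] := eqVneq x r; first by rewrite /u0 y1 !mulr0.
  by rewrite /u0 indl ?mul0r ?mulr0 // lt_neqAle xr' xr.
 + by rewrite /u0 /g0 indr // !mul0r mulr0.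
 + by rewrite /w0 indl // mul0r mulr0.
- rewrite !nsc // -/nu mulVf ?gt_eqF //; split=> // e We.
 rewrite mulrC ler_pdivrMr //; apply: le_trans (g_hi e We) _; rewrite (mulrDl _ _ nu) lerD2l.
 rewrite -[leLHS]mulr1 -(ler_pM2r k00) -(ler_pM2r (exprn_gt0 2 r0)).
 rewrite (_ : 5 * K1 / k0 / r ^+ 2 * nu * k0 * r ^+ 2 = 5 * K1 * nu); last by field; rewrite !gt_eqF.
 have : 5 * K1 * (r ^+ 12 * (2 * r * k0)) <= 5 * K1 * nu by rewrite ler_wpM2l // mulr_ge0. by apply: le_trans; rewrite /t; apply: eqW; ring.
Qed.

(** The supports of the cut-off Floquet solutions move to infinity, which gives weak convergence to
    0; the boundary condition holds because the Cauchy data at 0 vanish. *)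
Lemma le2_ess theta E : `|D E| <= 2 -> ess_spec q theta E.
Proof.
move=> hD; have [lam hl [l1 _ _]] := edge_root hD.
have [phi [wp fl]] := floquet_eigen IV per hf hl.
have [K K0 HK] := cutoff fl l1.
have [u Hu] := choice (fun n => HK n.+1 (ltn0Sn n)).
have [w Hw] := choice Hu; have [g Hg] := choice Hw.
have t0 (n : nat) : 0 <= 5 * n.+1%:R :> R by rewrite mulr_ge0.
have bu n : CLB (u n) by have [[h _ _] _ _] := Hg n; exact: CAC_CLB h.
have bg n : CLB (g n) by have [[_ _ h] _ _] := Hg n.
have ut n x : 5 * n.+1%:R < x -> u n x = 0 /\ g n x = 0 by have [_ [_ h _] _] := Hg n; exact: h.
have nsqL (v : R -> C) : CLB v -> LI (fun x => nsq (v x)) by move=> h; exact: LB_LI (CLB_nsq h).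
exists (fun n x => Re (u n x)), (fun n x => Im (u n x)), (fun n x => Re (g n x) + E * Re (u n x)), (fun n x => Im (g n x) + E * Im (u n x)).
split=> [n|n|f Lf|].
- have [[au aw _] [ul _ w0] _] := Hg n; have [bur bui] := bu n; have [bgr bgi] := bg n.
 have [aur aui] := au; have [awr awi] := aw. have u0 : u n 0 = 0 by apply: ul; rewrite ler0n.
 split; [exists (fun x => Re (w n x))|exists (fun x => Im (w n x))].
  split; [apply/solvesP; split=> //| | |by rewrite w0 u0 /= !mul0r].
  + by apply: AC_ext awr => // x _; rewrite /Qz -rmorphB ReD ReN ReM ReC ImC mul0r subr0; ring.
  + by apply: L2_trunc (t0 n) bur _ => x /ut[-> _].
  + by apply: (L2_trunc (t0 n)) => [|x /ut[-> ->]]; [apply: LB_add => //; exact: LB_mul (LB_cst E) bur|rewrite Re0 mulr0 addr0].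
 split; [apply/solvesP; split=> //| | |by rewrite w0 u0 /= !mul0r].
 + by apply: AC_ext awi => // x _; rewrite /Qz -rmorphB ImD ImN ImM ReC ImC mul0r addr0; ring.
 + by apply: L2_trunc (t0 n) bui _ => x /ut[-> _].
 + by apply: (L2_trunc (t0 n)) => [|x /ut[-> ->]]; [apply: LB_add => //; exact: LB_mul (LB_cst E) bui|rewrite Im0 mulr0 addr0].
- have [_ _ [N1 _]] := Hg n.
 rewrite (trunc_Rint (t0 n) (nsqL _ (bu n))) ?[X in (X%:E)%E]N1 // => x /ut[-> _]. by rewrite /nsq Re0 Im0 expr0n /= addr0.
- have [If If2] := L2_LI Lf; have aG := AC_prim 0 If2; set G := (fun x => 0 + _) in aG.
 have [_ Lfin] := Lf. have fk : (\int[leb]_(x in @halfline R) (f x ^+ 2)%:E)%E \is a fin_num.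
  by rewrite ge0_fin_numE // integral_ge0 // => x _; rewrite lee_fin sqr_ge0.
 have hG x : 0 <= x -> G x <= Rint (@halfline R) (fun x => f x ^+ 2).
  move=> x0; rewrite -lee_fin /Rint (fineK fk). have := halfline_ge aG (fun y _ => sqr_ge0 _) _ x0; apply. by rewrite /G RintI0 addr0.
 have key (v : nat -> R -> R) : (forall n, LB (v n)) -> (forall n x, v n x ^+ 2 <= nsq (u n x)) ->
   (fun n => Rint (@halfline R) (fun x => v n x * f x)) @ \oo --> (0 : R).
  move=> bv vn; apply/cvgrPdist_le => e e0; have [N HN] := sq_tail aG hG (exprn_gt0 2 e0). exists N => // n /= Nn; rewrite sub0r normrN.
  have [_ [ul _ _] [N1 _]] := Hg n; have n0 : 0 <= n.+1%:R :> R by []. have nt : n.+1%:R <= 5 * n.+1%:R :> R by rewrite ler_peMl // ler1n.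
  have v0 x : nsq (u n x) = 0 -> v n x = 0.
   by move=> h; apply/eqP; rewrite -sqrf_eq0 eq_le sqr_ge0 andbT -h vn.
  have z0 : nsq (0 : C) = 0 by rewrite /nsq Re0 Im0 expr0n /= addr0. have aA := AC_prim 0 (LB_LI (LB_mul (bv n) (bv n))).
  have aA' := AC_ext (fun x _ => erefl) (fun x _ => esym (expr2 _)) aA. apply: (weak_tail (bv n) If n0 nt _ _ e0 aA' aG).
  + by move=> x /ul h; apply: v0; rewrite h z0.
  + by move=> x /ut[h _]; apply: v0; rewrite h z0.
  + apply: le_trans (AC_le aA' (N2_AC (bu n)) n0 nt (fun x _ _ => vn n x)) _.
   by rewrite N1 gerBl N2_ge0.
  + by apply: HN => //; rewrite ler_nat (leq_trans Nn).
 split; apply: key => [n|n x]; try by have [] := bu n.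
  by rewrite /nsq lerDl sqr_ge0.
 by rewrite /nsq lerDr sqr_ge0.
- have e1 n : Rint (@halfline R) (fun x => (Re (g n x) + E * Re (u n x) - E * Re (u n x)) ^+ 2 + (Im (g n x) + E * Im (u n x) - E * Im (u n x)) ^+ 2) = N2 (g n) (5 * n.+1%:R).
  under [X in Rint _ X]eq_fun do rewrite !addrK. rewrite {1}/Rint (trunc_Rint (t0 n) (nsqL _ (bg n))) // => x /ut[_ ->].
  by rewrite /nsq Re0 Im0 expr0n /= addr0.
 under eq_cvg do rewrite e1. apply/cvgrPdist_le => e e0. have e4 : 0 < Num.min 1 (e / 4) by rewrite lt_min ltr01 divr_gt0.
 have [X HX] := Wsm e4; pose N := maxn (Num.truncn X).+1 (Num.truncn (2 * K / e)).+1.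
 exists N => // n /= Nn; rewrite sub0r normrN ger0_norm; last by rewrite N2_ge0. have [_ _ [_ Ng]] := Hg n.
 have n1 : 1 <= n.+1%:R :> R by rewrite ler1n. have n0 : 0 < n.+1%:R :> R by []. apply: le_trans (Ng _ _) _.
  move=> x nx; apply: HX; first by apply: le_trans nx. apply: le_trans nx; apply: le_trans (ltW (truncnS_gt _)) _.
  by rewrite ler_nat (leq_trans (leq_maxl _ (Num.truncn (2 * K / e)).+1)) // (leq_trans Nn).
 have h1 : Num.min 1 (e / 4) ^+ 2 <= e / 4.
  rewrite expr2; apply: (@le_trans _ _ (1 * Num.min 1 (e / 4))); last by rewrite mul1r ge_min lexx orbT.
  by rewrite ler_wpM2r ?(ltW e4) // ge_min lexx.
 have h2 : K / n.+1%:R ^+ 2 <= e / 2.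
  rewrite ler_pdivrMr ?exprn_gt0 //; apply: (@le_trans _ _ (e / 2 * n.+1%:R)); last first.
   by rewrite ler_wpM2l ?divr_ge0 ?(ltW e0) // expr2 ler_peMl // ltW.
  have : 2 * K / e <= n.+1%:R.
   apply: le_trans (ltW (truncnS_gt _)) _. by rewrite ler_nat (leq_trans (leq_maxr (Num.truncn X).+1 _)) // (leq_trans Nn).
  by rewrite ler_pdivrMr //; lin.
 apply: le_trans (lerD (ler_wpM2l (ler0n R 2) h1) h2) _. by apply: eqW; field.
Qed.

Variables (sigma : R).
Hypotheses (sg0 : 0 <= sigma) (sg1 : sigma < 1)
  (ell : forall E0 t, sigma < t -> `|D E0| < 2 -> exists2 d : R, 0 < d & hnull t ([set E | unbounded q E] `&` oitv E0 d)).

Lemma ess_disc theta : ess_spec q theta = [set E | `|D E| <= 2].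
Proof.
apply/seteqP; split=> E /=; first exact: ess_le2.
exact: le2_ess.
Qed.

Lemma edge_hnull t : 0 < t -> hnull t [set E | `|D E| = 2].
Proof.
move=> t0; apply: hnull_local => // E /= hE; have [[d d0 hd] _] := disc_edge IV aKv Q00 uni hf hE.
exists d => //; apply: hnull_sub (hnull_point E t0) => E' [/= h1 /itv_norm h2].
by apply: contrapT => ne; have := hd E' _ h2; rewrite h1 eqxx normr_gt0 subr_eq0 => h; apply: (notF (h _)); apply/eqP.
Qed.

(** Inside the bands this is [ell], made global by [hnull_local]; the band edges are isolated
    points. *)
Lemma exceptional_hnull t : sigma < t -> hnull t [set E | `|D E| <= 2 /\ unbounded q E].
Proof.
move=> st; have t0 : 0 < t := le_lt_trans sg0 st.
apply: (@hnull_sub _ _ ([set E | `|D E| < 2 /\ unbounded q E] `|` [set E | `|D E| = 2])).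
 by move=> E /= [h u]; have [|] := ltP `|D E| 2; [left|move=> h2; right; apply/eqP; rewrite eq_le h h2].
apply: hnullU => //; last exact: edge_hnull.
apply: hnull_local => // E /= [h _]; have [d d0 hd] := ell st h.
by exists d => //; apply: hnull_sub hd => E' [/= [_ u] i].
Qed.

Variables (theta : R) (mu : measure (measurableTypeR R) R).
Hypothesis Hmu : spectral_measure q theta mu.

Lemma bounded_leb_null B : meas B -> (forall E, B E -> ~ unbounded q E) -> (mu B = 0%E <-> leb B = 0%E).
Proof.
move=> mB hB; apply: (mu_leb_null Iq aKq Q10 uniq Hmu mB) => E /hB/contrapT h.
exact: (BE_exists Iq aKq Q10 uniq h).
Qed.

Lemma gap_mu E : 2 < `|D E| -> exists d P0 : R, 0 < d /\ mu (oitv E d `\` [set P0]) = 0%E.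
Proof.
move=> D2; have [lam [phi [wp [phi2 [wp2 [l1 f1 f2]]]]]] := hyp_floq IV per hf D2.
have [r0 [Cst [r00 r01 C0 HH]]] := hyper_est l1 f1 f2.
exact: (gap_null Iq aKq Q10 uniq r00 r01 C0 HH Hmu).
Qed.

(** [Z] is a null set containing the exceptional energies and the set [P] of atoms lying in an
    interval otherwise of measure 0. Such atoms are all that [mu] can have in the gaps, and in the
    bands off [Z] the measure has the null sets of Lebesgue measure. *)
Lemma singular_support : exists Z, [/\ meas Z, leb Z = 0%E,
  forall E, `|D E| <= 2 -> ~ Z E -> ~ unbounded q E & forall A, meas A -> leb A = 0%E -> mu (A `\` Z) = 0%E].
Proof.
pose P := [set E | mu [set E] <> 0%E /\ exists x d : R, (oitv x d) E /\
 mu (oitv x d `\` [set E]) = 0%E].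
have mI x (d : R) : meas (oitv x d) by exact: measurable_itv.
have mJ x (d y : R) : meas (oitv x d `\` [set y]) by apply: measurableD; [exact: mI|exact: measurable_set1].
have hP : hnull 1 P.
 apply: hnull_local => // E [_ [x [d [/itv_norm/itv_open_sub[d' d'0 sub] h0]]]]; exists d' => //.
 apply: hnull_sub (hnull_point E ltr01) => E' [[h _] i]; apply: contrapT => ne; apply: h.
 apply: (subset_measure0 _ (mJ x d E) _ h0); first exact: measurable_set1. by move=> _ ->; split=> //; exact: sub.
have [Z [mZ hZ Z0]] := hnull_leb (hnullU ltr01 (exceptional_hnull sg1) hP).
have mC : meas (~` Z) by exact: measurableC.
exists Z; split=> // [E h nZ u|A mA A0]; first by apply: nZ; apply: hZ; left.
(* Restricted to the complement of [Z], the measure is locally null in the gaps; they lie in the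
   open set [U] of local nullity, which is null by [measure_null_local]. *)
pose mu' : measure (measurableTypeR R) R := mrestr mu mC.
pose U := [set x | exists2 d : R, 0 < d & mu' (oitv x d) = 0%E].
have oU : open U.
 rewrite openE => x [d d0 hd]; apply/nbhs_ballP; exists d => // y; rewrite /ball /= distrC => /itv_open_sub[d' d'0 sub].
 by exists d' => //; apply: (subset_measure0 (mu := mu') _ _ sub hd).
have mU : meas U by exact: open_measurable.
have U0 : mu' U = 0%E by apply: (measure_null_local (mu := mu') mU).
have GU x : 2 < `|D x| -> U x.
 move=> h; have [d [P0 [d0 h0]]] := gap_mu h; exists d => //. have mX : meas (oitv x d `&` ~` Z) by exact: measurableI.
 change (mu (oitv x d `&` ~` Z) = 0%E). have [Zi|nZi] := pselect (~ (oitv x d) P0 \/ Z P0).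
  apply: (subset_measure0 mX (mJ x d P0) _ h0) => y [i nZ]; split=> // e. by have {}e : y = P0 := e; case: Zi; rewrite -e.
 have m0 : mu [set P0] = 0%E.
  apply: contrapT => n0; apply: nZi; have [i|] := pselect ((oitv x d) P0); last by left.
  by right; apply: hZ; right; split=> //; exists x, d.
 apply: (measure_subU0 mX (mJ x d P0) (measurable_set1 P0) _ h0 m0) => y [i _].
 by have [->|ne] := eqVneq y P0; [right|left; split=> //; apply/eqP].
have mAZ : meas (A `\` Z) by exact: measurableD.
have mAU : meas ((A `\` Z) `\` U) by exact: measurableD.
have h1 : mu ((A `\` Z) `\` U) = 0%E.
 apply/(bounded_leb_null mAU).
  move=> E [[_ nZ] nU] u; apply: nZ; apply: hZ; left; split=> //. by rewrite leNgt; apply/negP => /GU.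
 by apply: (subset_measure0 mAU mA _ A0) => E [[]].
have mUZ : meas (U `&` ~` Z) by exact: measurableI.
apply: (measure_subU0 mAZ mAU mUZ _ h1 U0) => E [a b].
by have [u|u] := pselect (U E); [right|left].
Qed.

(** The absolutely continuous part is [mu] restricted to the complement of [Z]. Near an energy with
    [|D| <= 2] there is an interval with [|D| < 2]; removing [Z] leaves positive Lebesgue measure,
    which [mu] charges. In a gap any candidate part is dominated by [mu] and gives points no mass,
    so it vanishes locally. *)
Lemma ac_spec_ess : ac_spec mu = ess_spec q theta.
Proof.
have [Z [mZ Z0 hZ muZ]] := singular_support.
have mC : meas (~` Z) by exact: measurableC.
have mI x (d : R) : meas (oitv x d) by exact: measurable_itv.
rewrite ess_disc; apply/seteqP; split=> E /=.
 move=> [nu [[nus [split_ ac _]] pos]]; rewrite leNgt; apply/negP => /gap_mu[d [P0 [d0 h0]]].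
 have mJ : meas (oitv E d `\` [set P0]) by apply: measurableD; [exact: mI|exact: measurable_set1].
 have n1 : nu [set P0] = 0%E by apply: ac; [exact: measurable_set1|exact: lebesgue_measure_set1].
 have n2 : nu (oitv E d `\` [set P0]) = 0%E.
  by apply/eqP; rewrite eq_le measure_ge0 andbT -h0 split_ // leeDl // measure_ge0.
 have := pos d d0; rewrite (_ : nu _ = 0%E) ?ltxx //. apply: (measure_subU0 (mI E d) mJ (measurable_set1 P0) _ n2 n1) => y i.
 by have [->|ne] := eqVneq y P0; [right|left; split=> //; apply/eqP].
move=> hE; exists (mrestr mu mC); split.
 exists (mrestr mu mZ); split=> [A mA|A mA A0|].
 - change (mu A = mu (A `&` ~` Z) + mu (A `&` Z))%E; have m1 : meas (A `&` ~` Z) by exact: measurableI.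
  have m2 : meas (A `&` Z) by exact: measurableI. have e0 : (A `&` ~` Z) `&` (A `&` Z) = set0 by apply/seteqP; split=> // x [[_ a] [_ b]].
  by rewrite -(measureU mu m1 m2 e0) -setIUr setUC setUv setIT.
 - by change (mu (A `&` ~` Z) = 0)%E; rewrite -setDE; exact: muZ.
 - by exists Z => //; change (mu (~` Z `&` Z) = 0)%E; rewrite setICl measure0.
move=> eps eps0.
have [E1 hE1 D1] : exists2 E1, `|E1 - E| < eps & `|D E1| < 2.
 have [lt|ge] := ltP `|D E| 2; first by exists E; rewrite ?subrr ?normr0. have e2 : `|D E| = 2 by apply/eqP; rewrite eq_le hE ge.
 by have [_ h] := disc_edge IV aKv Q00 uni hf e2; apply: h.
have [d1 [k [b [d10 _ b2 hd]]]] := disc_elliptic IV aKv Q00 uni hf D1.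
have [d2 d20 sub] := itv_open_sub hE1.
pose d : R := Num.min d1 d2; have d0 : 0 < d by rewrite lt_min d10.
have dd1 : d <= d1 by rewrite ge_min lexx.
have dd2 : d <= d2 by rewrite ge_min lexx orbT.
clearbody d.
have mB : meas (oitv E1 d `\` Z) by exact: measurableD.
have nB : mu (oitv E1 d `\` Z) <> 0%E.
 move=> /(bounded_leb_null mB) => h. have : leb (oitv E1 d) = 0%E.
  apply: (measure_subU0 (nu := leb) (mI E1 d) mB mZ _ _ Z0) => [x i|].
   by have [z|z] := pselect (Z x); [right|left].
  apply: h => x [/itv_norm i nZ]; apply: hZ => //; have xd : `|x - E1| <= d1 by lin. by have [l _] := hd x x xd xd; lin.
 rewrite lebesgue_measure_itv /= lte_fin ifT; last by lin. by move=> /eqP; rewrite -EFinB eqe => /eqP; lin.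
rewrite lt_neqAle measure_ge0 andbT eq_sym; apply/eqP => h0; apply: nB.
have mX : meas (oitv E eps `&` ~` Z) by exact: measurableI.
apply: (measure_subU0 mB mX mX _ h0 h0) => x [i nZ]; left; split=> //; apply: sub.
by move: i; rewrite /= !in_itv /= => /andP[a b']; apply/andP; split; lin.
Qed.

End SpectralSets.

End Halfline.

Theorem theorem1p3 (R : realType) (V0 V : R -> R) (p : nat)
  (c : nat -> R[i]) (phi : nat -> R) (gamma : nat -> R -> R[i])
  (fa theta : R) :
  (* V0 : real, 1-periodic, locally integrable *)
  loc_int V0 ->
  (forall x, V0 (x + 1) = V0 x) ->
  (* p >= 2 an integer *)
  (2 <= p)%N ->
  (* V(x) = sum_l c_l e^{-i phi_l x} gamma_l(x), real-valued, for x > 0 *)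
  (forall x : R, 0 < x ->
     (fun n => \sum_(l < n) complex.Re (c l * expmi (phi l * x) * gamma l x)%C)
       @ \oo --> V x /\
     (fun n => \sum_(l < n) complex.Im (c l * expmi (phi l * x) * gamma l x)%C)
       @ \oo --> 0) ->
  (* sup_l Var(gamma_l, (0,oo)) < oo *)
  (exists M : R, forall l, (var_oo (gamma l) <= M%:E)%E) ->
  (* sup_l int_0^oo |gamma_l|^p < oo *)
  (exists M : R, forall l,
     (\int[@lebesgue_measure R]_(x in @posline R)
        (Normc.normc (gamma l x) ^+ p)%:E <= M%:E)%E) ->
  (* fa in (0, 1/(p-1)) and sum_l |c_l|^fa < oo *)
  0 < fa -> fa < 1 / (p%:R - 1) ->
  (\sum_(0 <= l <oo) ((Normc.normc (c l)) `^ fa)%:E < +oo)%E ->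
  (* theta in [0, pi) *)
  0 <= theta -> theta < pi ->
  let q := fun x => V0 x + V x in
  let IntSess := interior (ess_spec q theta) in
  let S := [set E : R | IntSess E /\
              ~ (forall u, rsol q E u ->
                   exists M : R, forall x, 0 <= x -> `|u x| <= M)] in
  (hdim S <= ((p%:R - 1) * fa)%:E)%E /\
  (forall mu : measure (measurableTypeR R) R, spectral_measure q theta mu ->
     (forall B, measurable B -> B `<=` IntSess `\` S ->
        (mu B = 0%E <-> @lebesgue_measure R B = 0%E)) /\
     ac_spec mu = ess_spec q theta).
Proof.
(* From here on [p = n0 + 1]. *)
move=> IV0 per; case: p => [|[//|k]] // _; set n0 := k.+1 => hV [M0 hM0] [Mp0 hMp0] fa0; have n00 : (0 < n0)%N by [].
have -> : n0.+1%:R - 1 = n0%:R :> R by rewrite -natr1 addrK.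
move=> fa1 hfa _ _ q IntSess S.
have nn : 0 < n0%:R :> R by rewrite ltr0n.
have sg1 : n0%:R * fa < 1 by move: fa1; rewrite ltr_pdivlMr // mulrC.
have fal1 : fa <= 1 by apply: le_trans (ltW sg1); rewrite ler_peMl ?(ltW fa0) // ler1n.
(* Maxima with 0 provide the signs that [bv_lp] asks for. *)
pose M : R := Num.max M0 0; pose Mp : R := Num.max Mp0 0.
have M_0 : 0 <= M by rewrite le_max lexx orbT.
have Mp_0 : 0 <= Mp by rewrite le_max lexx orbT.
have hM l : (var_oo (gamma l) <= M%:E)%E by apply: le_trans (hM0 l) _; rewrite lee_fin le_max lexx.
have hMp l : (\int[@lebesgue_measure R]_(x in @posline R) (Normc.normc (gamma l x) ^+ n0.+1)%:E <= Mp%:E)%E.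
 by apply: le_trans (hMp0 l) _; rewrite lee_fin le_max lexx.
clearbody M Mp.
have [gt Hgt] := choice (fun l => bv_lp (ltn0Sn n0) (hM l) M_0 Mp_0 (hMp l)).
have [gt1 {}Hgt] := choice Hgt.
set Kg := M + Mp + 1 + 2 ^+ n0.+1 * (Mp + (M + 1) ^+ n0.+1 * M) + M in Hgt.
have Kg1 : 1 <= Kg.
 have : 0 <= 2 ^+ n0.+1 * (Mp + (M + 1) ^+ n0.+1 * M) by rewrite mulr_ge0 ?exprn_ge0 // addr_ge0 // mulr_ge0 // exprn_ge0 // addr_ge0.
 by rewrite /Kg; lra.
clearbody Kg.
have Lg l : CLB (pos_part (gamma l)) by have [de [De [y [Y [[h _] _ _ _ _]]]]] := Hgt l.
have gK l x : 0 < x -> Normc.normc (gamma l x) <= Kg by have [de [De [y [Y [[_ h] _ _ _ _]]]]] := Hgt l; exact: h.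
have agt l : CAC (gt l) (gt1 l) by have [de [De [y [Y [_ [h _] _ _ _]]]]] := Hgt l.
have gtK l x : 0 <= x -> Normc.normc (gt l x) <= Kg by have [de [De [y [Y [_ [_ h] _ _ _]]]]] := Hgt l; exact: h.
have gsm l (d : R) : 0 < d -> exists X : R, forall x, 0 < x -> X <= x -> Normc.normc (gamma l x) <= d.
 move=> d0; have [de [De [y [Y [_ _ h _ _]]]]] := Hgt l; have [X hX] := h d d0. by exists X => x x0 Xx; have [] := hX x x0 Xx.
have gts l (d : R) : 0 < d -> exists X : R, forall x, 0 < x -> X <= x -> Normc.normc (gt l x) <= d.
 move=> d0; have [de [De [y [Y [_ _ h _ _]]]]] := Hgt l; have [X hX] := h d d0. by exists X => x x0 Xx; have [] := hX x x0 Xx.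
have cgt1 l : ctrl Kg (gt1 l).
 have [de [De [y [Y [_ _ _ [h1 h2 h3 h4] _]]]]] := Hgt l; exists De, de; split=> // x x0; by have [] := h4 x x0.
have cde l : ctrl Kg (fun x => gt l x - gamma l x).
 have [de [De [y [Y [_ _ _ [h1 h2 h3 h4] _]]]]] := Hgt l; exists De, de; split=> // x x0; by have [] := h4 x x0.
have cgtp l : ctrl Kg (fun x => (Normc.normc (gt l x) ^+ n0.+1)%:C%C).
 have [de [De [y [Y [_ _ _ _ [h1 h2 h3 h4]]]]]] := Hgt l; exists Y, y; split=> // x x0.
 by rewrite nrmC ger0_norm ?h4 // exprn_ge0 // nrm_ge0.
have [Ac hAc] : exists Ac : R, forall N, \sum_(l <- iota 0 N) Normc.normc (c l) `^ fa <= Ac.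
 have ge0 n : (0 <= n)%N -> true -> (0 <= (Normc.normc (c n) `^ fa)%:E)%E by move=> _ _; rewrite lee_fin powR_ge0.
 exists (fine (\sum_(0 <= l <oo) (Normc.normc (c l) `^ fa)%:E)) => N.
 have := @nneseries_lim_ge _ (fun l => (Normc.normc (c l) `^ fa)%:E) xpredT 0 N ge0.
 rewrite sumEFin /index_iota subn0 -lee_fin fineK //; rewrite ge0_fin_numE //; exact: nneseries_ge0.
pose Bc := Ac `^ ((1 - fa) / fa) * Ac.
have cB_ N : \sum_(l <- iota 0 N) Normc.normc (c l) <= Bc by apply: sum_root (hAc N) => // l; exact: nrm_ge0.
clearbody Bc.
have Vapp := potential_approx hV Kg1 gK cB_; have LV := potential_LB hV Kg1 gK cB_ Lg.
have Wsm := potential_decay hV Kg1 gK cB_ gsm.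
have IV : LI V0 by move=> x _; exact: IV0.
have aKv := AC_prim 0 (LI_norm IV); set Kv := (fun x => 0 + _) in aKv.
have Kv01 : 0 <= Kv 1 - Kv 0 by rewrite subr_ge0; apply: (AC_homo aKv (lexx 0) ler01).
(* The mass of [|V0|] over [[s, s + 1]] does not depend on [s], since its derivative in [s] vanishes
   by periodicity. *)
have uni s : 0 <= s -> Kv (s + 1) - Kv s <= Kv 1 - Kv 0.
 move=> s0; have a0 : AC (fun x => Kv (x + 1) - Kv x) (fun=> 0).
  by apply: AC_ext (AC_sub (AC_shift ler01 aKv) aKv) => // x _; rewrite per subrr.
 have := AC_lip (M := 0) a0 (lexx 0) s0; rewrite add0r mul0r => h.
 have h2 : `|Kv (s + 1) - Kv s - (Kv 1 - Kv 0)| <= 0 by apply: h => *; rewrite normr0. by have := le_trans (ler_norm _) h2; lra.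
have Iq : LI q by apply: LI_add IV (LB_LI LV).
have aKq := AC_prim 0 (LI_norm Iq); set Kq := (fun x => 0 + _) in aKq.
have Bc0 : 0 <= Bc by apply: le_trans (cB_ 0%N); rewrite big_nil.
(* The value [V 0] enters separately, because the series controls [V] for [x > 0] only. *)
pose MV := Num.max `|V 0| (Bc * Kg + 1).
have hMV x : 0 <= x -> `|V x| <= MV.
 rewrite le_eqVlt => /orP[/eqP<-|x0]; rewrite le_max ?lexx //. by rewrite (potential_bound hV Kg1 gK cB_) // orbT.
have MV0 : 0 <= MV := le_trans (normr_ge0 _) (hMV 0 (lexx 0)).
clearbody MV.
have uniq s : 0 <= s -> Kq (s + 1) - Kq s <= Kv 1 - Kv 0 + MV.
 move=> s0; have s1 : s <= s + 1 by rewrite lerDl. have h := AC_le aKq (AC_add aKv (AC_scale MV (@AC_id R))) s0 s1.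
 have : Kq (s + 1) - Kq s <= Kv (s + 1) + MV * (s + 1) - (Kv s + MV * s).
  by apply: h => x sx _; rewrite mulr1; apply: le_trans (ler_normD _ _) _; rewrite lerD2l hMV // (le_trans s0).
 by have := uni s s0; lra.
have Q10 : 0 <= Kv 1 - Kv 0 + MV by rewrite addr_ge0.
have qE x : 0 <= x -> q x = V0 x + V x by [].
have per' x : 0 <= x -> V0 (x + 1) = V0 x by [].
have [f1 [f2 [f3 [f4 hf]]]] := fund_family IV.
have IV1 := LB_LI LV.
have sg0 : 0 <= n0%:R * fa by rewrite mulr_ge0 // ltW.
have ell E0 t : n0%:R * fa < t -> `|disc f1 f4 E0| < 2 -> exists2 d : R, 0 < d & hnull t ([set E | unbounded q E] `&` `](E0 - d)%R, (E0 + d)%R[%classic).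
 exact: (elliptic_local IV aKv Kv01 uni per' qE IV1 hf Kg1 agt gtK cgt1 cgtp gts cde n00 Vapp fa0 fal1 hAc).
have essE := ess_disc IV aKv Kv01 uni per' qE LV Wsm Iq aKq Q10 uniq hf theta.
split.
 apply: hdim_le => // s gs s1; apply: hnull_sub (exceptional_hnull IV aKv Kv01 uni hf sg0 ell gs) => E [hE hu].
 by split=> //; have := interior_subset hE; rewrite essE.
move=> mu Hmu; split.
 move=> B mB BS; apply: (bounded_leb_null Iq aKq Q10 uniq Hmu mB) => E /BS[iE nS] u. by apply: nS; split.
exact: (ac_spec_ess IV aKv Kv01 uni per' qE LV Wsm Iq aKq Q10 uniq hf sg0 sg1 ell Hmu).
Qed.
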